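(* Let $(\Delta,\mathcal S)$ be a quiver with potential, $\mathcal V$ a decorated representation of $(\Delta,\mathcal S)$ and $u$ a vertex of $\Delta$ at which mutation is performed. The mutation of presentations is compatible with the mutation of representations, that is, $$\mu_u(d_{\mathcal V})=d_{\mu_u(\mathcal V)},$$ where $d_{\mathcal V}$ and $d_{\mu_u(\mathcal V)}$ are the presentations corresponding to $\mathcal V$ and to $\mu_u(\mathcal V)$, and equality is understood as isomorphism of presentations in the homotopy category $K^b(\mathrm{proj}\text{-}J(\mu_u(\Delta,\mathcal S)))$.
   Context: **Quivers with potential.** Let $k$ be an algebraically closed field. A quiver $\Delta$ has finite vertex set $\Delta_0$, finitely many arrows and no loops. A potential $\mathcal S$ is a (possibly infinite) linear combination of oriented cycles up to cyclic equivalence; $J=J(\Delta,\mathcal S)=\widehat{k\Delta}/\partial\mathcal S$ is the Jacobian algebra (completed path algebra modulo the closed ideal generated by the cyclic derivatives $\partial_a\mathcal S$). $\mu_u$ is Derksen–Weyman–Zelevinsky mutation of QPs and of decorated representations at $u$. $P_u$ is the indecomposable projective module at $u$ (spanned by paths starting at $u$); $P(\beta)=\bigoplus_u\beta(u)P_u$. A decorated representation $\mathcal V=(V,V^-)$ is a finite-dimensional $J$-module $V$ together with a finite-dimensional $k^{\Delta_0}$-module $V^-$; it corresponds to the projective presentation $d_{\mathcal V}:P(\beta_-)\to P(\beta_+)$ that is the direct sum of the minimal presentation of $V$ and $P(\underline{\dim}V^-)\to0$. **Extension of a QP by $\mathcal V$.** Assume $P(\beta_-)$ and $P(\beta_+)$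 share no common summands. The extended QP $(\Delta,\mathcal S)[\mathcal V]$ has a new vertex $v$, $\beta_+(w)$ new arrows $v\to w$ and $\beta_-(u')$ new arrows $u'\to v$ for $w,u'\in\Delta_0$. Writing $d_{\mathcal V}$ as a matrix whose entries $c:P_{u'}\to P_w$ are linear combinations of paths, for each entry $c$ one adds $abc$ to the potential $\mathcal S$, where $a:u'\to v$ and $b:v\to w$ are the new arrows corresponding to that copy of $P_{u'}$ and of $P_w$. **Presentation attached to a simple vertex.** For a QP $(\Delta',\mathcal S')$, a vertex $v$ is called simple if for each pair of arrows $a:u'\to v$, $b:v\to w$, the derivative $\partial_{[ab]}[\mathcal S']$ contains no arrows to or from $v$ (here $[\mathcal S']$ is obtained by replacing each occurrence of $ab$ by a new arrow $[ab]$). Then $v$ defines the presentation $$d_v=\bigl(\partial_{[ab]}[\mathcal S']\bigr)_{a,b}:\ \bigoplus_{a:u'\to v}P_{u'}\longrightarrow\bigoplus_{b:v\to w}P_w$$ over the Jacobian algebra of the restriction of $(\Delta',\mathcal S')$ to the full subquiver on $\Delta'_0\setminus\{v\}$. The new vertex $v$ of $(\Delta,\mathcal S)[\mathcal V]$ is simple, and simplicity of $v$ is preserved by mutations at vertices other than $v$. **Mutation of presentations.** $\mu_u(d_{\mathcal V})$ is defined as the presentation $d_v$ over $J(\mu_u(\Delta,\mathcal S))$ obtained from the mutated QP $\mu_u\bigl((\Delta,\mathcal S)[\mathcal V]\bigr)$, whose restriction to $\mu_u(\Delta)$ is $\mu_u(\Delta,\mathcal S)$. *)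

(* Defs.v *)
From HB Require Import structures.
From mathcomp Require Import all_boot all_order all_algebra.

Set Implicit Arguments.
Unset Strict Implicit.
Unset Printing Implicit Defensive.

Import GRing.Theory.
Local Open Scope ring_scope.

(** Conventions: paths are written from left to right ([ab] means first [a],
    then [b]), modules are right modules, [P_i = e_i J] is spanned by the paths
    starting at [i], and a map [P_i -> P_j] is left multiplication by an
    element of [e_j J e_i].  A representation is thus covariant: an arrow
    [a : i -> j] maps [M e_i] to [M e_j]. *)

(** [Q i j] is the set of arrows from [i] to [j]. *)
Definition quiver (V : finType) := V -> V -> finType.

Definition loopless (V : finType) (Q : quiver V) := forall i, #|Q i i| = 0%N.

(** DWZ-mutation at [u] is defined when [u] lies on no oriented 2-cycle. *)
Definition no_2cycle_at (V : finType) (Q : quiver V) (u : V) :=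
  forall i, #|Q i u| = 0%N \/ #|Q u i| = 0%N.

Section Paths.
Variables (V : finType) (Q : quiver V).

Definition arr : finType := {ij : V * V & Q ij.1 ij.2}.
Definition mkarr i j (a : Q i j) : arr :=
  existT (fun ij : V * V => Q ij.1 ij.2) (i, j) a.
Definition src (a : arr) : V := (tag a).1.
Definition tgt (a : arr) : V := (tag a).2.

(** [walk i s j]: [s] is a path from [i] to [j] ([s = [::]] is [e_i]). *)
Fixpoint walk (i : V) (s : seq arr) (j : V) : bool :=
  if s is a :: s' then (src a == i) && walk (tgt a) s' j else i == j.

Definition cycl (s : seq arr) : bool :=
  if s is a :: s' then walk (tgt a) s' (src a) else false.

End Paths.

Definition coef (k : fieldType) (A : eqType) (P : pred (seq A))
    (f : {s : seq A | P s} -> k) (s : seq A) : k :=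
  oapp f 0 (insub s : option {s : seq A | P s}).

Section Algebra.
Variables (k : fieldType) (V : finType) (Q : quiver V).

(** [pser i j] is [e_i A e_j], where [A] is the completed path algebra. *)
Definition pser (i j : V) := {s : seq (arr Q) | walk i s j} -> k.

Definition pmul i j l (x : pser i j) (y : pser j l) : pser i l := fun s =>
  \sum_(n < (size (val s)).+1) coef x (take n (val s)) * coef y (drop n (val s)).

Definition pone i : pser i i := fun s => (val s == [::])%:R.

Definition parr (a : arr Q) : pser (src a) (tgt a) := fun s => (val s == [:: a])%:R.

Arguments pone : clear implicits.
Arguments parr : clear implicits.

(** Potentials: possibly infinite combinations of oriented cycles; they matter
    only up to [cyc_eq]. *)
Definition potential := {s : seq (arr Q) | cycl s} -> k.

(** [S - T] lies in the closed span of the [a_1 ... a_d - a_2 ... a_d a_1],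
    i.e. it is the possibly infinite sum of the [g_w (w - rot 1 w)]. *)
Definition cyc_eq (S T : potential) := exists g : potential,
  forall (a : arr Q) s, cycl (rcons s a) ->
    coef S (rcons s a) - coef T (rcons s a) = coef g (rcons s a) - coef g (a :: s).

(** Cyclic derivative: the coefficient at [p = q r] collects the cycles
    [r a q], which [\partial_a] maps to [q r]. *)
Definition cderiv (S : potential) (a : arr Q) : pser (tgt a) (src a) := fun p =>
  \sum_(n < (size (val p)).+1) coef S (drop n (val p) ++ a :: take n (val p)).

Arguments cderiv : clear implicits.

(** The [(i, j)]-part of the closure of the two-sided ideal generated by the
    cyclic derivatives: [x] is, up to paths of length [>= N] for every [N], a
    finite sum of elements [l * \partial_a S * r]. *)
Definition jideal (S : potential) i j (x : pser i j) := forall N : nat,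
  exists t : seq {a : arr Q & (pser i (tgt a) * pser (src a) j)%type},
  forall s, (size (val s) < N)%N ->
    x s = \sum_(lr <- t)
      pmul (pmul (tagged lr).1 (cderiv S (tag lr))) (tagged lr).2 s.

(** [B : V -> finType] stands for the projective [\bigoplus_i P_i^{B i}]; a
    map between projectives is a matrix over the completed path algebra,
    read modulo [jideal S]. *)

Definition hmx (B C : V -> finType) := forall i (b : B i) j (c : C j), pser j i.

Definition hcomp B C D (G : hmx C D) (F : hmx B C) : hmx B D := fun i b l d s =>
  \sum_j \sum_(c : C j) pmul (G j c l d) (F i b j c) s.

Arguments hcomp [B C D].

Definition hid B : hmx B B := fun i b j c s =>
  ((Tagged B b == Tagged B c) && (val s == [::]))%:R.

Arguments hid : clear implicits.

Definition heq S B C (F G : hmx B C) :=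
  forall i b j c, jideal S (fun s => F i b j c s - G i b j c s).

Arguments heq S [B C].

(** [1 - F = G] modulo the Jacobian ideal *)
Definition hid_sub_eq S B (F G : hmx B B) :=
  heq S (fun i b j c s => hid B i b j c s - F i b j c s) G.

Arguments hid_sub_eq S [B].

Record pres := Pres {
  neg : V -> finType;
  pos : V -> finType;
  pmx : hmx neg pos }.
Arguments pmx : clear implicits.

(** Isomorphism of the two-term complexes [D] and [D'] in [K^b(proj-J)]. *)
Definition htpy_iso (S : potential) (D D' : pres) :=
  exists (fm : hmx (neg D) (neg D')) (fp : hmx (pos D) (pos D'))
         (gm : hmx (neg D') (neg D)) (gp : hmx (pos D') (pos D))
         (h : hmx (pos D) (neg D)) (h' : hmx (pos D') (neg D')),
  [/\ heq S (hcomp fp (pmx D)) (hcomp (pmx D') fm),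
      heq S (hcomp gp (pmx D')) (hcomp (pmx D) gm),
      hid_sub_eq S (hcomp gm fm) (hcomp h (pmx D)) /\
      hid_sub_eq S (hcomp gp fp) (hcomp (pmx D) h)
    & hid_sub_eq S (hcomp fm gm) (hcomp h' (pmx D')) /\
      hid_sub_eq S (hcomp fp gp) (hcomp (pmx D') h')].

Definition no_common_summand (D : pres) :=
  forall i, #|neg D i| = 0%N \/ #|pos D i| = 0%N.

(** Image under [D] of an element of [P(neg D) e_l]. *)
Definition pimage (D : pres) l (z : forall i, neg D i -> pser i l) :
    forall i, pos D i -> pser i l := fun i b s =>
  \sum_j \sum_(m : neg D j) pmul (pmx D j m i b) (z j m) s.

(** A finite-dimensional module is its total space with the actions of the idempotents and of the
    arrows. *)
Record rep := Rep {
  rsp : vectType k;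
  ridem : V -> 'End(rsp);
  rarr : arr Q -> 'End(rsp) }.

Definition is_rep (M : rep) :=
  [/\ forall i j, (ridem M i \o ridem M j)%VF = (if i == j then ridem M i else 0),
      \sum_i ridem M i = \1%VF
    & forall a, (rarr M a \o ridem M (src a))%VF = rarr M a
             /\ (ridem M (tgt a) \o rarr M a)%VF = rarr M a].

(** [(f \o g)%VF] applies [g] first. *)
Fixpoint wact (M : rep) (s : seq (arr Q)) : 'End(rsp M) :=
  if s is a :: s' then (wact M s' \o rarr M a)%VF else \1%VF.

(** Finite-dimensional modules over the completed path algebra are nilpotent. *)
Definition nilpotent_rep (M : rep) :=
  exists N, forall s i j, walk i s j -> (N <= size s)%N -> wact M s = 0.

(** Paths of length at least [dim M] act as zero on a nilpotent [M], so that
    the sum may be truncated. *)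
Definition act (M : rep) i j (x : pser i j) : 'End(rsp M) :=
  \sum_(n < (\dim {: rsp M}).+1) \sum_(s : n.-tuple (arr Q))
    coef x s *: (wact M s \o ridem M i)%VF.

Definition is_Jmod (S : potential) (M : rep) :=
  [/\ is_rep M, nilpotent_rep M & forall a, act M (cderiv S a) = 0].

(** The map [P(B) -> M] sending the generators to [g], on elements of
    [P(B) e_l]. *)
Definition augm (M : rep) (B : V -> finType) (g : forall i, B i -> rsp M)
    l (y : forall i, B i -> pser i l) : rsp M :=
  \sum_i \sum_(b : B i) act M (y i b) (g i b).

(** [P(neg D) -> P(pos D) -> M -> 0] is exact over [J(Q, S)], and both
    [P(pos D) -> M] and [P(neg D) -> ker] are projective covers, i.e. their
    kernels lie in the radical. *)
Definition min_pres (S : potential) (M : rep) (D : pres) :=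
  exists g : forall i, pos D i -> rsp M,
  [/\ forall i b, ridem M i (g i b) = g i b,
      forall l (w : rsp M), w \in limg (ridem M l) ->
        exists y : forall i, pos D i -> pser i l, w = augm g y,
      forall l (y : forall i, pos D i -> pser i l),
        augm g y = 0 -> forall i b, coef (y i b) [::] = 0,
      forall l (y : forall i, pos D i -> pser i l),
        augm g y = 0 <->
        exists z : forall i, neg D i -> pser i l,
          forall i b, jideal S (fun s => y i b s - pimage z b s)
    & forall l (z : forall i, neg D i -> pser i l),
        (forall i (b : pos D i), jideal S (fun s => pimage z b s)) ->
        forall i m, coef (z i m) [::] = 0].

(** A decorated representation [(M, M^-)]; up to isomorphism [M^-] is its
    dimension vector. *)
Record drep := DRep { drmod : rep; drdec : V -> nat }.

(** The direct sum of [D] and of [P(m) -> 0]. *)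
Definition add_neg (D : pres) (m : V -> nat) : pres :=
  @Pres (fun i => (neg D i + 'I_(m i))%type) (pos D)
    (fun i b j c => match b with inl b0 => pmx D i b0 j c | inr _ => fun=> 0 end).

(** [D] is (a lift of) the presentation [d_W]. *)
Definition pres_of (S : potential) (W : drep) (D : pres) :=
  exists2 D0, min_pres S (drmod W) D0 & D = add_neg D0 (drdec W).

End Algebra.

Arguments pone {k V} Q i _.
Arguments parr {k V Q} a _.
Arguments cderiv {k V Q} S a _.
Arguments pmx {k V Q} D i b j c _ : rename.

Section Bracket.
Variables (k : fieldType) (V : finType) (Q : quiver V) (u : V).

(** Paths [ab] through [u] become new arrows [[ab]], and the arrows incident to
    [u] are dropped. *)
Definition brk : quiver V := fun i j =>
  ({c : Q i j | (i != u) && (j != u)} + (Q i u * Q u j))%type.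

Definition barr i j (a : Q i u) (b : Q u j) : arr brk :=
  @mkarr V brk i j (inr (a, b)).

Definition is_barr (c : arr brk) : bool := if tagged c is inr _ then true else false.

Definition unbrk (c : arr brk) : seq (arr Q) :=
  match c with
  | existT ij (inl c0) => [:: @mkarr V Q ij.1 ij.2 (val c0)]
  | existT ij (inr ab) => [:: mkarr ab.1; mkarr ab.2]
  end.

(** [[S]], where a cycle starting at [u] is first replaced by its cyclic
    rotation [rot 1], which does not start at [u] (there are no loops). *)
Definition brk_pot (S : potential k Q) : potential k brk := fun w =>
  let s := flatten [seq unbrk c | c <- val w] in
  coef S s
  + (if rotr 1 s is a :: _ then coef S (rotr 1 s) *+ (src a == u) else 0).

(** Reversed arrows are [inl]; they are those incident to [u]. *)
Definition premut : quiver V := fun i j =>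
  ({c : Q j i | (i == u) || (j == u)} + brk i j)%type.

Definition star_in i (a : Q i u) : arr premut :=
  @mkarr V premut u i (inl (exist _ a (introT orP (or_introl (eqxx u))))).
Definition star_out j (b : Q u j) : arr premut :=
  @mkarr V premut j u (inl (exist _ b (introT orP (or_intror (eqxx u))))).
Definition premut_brk (c : arr brk) : arr premut :=
  @mkarr V premut (src c) (tgt c) (inr (tagged c)).
Definition unpremut (c : arr premut) : option (arr brk) :=
  if tagged c is inr c0 then Some (@mkarr V brk (tag c).1 (tag c).2 c0) else None.

(** [[S] + \sum [ab] b^* a^*] *)
Definition premut_pot (S : potential k Q) : potential k premut := fun w =>
  coef (brk_pot S) (pmap unpremut (val w)) *+ all (isSome \o unpremut) (val w)
  + \sum_i \sum_(a : Q i u) \sum_j \sum_(b : Q u j)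
      (val w == [:: premut_brk (barr a b); star_out b; star_in a])%:R.

Definition brk_rep (M : rep k Q) : rep k brk :=
  Rep (ridem M) (fun c => wact M (unbrk c)).

Definition arr_in : finType := {i : V & Q i u}.
Definition arr_out : finType := {j : V & Q u j}.

Variables (S : potential k Q) (W : drep k Q).
Let M := drmod W.
Let E := rsp M.

(** [M_in] and [M_out] are subspaces of the spaces of families of vectors. *)
Definition M_in : {vspace {ffun arr_in -> E}} :=
  limg (linfun (fun z : {ffun arr_in -> E} => [ffun a : arr_in => ridem M (tag a) (z a)])).
Definition M_out : {vspace {ffun arr_out -> E}} :=
  limg (linfun (fun z : {ffun arr_out -> E} => [ffun b : arr_out => ridem M (tag b) (z b)])).
Definition M_at : {vspace E} := limg (ridem M u).

Definition alpha : 'Hom({ffun arr_in -> E}, E) :=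
  linfun (fun z : {ffun arr_in -> E} => \sum_(a : arr_in) rarr M (mkarr (tagged a)) (z a)).
Definition beta : 'Hom(E, {ffun arr_out -> E}) :=
  linfun (fun y : E => [ffun b : arr_out => rarr M (mkarr (tagged b)) y]).
Definition gamma : 'Hom({ffun arr_out -> E}, {ffun arr_in -> E}) :=
  linfun (fun z : {ffun arr_out -> E} => [ffun a : arr_in => \sum_(b : arr_out)
    act (brk_rep M) (cderiv (brk_pot S) (barr (tagged a) (tagged b))) (z b)]).

Definition ker_alpha := (lker alpha :&: M_in)%VS.
Definition im_alpha := (alpha @: M_in)%VS.
Definition ker_beta := (lker beta :&: M_at)%VS.
Definition im_beta := (beta @: M_at)%VS.
Definition ker_gamma := (lker gamma :&: M_out)%VS.
Definition im_gamma := (gamma @: M_out)%VS.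

(** The quotients [ker gamma / im beta] and [ker alpha / im gamma] are
    represented by complements. *)
Definition coh_out := (ker_gamma :\: im_beta)%VS.
Definition coh_in := (ker_alpha :\: im_gamma)%VS.

Definition mut_at : vectType k :=
  (subvs_of coh_out * subvs_of im_gamma * subvs_of coh_in * 'rV[k]_(drdec W u))%type.
Definition M_rest : {vspace E} := lker (ridem M u).
Definition mut_sp : vectType k := (subvs_of M_rest * mut_at)%type.

(** [alpha' = (- pi rho, - gamma, 0, 0)], where [rho : M_out -> ker gamma] is a
    retraction and [pi] the projection modulo [im beta]. *)
Definition mut_alpha (z : {ffun arr_out -> E}) : mut_at :=
  (- vsproj coh_out (addv_pi1 ker_gamma im_beta (projv ker_gamma z)),
   - vsproj im_gamma (gamma z), 0, 0).

(** [beta' = (0, iota, iota sigma, 0)], where [sigma] is the section of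
    [ker alpha -> ker alpha / im gamma] given by the complement. *)
Definition mut_beta (t : mut_at) : {ffun arr_in -> E} :=
  vsval t.1.1.2 + vsval t.1.2.

Definition mut_idem (i : V) : 'End(mut_sp) :=
  linfun (fun t : mut_sp =>
    if i == u then ((0, t.2) : mut_sp)
    else ((vsproj M_rest (ridem M i (vsval t.1)), 0) : mut_sp)).

(** The reversed arrow of [c] acts through the [c]-component of [alpha'] if [c]
    starts at [u], and of [beta'] if [c] ends at [u]. *)
Definition mut_arr (c : arr premut) : 'End(mut_sp) :=
  match c with
  | existT ij (inl c0) =>
      let a := @mkarr V Q ij.2 ij.1 (val c0) in
      if ij.2 == u then
        linfun (fun t : mut_sp => ((0, mut_alpha [ffun b : arr_out =>
          if mkarr (tagged b) == a then ridem M (tag b) (vsval t.1) else 0])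
          : mut_sp))
      else
        linfun (fun t : mut_sp => ((vsproj M_rest
          (\sum_(b : arr_in | mkarr (tagged b) == a) mut_beta t.2 b), 0) : mut_sp))
  | existT ij (inr c0) =>
      linfun (fun t : mut_sp => ((vsproj M_rest
        (rarr (brk_rep M) (@mkarr V brk ij.1 ij.2 c0) (vsval t.1)), 0) : mut_sp))
  end.

Definition premut_drep : drep k premut :=
  DRep (Rep mut_idem mut_arr)
    (fun i => if i == u then (\dim ker_beta - \dim (ker_beta :&: im_alpha))%N
              else drdec W i).

End Bracket.

Arguments brk_pot {k V Q} u S _.
Arguments premut_pot {k V Q} u S _.

Section Reduction.
Variables (k : fieldType) (V : finType).

Definition qsum (Q1 Q2 : quiver V) : quiver V := fun i j => (Q1 i j + Q2 i j)%type.

Definition in_l (Q1 Q2 : quiver V) (c : arr (qsum Q1 Q2)) : option (arr Q1) :=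
  if tagged c is inl c0 then Some (@mkarr V Q1 (tag c).1 (tag c).2 c0) else None.
Definition in_r (Q1 Q2 : quiver V) (c : arr (qsum Q1 Q2)) : option (arr Q2) :=
  if tagged c is inr c0 then Some (@mkarr V Q2 (tag c).1 (tag c).2 c0) else None.
Definition arr_l (Q1 Q2 : quiver V) (c : arr Q1) : arr (qsum Q1 Q2) :=
  @mkarr V (qsum Q1 Q2) (src c) (tgt c) (inl (tagged c)).

Definition pot_sum (Q1 Q2 : quiver V) (S1 : potential k Q1) (S2 : potential k Q2) :
    potential k (qsum Q1 Q2) := fun w =>
  coef S1 (pmap (@in_l Q1 Q2) (val w)) *+ all (isSome \o @in_l Q1 Q2) (val w)
  + coef S2 (pmap (@in_r Q1 Q2) (val w)) *+ all (isSome \o @in_r Q1 Q2) (val w).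

Definition alg_map (Q Q' : quiver V) := forall i j, pser k Q i j -> pser k Q' i j.

(** Algebra isomorphism of completed path algebras fixing the idempotents, with
    inverse [g]. *)
Definition alg_iso (Q Q' : quiver V) (f : alg_map Q Q') (g : alg_map Q' Q) :=
  [/\ forall i j (c : k) (x y : pser k Q i j),
        f i j (fun s => c * x s + y s) =1 fun s => c * f i j x s + f i j y s,
      forall i j l (x : pser k Q i j) (y : pser k Q j l),
        f i l (pmul x y) =1 pmul (f i j x) (f j l y),
      forall i, f i i (pone Q i) =1 pone Q' i,
      forall i j (x : pser k Q i j), g i j (f i j x) =1 x
    & forall i j (y : pser k Q' i j), f i j (g i j y) =1 y].

(** The part at [i] of a potential, as an element of the algebra; conversely,
    the cycles of a family of elements of the [e_i A e_i]. *)
Definition pot_at (Q : quiver V) (S : potential k Q) i : pser k Q i i :=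
  fun s => coef S (val s).
Arguments pot_at [Q] S i _.
Definition to_pot (Q : quiver V) (x : forall i, pser k Q i i) : potential k Q :=
  fun w => \sum_i coef (x i) (val w).

Arguments to_pot [Q] x _.

Definition image_pot (Q Q' : quiver V) (f : alg_map Q Q') (S : potential k Q) :
    potential k Q' := to_pot (fun i => f i i (pot_at S i)).

Arguments image_pot [Q Q'] f S _.

Definition reduced_pot (Q : quiver V) (S : potential k Q) :=
  forall s, (size s <= 2)%N -> coef S s = 0.

(** Trivial QP: [S] is homogeneous of degree 2 and [J(Q, S)] is spanned by the
    idempotents. *)
Definition trivial_pot (Q : quiver V) (S : potential k Q) :=
  (forall s, size s != 2%N -> coef S s = 0) /\ (forall a, jideal S (parr a)).

Arguments pot_sum [Q1 Q2] S1 S2 _.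

(** Data of a reduction of a QP on [Q]: [(Qr, Sr)] is the reduced part,
    [(Qt, St)] the trivial part. *)
Record red_data (Q : quiver V) := RedData {
  Qr : quiver V;
  Qt : quiver V;
  Sr : potential k Qr;
  St : potential k Qt;
  rphi : alg_map Q (qsum Qr Qt);
  rpsi : alg_map (qsum Qr Qt) Q }.

Arguments Sr [Q] r _.
Arguments St [Q] r _.
Arguments rphi [Q] r [i j] x _.
Arguments rpsi [Q] r [i j] x _.

(** [rphi] is a right-equivalence from [(Q, S)] to the direct sum of a reduced
    and of a trivial QP. *)
Definition is_reduction (Q : quiver V) (S : potential k Q) (R : red_data Q) :=
  [/\ alg_iso (@rphi _ R) (@rpsi _ R),
      cyc_eq (image_pot (@rphi _ R) S) (pot_sum (Sr R) (St R)),
      reduced_pot (Sr R) & trivial_pot (St R)].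

(** The reduced part of a decorated representation: [c] acts as its preimage
    under [rphi]. *)
Definition red_drep (Q : quiver V) (R : red_data Q) (W : drep k Q) :
    drep k (Qr R) :=
  DRep
    (Rep (ridem (drmod W)) (fun c : arr (Qr R) =>
       act (drmod W) (rpsi R (parr (arr_l (Qt R) c)))))
    (drdec W).

End Reduction.

Arguments Sr {k V Q} r _.
Arguments St {k V Q} r _.
Arguments rphi {k V Q} r [i j] x _.
Arguments rpsi {k V Q} r [i j] x _.

(** From here on, a quiver on [option V] has the distinguished vertex [v = None]. *)

Section Extension.
Variables (k : fieldType) (V : finType).

Definition restr (Q : quiver (option V)) : quiver V := fun i j => Q (Some i) (Some j).

Definition emb (Q : quiver (option V)) (c : arr (restr Q)) : arr Q :=
  @mkarr (option V) Q (Some (src c)) (Some (tgt c)) (tagged c).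

Definition unemb (Q : quiver (option V)) (c : arr Q) : option (arr (restr Q)) :=
  match c with
  | existT (i, j) c0 =>
    match i, j return Q i j -> option (arr (restr Q)) with
    | Some i', Some j' => fun c1 => Some (@mkarr V (restr Q) i' j' c1)
    | _, _ => fun=> None
    end c0
  end.

Definition restr_pot (Q : quiver (option V)) (S : potential k Q) :
  potential k (restr Q) := fun w => coef S (map (@emb Q) (val w)).

Arguments restr_pot [Q] S _.

(** Extension by zero to the paths through [v], and restriction to the paths
    avoiding [v]. *)
Definition pser_ext (Q : quiver (option V)) i j (x : pser k (restr Q) i j) :
    pser k Q (Some i) (Some j) := fun w =>
  coef x (pmap (@unemb Q) (val w)) *+ all (isSome \o @unemb Q) (val w).
Definition pser_restr (Q : quiver (option V)) i j (x : pser k Q (Some i) (Some j)) :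
    pser k (restr Q) i j := fun s => coef x (map (@emb Q) (val s)).

(** The restriction of a reduction: a right-equivalence induces a map modulo the
    ideal generated by [e_v]. *)
Definition restr_red (Q : quiver (option V)) (R : red_data k Q) :
    red_data k (restr Q) :=
  @RedData k V (restr Q) (restr (Qr R)) (restr (Qt R))
    (restr_pot (Sr R)) (restr_pot (St R))
    (fun i j x => @pser_restr (qsum (Qr R) (Qt R)) i j (rphi R (pser_ext x)))
    (fun i j x =>
       pser_restr (rpsi R (@pser_ext (qsum (Qr R) (Qt R)) i j x))).

(** [v] is simple: [\partial_{[ab]} [S]] only involves paths avoiding [v], i.e.
    without composite arrows [[a'b']]. *)
Definition simple_at (W : finType) (Q : quiver W) (S : potential k Q) (v : W) :=
  forall i j (a : Q i v) (b : Q v j) p,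
    has (@is_barr W Q v) (val p) -> cderiv (brk_pot v S) (barr a b) p = 0.

Definition emb_brk (Q : quiver (option V)) (c : arr (restr Q)) :
    arr (brk Q None) :=
  @mkarr (option V) (brk Q None) (Some (src c)) (Some (tgt c))
    (inl (exist _ (tagged c) isT)).

(** The presentation [d_v] over the restriction of [(Q, S)]. *)
Definition vertex_pres (Q : quiver (option V)) (S : potential k Q) :
    pres k (restr Q) :=
  @Pres k V (restr Q) (fun i => Q (Some i) None) (fun j => Q None (Some j))
    (fun i a j b s =>
       coef (cderiv (brk_pot None S) (barr a b)) (map (@emb_brk Q) (val s))).

(** The extension [(Q, S)[D]]. *)
Definition ext_quiver (Q : quiver V) (D : pres k Q) : quiver (option V) :=
  fun i j => match i, j with
  | Some i', Some j' => Q i' j'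
  | None, Some w => pos D w
  | Some w, None => neg D w
  | None, None => void
  end.

Definition ext_pot (Q : quiver V) (S : potential k Q) (D : pres k Q) :
    potential k (ext_quiver D) :=
  let X := ext_quiver D in fun w =>
  coef S (pmap (@unemb X) (val w)) *+ all (isSome \o @unemb X) (val w)
  + \sum_i \sum_(a : neg D i) \sum_j \sum_(b : pos D j)
      (if val w is a' :: b' :: p then
         coef (pmx D i a j b) (pmap (@unemb X) p)
         *+ [&& a' == @mkarr (option V) X (Some i) None a,
                b' == @mkarr (option V) X None (Some j) b
              & all (isSome \o @unemb X) p]
       else 0).

(** Premutation at [u] commutes, definitionally, with restriction. *)
Lemma restr_premut_ext (Q : quiver V) (D : pres k Q) (u : V) :
  restr (premut (ext_quiver D) (Some u)) = premut Q u.
Proof. by []. Qed.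

End Extension.

Arguments restr_pot {k V Q} S _.
Arguments vertex_pres {k V Q} S.
Arguments ext_pot {k V Q} S D _.

(* Main.v *)
Require Import Defs.
From HB Require Import structures.
From mathcomp Require Import all_boot all_order all_algebra.
From mathcomp Require Import boolp zify.

(** The two presentations present the same module, and a count of their summands shows that their
    decorations agree as well.  That [d_v] presents the mutated module follows from an exactness
    property which the extension by [W] has by construction and which mutations preserve.

    Let [M] be the module underlying [W].  The presentation [D] extends [M] to a module [N] over
    the extended quiver with potential ([extN]): [N] is [k] at the new vertex [v = None] and [M]
    elsewhere, the arrows from [v] send the generator of [k] to the generators of [M] that [D]
    prescribes, and the arrows into [v] act by zero.  For a module over a quiver with potential and a
    vertex [w], the arrows into [w] and the second derivatives of the potential give a complex
    [N_out -> N_in -> N_w] (maps [gamma] and [alpha]).  For [M] this complex misses exactly the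
    generators and the minimal relations of [M] at [w] ([gen_onto], [rel_onto] and the converses
    [gen_free], [rel_free]).  In [N] the new arrows account for them: the complex of [N]
    is exact at [N_in] and [N_w] for every [w != v] ([exact_N]).

    This exactness is preserved by mutation at [u] ([exact_mut]).  A mutation of [N] is built on
    the space of the mutation of [W] at [u], the decoration of [W] at [u] being used as the target
    of the reversed arrows of the summands [P_u -> 0]; its part off [v] is then the mutation of [M]
    ([mutation_extends]).

    Conversely, exactness off [v] determines the relations of the generator of the module at [v]:
    peeling off arrows one at a time, a series that kills it lies in the Jacobian ideal, up to
    paths of arbitrary length and up to paths that return to [v] ([ret]).  Along a
    right-equivalence Jacobian ideals correspond by the chain rule ([box_chain], [jid_to],
    [jid_from]), so that this survives the passage to the reduced part of the mutated quiver
    with potential, and it says that [d_v] is a presentation of the mutation of [M]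
    ([vertex_exact]).

    Finally two presentations of a module are homotopy equivalent as soon as the differences of
    the multiplicities of [P_i] in their two terms agree ([htpy_iso_of_exact]): the comparison
    maps can be corrected so that their mapping cone becomes an invertible matrix modulo the
    radical.  For [d_v] and [d_(mu_u W)] the multiplicities are the numbers of arrows
    [i -> v] and [v -> i] and those of a minimal presentation and the decoration.  Exactness
    expresses the discrepancy as the dimension of a space of forms on the arrows [i -> v]
    ([numerics]), which is the decoration of [mu_u(W)] ([deco_dim]); the trivial part
    of the mutated quiver has as many arrows [i -> v] as [v -> i] ([card_Qt]). *)

Set Implicit Arguments.
Unset Strict Implicit.
Unset Printing Implicit Defensive.

Import GRing.Theory.
Local Open Scope ring_scope.

(** * Power series in noncommuting letters *)

Section Ser.
Variables (k : fieldType) (X : eqType).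

Definition ser : Type := seq X -> k.
HB.instance Definition _ := gen_eqMixin ser.
HB.instance Definition _ := gen_choiceMixin ser.
Implicit Types (x y z : ser) (s t : seq X).

Definition sadd x y : ser := fun s => x s + y s.
Definition sopp x : ser := fun s => - x s.
Definition szero : ser := fun=> 0.
Definition sone : ser := fun s => (s == [::])%:R.
Definition sscale c x : ser := fun s => c * x s.
Definition smul x y : ser := fun s =>
  \sum_(n < (size s).+1) x (take n s) * y (drop n s).

(** Quotients of a series by a letter: [x = x [::] + \sum_a a * lq a x
    = x [::] + \sum_a rq a x * a]. *)
Definition lq (a : X) x : ser := fun s => x (a :: s).
Definition rq (a : X) x : ser := fun s => x (rcons s a).

Lemma saddA : associative sadd.
Proof. by move=> x y z; apply: funext => s; rewrite /sadd addrA. Qed.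
Lemma saddC : commutative sadd.
Proof. by move=> x y; apply: funext => s; rewrite /sadd addrC. Qed.
Lemma sadd0 : left_id szero sadd.
Proof. by move=> x; apply: funext => s; rewrite /sadd add0r. Qed.
Lemma saddN : left_inverse szero sopp sadd.
Proof. by move=> x; apply: funext => s; rewrite /sadd addNr. Qed.
HB.instance Definition _ := GRing.isZmodule.Build ser saddA saddC sadd0 saddN.

Lemma smul_nil x y : smul x y [::] = x [::] * y [::].
Proof. by rewrite /smul big_ord1. Qed.

Lemma smul_cons x y a s :
  smul x y (a :: s) = x [::] * y (a :: s) + smul (lq a x) y s.
Proof. by rewrite /smul big_ord_recl /=. Qed.

Lemma smulDl : left_distributive smul sadd.
Proof.
move=> x y z; apply: funext => s; rewrite /sadd /smul -big_split.
by apply: eq_bigr => i _; rewrite mulrDl.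
Qed.
Lemma smulDr : right_distributive smul sadd.
Proof.
move=> x y z; apply: funext => s; rewrite /sadd /smul -big_split.
by apply: eq_bigr => i _; rewrite mulrDr.
Qed.
Lemma sscalerAl c x y : sscale c (smul x y) = smul (sscale c x) y.
Proof.
apply: funext => s; rewrite /sscale /smul mulr_sumr.
by apply: eq_bigr => i _; rewrite mulrA.
Qed.
Lemma sscalerAr c x y : sscale c (smul x y) = smul x (sscale c y).
Proof.
apply: funext => s; rewrite /sscale /smul mulr_sumr.
by apply: eq_bigr => i _; rewrite mulrCA.
Qed.
Lemma smulA : associative smul.
Proof.
move=> x y z; apply: funext => s; elim: s x y z => [|a s IH] x y z.
  by rewrite !smul_nil mulrA.
rewrite !smul_cons !smul_nil.
have -> : lq a (smul x y) = sadd (sscale (x [::]) (lq a y)) (smul (lq a x) y).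
  by apply: funext => t; rewrite /lq smul_cons.
by rewrite smulDl -sscalerAl /sadd /sscale -IH mulrDr !mulrA addrA.
Qed.
Lemma smul1 : left_id sone smul.
Proof.
move=> x; apply: funext => -[|a s]; first by rewrite smul_nil mul1r.
rewrite smul_cons mul1r /smul big1 ?addr0 // => i _.
by rewrite /lq /sone /= mul0r.
Qed.
Lemma smulr1 : right_id sone smul.
Proof.
move=> x; apply: funext => s; elim: s x => [|a s IH] x.
  by rewrite smul_nil mulr1.
by rewrite smul_cons IH /sone /lq /= mulr0 add0r.
Qed.
HB.instance Definition _ :=
  GRing.Zmodule_isPzRing.Build ser smulA smul1 smulr1 smulDl smulDr.
Lemma sone_neq0 : 1 != 0 :> ser.
Proof.
apply/eqP => /(congr1 (fun x : ser => x [::])) /eqP.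
by rewrite [X in X == _](_ : _ = 1) // oner_eq0.
Qed.
HB.instance Definition _ := GRing.PzSemiRing_isNonZero.Build ser sone_neq0.

Lemma sscaleA c d x : sscale c (sscale d x) = sscale (c * d) x.
Proof. by apply: funext => s; rewrite /sscale mulrA. Qed.
Lemma sscale1 : left_id 1 sscale.
Proof. by move=> x; apply: funext => s; rewrite /sscale mul1r. Qed.
Lemma sscaleDr : right_distributive sscale +%R.
Proof. by move=> c x y; apply: funext => s; rewrite /sscale [LHS]mulrDr. Qed.
Lemma sscaleDl x : {morph (sscale^~ x) : c d / c + d}.
Proof. by move=> c d; apply: funext => s; rewrite /sscale mulrDl. Qed.
HB.instance Definition _ :=
  GRing.Zmodule_isLmodule.Build k ser sscaleA sscale1 sscaleDr sscaleDl.
HB.instance Definition _ := GRing.Lmodule_isLalgebra.Build k ser sscalerAl.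
HB.instance Definition _ := GRing.Lalgebra_isAlgebra.Build k ser sscalerAr.

Lemma serD x y s : (x + y) s = x s + y s. Proof. by []. Qed.
Lemma serN x s : (- x) s = - x s. Proof. by []. Qed.
Lemma ser0 s : (0 : ser) s = 0. Proof. by []. Qed.
Lemma ser1 s : (1 : ser) s = (s == [::])%:R. Proof. by []. Qed.
Lemma serZ c x s : (c *: x) s = c * x s. Proof. by []. Qed.
Lemma serM x y s :
  (x * y) s = \sum_(n < (size s).+1) x (take n s) * y (drop n s).
Proof. by []. Qed.
Lemma ser_sum I (r : seq I) (P : pred I) (F : I -> ser) s :
  (\sum_(i <- r | P i) F i) s = \sum_(i <- r | P i) F i s.
Proof. by elim/big_ind2: _ => // x u y v <- <-. Qed.
Definition serE := (serD, serN, ser0, ser1, serZ).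

Lemma serP x y : (forall s, x s = y s) -> x = y.
Proof. by move=> h; apply: funext. Qed.

Lemma serM_nil x y : (x * y) [::] = x [::] * y [::].
Proof. exact: smul_nil. Qed.
Lemma serM_cons x y a s :
  (x * y) (a :: s) = x [::] * y (a :: s) + (lq a x * y) s.
Proof. exact: smul_cons. Qed.

Lemma lq_mul a x y : lq a (x * y) = x [::] *: lq a y + lq a x * y.
Proof. by apply: serP => s; rewrite /lq serM_cons. Qed.

Lemma serM_rcons x y a s :
  (x * y) (rcons s a) = (x * rq a y) s + x (rcons s a) * y [::].
Proof.
elim: s x => [|b s IH] x /=.
  by rewrite serM_cons !serM_nil.
by rewrite !serM_cons IH addrA.
Qed.

Lemma rq_mul a x y : rq a (x * y) = x * rq a y + y [::] *: rq a x.
Proof. by apply: serP => s; rewrite /rq serM_rcons !serE (mulrC (y _)). Qed.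

Lemma lqD a x y : lq a (x + y) = lq a x + lq a y. Proof. by []. Qed.
Lemma rqD a x y : rq a (x + y) = rq a x + rq a y. Proof. by []. Qed.
Lemma rqB a x y : rq a (x - y) = rq a x - rq a y. Proof. by []. Qed.
Lemma lqN a x : lq a (- x) = - lq a x. Proof. by []. Qed.
Lemma rqN a x : rq a (- x) = - rq a x. Proof. by []. Qed.
Lemma lqZ a c x : lq a (c *: x) = c *: lq a x. Proof. by []. Qed.
Lemma lq0 a : lq a 0 = 0. Proof. by []. Qed.
Lemma rq0 a : rq a 0 = 0. Proof. by []. Qed.
Lemma lq1 a : lq a 1 = 0. Proof. by []. Qed.
Lemma lq_sum a I (r : seq I) (P : pred I) (F : I -> ser) :
  lq a (\sum_(i <- r | P i) F i) = \sum_(i <- r | P i) lq a (F i).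
Proof. by apply: serP => s; rewrite /lq !ser_sum. Qed.
Lemma rq_sum a I (r : seq I) (P : pred I) (F : I -> ser) :
  rq a (\sum_(i <- r | P i) F i) = \sum_(i <- r | P i) rq a (F i).
Proof. by apply: serP => s; rewrite /rq !ser_sum. Qed.
Lemma lq_rq a b x : lq a (rq b x) = rq b (lq a x). Proof. by []. Qed.

Definition ltr (a : X) : ser := fun s => (s == [:: a])%:R.

Lemma ltr_nil a : ltr a [::] = 0. Proof. by []. Qed.
Lemma lq_ltr a b : lq a (ltr b) = (a == b)%:R.
Proof.
apply: serP => s; rewrite /lq /ltr eqseq_cons; case: eqP => _ //=.
Qed.
Lemma rq_ltr a b : rq a (ltr b) = (a == b)%:R.
Proof.
apply: serP => s; rewrite /rq /ltr -[[:: b]]/(rcons [::] b) eqseq_rcons andbC.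
by case: eqP.
Qed.
Lemma lq_ltrM a b x : lq a (ltr b * x) = (a == b)%:R * x.
Proof. by rewrite lq_mul ltr_nil scale0r add0r lq_ltr. Qed.
Lemma rq_Mltr a b x : rq a (x * ltr b) = x * (a == b)%:R.
Proof. by rewrite rq_mul ltr_nil scale0r addr0 rq_ltr. Qed.

(** [ord N x]: [x] lies in the [N]-th power of the ideal of the letters. *)
Definition ord (N : nat) x := forall s, (size s < N)%N -> x s = 0.

Lemma ord_0 x : ord 0 x. Proof. by []. Qed.
Lemma ordW M N x : (M <= N)%N -> ord N x -> ord M x.
Proof. by move=> MN h s /leq_trans/(_ MN); apply: h. Qed.
Lemma ordD N x y : ord N x -> ord N y -> ord N (x + y).
Proof. by move=> hx hy s sN; rewrite serE hx // hy // addr0. Qed.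
Lemma ordN N x : ord N x -> ord N (- x).
Proof. by move=> hx s sN; rewrite serE hx // oppr0. Qed.
Lemma ordB N x y : ord N x -> ord N y -> ord N (x - y).
Proof. by move=> hx hy; apply: ordD => //; apply: ordN. Qed.
Lemma ordZ N c x : ord N x -> ord N (c *: x).
Proof. by move=> hx s sN; rewrite serE hx // mulr0. Qed.
Lemma ord_sum N I (r : seq I) (P : pred I) (F : I -> ser) :
  (forall i, P i -> ord N (F i)) -> ord N (\sum_(i <- r | P i) F i).
Proof. by move=> h; elim/big_ind: _ => // x y; apply: ordD. Qed.
Lemma ordM M N x y : ord M x -> ord N y -> ord (M + N) (x * y).
Proof.
move=> hx hy s sMN; rewrite serM big1 // => i _.
case: (ltnP (size (take i s)) M) => h1; first by rewrite hx // mul0r.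
rewrite hy ?mulr0 //.
have := sMN; rewrite -{1}(cat_take_drop i s) size_cat => h2.
by rewrite -(ltn_add2l M); apply: leq_ltn_trans h2; rewrite leq_add2r.
Qed.
Lemma ordMl N x y : ord N y -> ord N (x * y).
Proof. by move=> h; rewrite -[N]add0n; apply: ordM. Qed.
Lemma ordMr N x y : ord N x -> ord N (x * y).
Proof. by move=> h; rewrite -[N]addn0; apply: ordM. Qed.
Lemma ord_ltr a : ord 1 (ltr a).
Proof. by move=> -[]. Qed.
Lemma ord_lq N a x : ord N.+1 x -> ord N (lq a x).
Proof. by move=> h s sN; apply: h. Qed.
Lemma ord_rq N a x : ord N.+1 x -> ord N (rq a x).
Proof. by move=> h s sN; apply: h; rewrite size_rcons. Qed.
Lemma ord1P x : ord 1 x <-> x [::] = 0.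
Proof. by split=> [h|h []]//; apply: h. Qed.
Lemma ord_eq0 x : (forall N, ord N x) -> x = 0.
Proof. by move=> h; apply: serP => s; apply: (h (size s).+1). Qed.

End Ser.

Arguments ltr {k X} a.

Section SerFin.
Variables (k : fieldType) (X : finType).
Implicit Types (x y : ser k X).

Lemma lq_dec x : x = (x [::])%:A + \sum_a ltr a * lq a x.
Proof.
apply: serP => -[|a s]; rewrite serE ser_sum serE.
  by rewrite mulr1 big1 ?addr0 // => a _; rewrite serM_nil mul0r.
rewrite /= mulr0 add0r (bigD1 a) //= big1 ?addr0 => [|b ba].
  by rewrite -[RHS]/(lq a (ltr a * lq a x) s) lq_ltrM eqxx mul1r.
rewrite -[LHS]/(lq a (ltr b * lq b x) s) lq_ltrM.
by rewrite (eq_sym a) (negbTE ba) mul0r.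
Qed.

Lemma rq_dec x : x = (x [::])%:A + \sum_a rq a x * ltr a.
Proof.
apply: serP => s; case/lastP: s => [|s a]; rewrite serE ser_sum serE.
  by rewrite mulr1 big1 ?addr0 // => a _; rewrite serM_nil mulr0.
rewrite ser1 -size_eq0 size_rcons mulr0 add0r (bigD1 a) //= big1 ?addr0.
  by rewrite -[RHS]/(rq a (rq a x * ltr a) s) rq_Mltr eqxx mulr1.
move=> b ba; rewrite -[LHS]/(rq a (rq b x * ltr b) s) rq_Mltr.
by rewrite (eq_sym a) (negbTE ba) mulr0.
Qed.

End SerFin.

(** * Typed series, cyclic derivatives and the Jacobian ideal *)

Section Typed.
Variables (k : fieldType) (V : finType) (Q : quiver V).
Notation K := (ser k (arr Q)).
Implicit Types (x y z : K) (i j l : V) (a : arr Q).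

Lemma walk_cat i l j (s t : seq (arr Q)) : walk i s l -> walk l t j -> walk i (s ++ t) j.
Proof.
elim: s i => [|a s IH] i /=; first by move/eqP ->.
by case/andP => -> h1 h2; apply: IH.
Qed.

Lemma walk_split i j (s t : seq (arr Q)) : walk i (s ++ t) j -> exists2 l, walk i s l & walk l t j.
Proof.
elim: s i => [|a s IH] i /=; first by exists i.
by case/andP => -> /IH.
Qed.

Lemma walk_rcons i j s a : walk i (rcons s a) j = walk i s (src a) && (tgt a == j).
Proof.
elim: s i => [|b s IH] i /=; first by rewrite eq_sym.
by rewrite IH andbA.
Qed.

(** [x] lies in [e_i A e_j]. *)
Definition wt i j x := forall s, ~~ walk i s j -> x s = 0.

Lemma wt0 i j : wt i j 0. Proof. by []. Qed.
Lemma wtD i j x y : wt i j x -> wt i j y -> wt i j (x + y).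
Proof. by move=> hx hy s hs; rewrite serE hx // hy // addr0. Qed.
Lemma wtN i j x : wt i j x -> wt i j (- x).
Proof. by move=> hx s hs; rewrite serE hx // oppr0. Qed.
Lemma wtB i j x y : wt i j x -> wt i j y -> wt i j (x - y).
Proof. by move=> hx hy; apply: wtD => //; apply: wtN. Qed.
Lemma wtZ i j c x : wt i j x -> wt i j (c *: x).
Proof. by move=> hx s hs; rewrite serE hx // mulr0. Qed.
Lemma wt_sum i j I (r : seq I) (P : pred I) (F : I -> K) :
  (forall m, P m -> wt i j (F m)) -> wt i j (\sum_(m <- r | P m) F m).
Proof. by move=> h; elim/big_ind: _ => // x y; apply: wtD. Qed.
Lemma wt1 i : wt i i 1.
Proof. by case=> [|a s] //=; rewrite eqxx. Qed.
Lemma wt_ltr a : wt (src a) (tgt a) (ltr a).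
Proof.
move=> s hs; rewrite /ltr; case: eqP => // e.
by move: hs; rewrite e /= !eqxx.
Qed.
Lemma wtM i l j x y : wt i l x -> wt l j y -> wt i j (x * y).
Proof.
move=> hx hy s hs; rewrite serM big1 // => n _.
case: (boolP (walk i (take n s) l)) => [h1|/hx ->]; last by rewrite mul0r.
case: (boolP (walk l (drop n s) j)) => [h2|/hy ->]; last by rewrite mulr0.
by move: hs; rewrite -{1}(cat_take_drop n s) (walk_cat h1 h2).
Qed.
Lemma wt_lq i j a x : wt i j x -> wt (tgt a) j (lq a x).
Proof. by move=> hx s hs; apply: hx; rewrite /= (negbTE hs) andbF. Qed.
Lemma wt_lq0 i j a x : wt i j x -> src a != i -> lq a x = 0.
Proof.
by move=> hx hs; apply: serP => s; apply: hx; rewrite /= (negbTE hs).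
Qed.
Lemma wt_rq i j a x : wt i j x -> wt i (src a) (rq a x).
Proof. by move=> hx s hs; apply: hx; rewrite walk_rcons (negbTE hs). Qed.
Lemma wt_rq0 i j a x : wt i j x -> tgt a != j -> rq a x = 0.
Proof.
move=> hx hs; apply: serP => s; apply: hx.
by rewrite walk_rcons (negbTE hs) andbF.
Qed.
Lemma wt_nil i j x : wt i j x -> i != j -> x [::] = 0.
Proof. by move=> hx ij; apply: hx. Qed.

(** ** Translation to and from the pointwise operations on [pser] *)

Definition ofs i j x : pser k Q i j := fun s => x (val s).
Arguments ofs : clear implicits.

Lemma coef_in (A : eqType) (P : pred (seq A)) (f : {s | P s} -> k) (s : seq A)
  (h : P s) : coef f s = f (exist _ s h).
Proof.
rewrite /coef; case: insubP => [u _ e|/negP//] /=.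
by congr f; apply: val_inj.
Qed.
Lemma coef_val (A : eqType) (P : pred (seq A)) (f : {s | P s} -> k) s :
  coef f (val s) = f s.
Proof. by rewrite /coef valK. Qed.
Lemma coef_out (A : eqType) (P : pred (seq A)) (f : {s | P s} -> k) (s : seq A) :
  ~~ P s -> coef f s = 0.
Proof. by move=> h; rewrite /coef insubN. Qed.

Definition tos i j (x : pser k Q i j) : K := coef x.
Definition potS (S : potential k Q) : K := coef S.

Lemma wt_tos i j (x : pser k Q i j) : wt i j (tos x).
Proof. by move=> s; apply: coef_out. Qed.
Hint Resolve wt_tos : core.

Lemma tos_ofs i j x : wt i j x -> tos (ofs i j x) = x.
Proof.
move=> hx; apply: serP => s; case: (boolP (walk i s j)) => h.
  by rewrite /tos (coef_in _ h).
by rewrite /tos coef_out // hx.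
Qed.
Lemma ofs_tos i j (x : pser k Q i j) : ofs i j (tos x) = x.
Proof. by apply: funext => s; rewrite /ofs /tos coef_val. Qed.
Lemma tos_inj i j (x y : pser k Q i j) : tos x = tos y :> K -> x = y.
Proof. by move=> e; rewrite -(ofs_tos x) e ofs_tos. Qed.

(** Both sides vanish off the paths from [i] to [j]. *)
Lemma tos_eq i j (x : pser k Q i j) y :
  wt i j y -> (forall s : {s | walk i s j}, x s = y (val s)) -> tos x = y.
Proof. by move=> hy h; rewrite -(tos_ofs hy); congr tos; apply: funext. Qed.

Lemma tos_pmul i j l (x : pser k Q i j) (y : pser k Q j l) :
  tos (pmul x y) = tos x * tos y :> K.
Proof. by apply: tos_eq => //; apply: wtM. Qed.
Lemma tos_pone i : tos (pone Q i) = 1 :> K.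
Proof. by apply: tos_eq => //; apply: wt1. Qed.
Lemma tos_parr a : tos (parr a) = ltr a :> K.
Proof. by apply: tos_eq => //; apply: wt_ltr. Qed.
Lemma tos_sub i j (x y : pser k Q i j) :
  tos (fun s => x s - y s : k) = tos x - tos y :> K.
Proof.
by apply: tos_eq => [|s]; [apply: wtB | rewrite !serE /tos !coef_val].
Qed.
Lemma tos_lin i j (x y : pser k Q i j) c :
  tos (fun s => c * x s + y s : k) = c *: (tos x : K) + tos y :> K.
Proof.
apply: tos_eq => [|s]; first by apply: wtD => //; apply: wtZ.
by rewrite !serE /tos !coef_val.
Qed.
Lemma tos_zero i j : tos (fun _ : {s : seq (arr Q) | walk i s j} => 0 : k) = 0 :> K.
Proof. by apply: tos_eq. Qed.

(** ** Cyclic derivatives *)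

Definition cder (f : K) a : K := fun p =>
  \sum_(n < (size p).+1) f (drop n p ++ a :: take n p).

Lemma cycl_rcons a s : cycl (rcons s a) = cycl (a :: s).
Proof.
case: s => [|b s] //=; rewrite walk_rcons.
by rewrite andbC eq_sym.
Qed.

Lemma cycl_cat (s t : seq (arr Q)) : cycl (s ++ t) = cycl (t ++ s).
Proof.
elim: s t => [|a s IH] t; first by rewrite cats0.
by rewrite -cat_rcons -IH -rcons_cat cycl_rcons.
Qed.

Lemma cder_pot (S : potential k Q) a : tos (cderiv S a) = cder (potS S) a.
Proof.
apply: tos_eq => [p hp|//]; rewrite /cder big1 // => n _.
apply: coef_out; rewrite cycl_cat /= -[take n p]/(take n p).
by rewrite cat_take_drop.
Qed.

Lemma wt_cder (S : potential k Q) a : wt (tgt a) (src a) (cder (potS S) a).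
Proof. by rewrite -cder_pot. Qed.

Lemma wt_term (S : potential k Q) i j a (l r : K) : wt i (tgt a) l -> wt (src a) j r ->
  wt i j (l * cder (potS S) a * r).
Proof. by move=> wl wr; apply: wtM wr; apply: wtM wl _; apply: wt_cder. Qed.

(** ** The closed ideal of the cyclic derivatives *)

Definition jid (S : potential k Q) i j x := wt i j x /\ forall N,
  exists t : seq {a : arr Q & (pser k Q i (tgt a) * pser k Q (src a) j)%type},
  ord N (x - \sum_(lr <- t)
    tos (tagged lr).1 * cder (potS S) (tag lr) * tos (tagged lr).2).

Lemma jidP S i j (x : pser k Q i j) : jideal S x <-> jid S i j (tos x).
Proof.
have E (t : seq {a : arr Q & (pser k Q i (tgt a) * pser k Q (src a) j)%type}) s :
    (\sum_(lr <- t) tos (tagged lr).1 * cder (potS S) (tag lr)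
        * tos (tagged lr).2 : K) (val s)
    = \sum_(lr <- t) pmul (pmul (tagged lr).1 (cderiv S (tag lr))) (tagged lr).2 s.
  rewrite ser_sum; apply: eq_bigr => lr _.
  by rewrite -cder_pot -!tos_pmul /tos coef_val.
split=> [h|[_ h] N].
  split=> // N; have [t ht] := h N; exists t => s sN.
  case: (boolP (walk i s j)) => hs.
    pose s' : {s | walk i s j} := exist _ s hs.
    by rewrite !serE -[s]/(val s') E /tos coef_val ht ?subrr.
  rewrite (_ : _ - _ = (tos x - \sum_(lr <- t) tos (tagged lr).1 *
    cder (potS S) (tag lr) * tos (tagged lr).2 : K)) //.
  apply: (_ : wt i j _) => //; apply: wtB => //; apply: wt_sum => lr _.
  by apply: wt_term.
have [t ht] := h N; exists t => s sN.
by have /eqP := ht _ sN; rewrite !serE E /tos coef_val subr_eq0 => /eqP.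
Qed.

Section Jid.
Variable S : potential k Q.

Lemma jid_wt i j x : jid S i j x -> wt i j x. Proof. by case. Qed.
Lemma jid0 i j : jid S i j 0.
Proof. by split=> // N; exists [::]; rewrite big_nil subrr. Qed.
Lemma jidD i j x y : jid S i j x -> jid S i j y -> jid S i j (x + y).
Proof.
move=> [wx hx] [wy hy]; split=> [|N]; first exact: wtD.
have [t ht] := hx N; have [t' ht'] := hy N; exists (t ++ t').
by rewrite big_cat /= opprD addrACA; apply: ordD.
Qed.
Lemma jid_closed i j x : wt i j x ->
  (forall N, exists2 y, jid S i j y & ord N (x - y)) -> jid S i j x.
Proof.
move=> wx h; split=> // N; have [y [_ /(_ N)[t ht]] hxy] := h N; exists t.
by rewrite -(subrK y x) -addrA; apply: ordD.
Qed.
Lemma jid_gen3 i j a (l r : K) : wt i (tgt a) l -> wt (src a) j r ->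
  jid S i j (l * cder (potS S) a * r).
Proof.
move=> wl wr; split=> [|N].
  exact: wt_term.
exists [:: existT (fun a => (pser k Q i (tgt a) * pser k Q (src a) j)%type) a
   (ofs i (tgt a) l, ofs (src a) j r)].
by rewrite big_seq1 /= !tos_ofs // subrr.
Qed.

(** Induction principle: the Jacobian ideal is the least closed family that
    contains the products [l * \partial_a S * r]. *)
Lemma jid_min (P : V -> V -> K -> Prop) :
  (forall i j, P i j 0) ->
  (forall i j x y, P i j x -> P i j y -> P i j (x + y)) ->
  (forall i j x, wt i j x ->
     (forall N, exists y, [/\ wt i j y, P i j y & ord N (x - y)]) -> P i j x) ->
  (forall i j a (l r : K), wt i (tgt a) l -> wt (src a) j r ->
     P i j (l * cder (potS S) a * r)) ->
  forall i j x, jid S i j x -> P i j x.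
Proof.
move=> P0 PD Pc Pg i j x [wx hx]; apply: Pc => // N.
have [t ht] := hx N; eexists; split; last exact: ht.
  by apply: wt_sum => lr _; apply: wt_term.
by elim/big_ind: _ => [|y z|lr _]; [apply: P0 | apply: PD | apply: Pg].
Qed.

Lemma jid_gen a : jid S (tgt a) (src a) (cder (potS S) a).
Proof.
rewrite -[cder _ _]mul1r -[X in jid _ _ _ X]mulr1.
by apply: jid_gen3; apply: wt1.
Qed.

Lemma jidMl i l j y x : wt l i y -> jid S i j x -> jid S l j (y * x).
Proof.
move=> wy [wx hx]; apply: jid_closed => [|N]; first exact: wtM wy wx.
have [t ht] := hx N; exists (y * \sum_(lr <- t)
    tos (tagged lr).1 * cder (potS S) (tag lr) * tos (tagged lr).2).
  rewrite mulr_sumr; elim/big_ind: _ => [||lr _]; [exact: jid0 | exact: jidD |].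
  by rewrite !mulrA; apply: jid_gen3 => //; apply: wtM wy _.
by rewrite -mulrBr; apply: ordMl.
Qed.
Lemma jidMr i l j y x : wt j l y -> jid S i j x -> jid S i l (x * y).
Proof.
move=> wy [wx hx]; apply: jid_closed => [|N]; first exact: wtM wx wy.
have [t ht] := hx N; exists ((\sum_(lr <- t)
    tos (tagged lr).1 * cder (potS S) (tag lr) * tos (tagged lr).2) * y).
  rewrite mulr_suml; elim/big_ind: _ => [||lr _]; [exact: jid0 | exact: jidD |].
  by rewrite -!mulrA mulrA; apply: jid_gen3 => //; apply: wtM wy.
by rewrite -mulrBl; apply: ordMr.
Qed.
Lemma jidZ i j c x : jid S i j x -> jid S i j (c *: x).
Proof.
move=> h; rewrite -[x]mul1r scalerAl; apply: jidMl h.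
by apply: wtZ; apply: wt1.
Qed.
Lemma jidN i j x : jid S i j x -> jid S i j (- x).
Proof. by rewrite -scaleN1r; apply: jidZ. Qed.
Lemma jidB i j x y : jid S i j x -> jid S i j y -> jid S i j (x - y).
Proof. by move=> hx hy; apply: jidD => //; apply: jidN. Qed.
Lemma jid_sum i j I (r : seq I) (P : pred I) (F : I -> K) :
  (forall m, P m -> jid S i j (F m)) -> jid S i j (\sum_(m <- r | P m) F m).
Proof.
move=> h; elim/big_ind: _ => //; [exact: jid0 | exact: jidD].
Qed.

(** There are no loops, so the cyclic derivatives have no constant term. *)
Lemma jid_ord1 i j x : (forall l, #|Q l l| = 0%N) -> jid S i j x -> ord 1 x.
Proof.
move=> noloop; apply: (jid_min (P := fun _ _ x => ord 1 x)).
- by [].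
- by move=> *; apply: ordD.
- move=> {}i {}j {}x _ h; have [y [_ hy hxy]] := h 1%N.
  by rewrite -(subrK y x); apply: ordD.
move=> {}i {}j a l r wl wr; apply: ordMr; apply: ordMl; apply/ord1P.
rewrite (wt_nil (@wt_cder S a)) //.
case: a {wl wr} => -[i1 j1] c; apply/eqP => /= e.
rewrite /src /tgt /= in e; subst j1.
by have /card0_eq/(_ c) := noloop i1.
Qed.

End Jid.
End Typed.

Arguments ofs {k V Q} i j x _.
#[global] Hint Resolve wt_tos : core.

(** * The action of series on nilpotent representations *)

Lemma linfun_raw (k : fieldType) (aT rT : vectType k) (f : aT -> rT) :
  (forall c x y, f (c *: x + y) = c *: f x + f y) -> linfun f =1 f.
Proof.
move=> h.
pose A := GRing.isLinear.Build k aT rT *:%R f h.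
pose F : {linear aT -> rT} := HB.pack f A.
exact: (lfunE F).
Qed.

Section Rep.
Variables (k : fieldType) (V : finType) (Q : quiver V) (M : rep k Q).
Notation K := (ser k (arr Q)).
Notation E := (rsp M).
Implicit Types (x y z : K) (i j l : V) (a : arr Q) (m : E).

Fixpoint evf (N : nat) x : 'End(E) :=
  x [::] *: \1%VF +
  (if N is N'.+1 then \sum_a (evf N' (lq a x) \o rarr M a)%VF else 0).

Definition ev x := evf (\dim {: E}) x.

Lemma sum_tuple_cons (T : finType) (R : zmodType) n (F : seq T -> R) :
  \sum_(s : n.+1.-tuple T) F s = \sum_a \sum_(s : n.-tuple T) F (a :: s).
Proof.
rewrite pair_big /=.
rewrite (reindex (fun p : T * n.-tuple T => [tuple of p.1 :: p.2])) //=.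
exists (fun s : n.+1.-tuple T => (thead s, [tuple of behead s])) => [[a s] _|s _] /=.
  by congr pair; apply: val_inj.
by rewrite [in RHS](tuple_eta s).
Qed.

Lemma evfE N x : evf N x =
  \sum_(n < N.+1) \sum_(s : n.-tuple (arr Q)) x s *: wact M s.
Proof.
elim: N x => [|N IH] x.
  rewrite big_ord1 (big_pred1 [tuple]) /= ?addr0 // => s.
  by apply/esym/eqP/val_inj; case: s => -[].
rewrite big_ord_recl (big_pred1 [tuple]) /=; last first.
  by move=> s; apply/esym/eqP/val_inj; case: s => -[].
congr (_ + _); under eq_bigr => a _ do rewrite IH.
transitivity (\sum_a \sum_(n < N.+1) \sum_(s : n.-tuple (arr Q))
   (x (a :: s) *: wact M (a :: s))).
  apply: eq_bigr => a _; apply/lfunP => m; rewrite comp_lfunE !sum_lfunE.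
  apply: eq_bigr => n _; rewrite !sum_lfunE; apply: eq_bigr => s _.
  by rewrite !scale_lfunE /= comp_lfunE.
rewrite exchange_big; apply: eq_bigr => n _ /=.
by rewrite (sum_tuple_cons n (fun s => x s *: wact M s)).
Qed.

Lemma act_ev i j (x : pser k Q i j) m : act M x m = ev (tos x) (ridem M i m).
Proof.
rewrite /ev evfE /act !sum_lfunE; apply: eq_bigr => n _.
rewrite !sum_lfunE; apply: eq_bigr => s _.
by rewrite !scale_lfunE comp_lfunE.
Qed.

Lemma evf_lin N c x y : evf N (c *: x + y) = c *: evf N x + evf N y.
Proof.
elim: N x y => [|N IH] x y /=.
  by rewrite !addr0 serD serZ scalerDl scalerA.
rewrite serD serZ scalerDl scalerDr scalerA addrACA; congr (_ + _).
rewrite scaler_sumr -big_split; apply: eq_bigr => a _ /=.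
by rewrite lqD lqZ IH comp_lfunDl comp_lfunZl.
Qed.

Lemma evD x y : ev (x + y) = ev x + ev y.
Proof. by rewrite -[x in LHS]scale1r /ev evf_lin scale1r. Qed.
Lemma ev0 : ev 0 = 0.
Proof. by apply: (addrI (ev 0)); rewrite -evD !addr0. Qed.
Lemma evZ c x : ev (c *: x) = c *: ev x.
Proof. by rewrite -[c *: x]addr0 /ev evf_lin -/(ev 0) ev0 addr0. Qed.
Lemma evN x : ev (- x) = - ev x.
Proof. by rewrite -scaleN1r evZ scaleN1r. Qed.
Lemma evB x y : ev (x - y) = ev x - ev y.
Proof. by rewrite evD evN. Qed.
Lemma ev_sum I (r : seq I) (P : pred I) (F : I -> K) m :
  ev (\sum_(i <- r | P i) F i) m = \sum_(i <- r | P i) ev (F i) m.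
Proof.
elim/big_ind2: _ => [|x u y v <- <-|//]; first by rewrite ev0 lfunE.
by rewrite evD add_lfunE.
Qed.
Lemma evDE x y m : ev (x + y) m = ev x m + ev y m.
Proof. by rewrite evD add_lfunE. Qed.
Lemma evBE x y m : ev (x - y) m = ev x m - ev y m.
Proof. by rewrite evB add_lfunE opp_lfunE. Qed.
Lemma evZE c x m : ev (c *: x) m = c *: ev x m.
Proof. by rewrite evZ scale_lfunE. Qed.
Lemma ev0E m : ev 0 m = 0.
Proof. by rewrite ev0 lfunE. Qed.
Lemma evNE x m : ev (- x) m = - ev x m.
Proof. by rewrite evN opp_lfunE. Qed.

Definition good := is_rep M /\ nilpotent_rep M.

(** [vt i m]: [m] lies in [M e_i]. *)
Definition vt i m := ridem M i m = m.

Lemma vt0 i : vt i 0. Proof. exact: linear0. Qed.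
Lemma vtD i m n : vt i m -> vt i n -> vt i (m + n).
Proof. by rewrite /vt linearD /= => -> ->. Qed.
Lemma vtZ i c m : vt i m -> vt i (c *: m).
Proof. by rewrite /vt linearZ /= => ->. Qed.
Lemma vtN i m : vt i m -> vt i (- m).
Proof. by rewrite /vt linearN /= => ->. Qed.
Lemma vtB i m n : vt i m -> vt i n -> vt i (m - n).
Proof. by rewrite /vt linearB /= => -> ->. Qed.
Lemma vt_sum i I (r : seq I) (P : pred I) (F : I -> E) :
  (forall n, P n -> vt i (F n)) -> vt i (\sum_(n <- r | P n) F n).
Proof. by move=> h; elim/big_ind: _ => //; [exact: vt0 | move=> *; apply: vtD]. Qed.

(** The socle filtration of [M]. *)
Definition fil n m := forall s : seq (arr Q), (n <= size s)%N -> wact M s m = 0.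

Lemma fil0 m : fil 0 m -> m = 0.
Proof. by move=> h; have := h [::] isT; rewrite /= lfunE. Qed.
Lemma filW n p m : (n <= p)%N -> fil n m -> fil p m.
Proof. by move=> np h s /(leq_trans np); apply: h. Qed.
Lemma fil_arr n a m : fil n.+1 m -> fil n (rarr M a m).
Proof. by move=> h s hs; have := h (a :: s) hs; rewrite /= comp_lfunE. Qed.
Lemma filS n m : (forall a, fil n (rarr M a m)) -> fil n.+1 m.
Proof. by move=> h [|a s] //= hs; rewrite comp_lfunE; apply: h. Qed.
Lemma fil_0 n : fil n 0. Proof. by move=> s _; rewrite linear0. Qed.
Lemma filD n p q : fil n p -> fil n q -> fil n (p + q).
Proof. by move=> hp hq s hs; rewrite linearD /= hp // hq // addr0. Qed.
Lemma filZ n c m : fil n m -> fil n (c *: m).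
Proof. by move=> h s hs; rewrite linearZ /= h // scaler0. Qed.
Lemma fil_sum n I (r : seq I) (P : pred I) (F : I -> E) :
  (forall p, P p -> fil n (F p)) -> fil n (\sum_(p <- r | P p) F p).
Proof. by move=> h; elim/big_ind: _ => //; [apply: fil_0 | move=> *; apply: filD]. Qed.

(** The filtration is constant from the first step at which it stops growing. *)
Lemma fil_dim n : (forall m, fil n m) -> forall m, fil (\dim {: E}) m.
Proof.
move=> hn.
pose U := fix U p : {vspace E} :=
  if p is p'.+1 then (\bigcap_(a : arr Q) (rarr M a @^-1: U p'))%VS else 0%VS.
have UP p m : reflect (fil p m) (m \in U p).
  elim: p m => [|p IH] m /=.
    rewrite memv0; apply: (iffP eqP) => [->|]; [exact: fil_0 | exact: fil0].
  have memcap (I : finType) (W : I -> {vspace E}) :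
      (m \in (\bigcap_i W i)%VS) = [forall i, m \in W i].
    by rewrite memvE; apply/subv_bigcapP/forallP => h i; have := h i;
       rewrite ?memvE //; apply.
  rewrite memcap; apply: (iffP forallP) => h.
    by apply: filS => a; apply/IH; have := h a; rewrite memv_preim.
  by move=> a; rewrite -memv_preim; apply/IH/fil_arr.
have step p : U p = fullv \/ (p <= \dim (U p))%N.
  elim: p => [|p [h|h]]; first by right.
    left; apply/eqP; rewrite eqEsubv subvf -h; apply/subvP => m /UP hm.
    by apply/UP; apply: filW hm.
  have sub : (U p <= U p.+1)%VS.
    by apply/subvP => m /UP hm; apply/UP; apply: filW hm.
  have [e|ne] := eqVneq (U p) (U p.+1); last first.
    right; apply: leq_ltn_trans h _; rewrite ltn_neqAle dimvS // andbT.
    by apply: contra ne => /eqP e; rewrite eqEdim sub e leqnn.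
  left; apply/eqP; rewrite eqEsubv subvf -e; apply/subvP => m _.
  have stab q : U (p + q)%N = U p.
    elim: q => [|q IHq]; first by rewrite addn0.
    by rewrite addnS e /= IHq.
  by rewrite -(stab n); apply/UP; apply: filW (hn m); rewrite leq_addl.
move=> m; apply/UP; case: (step (\dim {: E})) => [->|h]; first by rewrite memvf.
suff -> : U (\dim {: E}) = fullv by rewrite memvf.
by apply/eqP; rewrite eqEdim subvf.
Qed.

Lemma evfS N x m :
  evf N.+1 x m = x [::] *: m + \sum_a evf N (lq a x) (rarr M a m).
Proof.
rewrite /= add_lfunE scale_lfunE id_lfunE; congr (_ + _).
by rewrite sum_lfunE; apply: eq_bigr => a _; rewrite comp_lfunE.
Qed.

Lemma evf_fil N n x m : fil n m -> (n <= N.+1)%N -> evf N.+1 x m = evf N x m.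
Proof.
elim: N n x m => [|N IH] n x m hm nN.
  rewrite /= add_lfunE sum_lfunE big1 ?addr0 // => a _.
  have h : fil 1 m by apply: filW nN hm.
  by have := h [:: a] isT; rewrite /= !comp_lfunE /= id_lfunE => ->; rewrite linear0.
have h : fil N.+2 m by apply: filW nN hm.
rewrite (evfS N.+1) (evfS N); congr (_ + _); apply: eq_bigr => a _.
exact: (IH N.+1 _ _ (fil_arr a h) (leqnn _)).
Qed.

Hypothesis gM : good.

Lemma arr_src a m : rarr M a (ridem M (src a) m) = rarr M a m.
Proof. by case: gM => [[_ _ /(_ a)[h _]] _]; rewrite -[in RHS]h comp_lfunE. Qed.
Lemma arr_tgt a m : vt (tgt a) (rarr M a m).
Proof. by case: gM => [[_ _ /(_ a)[_ h]] _]; rewrite /vt -[in RHS]h comp_lfunE. Qed.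
Lemma idem_idem i j m :
  ridem M i (ridem M j m) = if i == j then ridem M i m else 0.
Proof.
case: gM => [[/(_ i j) h _ _] _]; rewrite -comp_lfunE h.
by case: eqP => // _; rewrite lfunE.
Qed.
Lemma idem_vt i m : vt i (ridem M i m).
Proof. by rewrite /vt idem_idem eqxx. Qed.
Lemma idem_sum m : m = \sum_i ridem M i m.
Proof.
case: gM => [[_ h _] _]; rewrite -[LHS]id_lfunE -h sum_lfunE //.
Qed.
Lemma idem_vt0 i j m : vt j m -> i != j -> ridem M i m = 0.
Proof. by move=> <- ij; rewrite idem_idem (negbTE ij). Qed.
Lemma arr_vt0 i a m : vt i m -> src a != i -> rarr M a m = 0.
Proof. by move=> hm ai; rewrite -arr_src (idem_vt0 hm) // linear0. Qed.

Lemma wact_vt i s m : vt i m -> wact M s m != 0 -> exists j, walk i s j.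
Proof.
elim: s i m => [|a s IH] i m hm /=; first by exists i.
rewrite comp_lfunE => h; have [ai|ai] := eqVneq (src a) i; last first.
  by move: h; rewrite (arr_vt0 hm ai) linear0 eqxx.
by have [j hj] := IH _ _ (arr_tgt a m) h; exists j.
Qed.

Lemma filP m : fil (\dim {: E}) m.
Proof.
case: gM => _ [N hN]; apply: (@fil_dim N) => {}m s hs.
rewrite (idem_sum m) linear_sum big1 // => i _; apply: contraTeq isT => h.
have [j hj] := wact_vt (idem_vt i m) h.
by move: h; rewrite (hN s i j) //= zero_lfunE eqxx.
Qed.

Lemma ev_rec x m : ev x m = x [::] *: m + \sum_a ev (lq a x) (rarr M a m).
Proof.
by rewrite /ev -(evf_fil x (filP m)) // evfS.
Qed.

Lemma ev_mul x y m : ev (x * y) m = ev y (ev x m).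
Proof.
move: (filP m); move: (\dim _) => n; elim: n m x y => [|n IH] m x y hm.
  by rewrite (fil0 hm) !linear0.
rewrite (ev_rec x) linearD linearZ /= linear_sum [in RHS](ev_rec y m) scalerDr.
rewrite (ev_rec (x * y)) serM_nil scalerA -addrA; congr (_ + _).
rewrite scaler_sumr -big_split /=; apply: eq_bigr => a _.
by rewrite lq_mul evDE evZE IH //; apply: fil_arr.
Qed.

Lemma ev_1 m : ev 1 m = m.
Proof.
rewrite ev_rec scale1r big1 ?addr0 // => a _.
by rewrite lq1 ev0E.
Qed.

Lemma ev_ltr a m : ev (ltr a) m = rarr M a m.
Proof.
rewrite ev_rec ltr_nil scale0r add0r (bigD1 a) //= big1 ?addr0 => [|b ba].
  by rewrite lq_ltr eqxx mulr1n ev_1.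
by rewrite lq_ltr (negbTE ba) mulr0n ev0E.
Qed.

Lemma ev_rdec x m : ev x m = x [::] *: m + \sum_a rarr M a (ev (rq a x) m).
Proof.
rewrite {1}(rq_dec x) evDE evZE ev_1 ev_sum; congr (_ + _).
by apply: eq_bigr => a _; rewrite ev_mul ev_ltr.
Qed.

Lemma ev_ord n x m : fil n m -> ord n x -> ev x m = 0.
Proof.
elim: n x m => [|n IH] x m hm hx; first by rewrite (fil0 hm) linear0.
rewrite ev_rec hx // scale0r add0r big1 // => a _.
by apply: IH; [apply: fil_arr | apply: ord_lq].
Qed.

Lemma ev_big x m : ord (\dim {: E}) x -> ev x m = 0.
Proof. exact/ev_ord/filP. Qed.

Lemma fil_ev n p x m : fil (n + p) m -> ord p x -> fil n (ev x m).
Proof.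
move=> hm hx s hs.
have -> n' : wact M s n' = ev (foldr (fun a y => ltr a * y) 1 s) n'.
  elim: s {hs} n' => [|a s IH] n' /=; first by rewrite ev_1 id_lfunE.
  by rewrite comp_lfunE IH ev_mul ev_ltr.
rewrite -ev_mul; apply: ev_ord hm _; rewrite addnC; apply: ordM => //.
apply: ordW hs _; elim: s => [|a s IH] //=.
by rewrite -[(size s).+1]add1n; apply: ordM IH; apply: ord_ltr.
Qed.

Lemma vt_ev i j x m : wt i j x -> vt i m -> vt j (ev x m).
Proof.
move: (filP m); move: (\dim _) => n; elim: n m x i => [|n IH] m x i hm hx him.
  by rewrite (fil0 hm) linear0; apply: vt0.
rewrite ev_rec; apply: vtD; last first.
  apply: vt_sum => a _; apply: (IH _ _ (tgt a)); first exact: fil_arr.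
    exact: wt_lq hx.
  exact: arr_tgt.
have [<-|ij] := eqVneq i j; first exact: vtZ.
by rewrite (wt_nil hx ij) scale0r; apply: vt0.
Qed.

(** The condition on the derivatives in [is_Jmod], on the typed parts of the module. *)
Definition killed (S : potential k Q) :=
  forall a m, vt (tgt a) m -> ev (cder (potS S) a) m = 0.

Lemma jid_ev0 S i j x m : killed S -> jid S i j x -> vt i m -> ev x m = 0.
Proof.
move=> kS hx hm.
apply: (jid_min (P := fun i _ x => forall m, vt i m -> ev x m = 0) _ _ _ _ hx)
  hm => {i j x hx m} [i _ m|i _ x y hx hy m hm|i j x _ h m hm|i j a l r wl wr m hm].
- by rewrite ev0E.
- by rewrite evDE hx // hy // addr0.
- have [y [_ hy hxy]] := h (\dim {: E}).
  by rewrite -(subrK y x) evDE hy // addr0 ev_big.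
by rewrite !ev_mul (kS a) ?linear0 //; apply: vt_ev hm.
Qed.

End Rep.

Lemma is_Jmod_killed (k : fieldType) (V : finType) (Q : quiver V)
  (S : potential k Q) (M : rep k Q) : is_Jmod S M -> good M /\ killed M S.
Proof.
case=> h1 h2 h3; split=> // a m hm.
by have := congr1 (fun f : 'End(_) => f m) (h3 a); rewrite act_ev cder_pot hm lfunE.
Qed.

(** * Change of alphabet *)

Section Alphabet.
Variables (k : fieldType) (X Y : finType) (io : X -> Y) (de : Y -> option X).
Hypothesis ioK : pcancel io de.
Hypothesis deK : forall b a, de b = Some a -> b = io a.
Implicit Types (x y : ser k X) (z : ser k Y).

(** [ext] embeds the series over a subalphabet; [res] is its left inverse, and kills the
    letters outside the subalphabet. *)
Definition ext x : ser k Y := fun w => x (pmap de w) *+ all (isSome \o de) w.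
Definition res z : ser k X := fun s => z (map io s).

Lemma extD x y : ext (x + y) = ext x + ext y.
Proof. by apply: serP => w; rewrite /ext !serE mulrnDl. Qed.
Lemma ext0 : ext 0 = 0.
Proof. by apply: serP => w; rewrite /ext !serE mul0rn. Qed.
Lemma extZ c x : ext (c *: x) = c *: ext x.
Proof. by apply: serP => w; rewrite /ext !serE mulrnAr. Qed.
Lemma ext_nil x : ext x [::] = x [::]. Proof. by []. Qed.
Lemma lq_ext b x : lq b (ext x) = if de b is Some a then ext (lq a x) else 0.
Proof.
apply: serP => w; rewrite /lq /ext /=.
by case: (de b) => [a|] //=.
Qed.
Lemma rq_ext b x : rq b (ext x) = if de b is Some a then ext (rq a x) else 0.
Proof.
apply: serP => w; rewrite /rq /ext -cats1 pmap_cat all_cat /=.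
case: (de b) => [a|] /=; first by rewrite cats1 andbT.
by rewrite andbF.
Qed.
Lemma extM x y : ext (x * y) = ext x * ext y.
Proof.
apply: serP => w; elim: w x => [|b w IH] x.
  by rewrite serM_nil !ext_nil serM_nil.
rewrite serM_cons -[LHS]/(lq b (ext (x * y)) w) -[ext y (b :: w)]/(lq b (ext y) w).
rewrite !lq_ext; case: (de b) => [a|]; last by rewrite mul0r !serE mulr0 addr0.
by rewrite lq_mul extD extZ serD IH ext_nil serZ.
Qed.
Lemma ext1 : ext 1 = 1.
Proof.
apply: serP => -[|b w]; rewrite /ext !serE //=.
by case: (de b) => [a|] //=; rewrite mul0rn.
Qed.
Lemma ext_ltr a : ext (ltr a) = ltr (io a).
Proof.
apply: serP => -[|b w]; first by rewrite ext_nil.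
rewrite -[LHS]/(lq b (ext (ltr a)) w) -[RHS]/(lq b (ltr (io a)) w).
rewrite lq_ext lq_ltr; case e: (de b) => [a'|].
  rewrite (deK e) lq_ltr (inj_eq (pcan_inj ioK)).
  by case: eqP => _; rewrite ?ext1 ?ext0.
by case: eqP => // ba; rewrite ba ioK in e.
Qed.
Lemma ext_ord N x : ord N x -> ord N (ext x).
Proof.
move=> hx w wN; rewrite /ext; case: (boolP (all _ _)) => h; rewrite // ?mulr1n.
apply: hx; apply: leq_ltn_trans wN.
by rewrite size_pmap; apply: count_size.
Qed.

Lemma resB z (w : ser k Y) : res (z - w) = res z - res w. Proof. by []. Qed.
Lemma res_sum I (r : seq I) (P : pred I) (F : I -> ser k Y) :
  res (\sum_(i <- r | P i) F i) = \sum_(i <- r | P i) res (F i).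
Proof. by apply: serP => s; rewrite /res !ser_sum. Qed.
Lemma lq_res a z : lq a (res z) = res (lq (io a) z). Proof. by []. Qed.
Lemma rq_res a z : rq a (res z) = res (rq (io a) z).
Proof. by apply: serP => s; rewrite /rq /res map_rcons. Qed.
Lemma resM z (w : ser k Y) : res (z * w) = res z * res w.
Proof.
apply: serP => s; elim: s z => [|a s IH] z.
  by rewrite serM_nil -[LHS]/((z * w) [::]) serM_nil.
rewrite -[LHS]/((z * w) (io a :: map io s)) !serM_cons.
by congr (_ + _); apply: IH.
Qed.
Lemma res1 : res 1 = 1.
Proof. by apply: serP => -[]. Qed.
Lemma res_ord N z : ord N z -> ord N (res z).
Proof. by move=> hz s sN; apply: hz; rewrite size_map. Qed.
Lemma res_ext x : res (ext x) = x.
Proof.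
apply: serP => s; rewrite /res /ext map_pK // all_map.
rewrite (eq_all (a2 := predT)) ?all_predT // => a /=.
by rewrite ioK.
Qed.

Lemma sum_io (R : zmodType) (F : Y -> R) :
  (forall b, de b = None -> F b = 0) -> \sum_b F b = \sum_a F (io a).
Proof.
move=> h; rewrite (bigID (fun b => de b : bool)) /= addrC big1 ?add0r; last first.
  by move=> b; case e: (de b) => // _; apply: h.
rewrite (reindex_omap io de) /=; last first.
  by move=> b; case e: (de b) => [a|] // _; rewrite /= -(deK e).
by apply: eq_bigl => a; rewrite ioK eqxx.
Qed.

End Alphabet.

Section AlphabetRep.
Variables (k : fieldType) (V1 V2 : finType) (Q1 : quiver V1) (Q2 : quiver V2).
Variables (io : arr Q1 -> arr Q2) (de : arr Q2 -> option (arr Q1)).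
Hypothesis ioK : pcancel io de.
Hypothesis deK : forall b a, de b = Some a -> b = io a.
Variables (M1 : rep k Q1) (M2 : rep k Q2) (la : 'Hom(rsp M1, rsp M2)).
Hypotheses (g1 : good M1) (g2 : good M2).
Hypothesis la_io : forall a m, la (rarr M1 a m) = rarr M2 (io a) (la m).

Hypothesis la_de : forall b m, de b = None -> rarr M2 b (la m) = 0.

Lemma ev_res z m : ev M2 z (la m) = la (ev M1 (res io z) m).
Proof.
move: (filP g1 m); move: (\dim _) => n; elim: n m z => [|n IH] m z hm.
  by rewrite (fil0 hm) !linear0.
rewrite (ev_rec g2) (ev_rec g1) linearD linearZ linear_sum /=.
congr (_ + _); rewrite (sum_io ioK deK); last first.
  by move=> b h; rewrite la_de // linear0.
by apply: eq_bigr => a _; rewrite -la_io IH //; apply: fil_arr.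
Qed.

End AlphabetRep.

(** * Presentations of modules *)

Section Pres.
Variables (k : fieldType) (V : finType) (Q : quiver V).
Notation K := (ser k (arr Q)).
Implicit Types (D : pres k Q) (S : potential k Q) (M : rep k Q).
Implicit Types (i j l w : V) (a : arr Q).

Definition Tn D := {i : V & neg D i}.
Definition Tp D := {i : V & pos D i}.

Definition dm D (m : Tn D) (b : Tp D) : K :=
  tos (pmx D (tag m) (tagged m) (tag b) (tagged b)).

(** The elements of [P(B) e_l]. *)
Definition wtv (B : V -> finType) l (y : {i : V & B i} -> K) :=
  forall b, wt (tag b) l (y b).

Definition aug M (B : V -> finType) (g : {i : V & B i} -> rsp M)
    (y : {i : V & B i} -> K) : rsp M := \sum_b ev M (y b) (g b).

Definition img D (z : Tn D -> K) (b : Tp D) : K := \sum_m dm m b * z m.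

Definition exact_pres S M D (g : Tp D -> rsp M) :=
  [/\ forall b, vt (tag b) (g b),
      forall l x, vt l x -> exists2 y, wtv l y & x = aug g y
    & forall l y, wtv l y -> (aug g y = 0 <->
        exists2 z, wtv l z & forall b, jid S (tag b) l (y b - @img D z b))].

Definition min_conds S M D (g : Tp D -> rsp M) :=
  (forall l y, wtv l y -> aug g y = 0 -> forall b, y b [::] = 0) /\
  (forall l z, wtv l z -> (forall b, jid S (tag b) l (@img D z b)) ->
     forall m, z m [::] = 0).

Lemma wt_dm D (m : Tn D) (b : Tp D) : wt (tag b) (tag m) (dm m b).
Proof. exact: wt_tos. Qed.

Lemma wtv_img D l z : wtv l z -> wtv l (@img D z).
Proof. by move=> hz b; apply: wt_sum => m _; exact: (wtM (@wt_dm _ m b) (hz m)). Qed.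

Section Untyped.
Variables (B : V -> finType) (l : V).
Definition toT (y : forall i, B i -> pser k Q i l) (b : {i : V & B i}) : K :=
  tos (y (tag b) (tagged b)).
Definition ofT (y : {i : V & B i} -> K) i (b : B i) : pser k Q i l :=
  ofs i l (y (existT (fun i => B i : Type) i b)).
Lemma wtv_toT y : wtv l (toT y).
Proof. by move=> b; apply: wt_tos. Qed.
Lemma ofTK y : wtv l y -> toT (ofT y) = y.
Proof.
by move=> hy; apply: funext => -[i b]; rewrite /toT /ofT tos_ofs //; apply: hy.
Qed.
End Untyped.

Lemma augmE M (gM : good M) (B : V -> finType) (g : forall i, B i -> rsp M) l
    (y : forall i, B i -> pser k Q i l) :
  (forall i b, ridem M i (g i b) = g i b) ->
  augm g y = aug (fun b : {i : V & B i} => g (tag b) (tagged b)) (toT y).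
Proof.
move=> hg; rewrite /augm sig_big_dep; apply: eq_bigr => b _.
by rewrite act_ev hg.
Qed.

Lemma pimageE D l (z : forall i, neg D i -> pser k Q i l) (b : Tp D) :
  tos (pimage z (i := tag b) (tagged b)) = img (toT z) b.
Proof.
apply: tos_eq => [|s].
  by apply: wtv_img; apply: wtv_toT.
rewrite /pimage sig_big_dep /img ser_sum; apply: eq_bigr => m _.
by rewrite -[X in X s]ofs_tos /ofs tos_pmul.
Qed.

Lemma min_presP S M D : good M -> min_pres S M D ->
  exists g : Tp D -> rsp M, exact_pres S g /\ min_conds S g.
Proof.
move=> gM [g [h1 h2 h3 h4 h5]].
exists (fun b => g (tag b) (tagged b)); split; first split.
- by move=> b; apply: h1.
- move=> l x hx; have [|y ->] := h2 l x; first by rewrite -hx memv_img ?memvf.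
  exists (toT y); [exact: wtv_toT | exact: augmE].
- move=> l y hy; rewrite -(ofTK hy) -augmE // h4; split=> -[z hz].
    exists (toT z) => [|b]; first exact: wtv_toT.
    by have /jidP := hz (tag b) (tagged b); rewrite tos_sub pimageE.
  move=> hj; exists (ofT z) => i b; apply/jidP.
  rewrite tos_sub.
  rewrite (pimageE (ofT z) (existT (fun i => pos D i : Type) i b)) ofTK //.
  exact: (hj (existT (fun i => pos D i : Type) i b)).
split=> l y hy; rewrite -(ofTK hy).
  rewrite -augmE // => h b; rewrite /toT /tos; exact: h3 h _ _.
move=> h m; apply: h5 => i b; apply/jidP.
rewrite (pimageE (ofT y) (existT (fun i => pos D i : Type) i b)).
exact: (h (existT (fun i => pos D i : Type) i b)).
Qed.

Section Aug.
Variables (M : rep k Q) (gM : good M) (B : V -> finType) (g : {i : V & B i} -> rsp M).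
Hypothesis hg : forall b, vt (tag b) (g b).
Implicit Types (y : {i : V & B i} -> K).

Lemma augD y1 y2 : aug g (fun b => y1 b + y2 b) = aug g y1 + aug g y2.
Proof. by rewrite /aug -big_split; apply: eq_bigr => b _; rewrite evDE. Qed.
Lemma augB y1 y2 : aug g (fun b => y1 b - y2 b) = aug g y1 - aug g y2.
Proof. by rewrite /aug -sumrB; apply: eq_bigr => b _; rewrite evBE. Qed.
Lemma augZ c y : aug g (fun b => c *: y b) = c *: aug g y.
Proof. by rewrite /aug scaler_sumr; apply: eq_bigr => b _; rewrite evZE. Qed.
Lemma aug_sum I (r : seq I) (P : pred I) (F : I -> {i : V & B i} -> K) :
  aug g (fun b => \sum_(i <- r | P i) F i b) = \sum_(i <- r | P i) aug g (F i).
Proof.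
rewrite /aug exchange_big; apply: eq_bigr => b _ /=.
by rewrite ev_sum.
Qed.
Lemma augM y x : aug g (fun b => y b * x) = ev M x (aug g y).
Proof. by rewrite /aug linear_sum; apply: eq_bigr => b _; rewrite ev_mul. Qed.
Lemma aug_big y : (forall b, ord (\dim {: rsp M}) (y b)) -> aug g y = 0.
Proof. by move=> h; rewrite /aug big1 // => b _; apply: ev_big. Qed.
Lemma vt_aug l y : wtv l y -> vt l (aug g y).
Proof. by move=> hy; apply: vt_sum => b _; apply: vt_ev (hy b) (hg b). Qed.
End Aug.

(** ** The first syzygies of a module *)
(** The [w]-part of a presentation, restricted to the leading terms of its entries, completes the
    complex [M_out -> M_in -> M_w] formed by the second and first derivatives of the potential. *)
Section Syzygy.
Variables (S : potential k Q) (M : rep k Q) (gM : good M) (kM : killed M S).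
Hypothesis noloop : loopless Q.

Definition tyin (y : arr Q -> rsp M) := forall a, vt (src a) (y a).
Definition tyout (z : arr Q -> rsp M) := forall c, vt (tgt c) (z c).

Definition gam w (z : arr Q -> rsp M) (a : arr Q) : rsp M :=
  \sum_(c | src c == w) ev M (rq a (cder (potS S) c)) (z c).

Lemma gam_lin w c (z1 z2 : arr Q -> rsp M) a :
  gam w (fun b => c *: z1 b + z2 b) a = c *: gam w z1 a + gam w z2 a.
Proof.
by rewrite /gam scaler_sumr -big_split; apply: eq_bigr => b _; rewrite linearP.
Qed.

Lemma gamD w (z1 z2 : arr Q -> rsp M) a :
  gam w (fun b => z1 b + z2 b) a = gam w z1 a + gam w z2 a.
Proof. by rewrite -[gam w z1 a]scale1r -gam_lin; congr (gam w _ a); apply: funext => b; rewrite scale1r. Qed.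

Lemma gam0 w a : gam w (fun=> 0) a = 0.
Proof. by rewrite /gam big1 // => c _; rewrite linear0. Qed.

Lemma gam_sum w I (r : seq I) (F : I -> arr Q -> rsp M) a :
  gam w (fun b => \sum_(i <- r) F i b) a = \sum_(i <- r) gam w (F i) a.
Proof.
elim: r => [|i r IH].
  rewrite big_nil; transitivity (gam w (fun=> 0) a); last exact: gam0.
  congr (gam w _ a).
  by apply: funext => b; rewrite big_nil.
rewrite big_cons -IH -gamD; congr (gam w _ a).
by apply: funext => b; rewrite big_cons.
Qed.

(** Induction over the ideal: only the last factor of a product [l * cder a * r] meets the
    right quotient, and when [r = 1] the quotients of [cder a] are the second derivatives. *)
Lemma jid_gam i l x p : jid S i l x -> vt i p ->
  exists2 z, tyout z & forall a, tgt a = l -> ev M (rq a x) p = gam l z a.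
Proof.
move=> hx; apply: (jid_min (P := fun i l x => forall p, vt i p ->
  exists2 z, tyout z & forall a, tgt a = l -> ev M (rq a x) p = gam l z a)
  _ _ _ _ hx p) => {i l x p hx}.
- move=> i l p _; exists (fun=> 0) => [c|a _]; first exact: vt0.
  by rewrite rq0 ev0E gam0.
- move=> i l x y hx hy p hp; have [z hz ez] := hx p hp; have [z' hz' ez'] := hy p hp.
  exists (fun c => z c + z' c) => [c|a al]; first exact: vtD.
  by rewrite rqD evDE ez // ez' // gamD.
- move=> i l x wx h p hp; have [y [_ hy hxy]] := h (\dim {: rsp M}).+1.
  have [z hz ez] := hy p hp; exists z => // a al.
  by rewrite -(ez a al) -(subrK y x) rqD evDE ev_big ?add0r //; apply: ord_rq.
move=> i l c L R wL wR p hp.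
have hv : vt (tgt c) (ev M L p) by apply: vt_ev hp.
exists (fun c' => if c' == c then (R [::]) *: ev M L p else 0) => [c'|a al].
  by case: eqP => [->|_]; [apply: vtZ | apply: vt0].
have c0 : cder (potS S) c [::] = 0.
  by apply: (jid_ord1 noloop (jid_gen S c)).
rewrite rq_mul evDE evZE rq_mul evDE evZE c0 scale0r addr0.
have k0 : ev M (L * cder (potS S) c) p = 0 by rewrite (ev_mul gM) kM.
rewrite (ev_mul gM _ (rq a R)) k0 linear0 add0r (ev_mul gM L).
have [e|ne] := eqVneq (src c) l.
  rewrite /gam (bigD1 c) ?e //= eqxx big1 ?addr0 ?linearZ //= => c' /andP[_].
  by move/negbTE => ->; apply: linear0.
rewrite (wt_nil wR ne) scale0r /gam big1 // => c' e.
case: eqP => [cc|_]; last exact: linear0.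
by move: e ne; rewrite cc => /eqP -> /eqP.
Qed.

Variables (D : pres k Q) (g : Tp D -> rsp M).
Hypothesis ex : exact_pres S g.

Lemma aug_img l z : wtv l z -> aug g (@img D z) = 0.
Proof.
move=> hz; case: ex => _ _ /(_ l _ (wtv_img hz)) [_]; apply; exists z => // b.
by rewrite subrr; apply: jid0.
Qed.

(** The leading term at [a] of the relation attached to the generator [m] of [P(neg D)]. *)
Definition relv (m : Tn D) a : rsp M := aug g (fun b => rq a (dm m b)).

Lemma vt_rel m a : tgt a = tag m -> vt (src a) (relv m a).
Proof.
case: ex => hg _ _ e; apply: vt_aug => // b.
exact: wt_rq (@wt_dm _ m b).
Qed.

(** Separate the constant terms of the coefficients of [x] over the generators from the terms
    that end in an arrow. *)
Lemma gen_onto w x : vt w x -> exists (c : Tp D -> k) (y : arr Q -> rsp M),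
  tyin y /\ x = \sum_(b | tag b == w) c b *: g b + \sum_(a | tgt a == w) rarr M a (y a).
Proof.
case: ex => hg hs _ /hs [y hy ->].
exists (fun b => y b [::]), (fun a => aug g (fun b => rq a (y b))); split.
  by move=> a; apply: vt_aug => // b; apply: wt_rq (hy b).
rewrite /aug; under eq_bigr => b _ do rewrite (ev_rdec gM).
rewrite big_split /= [X in X + _](bigID (fun b => tag b == w)) /=.
rewrite [X in _ + X + _]big1 ?addr0; last first.
  by move=> b bw; rewrite (wt_nil (hy b) bw) scale0r.
congr (_ + _); rewrite exchange_big [LHS](bigID (fun a => tgt a == w)) /=.
rewrite [X in _ + X]big1 ?addr0; last first.
  move=> a aw; rewrite big1 // => b _.
  by rewrite (wt_rq0 (hy b) aw) ev0E linear0.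
by apply: eq_bigr => a _; rewrite linear_sum.
Qed.

Lemma lift_tyin y : tyin y -> exists Y : arr Q -> Tp D -> K,
  (forall a, wtv (src a) (Y a)) /\ forall a, aug g (Y a) = y a.
Proof.
case: ex => _ hs _ hy.
have /choice [Y hY] a : exists Y, wtv (src a) Y /\ aug g Y = y a.
  by have [Y h1 ->] := hs _ _ (hy a); exists Y.
by exists Y; split=> a; case: (hY a).
Qed.

Lemma lift_tyout z : tyout z -> exists Z : arr Q -> Tp D -> K,
  (forall a, wtv (tgt a) (Z a)) /\ forall a, aug g (Z a) = z a.
Proof.
case: ex => _ hs _ hz.
have /choice [Z hZ] a : exists Z, wtv (tgt a) Z /\ aug g Z = z a.
  by have [Z h1 ->] := hs _ _ (hz a); exists Z.
by exists Z; split=> a; case: (hZ a).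
Qed.

Lemma wtv_join w (Y : arr Q -> Tp D -> K) : (forall a, wtv (src a) (Y a)) ->
  wtv w (fun b => \sum_(a | tgt a == w) Y a b * ltr a).
Proof.
move=> hY b; apply: wt_sum => a /eqP <-.
by apply: wtM (hY a b) _; apply: wt_ltr.
Qed.

Lemma rq_join w (Y : arr Q -> Tp D -> K) a b : tgt a = w ->
  rq a (\sum_(a | tgt a == w) Y a b * ltr a) = Y a b.
Proof.
move=> aw; rewrite rq_sum (bigD1 a) ?aw //= rq_Mltr eqxx mulr1 big1 ?addr0 //.
by move=> a' /andP[_ ne]; rewrite rq_Mltr eq_sym (negbTE ne) mulr0.
Qed.

(** Lift [y] to a relation between the generators, write it as the image of an element of
    [P(neg D)] up to the Jacobian ideal, and take right quotients: the constant terms give [c],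
    the ideal and the other terms give [z]. *)
Lemma rel_onto w y : tyin y -> \sum_(a | tgt a == w) rarr M a (y a) = 0 ->
  exists (c : Tn D -> k) (z : arr Q -> rsp M), tyout z /\
  forall a, tgt a = w -> y a = \sum_(m | tag m == w) c m *: relv m a + gam w z a.
Proof.
move=> /lift_tyin [Y [wY eY]] h0.
have [hg _ hex] := ex.
have wJ := wtv_join (w := w) wY.
have /(hex _ _ wJ) [z wz hz] : aug g (fun b => \sum_(a | tgt a == w) Y a b * ltr a) = 0.
  rewrite aug_sum -[RHS]h0; apply: eq_bigr => a _.
  by rewrite augM // ev_ltr // eY.
have /choice [ze hze] (b : Tp D) : exists zb, tyout zb /\ forall a, tgt a = w ->
    ev M (rq a (\sum_(a | tgt a == w) Y a b * ltr a - img z b)) (g b) = gam w zb a.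
  by have [zb h1 h2] := jid_gam (hz b) (hg b); exists zb.
exists (fun m => z m [::]), (fun c => \sum_b ze b c); split.
  by move=> c; apply: vt_sum => b _; case: (hze b).
move=> a aw; rewrite gam_sum -eY.
have wrz : wtv (src a) (fun m => rq a (z m)) by move=> m; apply: wt_rq (wz m).
transitivity (\sum_b ev M (rq a (img z b)) (g b) + \sum_b gam w (ze b) a).
  rewrite -big_split; apply: eq_bigr => b _ /=; case: (hze b) => _ <- //.
  by rewrite rqB evBE rq_join // addrC subrK.
congr (_ + _).
transitivity (aug g (img (fun m => rq a (z m))) +
   \sum_m z m [::] *: relv m a).
  rewrite /aug; under [X in _ = _ + X]eq_bigr => m _ do rewrite scaler_sumr.
  rewrite [X in _ = _ + X]exchange_big -big_split /=; apply: eq_bigr => b _.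
  rewrite /img !ev_sum rq_sum ev_sum -big_split /=; apply: eq_bigr => m _.
  by rewrite rq_mul evDE evZE.
rewrite (aug_img wrz) add0r (bigID (fun m => tag m == w)) /=.
by rewrite [X in _ + X]big1 ?addr0 // => m mw; rewrite (wt_nil (wz m) mw) scale0r.
Qed.

Hypothesis mc : min_conds S g.

(** A linear combination of generators in the radical is a relation with nonzero constant term. *)
Lemma gen_free w (c : Tp D -> k) y : tyin y ->
  \sum_(b | tag b == w) c b *: g b + \sum_(a | tgt a == w) rarr M a (y a) = 0 ->
  forall b, tag b = w -> c b = 0.
Proof.
move=> /lift_tyin [Y [wY eY]] h b bw.
pose Z b := (c b *+ (tag b == w))%:A + \sum_(a | tgt a == w) Y a b * ltr a : K.
have wZ : wtv w Z.
  move=> b'; apply: wtD; last exact: wtv_join.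
  by case: eqP => [->|_]; [apply: wtZ; apply: wt1 | rewrite scale0r].
have /(mc.1 _ _ wZ)/(_ b) : aug g Z = 0.
  rewrite augD aug_sum -[RHS]h; congr (_ + _).
    rewrite [RHS]big_mkcond; apply: eq_bigr => b' _; rewrite evZE ev_1 //.
    by case: eqP; rewrite ?scale0r.
  by apply: eq_bigr => a _; rewrite augM // ev_ltr // eY.
rewrite /Z !serE ser_sum bw eqxx mulr1 big1 ?addr0 // => a _.
by rewrite serM_nil mulr0.
Qed.

Lemma dm_nil (m : Tn D) (b : Tp D) : dm m b [::] = 0 :> k.
Proof.
apply: (mc.1 (tag m) (fun b => dm m b)); first by move=> b'; apply: wt_dm.
have w1 : wtv (tag m) (fun m' : Tn D => (m' == m)%:R : K).
  by move=> m'; case: eqP => [->|_]; [apply: wt1 | apply: wt0].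
rewrite -[RHS](aug_img w1); congr (aug g _); apply: funext => b'.
rewrite /img (bigD1 m) //= eqxx mulr1 big1 ?addr0 // => m' /negbTE ->.
by rewrite mulr0.
Qed.

(** [c] and a lift of [z] assemble into an element of [P(neg D)] with constant term [c] that
    maps into the Jacobian ideal. *)
Lemma rel_free w (c : Tn D -> k) z : tyout z ->
  (forall a, tgt a = w -> \sum_(m | tag m == w) c m *: relv m a + gam w z a = 0) ->
  forall m, tag m = w -> c m = 0.
Proof.
move=> /lift_tyout [Z [wZ eZ]] h m mw.
have [hg _ hex] := ex.
have c0 b : cder (potS S) b [::] = 0 by apply: (jid_ord1 noloop (jid_gen S b)).
pose X b := \sum_(m | tag m == w) c m *: dm m b +
   \sum_(e | src e == w) Z e b * cder (potS S) e.
have wX : wtv w X.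
  move=> b; apply: wtD; apply: wt_sum => m' /eqP <-.
    by apply: wtZ; apply: wt_dm.
  by apply: wtM (wZ _ _) _; apply: wt_cder.
have X0 b : X b [::] = 0.
  rewrite /X serD !ser_sum big1 => [|m' _]; last by rewrite serE dm_nil mulr0.
  by rewrite big1 ?addr0 // => e _; rewrite serM_nil c0 mulr0.
have /choice [z' hz'] (a : arr Q) : exists z', wtv (src a) z' /\ (tgt a = w ->
    forall b, jid S (tag b) (src a) (rq a (X b) - img z' b)).
  have [aw|aw] := eqVneq (tgt a) w; last first.
    by exists (fun=> 0); split=> [b|/eqP]; [apply: wt0 | rewrite (negbTE aw)].
  have wr : wtv (src a) (fun b => rq a (X b)) by move=> b; apply: wt_rq (wX b).
  have /(hex _ _ wr) [z' h1 h2] : aug g (fun b => rq a (X b)) = 0; last by exists z'.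
  rewrite -[RHS](h a aw) /X.
  transitivity (aug g (fun b => \sum_(m | tag m == w) c m *: rq a (dm m b)) +
      aug g (fun b => \sum_(e | src e == w) Z e b * rq a (cder (potS S) e))).
    rewrite -augD; congr (aug g _); apply: funext => b.
    rewrite rqD !rq_sum; congr (_ + _); apply: eq_bigr => e _.
    by rewrite rq_mul c0 scale0r addr0.
  rewrite !aug_sum; congr (_ + _); apply: eq_bigr => e _; first exact: augZ.
  by rewrite augM // eZ.
pose Y (m : Tn D) : K := (c m *+ (tag m == w))%:A - \sum_(a | tgt a == w) z' a m * ltr a.
have wY : wtv w Y.
  move=> m'; apply: wtB.
    by case: eqP => [->|_]; [apply: wtZ; apply: wt1 | rewrite scale0r].
  apply: wt_sum => a /eqP <-; case: (hz' a) => h1 _.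
  by apply: wtM (h1 m') _; apply: wt_ltr.
have : Y m [::] = 0.
  apply: (mc.2 _ _ wY) => b.
  have -> : img Y b = \sum_(a | tgt a == w) (rq a (X b) - img (z' a) b) * ltr a
      - \sum_(e | src e == w) Z e b * cder (potS S) e.
    have XE : X b = \sum_(a | tgt a == w) rq a (X b) * ltr a.
      rewrite [LHS]rq_dec X0 scale0r add0r (bigID (fun a => tgt a == w)) /=.
      rewrite [X in _ + X]big1 ?addr0 // => a aw.
      by rewrite (wt_rq0 (wX b) aw) mul0r.
    under [X in _ = X - _]eq_bigr => a _ do rewrite mulrBl.
    rewrite sumrB -XE /X addrAC addrK /img /Y.
    under eq_bigr => m' _ do rewrite mulrBr.
    rewrite sumrB; congr (_ - _).
      rewrite [RHS]big_mkcond; apply: eq_bigr => m' _.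
      by rewrite -scalerAr mulr1; case: eqP; rewrite ?scale0r.
    under [RHS]eq_bigr => a _ do rewrite mulr_suml.
    rewrite exchange_big; apply: eq_bigr => m' _; rewrite mulr_sumr.
    by apply: eq_bigr => a _; rewrite mulrA.
  apply: jidB; apply: jid_sum => a /eqP aw.
    by case: (hz' a) => _ /(_ aw) h2; rewrite -{1}aw; apply: jidMr (h2 b); apply: wt_ltr.
  by rewrite -{1}aw; apply: jidMl (wZ a b) _; apply: jid_gen.
rewrite /Y !serE ser_sum mw eqxx mulr1 big1 ?subr0 // => a _.
by rewrite serM_nil mulr0.
Qed.

End Syzygy.
End Pres.

(** * Derivatives of the mutated potential *)

Section CyclicSums.
Variables (k : fieldType) (X : eqType).
Implicit Types (f : seq X -> k) (p q : seq X).

(** The sum of [f] over the cyclic rotations of [p q] that do not cut [q]. *)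
Definition cs f q p : k := \sum_(n < (size p).+1) f (drop n p ++ q ++ take n p).

Lemma cs_nil f q : cs f q [::] = f q.
Proof. by rewrite /cs big_ord1 /= cats0. Qed.

Lemma cs_cons f q x p : cs f q (x :: p) = f (x :: p ++ q) + cs f (rcons q x) p.
Proof.
rewrite /cs big_ord_recl /= cats0; congr (_ + _).
by apply: eq_bigr => n _; rewrite cat_rcons.
Qed.

Lemma cs_rcons f q x p : cs f q (rcons p x) = cs f (x :: q) p + f (q ++ rcons p x).
Proof.
rewrite /cs size_rcons big_ord_recr /=; congr (_ + _).
  apply: eq_bigr => -[n hn] _ /=; rewrite ltnS in hn.
  by rewrite -cats1 drop_cat takel_cat //; move: hn; rewrite leq_eqVlt
    => /orP[/eqP ->|->]; rewrite ?ltnn ?subnn ?drop0 ?drop_size -?catA.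
by rewrite -(size_rcons p x) drop_size take_size.
Qed.

End CyclicSums.

Section SecondDerivative.
Variables (k : fieldType) (V : finType) (Q : quiver V).
Notation K := (ser k (arr Q)).
Implicit Types (f : K) (a b : arr Q).

Lemma cder_cs f a p : cder f a p = cs f [:: a] p.
Proof. by []. Qed.

(** The second derivative [\partial_{ab} S], for a path [ab] of length two. *)
Lemma lq_cder f a b : lq b (cder f a) = rq a (cder f b).
Proof.
apply: serP => p; rewrite /lq /rq !cder_cs cs_cons cs_rcons /= addrC.
by rewrite cats1.
Qed.

Lemma cderD f1 f2 a : cder (f1 + f2) a = cder f1 a + cder f2 a.
Proof. by apply: serP => p; rewrite serD /cder -big_split. Qed.

Lemma cder_sum I (r : seq I) (P : pred I) (F : I -> K) a :
  cder (\sum_(i <- r | P i) F i) a = \sum_(i <- r | P i) cder (F i) a.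
Proof.
elim/big_ind2: _ => [|x u y v <- <-|//]; last by rewrite cderD.
by apply: serP => p; rewrite /cder big1.
Qed.

Definition tri (x y z : arr Q) : K := fun w => (w == [:: x; y; z])%:R.

Lemma cder_tri (x y z : arr Q) a : cder (tri x y z) a =
  (a == x)%:R * (ltr y * ltr z) + (a == y)%:R * (ltr z * ltr x)
  + (a == z)%:R * (ltr x * ltr y) :> K.
Proof.
have L (y' z' : arr Q) p : (ltr y' * ltr z' : K) p = (p == [:: y'; z'])%:R.
  case: p => [|b p]; first by rewrite serM_nil mul0r.
  rewrite -[LHS]/(lq b (ltr y' * ltr z') p) lq_ltrM eqseq_cons.
  by case: eqP => _; rewrite ?mul1r // mul0r.
have L' (c : bool) y' z' p :
    (c%:R * (ltr y' * ltr z') : K) p = (c && (p == [:: y'; z']))%:R.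
  by case: c; rewrite ?mul1r ?mul0r ?L.
apply: serP => p; rewrite !serD !L'.
have [|np] := eqVneq (size p) 2; last first.
  rewrite /cder big1 => [|n _]; last first.
    rewrite /tri; case: eqP => // /(congr1 size) /eqP; rewrite size_cat /= addnS -size_cat.
    rewrite size_cat addnC -size_cat cat_take_drop eqSS => /eqP e.
    by rewrite e in np.
  have h y' z' : (p == [:: y'; z']) = false.
    by apply/eqP => e; rewrite e in np.
  by rewrite !h !andbF !addr0.
case: p => [|p1 [|p2 [|//]]] // _.
rewrite /cder /tri !big_ord_recr big_ord0 /= add0r !eqseq_cons !andbT.
rewrite [LHS]addrC addrCA addrA [LHS]addrAC -addrA addrCA addrA.
rewrite [LHS]addrAC [X in X + _ = _]addrC; congr (_ + _ + _).
  by rewrite andbC -andbA.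
by rewrite andbA andbC.
Qed.

End SecondDerivative.
Arguments tri k {V Q} x y z _.

Section ExtDer.
Variables (k : fieldType) (V1 V2 : finType) (Q1 : quiver V1) (Q2 : quiver V2).
Variables (io : arr Q1 -> arr Q2) (de : arr Q2 -> option (arr Q1)).
Hypothesis ioK : pcancel io de.
Hypothesis deK : forall b a, de b = Some a -> b = io a.

Lemma all_deP w : all (isSome \o de) w -> w = map io (pmap de w).
Proof.
elim: w => //= b w IH; case e: (de b) => [a|] //= h.
by rewrite -(deK e) -IH.
Qed.

Lemma cder_ext (f : ser k (arr Q1)) a : cder (ext de f) (io a) = ext de (cder f a).
Proof.
apply: serP => p; rewrite [RHS]/ext /cder.
case: (boolP (all _ _)) => h; last first.
  rewrite mulr0n big1 // => n _; rewrite /ext all_cat /= ioK /= andbC.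
  by rewrite -all_cat cat_take_drop (negbTE h).
have [p' e] : exists p', p = map io p' by exists (pmap de p); apply: all_deP.
subst p; rewrite map_pK // mulr1n size_map; apply: eq_bigr => n _.
rewrite -map_drop -map_take -map_cons -map_cat /ext map_pK // all_map.
by rewrite (eq_all (a2 := predT)) ?all_predT // => c /=; rewrite ioK.
Qed.

Lemma cder_ext0 (f : ser k (arr Q1)) b : de b = None -> cder (ext de f) b = 0.
Proof.
move=> e; apply: serP => p; rewrite /cder big1 // => n _.
by rewrite /ext all_cat /= e andbF.
Qed.

Lemma cder_res (f : ser k (arr Q2)) a :
  cder (res io f) a = res io (cder f (io a)).
Proof.
apply: serP => p; rewrite /res /cder size_map; apply: eq_bigr => n _.
by rewrite map_cat /= map_drop map_take.
Qed.

End ExtDer.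

Lemma inj_surj_bij (A B : Type) (f : A -> B) :
  injective f -> (forall b, exists a, f a = b) -> bijective f.
Proof.
move=> fi /choice [g gK]; exists g => // a.
by apply: fi; rewrite gK.
Qed.

Section Premutation.
Variables (k : fieldType) (V : finType) (Q : quiver V) (u : V).
Hypothesis noloop : loopless Q.
Notation K := (ser k (arr Q)).
Notation Kb := (ser k (arr (brk Q u))).
Notation Km := (ser k (arr (premut Q u))).
Implicit Types (a : arr_in Q u) (b : arr_out Q u) (S : potential k Q).

Definition un (w : seq (arr (brk Q u))) : seq (arr Q) := flatten (map (@unbrk V Q u) w).

Lemma walk_un i p j : walk i (un p) j = walk i p j.
Proof.
elim: p i => [|[[x y] [c0|[a0 b0]]] p IH] i //=; first by rewrite IH.
by rewrite /un /= -/(un _) eqxx IH.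
Qed.

Lemma cycl_un p : cycl (un p) = cycl p.
Proof.
case: p => [|[[x y] [c0|[a0 b0]]] p] //=; first by rewrite walk_un.
by rewrite /un /= -/(un _) eqxx walk_un.
Qed.

Lemma brk_potE (S : potential k Q) w : potS (brk_pot u S) w = potS S (un w) +
  (if rotr 1 (un w) is c :: _ then potS S (rotr 1 (un w)) *+ (src c == u) else 0).
Proof.
rewrite /potS; case: (boolP (cycl w)) => h; first by rewrite (coef_in _ h).
have h' : ~~ cycl (un w) by rewrite cycl_un.
rewrite coef_out // [coef S (un w)]coef_out // add0r.
case e: (rotr _ _) => [//|c s]; rewrite -e coef_out ?mul0rn //.
by rewrite /rotr /rot cycl_cat cat_take_drop.
Qed.

Definition sub (x : K) : Kb := fun w => x (un w).

Lemma un_cat p q : un (p ++ q) = un p ++ un q.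
Proof. by rewrite /un map_cat flatten_cat. Qed.

Definition extra (S : potential k Q) (c : arr (brk Q u)) (q p : seq (arr Q)) : k :=
  match c with
  | existT ij (inl c0) => 0
  | existT ij (inr ab) => potS S (mkarr ab.2 :: p ++ q ++ [:: mkarr ab.1])
  end.

Lemma brk_pot_rcons S q c : potS (brk_pot u S) (rcons q c) =
  potS S (un (rcons q c)) + extra S c (un q) [::].
Proof.
rewrite brk_potE; congr (_ + _); rewrite -cats1 un_cat.
case: c => -[x y] [c0|[a0 b0]]; rewrite /un /= -/(un _).
  rewrite cats1 rotr1_rcons /src /=.
  have mulrb0 (z : k) (t : bool) : ~~ t -> z *+ t = 0 by case: t.
  by have /andP[/= h1 _] := valP c0; apply: mulrb0.
by rewrite -cat_rcons cats1 rotr1_rcons /src /= eqxx mulr1n cats1.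
Qed.

Lemma cs_brk S q c p : cs (potS (brk_pot u S)) (rcons q c) p =
  cs (potS S) (un (rcons q c)) (un p) + extra S c (un q) (un p).
Proof.
elim: p q c => [|d p IH] q c; first by rewrite !cs_nil brk_pot_rcons.
rewrite cs_cons IH -rcons_cat -rcons_cons brk_pot_rcons.
have E : extra S c (un (d :: p ++ q)) [::] = extra S c (un q) (un (d :: p)).
  by rewrite -cat_cons un_cat; case: c {IH} => -[x y] [c0|[a0 b0]] //; rewrite /extra cat0s catA.
rewrite E addrAC; congr (_ + _).
rewrite rcons_cons rcons_cat -cat_cons un_cat -(cats1 (rcons q c) d) un_cat.
rewrite -[d :: p]cat1s un_cat; move: (un (rcons q c)) (un p) => q' p'.
case: d {IH E} => -[x y] [c0|[a0 b0]].
  by rewrite /extra addr0 /un /= cs_cons cats1.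
rewrite /extra /un /= !cs_cons -!cats1 -?catA /=.
by rewrite addrA addrAC addrA.
Qed.

Definition ain a : arr Q := mkarr (tagged a).
Definition aout b : arr Q := mkarr (tagged b).
Definition abr a b : arr (brk Q u) := barr (tagged a) (tagged b).

Lemma cder_brk_br S a b :
  cder (potS (brk_pot u S)) (abr a b) = sub (rq (ain a) (cder (potS S) (aout b))).
Proof.
apply: serP => p; rewrite /sub /rq !cder_cs -[[:: abr a b]]/(rcons [::] (abr a b)).
by rewrite cs_brk cs_rcons /= cats1.
Qed.

Lemma cder_brk_inl S i j (c : {c : Q i j | (i != u) && (j != u)}) :
  cder (potS (brk_pot u S)) (@mkarr V (brk Q u) i j (inl c)) =
  sub (cder (potS S) (mkarr (val c))).
Proof.
apply: serP => p; rewrite /sub !cder_cs -[[:: mkarr (inl c)]]/(rcons [::] _).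
by rewrite cs_brk addr0.
Qed.

(** ** The arrows of the mutated quiver *)

Definition okarr (c : arr Q) := (src c != u) && (tgt c != u).
Definition oldT : finType := {c : arr Q | okarr c}.

Definition bold (c : oldT) : arr (brk Q u) :=
  @mkarr V (brk Q u) (src (val c)) (tgt (val c))
    (inl (exist _ (tagged (val c)) (valP c))).

Notation pb := (@premut_brk V Q u).
Definition mold (c : oldT) : arr (premut Q u) := pb (bold c).
Definition mbr a b : arr (premut Q u) := pb (abr a b).
Definition sin a : arr (premut Q u) := star_in (tagged a).
Definition sout b : arr (premut Q u) := star_out (tagged b).

Lemma pbK : pcancel pb (@unpremut V Q u).
Proof. by case=> -[i j] c. Qed.
Lemma unpbK (e : arr (premut Q u)) c : unpremut e = Some c -> e = pb c.
Proof. by case: e => -[i j] [c0|c0] //= [<-]. Qed.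

Lemma unbrk_bold c : unbrk (bold c) = [:: val c].
Proof. by case: c => -[[i j] c0] h. Qed.
Lemma unbrk_abr a b : unbrk (abr a b) = [:: ain a; aout b].
Proof. by []. Qed.

Lemma cder_brk_old S c :
  cder (potS (brk_pot u S)) (bold c) = sub (cder (potS S) (val c)).
Proof. by rewrite cder_brk_inl; congr (sub (cder _ _)); case: c => -[[i j] c0] h. Qed.

Lemma tag_in a : tag a != u.
Proof.
case: a => i a /=; apply/eqP => e; subst i.
by have /card0_eq/(_ a) := noloop u.
Qed.
Lemma tag_out b : tag b != u.
Proof.
case: b => j b /=; apply/eqP => e; subst j.
by have /card0_eq/(_ b) := noloop u.
Qed.

Lemma src_ain a : src (ain a) = tag a. Proof. by []. Qed.
Lemma tgt_ain a : tgt (ain a) = u. Proof. by []. Qed.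
Lemma src_aout b : src (aout b) = u. Proof. by []. Qed.
Lemma tgt_aout b : tgt (aout b) = tag b. Proof. by []. Qed.
Lemma src_mold c : src (mold c) = src (val c). Proof. by []. Qed.
Lemma tgt_mold c : tgt (mold c) = tgt (val c). Proof. by []. Qed.
Lemma src_mbr a b : src (mbr a b) = tag a. Proof. by []. Qed.
Lemma tgt_mbr a b : tgt (mbr a b) = tag b. Proof. by []. Qed.
Lemma src_sin a : src (sin a) = u. Proof. by []. Qed.
Lemma tgt_sin a : tgt (sin a) = tag a. Proof. by []. Qed.
Lemma src_sout b : src (sout b) = tag b. Proof. by []. Qed.
Lemma tgt_sout b : tgt (sout b) = u. Proof. by []. Qed.
Lemma un_sin a : unpremut (sin a) = None. Proof. by []. Qed.
Lemma un_sout b : unpremut (sout b) = None. Proof. by []. Qed.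

Lemma ain_inj : injective ain.
Proof.
move=> [i a] [j b] e; have /= ij : i = j := congr1 (@src V Q) e.
by subst j; congr existT; apply: (eq_from_Tagged e).
Qed.
Lemma aout_inj : injective aout.
Proof.
move=> [i a] [j b] e; have /= ij : i = j := congr1 (@tgt V Q) e.
by subst j; congr existT; apply: (eq_from_Tagged e).
Qed.
Lemma abr_inj a a' b b' : abr a b = abr a' b' -> a = a' /\ b = b'.
Proof.
move=> /(congr1 (@unbrk V Q u)) e; split.
  exact/ain_inj/(congr1 (head (ain a)) e).
exact/aout_inj/(congr1 (last (ain a)) e).
Qed.
Lemma bold_inj : injective bold.
Proof.
move=> c c' /(congr1 (@unbrk V Q u)); rewrite !unbrk_bold.
by move/(congr1 (head (val c)))/val_inj.
Qed.
Lemma mold_inj : injective mold.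
Proof. by move=> c c' /(pcan_inj pbK)/bold_inj. Qed.
Lemma mbr_inj a a' b b' : mbr a b = mbr a' b' -> a = a' /\ b = b'.
Proof. by move=> /(pcan_inj pbK)/abr_inj. Qed.
Lemma sin_inj : injective sin.
Proof.
move=> [i a] [j b] e; have /= ij : i = j := congr1 (@tgt V _) e.
by subst j; congr existT; have /= [] := eq_from_Tagged e.
Qed.
Lemma sout_inj : injective sout.
Proof.
move=> [i a] [j b] e; have /= ij : i = j := congr1 (@src V _) e.
by subst j; congr existT; have /= [] := eq_from_Tagged e.
Qed.
Lemma sin_sout a b : sin a != sout b.
Proof.
by apply/eqP => /(congr1 (@src V _)) /= /eqP; rewrite eq_sym (negbTE (tag_out b)).
Qed.
Lemma bold_abr c a b : bold c != abr a b.
Proof. by apply/eqP => /(congr1 (@unbrk V Q u)); rewrite unbrk_bold. Qed.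
Lemma mold_mbr c a b : mold c != mbr a b.
Proof. by apply/eqP => /(pcan_inj pbK)/eqP; rewrite (negbTE (bold_abr _ _ _)). Qed.
Lemma mold_sin c a : mold c != sin a.
Proof. by apply/eqP => /(congr1 (@unpremut V Q u)); rewrite pbK. Qed.
Lemma mold_sout c b : mold c != sout b.
Proof. by apply/eqP => /(congr1 (@unpremut V Q u)); rewrite pbK. Qed.
Lemma mbr_sin a b a' : mbr a b != sin a'.
Proof. by apply/eqP => /(congr1 (@unpremut V Q u)); rewrite pbK. Qed.
Lemma mbr_sout a b b' : mbr a b != sout b'.
Proof. by apply/eqP => /(congr1 (@unpremut V Q u)); rewrite pbK. Qed.

Lemma old_ain (c : oldT) a : val c != ain a.
Proof. by apply/eqP => e; have := valP c; rewrite e /okarr eqxx andbF. Qed.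
Lemma old_aout (c : oldT) b : val c != aout b.
Proof. by apply/eqP => e; have := valP c; rewrite e /okarr eqxx. Qed.

Lemma star_sin i j (c : {c : Q j i | (i == u) || (j == u)}) : i = u ->
  exists a, sin a = @mkarr V (premut Q u) i j (inl c).
Proof.
case: c => c h e; subst i; exists (existT (fun j => Q j u : Type) j c).
by rewrite /sin /star_in; congr mkarr; congr inl; apply: val_inj.
Qed.
Lemma star_sout i j (c : {c : Q j i | (i == u) || (j == u)}) : j = u ->
  exists b, sout b = @mkarr V (premut Q u) i j (inl c).
Proof.
case: c => c h e; subst j; exists (existT (fun i => Q u i : Type) i c).
by rewrite /sout /star_out; congr mkarr; congr inl; apply: val_inj.
Qed.

Definition arr_sum (x : (oldT + arr_in Q u + arr_out Q u)%type) : arr Q :=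
  match x with inl (inl c) => val c | inl (inr a) => ain a | inr b => aout b end.

Lemma arr_sum_bij : bijective arr_sum.
Proof.
apply: inj_surj_bij => [|c].
  move=> [[c|a]|b] [[c'|a']|b'] /= e.
  - by congr (inl (inl _)); apply: val_inj.
  - by case/eqP: (old_ain c a').
  - by case/eqP: (old_aout c b').
  - by case/eqP: (old_ain c' a); apply: esym.
  - by rewrite (ain_inj e).
  - by have /eqP := congr1 (@src V Q) e; rewrite /= (negbTE (tag_in a)).
  - by case/eqP: (old_aout c' b); apply: esym.
  - by have /eqP := congr1 (@src V Q) e; rewrite /= eq_sym (negbTE (tag_in a')).
  - by rewrite (aout_inj e).
case: (boolP (okarr c)) => h; first by exists (inl (inl (exist _ c h))).
case: c h => -[i j] c; rewrite /okarr /src /tgt /= negb_and !negbK.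
case: eqP => [e _|_ /= /eqP e]; subst.
  by exists (inr (existT _ j c)).
by exists (inl (inr (existT _ i c))).
Qed.

Definition brk_sum (x : (oldT + arr_in Q u * arr_out Q u)%type) : arr (brk Q u) :=
  match x with inl c => bold c | inr ab => abr ab.1 ab.2 end.

Lemma brk_sum_bij : bijective brk_sum.
Proof.
apply: inj_surj_bij => [|c].
  move=> [c|[a b]] [c'|[a' b']] /= e.
  - by rewrite (bold_inj e).
  - by have := bold_abr c a' b'; rewrite e eqxx.
  - by have := bold_abr c' a b; rewrite e eqxx.
  - by have [-> ->] := abr_inj e.
case: c => -[i j] [[c h]|[a b]].
  exists (inl (exist (fun c => okarr c) (mkarr c) h)).
  transitivity (@mkarr V (brk Q u) i j
    (inl (exist _ c (valP (exist (fun c => okarr c) (mkarr c) h))))) => //.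
  by congr mkarr; congr inl; apply: val_inj.
by exists (inr (existT _ i a, existT _ j b)).
Qed.

Definition premut_sum (x : (arr (brk Q u) + arr_in Q u + arr_out Q u)%type) :
    arr (premut Q u) :=
  match x with inl (inl c) => pb c | inl (inr a) => sin a | inr b => sout b end.

Lemma premut_sum_bij : bijective premut_sum.
Proof.
apply: inj_surj_bij => [|c].
  move=> [[c|a]|b] [[c'|a']|b'] /= e.
  - by rewrite (pcan_inj pbK e).
  - by have := congr1 (@unpremut V Q u) e; rewrite pbK.
  - by have := congr1 (@unpremut V Q u) e; rewrite pbK.
  - by have := congr1 (@unpremut V Q u) e; rewrite pbK.
  - by rewrite (sin_inj e).
  - by have := sin_sout a b'; rewrite e eqxx.
  - by have := congr1 (@unpremut V Q u) e; rewrite pbK.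
  - by have := sin_sout a' b; rewrite e eqxx.
  - by rewrite (sout_inj e).
case: c => -[i j] [c|c]; last by exists (inl (inl (@mkarr V (brk Q u) i j c))).
have [e|e] : i = u \/ j = u by case/orP: (valP c) => /eqP; [left | right].
  by have [a ea] := star_sin c e; exists (inl (inr a)).
by have [b eb] := star_sout c e; exists (inr b).
Qed.

Lemma bij_ex (A B : Type) (f : A -> B) : bijective f -> forall y, exists x, f x = y.
Proof. by case=> g _ gK y; exists (g y). Qed.

(** Arrows are dependent pairs; these principles, and the bijections behind them, replace
    destructing them. *)
Lemma arr_case (P : arr Q -> Prop) : (forall c : oldT, P (val c)) ->
  (forall a, P (ain a)) -> (forall b, P (aout b)) -> forall c, P c.
Proof.
move=> h1 h2 h3 c; case: (bij_ex arr_sum_bij c) => -[[x|x]|x] <-;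
  [exact: h1 | exact: h2 | exact: h3].
Qed.

Lemma brk_case (P : arr (brk Q u) -> Prop) : (forall c : oldT, P (bold c)) ->
  (forall a b, P (abr a b)) -> forall c, P c.
Proof.
move=> h1 h2 c; case: (bij_ex brk_sum_bij c) => -[x|[x y]] <-;
  [exact: h1 | exact: h2].
Qed.

Lemma premut_case (P : arr (premut Q u) -> Prop) :
  (forall c : oldT, P (mold c)) -> (forall a b, P (mbr a b)) ->
  (forall a, P (sin a)) -> (forall b, P (sout b)) -> forall c, P c.
Proof.
move=> h1 h2 h3 h4 c; case: (bij_ex premut_sum_bij c) => -[[x|x]|x] <-;
  [move: x | exact: h3 | exact: h4].
exact: (brk_case h1 h2).
Qed.

Lemma arr_def T (f1 : oldT -> T) (f2 : arr_in Q u -> T) (f3 : arr_out Q u -> T) :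
  exists f : arr Q -> T, [/\ forall c : oldT, f (val c) = f1 c,
    forall a, f (ain a) = f2 a & forall b, f (aout b) = f3 b].
Proof.
case: arr_sum_bij => g gK _.
exists (fun c => match g c with inl (inl x) => f1 x | inl (inr x) => f2 x | inr x => f3 x end).
split=> x.
- by rewrite -[val x]/(arr_sum (inl (inl x))) gK.
- by rewrite -[ain x]/(arr_sum (inl (inr x))) gK.
by rewrite -[aout x]/(arr_sum (inr x)) gK.
Qed.

Lemma premut_def T (f1 : oldT -> T) (f2 : arr_in Q u -> arr_out Q u -> T)
    (f3 : arr_in Q u -> T) (f4 : arr_out Q u -> T) :
  exists f : arr (premut Q u) -> T, [/\ forall c, f (mold c) = f1 c,
    forall a b, f (mbr a b) = f2 a b, forall a, f (sin a) = f3 a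
    & forall b, f (sout b) = f4 b].
Proof.
case: premut_sum_bij => g gK _; case: brk_sum_bij => h hK _.
exists (fun c => match g c with
  | inl (inl x) => match h x with inl y => f1 y | inr y => f2 y.1 y.2 end
  | inl (inr x) => f3 x | inr x => f4 x end).
split=> [x|x y|x|x].
- by rewrite -[mold x]/(premut_sum (inl (inl (brk_sum (inl x))))) gK hK.
- by rewrite -[mbr x y]/(premut_sum (inl (inl (brk_sum (inr (x, y)))))) gK hK.
- by rewrite -[sin x]/(premut_sum (inl (inr x))) gK.
by rewrite -[sout x]/(premut_sum (inr x)) gK.
Qed.

Section Sums.
Variables (R : zmodType).

Lemma sum_arr (F : arr Q -> R) : \sum_c F c =
  \sum_(c : oldT) F (val c) + \sum_a F (ain a) + \sum_b F (aout b).
Proof.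
by rewrite (reindex arr_sum) /=; [rewrite !big_sumType | apply: (onW_bij _ arr_sum_bij)].
Qed.

Lemma sum_brk (F : arr (brk Q u) -> R) : \sum_c F c =
  \sum_(c : oldT) F (bold c) + \sum_a \sum_b F (abr a b).
Proof.
rewrite (reindex brk_sum) /=; last exact: (onW_bij _ brk_sum_bij).
by rewrite !big_sumType pair_big.
Qed.

Lemma sum_premut (F : arr (premut Q u) -> R) : \sum_c F c =
  \sum_(c : oldT) F (mold c) + \sum_a \sum_b F (mbr a b)
  + \sum_a F (sin a) + \sum_b F (sout b).
Proof.
rewrite (reindex premut_sum) /=; last exact: (onW_bij _ premut_sum_bij).
by rewrite !big_sumType /= sum_brk.
Qed.

End Sums.

(** ** First derivatives of the mutated potential *)

Definition mlift (x : K) : Km := ext (@unpremut V Q u) (sub x).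

Lemma premut_potE S : potS (premut_pot u S) =
  ext (@unpremut V Q u) (potS (brk_pot u S)) +
  \sum_a \sum_b tri k (mbr a b) (sout b) (sin a).
Proof.
apply: serP => w; rewrite serD [LHS]/potS.
have E : (\sum_a \sum_b tri k (mbr a b) (sout b) (sin a)) w =
   \sum_i \sum_(a : Q i u) \sum_j \sum_(b : Q u j)
      (w == [:: premut_brk (barr a b); star_out b; star_in a])%:R.
  rewrite ser_sum sig_big_dep; apply: eq_bigr => a _.
  by rewrite ser_sum sig_big_dep; apply: eq_bigr => b _.
rewrite E.
case: (boolP (cycl w)) => h; first by rewrite (coef_in _ h).
rewrite coef_out //; symmetry.
rewrite big1 ?addr0 => [|i _]; last first.
  rewrite big1 // => a _; rewrite big1 // => j _; rewrite big1 // => b _.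
  case: eqP => // e; move: h; rewrite e /= /src /tgt /= !eqxx.
  by [].
rewrite /ext; case: (boolP (all _ _)) => hw; rewrite ?mulr0n // mulr1n.
apply: coef_out; apply: contra h => h; rewrite (all_deP unpbK hw).
case: (pmap _ w) h => [//|c s] /=.
suff W i p j : walk i (map pb p) j = walk i p j by rewrite W.
by elim: p i => [|d p IH] i //=; rewrite IH.
Qed.

Lemma cder_premut S c : cder (potS (premut_pot u S)) c =
  cder (ext (@unpremut V Q u) (potS (brk_pot u S))) c +
  \sum_a \sum_b ((c == mbr a b)%:R * (ltr (sout b) * ltr (sin a)) +
     (c == sout b)%:R * (ltr (sin a) * ltr (mbr a b)) +
     (c == sin a)%:R * (ltr (mbr a b) * ltr (sout b))).
Proof.
rewrite premut_potE cderD; congr (_ + _); rewrite cder_sum.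
apply: eq_bigr => a _; rewrite cder_sum; apply: eq_bigr => b _.
by rewrite cder_tri.
Qed.

Lemma cder_mold S c : cder (potS (premut_pot u S)) (mold c) = mlift (cder (potS S) (val c)).
Proof.
rewrite cder_premut (cder_ext pbK unpbK) cder_brk_old big1 ?addr0 // => a _.
rewrite big1 // => b _.
by rewrite (negbTE (mold_mbr _ _ _)) (negbTE (mold_sin _ _)) (negbTE (mold_sout _ _))
   !mul0r !addr0.
Qed.

Lemma cder_mbr S a b : cder (potS (premut_pot u S)) (mbr a b) =
  mlift (rq (ain a) (cder (potS S) (aout b))) + ltr (sout b) * ltr (sin a).
Proof.
rewrite cder_premut (cder_ext pbK unpbK) cder_brk_br; congr (_ + _).
have z a' b' : (mbr a b == sout b')%:R * (ltr (sin a') * ltr (mbr a' b')) +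
     (mbr a b == sin a')%:R * (ltr (mbr a' b') * ltr (sout b')) = 0 :> Km.
  by rewrite (negbTE (mbr_sin _ _ _)) (negbTE (mbr_sout _ _ _)) !mul0r addr0.
rewrite (bigD1 a) //= [X in _ + X]big1 ?addr0 => [|a' ne]; last first.
  rewrite big1 // => b' _; rewrite -addrA z addr0; case: eqP => [e|_]; last exact: mul0r.
  by have [aa _] := mbr_inj e; rewrite aa eqxx in ne.
rewrite (bigD1 b) //= [X in _ + X]big1 ?addr0 => [|b' ne]; last first.
  rewrite -addrA z addr0; case: eqP => [e|_]; last exact: mul0r.
  by have [_ bb] := mbr_inj e; rewrite bb eqxx in ne.
by rewrite -addrA z addr0 eqxx mul1r.
Qed.

Lemma cder_sout S b : cder (potS (premut_pot u S)) (sout b) =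
  \sum_a ltr (sin a) * ltr (mbr a b).
Proof.
rewrite cder_premut (cder_ext0 _ (un_sout b)) add0r; apply: eq_bigr => a _.
rewrite (bigD1 b) //= [X in _ + X]big1 ?addr0 => [|b' ne].
  rewrite eqxx mul1r (eq_sym _ (mbr _ _)) (negbTE (mbr_sout _ _ _)) mul0r add0r.
  by rewrite (eq_sym _ (sin _)) (negbTE (sin_sout _ _)) mul0r addr0.
rewrite (eq_sym _ (mbr _ _)) (negbTE (mbr_sout _ _ _)) mul0r add0r.
rewrite (eq_sym _ (sin _)) (negbTE (sin_sout _ _)) mul0r addr0.
by case: eqP => [/sout_inj e|_]; [rewrite e eqxx in ne | rewrite mul0r].
Qed.

Lemma cder_sin S a : cder (potS (premut_pot u S)) (sin a) =
  \sum_b ltr (mbr a b) * ltr (sout b).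
Proof.
rewrite cder_premut (cder_ext0 _ (un_sin a)) add0r.
rewrite (bigD1 a) //= [X in _ + X]big1 ?addr0 => [|a' ne].
  apply: eq_bigr => b _; rewrite (eq_sym _ (mbr _ _)) (negbTE (mbr_sin _ _ _)).
  by rewrite (negbTE (sin_sout _ _)) !mul0r !add0r eqxx mul1r.
rewrite big1 // => b _; rewrite (eq_sym _ (mbr _ _)) (negbTE (mbr_sin _ _ _)).
rewrite (negbTE (sin_sout _ _)) !mul0r !add0r.
by case: eqP => [/sin_inj e|_]; [rewrite e eqxx in ne | rewrite mul0r].
Qed.

(** ** Right quotients *)

Lemma rq_lift e x : rq e (mlift x) =
  if unpremut e is Some c then
    match c with
    | existT ij (inl c0) => mlift (rq (mkarr (val c0)) x)
    | existT ij (inr ab) => mlift (rq (mkarr ab.1) (rq (mkarr ab.2) x))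
    end else 0.
Proof.
rewrite /mlift rq_ext; case: (unpremut e) => [c|] //.
case: c => -[i j] [c0|[a b]]; congr (ext _ _); apply: serP => w;
  by rewrite /rq /sub -cats1 un_cat -?cats1 /un /= -?catA.
Qed.

Lemma rq_lift_mold c x : rq (mold c) (mlift x) = mlift (rq (val c) x).
Proof. by rewrite rq_lift pbK /=; case: c => -[[i j] c0] h. Qed.
Lemma rq_lift_mbr a b x : rq (mbr a b) (mlift x) = mlift (rq (ain a) (rq (aout b) x)).
Proof. by rewrite rq_lift pbK. Qed.
Lemma rq_lift_sin a x : rq (sin a) (mlift x) = 0.
Proof. by rewrite rq_lift un_sin. Qed.
Lemma lq_lift_mold c x : lq (mold c) (mlift x) = mlift (lq (val c) x).
Proof.
rewrite /mlift lq_ext pbK; congr (ext _ _); apply: serP => w.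
by rewrite /lq /sub; congr (x _); case: c => -[[i j] c0] h.
Qed.
Lemma lq_lift_mbr a b x : lq (mbr a b) (mlift x) = mlift (lq (aout b) (lq (ain a) x)).
Proof. by rewrite /mlift lq_ext pbK. Qed.
Lemma lq_lift_sin a x : lq (sin a) (mlift x) = 0.
Proof. by rewrite /mlift lq_ext un_sin. Qed.
Lemma lq_lift_sout b x : lq (sout b) (mlift x) = 0.
Proof. by rewrite /mlift lq_ext un_sout. Qed.
Lemma lift_nil x : mlift x [::] = x [::]. Proof. by []. Qed.

End Premutation.

(** * Mutation of modules *)

Section Exactness.
Variables (k : fieldType) (V : finType) (Q : quiver V) (S : potential k Q).
Variable M : rep k Q.

(** Exactness at [M_w] and at [M_in] of the complex [M_out -> M_in -> M_w]. *)
Definition onto_at w := forall x, vt w x -> exists2 y : arr Q -> rsp M,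
  tyin y & x = \sum_(a | tgt a == w) rarr M a (y a).
Definition exact_at w := forall y : arr Q -> rsp M, tyin y ->
  \sum_(a | tgt a == w) rarr M a (y a) = 0 ->
  exists2 z, tyout z & forall a, tgt a = w -> y a = gam S w z a.

Lemma arr_gam w (z : arr Q -> rsp M) : good M -> loopless Q -> killed M S -> tyout z ->
  \sum_(a | tgt a == w) rarr M a (gam S w z a) = 0.
Proof.
move=> gM noloop kM hz; rewrite /gam.
under eq_bigr => a _ do rewrite linear_sum.
rewrite exchange_big big1 // => c /eqP cw /=.
rewrite -[RHS](kM c (z c) (hz c)) (ev_rdec gM).
rewrite (jid_ord1 noloop (jid_gen S c)) // scale0r add0r.
rewrite [RHS](bigID (fun a => tgt a == w)) /= [X in _ = _ + X]big1 ?addr0 //.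
move=> a aw; rewrite (wt_rq0 (@wt_cder _ _ _ S c)) ?ev0E ?linear0 //.
by rewrite cw.
Qed.

Lemma vt_gam w (z : arr Q -> rsp M) a : good M -> tyout z -> vt (src a) (gam S w z a).
Proof.
by move=> gM hz; apply: vt_sum => c _; apply: vt_ev (hz c) => //;
  apply: wt_rq; apply: wt_cder.
Qed.
End Exactness.

Section MutRel.
Variables (k : fieldType) (V : finType) (Q : quiver V) (u : V).
Hypothesis noloop : loopless Q.
Hypothesis no2 : no_2cycle_at Q u.
Variables (S : potential k Q) (M : rep k Q) (M' : rep k (premut Q u)).
Hypotheses (gM : good M) (kM : killed M S).
Variables (ka : 'Hom(rsp M', rsp M)) (la : 'Hom(rsp M, rsp M')).

Notation ain := (@ain V Q u).
Notation aout := (@aout V Q u).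
Notation mold := (@mold V Q u).
Notation mbr := (@mbr V Q u).
Notation sin := (@sin V Q u).
Notation sout := (@sout V Q u).
Notation del := (cder (potS S)).
Notation S' := (premut_pot u S).
Implicit Types (a : arr_in Q u) (b : arr_out Q u) (c : oldT Q u) (t : rsp M') (m : rsp M).

(** [M'] is a mutation of [M] at [u]: away from [u] it is identified with [M]
    by [ka] and [la]; at [u] the maps [alpha' : M_out -> M'_u] and
    [beta' : M'_u -> M_in] satisfy [beta' alpha' = - gamma],
    [ker alpha' = im beta] and [im beta' = ker alpha]. *)
Record mutrel : Prop := MutRel {
  mr_rep : is_rep M';
  mr_kala : forall m, ka (la m) = m - ridem M u m;
  mr_laka : forall t, la (ka t) = t - ridem M' u t;
  mr_ka : forall i t, i != u -> vt i t -> vt i (ka t);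
  mr_kau : forall t, vt u t -> ka t = 0;
  mr_la : forall i m, i != u -> vt i m -> vt i (la m);
  mr_brk : forall e t, rarr M' (premut_brk e) t = la (wact M (unbrk e) (ka t));
  mr_in_out : forall a b t, vt (tag b) t ->
    rarr M' (sin a) (rarr M' (sout b) t) = - la (ev M (rq (ain a) (del (aout b))) (ka t));
  mr_out : forall z : arr_out Q u -> rsp M', (forall b, vt (tag b) (z b)) ->
    (\sum_b rarr M' (sout b) (z b) = 0 <->
     exists2 m, vt u m & forall b, ka (z b) = rarr M (aout b) m);
  mr_in : forall y : arr_in Q u -> rsp M', (forall a, vt (tag a) (y a)) ->
    (\sum_a rarr M (ain a) (ka (y a)) = 0 <->
     exists2 t, vt u t & forall a, y a = rarr M' (sin a) t) }.

Hypothesis mr : mutrel.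

Lemma tag_in_out a b : tag a != tag b.
Proof.
case: a => i a; case: b => j b /=; apply/eqP => ij; subst j.
by case: (no2 i) => /card0_eq; [move/(_ a) | move/(_ b)].
Qed.

Lemma loopless_premut : loopless (premut Q u).
Proof.
have H (e : arr (premut Q u)) : src e != tgt e.
  move: e; apply: (premut_case noloop) => [c|a b|a|b].
  - case: c => -[[i j] c] h; rewrite src_mold tgt_mold /src /tgt /=.
    apply/eqP => ij; subst j; have /card0_eq/(_ c) := noloop i; by [].
  - exact: tag_in_out.
  - by rewrite src_sin tgt_sin eq_sym tag_in.
  by rewrite src_sout tgt_sout tag_out.
move=> l; apply/eqP; rewrite -leqn0 leqNgt; apply/negP => /card_gt0P [e _].
by have := H (mkarr e); rewrite /src /tgt /= eqxx.
Qed.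

Lemma laK i t : i != u -> vt i t -> la (ka t) = t.
Proof.
move=> iu hi; rewrite (mr_laka mr).
have [h _ _] := mr_rep mr; have := congr1 (fun f : 'End(_) => f t) (h u i).
by rewrite comp_lfunE hi eq_sym (negbTE iu) zero_lfunE => ->; rewrite subr0.
Qed.
Lemma kaK i m : i != u -> vt i m -> ka (la m) = m.
Proof.
by move=> iu hi; rewrite (mr_kala mr) (idem_vt0 gM hi) ?subr0 // eq_sym.
Qed.

Lemma mold_act c t : rarr M' (mold c) t = la (rarr M (val c) (ka t)).
Proof. by rewrite /mold (mr_brk mr) unbrk_bold /= comp_lfunE id_lfunE. Qed.
Lemma mbr_act a b t : rarr M' (mbr a b) t = la (rarr M (aout b) (rarr M (ain a) (ka t))).
Proof. by rewrite /mbr (mr_brk mr) unbrk_abr /= !comp_lfunE id_lfunE. Qed.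

Lemma wt_del2 a b : wt (tag b) (tag a) (rq (ain a) (del (aout b))).
Proof. exact: (wt_rq (a := ain a) (@wt_cder _ _ _ S (aout b))). Qed.

Lemma wt_del3 e a b : wt (tgt e) (tag a) (rq (ain a) (rq (aout b) (del e))).
Proof. exact: (wt_rq (a := ain a) (wt_rq (a := aout b) (@wt_cder _ _ _ S e))). Qed.

Lemma del2_ord a b : ord 1 (rq (ain a) (del (aout b))).
Proof.
by apply/ord1P; apply: (wt_nil (@wt_del2 a b)); rewrite eq_sym tag_in_out.
Qed.

Lemma okE c : (src (val c) != u) * (tgt (val c) != u).
Proof. by have /andP[-> ->] := valP c. Qed.

(** The reversed arrows of a path come in pairs through [u], that act by the second derivatives
    of the potential; these have no constant term because [u] lies on no 2-cycle. *)
Lemma good_mut : good M'.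
Proof.
have [h1 h2 h3] := mr_rep mr; split; first exact: mr_rep.
have z i e t : vt i t -> src e != i -> rarr M' e t = 0.
  move=> <- ei; have [<- _] := h3 e; rewrite comp_lfunE -[X in rarr M' e X]comp_lfunE.
  by rewrite h1 (negbTE ei) zero_lfunE linear0.
have tv e t : vt (tgt e) (rarr M' e t).
  by rewrite /vt -comp_lfunE; have [_ ->] := h3 e.
have F n i t : i != u -> vt i t -> fil n (ka t) -> fil n.*2 t.
  elim: n i t => [|n IH] i t iu hi hf.
    by rewrite -(laK iu hi) (fil0 hf) linear0; apply: fil_0.
  rewrite doubleS; apply: filS.
  apply: (premut_case noloop) => [c|a b|a|b].
  - rewrite mold_act; apply: filW (leqnSn _) _; have [_ tu] := okE c.
    apply: (IH (tgt (val c))) => //; first by apply: (mr_la mr) tu _; apply: arr_tgt.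
    by rewrite (kaK tu (arr_tgt gM _ _)); apply: fil_arr.
  - rewrite mbr_act; apply: filW (leqnSn _) _; have tu := tag_out noloop b.
    apply: (IH (tag b)) => //; first by apply: (mr_la mr) tu _; apply: (arr_tgt gM (aout b)).
    rewrite (kaK tu (arr_tgt gM (aout b) _)); apply: fil_arr.
    by apply: (filW (leqnSn n)); apply: fil_arr.
  - by rewrite (z i) ?src_sin 1?eq_sym //; apply: fil_0.
  have [bi|bi] := eqVneq (tag b) i; last by rewrite (z i) //; apply: fil_0.
  apply: filS; have hu : vt u (rarr M' (sout b) t) := tv (sout b) t.
  apply: (premut_case noloop) => [c|a b'|a|b'].
  - by rewrite mold_act (mr_kau mr) // !linear0; apply: fil_0.
  - by rewrite mbr_act (mr_kau mr) // !linear0; apply: fil_0.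
  - rewrite (mr_in_out mr) ?bi //; apply: (IH (tag a)).
    + exact: tag_in.
    + apply: vtN; apply: (mr_la mr); first exact: tag_in.
      by apply: (vt_ev gM (@wt_del2 a b)); rewrite bi; apply: (mr_ka mr).
    rewrite linearN /= (kaK (tag_in noloop a)); last first.
      by apply: (vt_ev gM (@wt_del2 a b)); rewrite bi; apply: (mr_ka mr).
    rewrite -scaleN1r; apply: filZ; apply: fil_ev => //; last exact: del2_ord.
    by rewrite addn1.
  by rewrite (z u) //; [apply: fil_0 | rewrite src_sout tag_out].
exists (\dim {: rsp M}).*2.+1 => s i j hs sN; apply/lfunP => t; rewrite zero_lfunE.
suff : fil (\dim {: rsp M}).*2.+1 t by apply.
have -> : t = \sum_i ridem M' i t by rewrite -sum_lfunE h2 id_lfunE.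
have idv l : vt l (ridem M' l t) by rewrite /vt -comp_lfunE h1 eqxx.
apply: fil_sum => l _; have [lu|lu] := eqVneq l u; last first.
  by apply: filW (leqnSn _) _; apply: (F _ l) => //; apply: filP.
apply: filS => e; have [ee|ne] := eqVneq (src e) u; last first.
  by rewrite (z l) ?lu //; apply: fil_0.
move: e ee; apply: (premut_case noloop) => [c|a b|a|b] /= ee.
- by case: (okE c) => /eqP.
- by have /eqP := tag_in noloop a.
- apply: (F _ (tag a)); [exact: tag_in | exact: (tv (sin a)) | exact: filP].
by have /eqP := tag_out noloop b.
Qed.

Let gM' := good_mut.

(** The composite arrows act as the paths of length two that they replace. *)
Lemma ev_lift i j x t : wt i j x -> i != u -> j != u -> vt i t ->
  ev M' (mlift x) t = la (ev M x (ka t)).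
Proof.
move=> + + ju; move: (filP gM (ka t)); move: (\dim _) => n.
elim: n i x t => [|n IH] i x t hf wx iu hi.
  by rewrite -[t](laK iu hi) (fil0 hf) !linear0.
rewrite (ev_rec gM') (ev_rec gM) linearD linearZ linear_sum /= lift_nil (laK iu hi).
congr (_ + _); rewrite (sum_premut noloop) (sum_arr u noloop).
rewrite [X in _ + _ + X + _]big1 => [|a _]; last by rewrite lq_lift_sin ev0E.
rewrite [X in _ + X]big1 => [|b _]; last by rewrite lq_lift_sout ev0E.
rewrite [X in _ = _ + X]big1 => [|b _]; last first.
  by rewrite (wt_lq0 wx) ?ev0E ?linear0 // eq_sym.
rewrite !addr0; congr (_ + _).
  apply: eq_bigr => c _; have [_ tu] := okE c.
  rewrite lq_lift_mold mold_act (IH (tgt (val c))) //.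
  - by rewrite (kaK tu (arr_tgt gM _ _)).
  - by rewrite (kaK tu (arr_tgt gM _ _)); apply: fil_arr.
  - exact: wt_lq wx.
  by apply: (mr_la mr) tu _; apply: arr_tgt.
apply: eq_bigr => a _; have wa := wt_lq (a := ain a) wx.
rewrite (ev_rec gM (lq (ain a) x)) (wt_nil wa) ?scale0r ?add0r; last first.
  by rewrite tgt_ain eq_sym.
rewrite (sum_arr u noloop) !linearD /=.
rewrite [X in _ = la X + _ + _]big1 ?linear0 ?add0r => [|c _]; last first.
  by rewrite (wt_lq0 wa) ?ev0E // tgt_ain; case: (okE c).
rewrite [X in _ = la X + _]big1 ?linear0 ?add0r => [|a' _]; last first.
  by rewrite (wt_lq0 wa) ?ev0E // tgt_ain src_ain tag_in.
rewrite linear_sum; apply: eq_bigr => b _; have tu := tag_out noloop b.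
have tb := arr_tgt gM (aout b) (rarr M (ain a) (ka t)).
rewrite lq_lift_mbr mbr_act (IH (tag b)) ?(kaK tu tb) //.
- by apply: fil_arr; apply: (filW (leqnSn n)); apply: fil_arr.
- exact: (wt_lq (a := aout b) wa).
exact: (mr_la mr) tu tb.
Qed.

(** The derivatives at the four kinds of arrows are the old ones, [gamma + beta' alpha'],
    [alpha' beta] and [alpha beta'], composed with arrows of [M]. *)
Lemma killed_mut : killed M' S'.
Proof.
apply: (premut_case noloop) => [c|a b|a|b] t ht.
- have [su tu] := okE c.
  rewrite cder_mold (ev_lift (@wt_cder _ _ _ S _) tu su ht).
  by rewrite kM ?linear0 //; apply: (mr_ka mr).
- rewrite cder_mbr evDE (ev_lift (@wt_del2 a b)) ?tag_in ?tag_out //.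
  by rewrite (ev_mul gM') !ev_ltr // (mr_in_out mr) // addrN.
- rewrite (cder_sin noloop) ev_sum.
  under eq_bigr => b _ do rewrite (ev_mul gM') !(ev_ltr gM') mbr_act.
  apply/(mr_out mr) => [b|].
    by apply: (mr_la mr); [exact: tag_out | exact: (arr_tgt gM (aout b))].
  exists (rarr M (ain a) (ka t)) => [|b]; first exact: (arr_tgt gM (ain a)).
  by rewrite (kaK (tag_out noloop b)) //; apply: (arr_tgt gM (aout b)).
rewrite (cder_sout noloop) ev_sum.
under eq_bigr => a _ do rewrite (ev_mul gM') !(ev_ltr gM') mbr_act.
rewrite -linear_sum -linear_sum /=.
suff -> : \sum_a rarr M (ain a) (ka (rarr M' (sin a) t)) = 0 by rewrite !linear0.
by apply/(mr_in mr) => [a|]; [exact: (arr_tgt gM' (sin a)) | exists t].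
Qed.

(** ** The maps [gamma] of [M] and of [M'] away from [u] *)

Section AwayFromU.
Variable w : V.
Hypothesis wu : w != u.
Implicit Types (z : arr Q -> rsp M).

Lemma gam_mold (z' : arr (premut Q u) -> rsp M') c0 : tyout z' -> gam S' w z' (mold c0) = la (
  \sum_(c : oldT Q u | src (val c) == w) ev M (rq (val c0) (del (val c))) (ka (z' (mold c))) +
  \sum_(a | tag a == w) \sum_b
     ev M (rq (val c0) (rq (ain a) (del (aout b)))) (ka (z' (mbr a b)))).
Proof.
move=> hz; have [s0 _] := okE c0.
rewrite /gam big_mkcond (sum_premut noloop) linearD !linear_sum /=.
rewrite [X in _ + _ + X + _]big1 => [|a _]; last by rewrite src_sin eq_sym (negbTE wu).
rewrite [X in _ + X]big1 => [|b _]; last first.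
  rewrite (cder_sout noloop) rq_sum ev_sum big1 ?if_same // => a _.
  by rewrite rq_Mltr (negbTE (mold_mbr _ _ _)) mulr0 ev0E.
rewrite !addr0; congr (_ + _).
  rewrite [RHS]big_mkcond; apply: eq_bigr => c _; rewrite src_mold; case: eqP => // sw.
  have [su tu] := okE c; rewrite cder_mold rq_lift_mold.
  rewrite (@ev_lift (tgt (val c)) (src (val c0))) //.
    by apply: wt_rq; apply: wt_cder.
  exact: (hz (mold c)).
rewrite [RHS]big_mkcond; apply: eq_bigr => a _.
rewrite -big_mkcondr /=; case: eqP => aw; last by rewrite big1 // => b /andP[].
rewrite linear_sum; apply: eq_bigr => b _.
rewrite cder_mbr rqD rq_lift_mold rq_Mltr (negbTE (mold_sin _ _)) mulr0 addr0.
rewrite (@ev_lift (tag b) (src (val c0))) ?tag_out //.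
  by apply: wt_rq; apply: wt_del2.
exact: (hz (mbr a b)).
Qed.

Lemma gam_sin (z' : arr (premut Q u) -> rsp M') a0 : tag a0 = w ->
  gam S' w z' (sin a0) = \sum_b rarr M' (sout b) (z' (mbr a0 b)).
Proof.
move=> aw; rewrite /gam big_mkcond (sum_premut noloop).
rewrite [X in X + _ + _ + _]big1 => [|c _]; last first.
  by rewrite cder_mold rq_lift_sin ev0E if_same.
rewrite [X in _ + X + _]big1 => [|a _]; last by rewrite src_sin eq_sym (negbTE wu).
rewrite [X in _ + X]big1 => [|b _]; last first.
  rewrite (cder_sout noloop) rq_sum ev_sum big1 ?if_same // => a _.
  by rewrite rq_Mltr eq_sym (negbTE (mbr_sin _ _ _)) mulr0 ev0E.
rewrite add0r !addr0 (bigD1 a0) //= [X in _ + X]big1 ?addr0 => [|a ne].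
  apply: eq_bigr => b _; rewrite src_mbr aw eqxx cder_mbr rqD rq_lift_sin.
  by rewrite add0r rq_Mltr eqxx mulr1 ev_ltr.
rewrite big1 // => b _; rewrite cder_mbr rqD rq_lift_sin add0r rq_Mltr.
rewrite (inj_eq (@sin_inj _ _ _)) [a0 == a]eq_sym (negbTE ne) mulr0 ev0E.
by rewrite if_same.
Qed.

Lemma gam_mbr (z' : arr (premut Q u) -> rsp M') a0 b0 : tyout z' -> tag b0 = w -> gam S' w z' (mbr a0 b0) =
  la (\sum_(c : oldT Q u | src (val c) == w)
        ev M (rq (ain a0) (rq (aout b0) (del (val c)))) (ka (z' (mold c))))
  + rarr M' (sin a0) (z' (sout b0)).
Proof.
move=> hz bw; rewrite /gam big_mkcond (sum_premut noloop).
rewrite [X in _ + X + _ + _]big1 => [|a _]; last first.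
  by rewrite big1 // => b _; rewrite src_mbr -bw (negbTE (tag_in_out _ _)).
rewrite [X in _ + X + _]big1 => [|a _]; last by rewrite src_sin eq_sym (negbTE wu).
rewrite !addr0 linear_sum /=; congr (_ + _).
  rewrite [RHS]big_mkcond; apply: eq_bigr => c _; rewrite src_mold; case: eqP => // sw.
  have [su tu] := okE c; rewrite cder_mold rq_lift_mbr.
  rewrite (@ev_lift (tgt (val c)) (tag a0)) ?tag_in //.
    exact: wt_del3.
  exact: (hz (mold c)).
rewrite (bigD1 b0) //= [X in _ + X]big1 ?addr0 => [|b ne].
  rewrite src_sout bw eqxx (cder_sout noloop) rq_sum ev_sum (bigD1 a0) //=.
  rewrite rq_Mltr eqxx mulr1 ev_ltr // big1 ?addr0 // => a ne.
  rewrite rq_Mltr; case: eqP => [e|_]; last by rewrite mulr0 ev0E.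
  by have [aa _] := mbr_inj e; rewrite aa eqxx in ne.
rewrite (cder_sout noloop) rq_sum ev_sum big1 ?if_same // => a _.
rewrite rq_Mltr; case: eqP => [e|_]; last by rewrite mulr0 ev0E.
by have [_ bb] := mbr_inj e; rewrite bb eqxx in ne.
Qed.

Lemma gam_old z c0 : tyout z -> gam S w z (val c0) =
  \sum_(c : oldT Q u | src (val c) == w) ev M (rq (val c0) (del (val c))) (z (val c)) +
  \sum_(a | tag a == w) \sum_b
     ev M (rq (val c0) (rq (ain a) (del (aout b)))) (rarr M (aout b) (z (ain a))).
Proof.
move=> hz; have [s0 _] := okE c0.
rewrite /gam big_mkcond (sum_arr u noloop) [X in _ + X]big1 ?addr0 => [|b _]; last first.
  by rewrite src_aout eq_sym (negbTE wu).
congr (_ + _); first by rewrite [RHS]big_mkcond.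
rewrite [RHS]big_mkcond; apply: eq_bigr => a _; rewrite src_ain; case: eqP => // aw.
have wx : wt u (src (val c0)) (rq (val c0) (del (ain a))).
  exact: (wt_rq (@wt_cder _ _ _ S (ain a))).
rewrite (ev_rec gM) (wt_nil wx) 1?eq_sym // scale0r add0r (sum_arr u noloop).
rewrite [X in X + _ + _]big1 ?add0r => [|c _]; last first.
  by rewrite (wt_lq0 wx) ?ev0E //; case: (okE c).
rewrite [X in X + _]big1 ?add0r => [|a' _]; last first.
  by rewrite (wt_lq0 wx) ?ev0E // src_ain tag_in.
by apply: eq_bigr => b _; rewrite lq_rq lq_cder.
Qed.

Lemma gam_aout z b0 : tag b0 = w -> gam S w z (aout b0) =
  \sum_a rarr M (ain a) (\sum_(c : oldT Q u | src (val c) == w)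
     ev M (rq (ain a) (rq (aout b0) (del (val c)))) (z (val c))).
Proof.
move=> bw; rewrite /gam big_mkcond (sum_arr u noloop).
rewrite [X in _ + X + _]big1 ?addr0 => [|a _]; last first.
  by rewrite src_ain -bw (negbTE (tag_in_out _ _)).
rewrite [X in _ + X]big1 ?addr0 => [|b _]; last by rewrite src_aout eq_sym (negbTE wu).
under [RHS]eq_bigr => a _ do rewrite linear_sum.
rewrite [RHS]exchange_big [RHS]big_mkcond; apply: eq_bigr => c _; case: eqP => // cw.
have [su tu] := okE c.
have wx : wt (tgt (val c)) u (rq (aout b0) (del (val c))).
  exact: (wt_rq (a := aout b0) (@wt_cder _ _ _ S (val c))).
rewrite (ev_rdec gM) (wt_nil wx) // scale0r add0r (sum_arr u noloop).
rewrite [X in X + _ + _]big1 ?add0r => [|c' _]; last first.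
  by rewrite (wt_rq0 wx) ?ev0E ?linear0 //; case: (okE c').
rewrite [X in _ + X]big1 ?addr0 // => b _.
by rewrite (wt_rq0 wx) ?ev0E ?linear0 // tgt_aout tag_out.
Qed.

(** The vanishing of the [sin]-components puts the composite coordinates of [z'] into the
    kernel of [alpha'], that is, into the image of [beta]. *)
Lemma lift_ker (z' : arr (premut Q u) -> rsp M') : tyout z' -> exists z : arr Q -> rsp M, [/\ tyout z,
  forall c : oldT Q u, z (val c) = ka (z' (mold c))
  & (forall a, tag a = w -> gam S' w z' (sin a) = 0) ->
    forall a b, tag a = w -> ka (z' (mbr a b)) = rarr M (aout b) (z (ain a))].
Proof.
move=> hz; have /choice [m hm] a : exists m, vt u m /\
   (tag a = w -> gam S' w z' (sin a) = 0 ->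
    forall b, ka (z' (mbr a b)) = rarr M (aout b) m).
  have [[aw e]|n] := pselect (tag a = w /\ gam S' w z' (sin a) = 0); last first.
    exists 0; split; first exact: vt0.
    by move=> aw e; case: n.
  rewrite (gam_sin z' aw) in e.
  have /(mr_out mr) : forall b, vt (tag b) (z' (mbr a b)) by move=> b; apply: (hz (mbr a b)).
  by case=> /(_ e) [m h1 h2] _; exists m.
have [z [z1 z2 z3]] := arr_def noloop (fun c => ka (z' (mold c))) m (fun=> 0).
exists z; split=> //.
- apply: (arr_case (u := u) noloop) => [c|a|b].
  + by rewrite z1; apply: (mr_ka mr); [case: (okE c) | apply: (hz (mold c))].
  + by rewrite z2; case: (hm a).
  by rewrite z3; apply: vt0.
by move=> h a b aw; rewrite z2; case: (hm a) => _ /(_ aw (h a aw)).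
Qed.

(** The [sin]-components of [gamma' z' = 0] say that the coordinates of [z'] at the composite
    arrows come from coordinates at the arrows into [u] ([lift_ker]); the other components of
    [gamma' z'] are then those of [gamma z]. *)
Lemma gam_ker_to (z' : arr (premut Q u) -> rsp M') : tyout z' -> (forall e, tgt e = w -> gam S' w z' e = 0) ->
  exists z : arr Q -> rsp M, [/\ tyout z, forall e, tgt e = w -> gam S w z e = 0,
    forall c : oldT Q u, z (val c) = ka (z' (mold c))
    & forall a b, tag a = w -> ka (z' (mbr a b)) = rarr M (aout b) (z (ain a))].
Proof.
move=> hz h; have [z [tz z1 /(_ (fun a => h (sin a))) z2]] := lift_ker hz.
exists z; split=> //; apply: (arr_case (u := u) noloop) => [c0|a|b0] /= ew.
- have := h (mold c0) ew; rewrite gam_mold // gam_old // => /(congr1 ka).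
  rewrite linear0 => e0.
  have [s0 _] := okE c0.
  rewrite (kaK (i := src (val c0))) // in e0.
    rewrite -[RHS]e0; congr (_ + _); first by apply: eq_bigr => c _; rewrite z1.
    by apply: eq_bigr => a /eqP aw; apply: eq_bigr => b _; rewrite z2.
  apply: vtD.
    apply: vt_sum => c _.
    apply: (vt_ev gM (i := tgt (val c))); first by apply: wt_rq; apply: wt_cder.
    by apply: (mr_ka mr); [case: (okE c) | apply: (hz (mold c))].
  apply: vt_sum => a _; apply: vt_sum => b _.
  apply: (vt_ev gM (i := tag b)); first by apply: wt_rq; apply: wt_del2.
  by apply: (mr_ka mr); [apply: tag_out | apply: (hz (mbr a b))].
- by move: wu; rewrite -ew eqxx.
rewrite gam_aout //.
pose y a := - rarr M' (sin a) (z' (sout b0)).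
have /(mr_in mr) [_ e0] : forall a, vt (tag a) (y a).
  by move=> a; apply: vtN; apply: (arr_tgt gM' (sin a)).
rewrite -[RHS]e0; last first.
  exists (- z' (sout b0)) => [|a]; last by rewrite linearN.
  by apply: vtN; apply: (hz (sout b0)).
apply: eq_bigr => a _; congr (rarr M (ain a) _).
have := h (mbr a b0) ew; rewrite gam_mbr // => /(canRL (addrK _)).
rewrite sub0r -/(y a) => <-.
rewrite (kaK (tag_in noloop a)).
  by apply: eq_bigr => c _; rewrite z1.
apply: vt_sum => c _; apply: (vt_ev gM (i := tgt (val c))).
  exact: wt_del3.
by apply: (mr_ka mr); [case: (okE c) | apply: (hz (mold c))].
Qed.

(** The composite coordinates of [z'] are forced by [z].  What its coordinates at the reversed
    arrows have to produce lies in the kernel of [alpha] by hypothesis, hence in the image of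
    [beta']. *)
Lemma gam_lift z (y : arr_in Q u -> arr_out Q u -> rsp M') : tyout z ->
  (forall a b, vt (tag a) (y a b)) ->
  (forall b, tag b = w -> gam S w z (aout b) = \sum_a rarr M (ain a) (ka (y a b))) ->
  exists z' : arr (premut Q u) -> rsp M', [/\ tyout z',
    forall c : oldT Q u, z' (mold c) = la (z (val c)),
    forall a b, tag a = w -> z' (mbr a b) = la (rarr M (aout b) (z (ain a)))
    & [/\ forall c : oldT Q u, tgt (val c) = w -> gam S' w z' (mold c) = la (gam S w z (val c)),
          forall a, tag a = w -> gam S' w z' (sin a) = 0
        & forall a b, tag b = w -> gam S' w z' (mbr a b) = y a b]].
Proof.
move=> hz hy h.
pose r a b := \sum_(c : oldT Q u | src (val c) == w)
  ev M (rq (ain a) (rq (aout b) (del (val c)))) (z (val c)).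
have vr a b : vt (tag a) (r a b).
  apply: vt_sum => c _; apply: (vt_ev gM (i := tgt (val c))) (hz _).
  exact: wt_del3.
have /choice [t ht] b : exists t, vt u t /\ (tag b = w -> forall a,
    y a b - la (r a b) = rarr M' (sin a) t).
  have [bw|bw] := eqVneq (tag b) w; last first.
    by exists 0; split=> [|/eqP]; [apply: vt0 | rewrite (negbTE bw)].
  have /(mr_in mr) [h1 _] : forall a, vt (tag a) (y a b - la (r a b)).
    by move=> a; apply: vtB => //; apply: (mr_la mr) => //; apply: tag_in.
  have [|t t1 t2] := h1; last by exists t.
  under eq_bigr => a _ do rewrite linearB linearB /= (kaK (tag_in noloop a) (vr a b)).
  by rewrite sumrB -h // gam_aout // subrr.
have [z' [e1 e2 e3 e4]] := premut_def noloop (fun c => la (z (val c)))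
  (fun a b => la (rarr M (aout b) (z (ain a)))) (fun=> 0) t.
have tz : tyout z'.
  apply: (premut_case noloop) => [c|a b|a|b].
  - by rewrite e1; apply: (mr_la mr); [case: (okE c) | apply: hz].
  - rewrite e2; apply: (mr_la mr); first exact: tag_out.
    exact: (arr_tgt gM (aout b)).
  - by rewrite e3; apply: vt0.
  by rewrite e4; case: (ht b).
exists z'; split=> //; split=> [c0 cw|a aw|a b bw].
- rewrite gam_mold // gam_old //; congr (la (_ + _)).
    by apply: eq_bigr => c _; rewrite e1 (kaK (i := tgt (val c))) //; case: (okE c).
  apply: eq_bigr => a _; apply: eq_bigr => b _.
  by rewrite e2 (kaK (tag_out noloop b)) //; apply: (arr_tgt gM (aout b)).
- rewrite gam_sin //; under eq_bigr => b _ do rewrite e2.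
  apply/(mr_out mr) => [b|].
    by apply: (mr_la mr); [exact: tag_out | exact: (arr_tgt gM (aout b))].
  exists (z (ain a)) => [|b]; first exact: (hz (ain a)).
  by rewrite (kaK (tag_out noloop b)) //; apply: (arr_tgt gM (aout b)).
rewrite gam_mbr // e4; case: (ht b) => _ /(_ bw a) <-.
rewrite [X in la X](_ : _ = r a b) ?subrKC //.
apply: eq_bigr => c _; rewrite e1 (kaK (i := tgt (val c))) //.
by case: (okE c).
Qed.

Hypothesis onto' : forall t, vt u t -> exists2 z : arr_out Q u -> rsp M',
  forall b, vt (tag b) (z b) & t = \sum_b rarr M' (sout b) (z b).
Hypothesis onto_u : onto_at M u.

Lemma onto_mut_away : onto_at M w -> onto_at M' w.
Proof.
move=> ow x hx; have [y ty ey] := ow _ ((mr_ka mr) _ _ wu hx).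
have /choice [Y hY] b : exists Y : arr Q -> rsp M, tyin Y /\
    y (aout b) = \sum_(a | tgt a == u) rarr M a (Y a).
  by have [Y h1 h2] := onto_u (ty (aout b)); exists Y.
have [x'' [f1 f2 f3 f4]] := premut_def noloop (fun c => la (y (val c)))
  (fun a b => la (Y b (ain a))) (fun=> 0) (fun=> 0).
exists x''.
  apply: (premut_case noloop) => [c|a b|a|b].
  - by rewrite f1; apply: (mr_la mr); [case: (okE c) | apply: ty].
  - rewrite f2; apply: (mr_la mr); first exact: tag_in.
    by case: (hY b) => tY _; apply: (tY (ain a)).
  - by rewrite f3; apply: vt0.
  by rewrite f4; apply: vt0.
rewrite -(laK wu hx) ey [X in la X]big_mkcond [RHS]big_mkcond (sum_arr u noloop) (sum_premut noloop) linearD linearD /=.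
rewrite [X in _ = _ + X + _]big1 => [|a _]; last by rewrite f3 linear0 if_same.
rewrite [X in _ = _ + X]big1 => [|b _]; last by rewrite f4 linear0 if_same.
rewrite [X in _ + la X + _]big1 => [|a _]; last by rewrite tgt_ain eq_sym (negbTE wu).
rewrite linear0 !addr0 !linear_sum; congr (_ + _).
  apply: eq_bigr => c _; rewrite tgt_mold /=; case: eqP => _; last by rewrite linear0.
  by rewrite f1 mold_act (kaK (i := src (val c))) //; case: (okE c).
rewrite exchange_big; apply: eq_bigr => b _ /=.
case: (hY b) => tY ->; case: eqP => bw; last by rewrite linear0 big1.
rewrite big_mkcond (sum_arr u noloop).
rewrite [X in X + _ + _]big1 ?add0r => [|c _]; last by rewrite ifN //; case: (okE c).
rewrite [X in _ + X]big1 ?addr0 => [|b' _]; last by rewrite tgt_aout (negbTE (tag_out noloop _)).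
rewrite !linear_sum /=; apply: eq_bigr => a _.
rewrite tgt_ain eqxx f2 mbr_act (kaK (i := tag a)) ?tag_in //.
exact: (tY (ain a)).
Qed.

(** A cycle of the mutated complex at [w] is corrected by [beta'] into one of the complex of
    [M] at [w], where the composite arrows into [w] are absorbed by the arrows into [w] from
    [u]. *)
Lemma exact_mut_away : exact_at S M w -> exact_at S' M' w.
Proof.
move=> ew y ty h0.
have /choice [Z hZ] a : exists Z : arr_out Q u -> rsp M', (forall b, vt (tag b) (Z b)) /\
    y (sin a) = \sum_b rarr M' (sout b) (Z b).
  by have [Z h1 h2] := onto' (ty (sin a)); exists Z.
have [z1 [e1 e2 e3 e4]] := premut_def noloop (fun=> 0)
  (fun a b => Z a b) (fun=> 0) (fun=> 0).
have tz1 : tyout z1.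
  apply: (premut_case noloop) => [c|a b|a|b]; rewrite ?e1 ?e2 ?e3 ?e4; try exact: vt0.
  by case: (hZ a) => h _; apply: (h b).
pose y1 e := y e - gam S' w z1 e.
have ty1 : tyin y1 by move=> e; apply: vtB => //; apply: vt_gam.
have y1s a : tag a = w -> y1 (sin a) = 0.
  move=> aw; rewrite /y1 gam_sin //; case: (hZ a) => _ ->.
  by rewrite -sumrB big1 // => b _; rewrite e2 subrr.
have h1 : \sum_(e | tgt e == w) rarr M' e (y1 e) = 0.
  under eq_bigr => e _ do rewrite linearB.
  by rewrite sumrB h0 arr_gam ?subrr //; [apply: loopless_premut | apply: killed_mut].
have [Y [f1 f2 f3]] := arr_def noloop (fun c => ka (y1 (mold c))) (fun=> 0)
  (fun b => \sum_a rarr M (ain a) (ka (y1 (mbr a b)))).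
have tY : tyin Y.
  apply: (arr_case (u := u) noloop) => [c|a|b].
  - by rewrite f1; apply: (mr_ka mr); [case: (okE c) | apply: (ty1 (mold c))].
  - by rewrite f2; apply: vt0.
  by rewrite f3; apply: vt_sum => a _; apply: (arr_tgt gM (ain a)).
have [z tz ez] : exists2 z : arr Q -> rsp M, tyout z &
    forall e : arr Q, tgt e = w -> Y e = gam S w z e.
  apply: ew => //.
  have -> : \sum_(a | tgt a == w) rarr M a (Y a) = ka (\sum_(e | tgt e == w) rarr M' e (y1 e)).
    rewrite [LHS]big_mkcond [X in ka X]big_mkcond (sum_arr u noloop) (sum_premut noloop) !linearD /=.
    rewrite [X in _ = _ + ka X + _]big1 => [|a _]; last first.
      by rewrite tgt_sin; case: eqP => // aw; rewrite y1s // linear0.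
    rewrite [X in _ = _ + ka X]big1 => [|b _]; last by rewrite tgt_sout eq_sym (negbTE wu).
    rewrite [X in _ + X + _]big1 => [|a _]; last by rewrite tgt_ain eq_sym (negbTE wu).
    rewrite linear0 !addr0 !linear_sum; congr (_ + _).
      apply: eq_bigr => c _; rewrite tgt_mold /=; case: eqP => _; last by rewrite linear0.
      rewrite f1 mold_act (kaK (i := tgt (val c))) //; first by case: (okE c).
      exact: arr_tgt.
    under [RHS]eq_bigr => a _ do rewrite linear_sum.
    rewrite [RHS]exchange_big; apply: eq_bigr => b _ /=.
    rewrite tgt_aout; case: eqP => bw; last first.
      by rewrite big1 // => a _; rewrite linear0.
    rewrite f3 !linear_sum; apply: eq_bigr => a _ /=; rewrite mbr_act.
    by rewrite (kaK (tag_out noloop b)) //; apply: (arr_tgt gM (aout b)).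
  by rewrite h1 linear0.
have [||z2 [tz2 _ _ [g1 g2 g3]]] := @gam_lift z (fun a b => y1 (mbr a b)) tz.
- by move=> a b; apply: (ty1 (mbr a b)).
- by move=> b bw; rewrite -ez // f3.
exists (fun e => z1 e + z2 e) => [e|e ew']; first exact: vtD.
rewrite gamD; apply: (canRL (subrKC _)); rewrite -/(y1 e).
move: e ew'; apply: (premut_case noloop) => [c|a b|a|b] ew'.
- rewrite g1 // -ez // f1 (laK (i := src (val c))) //; first by case: (okE c).
  exact: (ty1 (mold c)).
- by rewrite g3.
- by rewrite g2 // y1s.
by move: wu; rewrite -ew' eqxx.
Qed.

End AwayFromU.

(** ** Exactness at [u] *)

Hypothesis onto' : forall t, vt u t -> exists2 z : arr_out Q u -> rsp M',
  forall b, vt (tag b) (z b) & t = \sum_b rarr M' (sout b) (z b).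
Hypothesis onto_u : onto_at M u.

Lemma sum_into_u (y : arr (premut Q u) -> rsp M') :
  \sum_(e | tgt e == u) rarr M' e (y e) = \sum_b rarr M' (sout b) (y (sout b)).
Proof.
rewrite big_mkcond (sum_premut noloop).
rewrite [X in X + _ + _ + _]big1 => [|c _]; last by rewrite ifN //; case: (okE c).
rewrite [X in _ + X + _ + _]big1 => [|a _]; last first.
  by rewrite big1 // => b _; rewrite tgt_mbr (negbTE (tag_out noloop _)).
rewrite [X in _ + X + _]big1 => [|a _]; last by rewrite tgt_sin (negbTE (tag_in noloop _)).
by rewrite !add0r; apply: eq_bigr => b _; rewrite tgt_sout eqxx.
Qed.

Lemma sum_into_u_M (y : arr Q -> rsp M) :
  \sum_(e | tgt e == u) rarr M e (y e) = \sum_a rarr M (ain a) (y (ain a)).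
Proof.
rewrite big_mkcond (sum_arr u noloop).
rewrite [X in X + _ + _]big1 ?add0r => [|c _]; last by rewrite ifN //; case: (okE c).
rewrite [X in _ + X]big1 ?addr0 => [|b _]; last by rewrite tgt_aout (negbTE (tag_out noloop _)).
by apply: eq_bigr => a _; rewrite tgt_ain eqxx.
Qed.

Lemma gam_u_sout (z' : arr (premut Q u) -> rsp M') b : tyout z' -> gam S' u z' (sout b) =
  la (rarr M (aout b) (\sum_a rarr M (ain a) (ka (z' (sin a))))).
Proof.
move=> hz; rewrite /gam big_mkcond (sum_premut noloop).
rewrite [X in X + _ + _ + _]big1 => [|c _]; last by rewrite ifN //; case: (okE c).
rewrite [X in _ + X + _ + _]big1 => [|a _]; last first.
  by rewrite big1 // => b' _; rewrite src_mbr (negbTE (tag_in noloop _)).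
rewrite [X in _ + X]big1 => [|b' _]; last by rewrite src_sout (negbTE (tag_out noloop _)).
rewrite !add0r addr0 !linear_sum /=; apply: eq_bigr => a _.
rewrite src_sin eqxx (cder_sin noloop) rq_sum ev_sum (bigD1 b) //= rq_Mltr eqxx mulr1.
rewrite big1 ?addr0 => [|b' ne]; first by rewrite ev_ltr // mbr_act.
by rewrite rq_Mltr (inj_eq (@sout_inj _ _ _)) [b == b']eq_sym (negbTE ne) mulr0 ev0E.
Qed.

Lemma onto_mut_u : onto_at M' u.
Proof.
move=> x /onto' [z hz ->].
have [y [e1 e2 e3 e4]] := premut_def noloop (fun=> 0 : rsp M') (fun _ _ => 0) (fun=> 0) z.
exists y; last by rewrite sum_into_u; apply: eq_bigr => b _; rewrite e4.
apply: (premut_case noloop) => [c|a b|a|b]; rewrite ?e1 ?e2 ?e3 ?e4; try exact: vt0.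
exact: hz.
Qed.

Lemma exact_mut_u : exact_at S' M' u.
Proof.
move=> y ty; rewrite sum_into_u => h0.
have [|m hm em] := (mr_out mr (fun b => ty (sout b))).1; first exact: h0.
have [x tx ex] := onto_u hm.
have [z [e1 e2 e3 e4]] := premut_def noloop (fun=> 0 : rsp M') (fun _ _ => 0)
   (fun a => la (x (ain a))) (fun=> 0).
have tz : tyout z.
  apply: (premut_case noloop) => [c|a b|a|b]; rewrite ?e1 ?e2 ?e3 ?e4; try exact: vt0.
  by apply: (mr_la mr); [apply: tag_in | apply: (tx (ain a))].
exists z => //; apply: (premut_case noloop) => [c|a b|a|b] eu.
- by case: (okE c) => _ /eqP[].
- by case/eqP: (tag_out noloop b).
- by case/eqP: (tag_in noloop a).
rewrite gam_u_sout // -[LHS](laK (tag_out noloop b) (ty (sout b))) em ex sum_into_u_M.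
congr (la (rarr M (aout b) _)); apply: eq_bigr => a _.
by rewrite e3 (kaK (tag_in noloop a)) //; apply: (tx (ain a)).
Qed.

(** At [u] exactness amounts to [ker alpha' = im beta] and to the surjectivity of [alpha] and
    [alpha']; elsewhere it is inherited. *)
Theorem exact_mut w : onto_at M w -> exact_at S M w ->
  onto_at M' w /\ exact_at S' M' w.
Proof.
move=> ow ew; have [->|wu] := eqVneq w u.
  by split; [apply: onto_mut_u | apply: exact_mut_u].
by split; [apply: onto_mut_away | apply: exact_mut_away].
Qed.

End MutRel.

(** * Presentations of the same module are homotopy equivalent *)

Section LinearAlgebra.
Variables (k : fieldType).

Lemma pred_vspace (E : vectType k) (P : E -> Prop) : P 0 ->
  (forall c x y, P x -> P y -> P (c *: x + y)) ->
  exists W : {vspace E}, forall x, x \in W <-> P x.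
Proof.
move=> P0 Pl; pose ok n := `[< exists W : {vspace E}, \dim W = n /\ forall x, x \in W -> P x >].
have ex : exists n, ok n.
  exists 0%N; apply/asboolP; exists 0%VS; split; first exact: dimv0.
  by move=> x; rewrite memv0 => /eqP ->.
have ub n : ok n -> (n <= \dim {: E})%N.
  by move=> /asboolP [W [<- _]]; apply/dimvS/subvf.
case: (ex_maxnP ex ub) => n /asboolP [W [dW hW]] mx; exists W => x.
split=> [/hW //|Px]; apply: contraT => xW.
have : ok (\dim (W + <[x]>)%VS).
  apply/asboolP; exists (W + <[x]>)%VS; split=> // y /memv_addP [w hw [l /vlineP [c ->] ->]].
  by rewrite addrC; apply: Pl => //; apply: hW.
move/mx; rewrite -dW leqNgt => /negP []; rewrite ltn_neqAle dimvS ?addvSl // andbT.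
apply: contra xW => /eqP e; have : (W + <[x]>)%VS == W.
  by rewrite eq_sym eqEdim addvSl e leqnn.
by move/eqP <-; apply: subvP (addvSr _ _) _ _; apply: memv_line.
Qed.

(** Match two bases. *)
Lemma iso_between (U Y : vectType k) (W : {vspace U}) (Z : {vspace Y}) :
  \dim W = \dim Z -> exists2 th : 'Hom(U, Y), (forall x, x \in W -> th x \in Z) &
    forall x, x \in W -> th x = 0 -> x = 0.
Proof.
move=> dWZ.
have [t [ft mt]] : exists t : (\dim W).-tuple Y, free t /\ forall i : 'I_(\dim W), t`_i \in Z.
  rewrite dWZ; exists (vbasis Z); split; first exact: basis_free (vbasisP Z).
  by move=> i; apply/vbasis_mem/mem_nth; rewrite size_tuple.
pose F (x : U) : Y := \sum_(i < \dim W) coord (vbasis W) i x *: t`_i.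
have linF c x y : F (c *: x + y) = c *: F x + F y.
  rewrite /F scaler_sumr -big_split; apply: eq_bigr => i _ /=.
  by rewrite linearP scalerDl scalerA.
exists (linfun F) => x xW; rewrite (linfun_raw linF).
  by apply: memv_suml => i _; apply: memvZ.
move=> F0; rewrite (coord_vbasis xW) big1 // => i _.
by move/freeP: ft => /(_ _ F0) ->; rewrite scale0r.
Qed.

(** The kernel of [Phi] and a complement of its image inside [Z] have the same dimension; [psi]
    identifies them through [pr], which is injective on the kernel. *)
Lemma correct_into (U Y A A2 : vectType k) (Phi : 'Hom(U, Y)) (pr : 'Hom(U, A))
    (ia : 'Hom(A2, Y)) (Z : {vspace A2}) :
  \dim {: U} = \dim {: Y} -> (forall x, ia x = 0 -> x = 0) ->
  (forall y, exists u, exists2 z, z \in Z & y = Phi u + ia z) ->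
  (forall u, pr u = 0 -> forall z, z \in Z -> Phi u = ia z -> u = 0) ->
  exists2 psi : 'Hom(A, A2), (forall x, psi x \in Z) &
    forall u, Phi u + ia (psi (pr u)) = 0 -> u = 0.
Proof.
move=> dUY iai onto inj.
have kia : lker ia == 0%VS.
  rewrite -subv0; apply/subvP => x; rewrite memv_ker memv0 => /eqP h.
  by apply/eqP/iai.
pose W := (Phi @^-1: (ia @: Z))%VS.
have WP u : reflect (exists2 z, z \in Z & Phi u = ia z) (u \in W).
  by rewrite -memv_preim; apply: memv_imgP.
have full : (limg Phi + ia @: Z)%VS = fullv.
  apply/eqP; rewrite eqEsubv subvf; apply/subvP => y _.
  have [u [z zZ ->]] := onto y; apply: memv_add; first by rewrite memv_img ?memvf.
  exact: memv_img.
have dW : \dim W = \dim Z.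
  have d1 := limg_ker_dim Phi fullv; rewrite capfv in d1.
  have d2 := limg_ker_dim Phi W.
  have kW : (W :&: lker Phi)%VS = lker Phi.
    apply/capv_idPr/subvP => u; rewrite memv_ker => /eqP h.
    by apply/WP; exists 0; rewrite ?mem0v // h linear0.
  have iW : (Phi @: W)%VS = (limg Phi :&: ia @: Z)%VS.
    apply/eqP; rewrite eqEsubv; apply/andP; split; apply/subvP => y.
      move=> /memv_imgP [u /WP [z zZ e] ->]; rewrite memv_cap memv_img ?memvf //=.
      by rewrite e memv_img.
    rewrite memv_cap => /andP [/memv_imgP [u _ ->] /memv_imgP [z zZ e]].
    by apply: memv_img; apply/WP; exists z.
  rewrite kW iW in d2.
  have d3 := dimv_sum_cap (limg Phi) (ia @: Z)%VS.
  have d4 : \dim (ia @: Z) = \dim Z by apply: limg_dim_eq; rewrite (eqP kia) capv0.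
  rewrite full -dUY in d3; rewrite d4 in d3.
  move: d1 d2 d3; move: (\dim (lker Phi)) (\dim (limg Phi)) (\dim W) (\dim Z).
  by move: (\dim _) (\dim _) => *; lia.
have [th thZ thi] := iso_between dW.
have prW x : x \in W -> pr x = 0 -> x = 0.
  by move=> /WP [z zZ e] h; apply: inj h z zZ e.
pose f := (pr \o projv W)%VF.
pose s := (projv W \o f^-1)%VF.
have sW x : s x \in W by rewrite comp_lfunE memv_proj.
have sK x : x \in W -> s (pr x) = x.
  move=> xW; apply/eqP; rewrite -subr_eq0; apply/eqP/prW.
    by rewrite rpredB.
  rewrite linearB /= comp_lfunE -[pr (projv W _)]comp_lfunE -/f.
  have e : f x = pr x by rewrite comp_lfunE projv_id.
  by rewrite limg_lfunVK ?subrr // -e memv_img ?memvf.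
pose th' := th - (ia^-1 \o Phi)%VF.
have th'Z x : x \in W -> th' x \in Z.
  move=> xW; rewrite add_lfunE opp_lfunE comp_lfunE rpredB ?thZ //.
  by have /WP [z zZ ->] := xW; rewrite lker0_lfunK.
exists (th' \o s)%VF => [x|u h]; first by rewrite comp_lfunE th'Z.
have uW : u \in W.
  apply/WP; exists (- (th' \o s)%VF (pr u)); first by rewrite rpredN comp_lfunE th'Z.
  by rewrite linearN; apply/eqP; rewrite -addr_eq0 h.
apply: (thi _ uW); apply: iai; rewrite -[RHS]h comp_lfunE sK //.
have /WP [z zZ e] := uW.
rewrite add_lfunE opp_lfunE comp_lfunE linearB /= e lker0_lfunK // addrC subrK //.
Qed.

End LinearAlgebra.

Section Matrices.
Variables (k : fieldType) (V : finType) (Q : quiver V).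
Notation K := (ser k (arr Q)).

Definition mm (I J L : finType) (G : J -> L -> K) (F : I -> J -> K) (b : I) (d : L) : K :=
  \sum_c G c d * F b c.
Definition dl (I : finType) (b c : I) : K := (b == c)%:R.

Lemma mmA (I J L H : finType) (A : L -> H -> K) (B : J -> L -> K) (C : I -> J -> K) :
  mm A (mm B C) = mm (mm A B) C.
Proof.
apply: funext => b; apply: funext => d; rewrite /mm.
under eq_bigr => c _ do rewrite mulr_sumr.
rewrite exchange_big; apply: eq_bigr => c _ /=; rewrite mulr_suml.
by apply: eq_bigr => e _; rewrite mulrA.
Qed.
Lemma mm1l (I J : finType) (A : I -> J -> K) : mm (@dl J) A = A.
Proof.
apply: funext => b; apply: funext => d; rewrite /mm (bigD1 d) //= /dl eqxx mul1r.
by rewrite big1 ?addr0 // => c /negbTE ->; rewrite mul0r.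
Qed.
Lemma mm1r (I J : finType) (A : I -> J -> K) : mm A (@dl I) = A.
Proof.
apply: funext => b; apply: funext => d; rewrite /mm (bigD1 b) //= /dl eqxx mulr1.
by rewrite big1 ?addr0 // => c cb; rewrite eq_sym (negbTE cb) mulr0.
Qed.

Definition wtm (I J : finType) (tI : I -> V) (tJ : J -> V) (F : I -> J -> K) :=
  forall b c, wt (tJ c) (tI b) (F b c).

Lemma wtm_mm (I J L : finType) (tI : I -> V) (tJ : J -> V) (tL : L -> V)
    (G : J -> L -> K) (F : I -> J -> K) :
  wtm tJ tL G -> wtm tI tJ F -> wtm tI tL (mm G F).
Proof. by move=> hG hF b d; apply: wt_sum => c _; apply: (wtM (hG c d) (hF b c)). Qed.
Lemma wtm_dl (I : finType) (tI : I -> V) : wtm tI tI (@dl I).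
Proof. by move=> b c; rewrite /dl; case: eqP => [->|_]; [apply: wt1 | apply: wt0]. Qed.

(** The Neumann series [1 + X + X^2 + ...]. *)
Lemma neumann (J : finType) (t : J -> V) (X : J -> J -> K) : wtm t t X ->
  (forall y z, ord 1 (X y z)) ->
  exists2 N : J -> J -> K, wtm t t N & forall y z, N y z = dl y z + mm X N y z.
Proof.
move=> wX oX.
pose pw n : J -> J -> K := iter n (mm X) (@dl J).
have opw n y z : ord n (pw n y z).
  elim: n y z => [|n IH] y z //; rewrite /pw iterS -/(pw n) /mm.
  by apply: ord_sum => c _; rewrite -add1n; apply: ordM.
have wpw n : wtm t t (pw n).
  by elim: n => [|n IH]; [apply: wtm_dl | apply: (wtm_mm wX IH)].
pose sm n y z : K := \sum_(m < n) pw m y z.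
have smS n y z : sm n.+1 y z = sm n y z + pw n y z by rewrite /sm big_ord_recr.
pose N y z : K := fun s => sm (size s).+1 y z s.
have st n y z s : (size s < n)%N -> sm n y z s = N y z s.
  move=> sn; rewrite /N -(subnKC sn); elim: (n - _)%N => [|p IH]; first by rewrite addn0.
  rewrite addnS smS serD IH opw ?addr0 //.
  by rewrite leq_addr.
exists N => [y z s hs|y z].
  suff w : wt (t z) (t y) (sm (size s).+1 y z) by apply: w.
  by apply: wt_sum => m _; apply: wpw.
apply: serP => s; rewrite serD.
rewrite [LHS]/N /sm big_ord_recl /= serD; congr (_ + _).
transitivity (mm X (sm (size s)) y z s).
  rewrite /mm !ser_sum.
  transitivity (\sum_(m < size s) \sum_c (X c z * pw m y c) s).
    by apply: eq_bigr => m _; apply: ser_sum.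
  rewrite exchange_big; apply: eq_bigr => c _ /=.
  by rewrite /sm mulr_sumr ser_sum.
rewrite /mm !ser_sum; apply: eq_bigr => c _; rewrite !serM.
apply: eq_bigr => -[[|n] hn] _ /=; first by rewrite take0 oX // !mul0r.
rewrite st // size_drop; rewrite ltnS in hn.
by rewrite ltn_subrL /= (leq_ltn_trans _ hn).
Qed.

Lemma rinv (I J : finType) (tI : I -> V) (tJ : J -> V) (Phi : I -> J -> K)
    (Psi0 : J -> I -> k) : wtm tI tJ Phi ->
  (forall y x, tI x != tJ y -> Psi0 y x = 0) ->
  (forall y y', \sum_x Phi x y' [::] * Psi0 y x = (y == y')%:R) ->
  exists Psi, [/\ wtm tJ tI Psi, mm Phi Psi = @dl J &
    forall y x, Psi y x [::] = Psi0 y x].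
Proof.
move=> wP hb h; pose P0 y x : K := (Psi0 y x)%:A.
have wP0 : wtm tJ tI P0.
  move=> y x; rewrite /P0; have [->|ne] := eqVneq (tI x) (tJ y).
    by apply: wtZ; apply: wt1.
  by rewrite hb // scale0r.
pose X y z : K := dl y z - mm Phi P0 y z.
have wX : wtm tJ tJ X by move=> y z; apply: wtB; [apply: wtm_dl | apply: (wtm_mm wP wP0)].
have P0n y x : P0 y x [::] = Psi0 y x by rewrite /P0 serZ ser1 mulr1.
have [|N wN eN] := neumann wX.
  move=> y z; apply/ord1P; rewrite /X serD serN /mm ser_sum.
  rewrite (_ : \sum_i _ = (y == z)%:R); last first.
    by rewrite -h; apply: eq_bigr => x _; rewrite serM_nil P0n.
  by rewrite /dl; case: eqP => _; rewrite ?ser1 ?ser0 subrr.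
exists (mm P0 N); split; first exact: wtm_mm wP0 wN.
  rewrite mmA; apply: funext => y; apply: funext => z.
  have -> : mm (mm Phi P0) N y z = N y z - mm X N y z.
    transitivity (mm (@dl J) N y z - mm X N y z); last by rewrite mm1l.
    rewrite /mm -sumrB; apply: eq_bigr => c _.
    by rewrite -mulrBl /X opprB addrC subrK.
  by rewrite {1}eN addrK.
move=> y x; rewrite /mm ser_sum (bigD1 y) //= big1 => [|c cy].
  rewrite addr0 serM_nil P0n eN serD /dl eqxx /mm ser_sum big1 ?addr0 ?mulr1 // => c _.
  rewrite serM_nil (_ : X c y [::] = 0) ?mul0r //.
  rewrite /X serD serN /mm ser_sum (_ : \sum_i _ = (c == y)%:R); last first.
    by rewrite -h; apply: eq_bigr => x' _; rewrite serM_nil P0n.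
  by rewrite /dl; case: eqP => _; rewrite ?ser1 ?ser0 subrr.
rewrite serM_nil eN serD /dl eq_sym (negbTE cy) mulr0n ser0 add0r /mm ser_sum big1 ?mulr0 // => c' _.
rewrite serM_nil (_ : X c' c [::] = 0) ?mul0r //.
rewrite /X serD serN /mm ser_sum (_ : \sum_i _ = (c' == c)%:R); last first.
  by rewrite -h; apply: eq_bigr => x' _; rewrite serM_nil P0n.
by rewrite /dl; case: eqP => _; rewrite ?ser1 ?ser0 subrr.
Qed.

Lemma sum_grade (B : V -> finType) i (R : zmodType) (F : {i : V & B i} -> R) :
  (forall x, tag x != i -> F x = 0) -> \sum_x F x = \sum_(b : B i) F (existT _ i b).
Proof.
move=> h; transitivity (\sum_j \sum_(b : B j) F (existT (fun j => B j : Type) j b)).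
  by rewrite sig_big_dep; apply: eq_bigr => -[].
by rewrite (bigD1 i) //= [X in _ + X]big1 ?addr0 // => j ji; rewrite big1 // => b _; apply: h.
Qed.

(** Correct by the inverse of the constant term and sum the Neumann series. *)
Lemma graded_inv (BI BJ : V -> finType) (Phi : {i : V & BI i} -> {i : V & BJ i} -> K) :
  wtm (@tag _ _) (@tag _ _) Phi -> (forall i, #|BI i| = #|BJ i|) ->
  (forall i (u : BI i -> k), (forall y : BJ i, \sum_x u x *
     Phi (existT (fun i => BI i : Type) i x) (existT (fun i => BJ i : Type) i y) [::] = 0) ->
     forall x, u x = 0) ->
  exists Psi, [/\ wtm (@tag _ _) (@tag _ _) Psi, mm Phi Psi = @dl _ & mm Psi Phi = @dl _].
Proof.
move=> wP card inj.
pose eI i (x : BI i) : {i : V & BI i} := existT (fun i => BI i : Type) i x.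
pose eJ i (x : BJ i) : {i : V & BJ i} := existT (fun i => BJ i : Type) i x.
have etaI x : eI (tag x) (tagged x) = x by case: x.
have etaJ y : eJ (tag y) (tagged y) = y by case: y.
have P0 x y : tag x != tag y -> Phi x y [::] = 0.
  by move=> ne; apply: (wt_nil (wP x y)); rewrite eq_sym.
pose lf i (u : {ffun BI i -> k^o}) : {ffun BJ i -> k^o} :=
  [ffun y => \sum_x u x * Phi (eI i x) (eJ i y) [::]].
have lin i c u v : lf i (c *: u + v) = c *: lf i u + lf i v.
  apply/ffunP => y; rewrite !ffunE scaler_sumr -big_split; apply: eq_bigr => x _ /=.
  by rewrite !ffunE mulrDl -scalerAl.
pose L i := linfun (lf i).
have LE i u : L i u = lf i u by rewrite /L (linfun_raw (lin i)).
have kL i : lker (L i) == 0%VS.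
  rewrite -subv0; apply/subvP => u; rewrite memv_ker memv0 LE => /eqP h.
  apply/eqP/ffunP => x; rewrite ffunE; apply: (inj i u) => y.
  by have := congr1 (fun f : {ffun _ -> _} => f y) h; rewrite !ffunE.
have fL i : limg (L i) = fullv.
  apply/eqP; rewrite eqEdim subvf limg_dim_eq ?(eqP (kL i)) ?capv0 // !dimvf.
  by rewrite /dim /= card.
pose de i (y : {i : V & BJ i}) : {ffun BJ i -> k^o} := [ffun y1 => (eJ i y1 == y)%:R].
pose Psi0 (y : {i : V & BJ i}) (x : {i : V & BI i}) : k :=
  ((L (tag x))^-1%VF (de (tag x) y)) (tagged x).
have h1 y x : tag x != tag y -> Psi0 y x = 0.
  move=> ne; rewrite /Psi0 (_ : de _ _ = 0) ?linear0 ?ffunE //.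
  apply/ffunP => y1; rewrite !ffunE; case: eqP => // e.
  by rewrite -e eqxx in ne.
have h2 y y' : \sum_x Phi x y' [::] * Psi0 y x = (y == y')%:R.
  rewrite (sum_grade (i := tag y')) => [|x ne]; last by rewrite P0 // mul0r.
  transitivity ((L (tag y') ((L (tag y'))^-1%VF (de (tag y') y))) (tagged y')).
    by rewrite LE ffunE; apply: eq_bigr => x _; rewrite mulrC etaJ.
  by rewrite limg_lfunVK ?fL ?memvf // ffunE etaJ eq_sym.
have h3 x x' : \sum_y Psi0 y x' * Phi x y [::] = (x == x')%:R.
  transitivity (((L (tag x'))^-1%VF (\sum_y Phi x y [::] *: de (tag x') y)) (tagged x')).
    rewrite linear_sum sum_ffunE; apply: eq_bigr => y _.
    by rewrite linearZ /= ffunE mulrC.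
  have -> : \sum_y Phi x y [::] *: de (tag x') y =
      L (tag x') [ffun x1 => (eI (tag x') x1 == x)%:R].
    apply/ffunP => y1; rewrite LE sum_ffunE ffunE (bigD1 (eJ _ y1)) //= !ffunE eqxx.
    rewrite [X in _ + X]big1 ?addr0 => [|y ne]; last first.
      by rewrite !ffunE eq_sym (negbTE ne) scaler0.
    rewrite /GRing.scale /= mulr1; have [e|ne] := eqVneq (tag x) (tag x'); last first.
      rewrite P0 // big1 // => x1 _; rewrite ffunE; case: eqP => [e|_]; last by rewrite mul0r.
      by rewrite -e eqxx in ne.
    case: x e => i x /= e; subst i; rewrite (bigD1 x) //= ffunE eqxx mul1r.
    rewrite big1 ?addr0 // => x1 ne; rewrite ffunE.
    case: eqP => [e|_]; last by rewrite mul0r.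
    by have e' : x1 = x := eq_from_Tagged e; rewrite e' eqxx in ne.
  by rewrite lker0_lfunK // ffunE etaI eq_sym.
have [Psi [wPsi e1 e2]] := rinv wP h1 h2.
have [||Th [wTh e3 _]] := @rinv _ _ _ _ Psi (fun x y => Phi x y [::]) wPsi.
- by move=> x y ne; apply: P0; rewrite eq_sym.
- by move=> x x'; rewrite -h3; apply: eq_bigr => y _; rewrite e2.
have : Th = Phi by rewrite -[Th]mm1l -e1 -mmA e3 mm1r.
by move=> e; exists Psi; split=> //; rewrite -e.
Qed.

End Matrices.
Arguments dl k {V} Q {I} b c.

Section Hmx.
Variables (k : fieldType) (V : finType) (Q : quiver V) (S : potential k Q).
Notation K := (ser k (arr Q)).
Notation ex_ B := (existT (fun i => Finite.sort (B i))).

Definition toM (B C : V -> finType) (F : hmx k Q B C)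
    (b : {i : V & B i}) (c : {i : V & C i}) : K :=
  tos (F (tag b) (tagged b) (tag c) (tagged c)).
Definition ofM (B C : V -> finType) (F : {i : V & B i} -> {i : V & C i} -> K) :
    hmx k Q B C :=
  fun i b j c => ofs j i (F (ex_ B i b) (ex_ C j c)).

Notation typed F := (wtm (@tag _ _) (@tag _ _) F).

Lemma ofMK (B C : V -> finType) (F : {i : V & B i} -> {i : V & C i} -> K) :
  typed F -> toM (ofM F) = F.
Proof.
move=> wF; apply: funext => -[i b]; apply: funext => -[j c].
by rewrite /toM /ofM tos_ofs //; apply: (wF (ex_ B i b) (ex_ C j c)).
Qed.

Definition jc (I J : finType) (tI : I -> V) (tJ : J -> V) (F G : I -> J -> K) :=
  forall b c, jid S (tJ c) (tI b) (F b c - G b c).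

Lemma heqP (B C : V -> finType) (F G : hmx k Q B C) :
  heq S F G <-> jc (@tag _ _) (@tag _ _) (toM F) (toM G).
Proof.
split=> h.
  by move=> b c; have /jidP := h _ (tagged b) _ (tagged c); rewrite tos_sub.
by move=> i b j c; apply/jidP; rewrite tos_sub; apply: (h (ex_ B i b) (ex_ C j c)).
Qed.

Lemma toM_comp (B C D : V -> finType) (G : hmx k Q C D) (F : hmx k Q B C) :
  toM (hcomp G F) = mm (toM G) (toM F).
Proof.
apply: funext => b; apply: funext => d.
apply: tos_eq => [|s].
  by apply: wt_sum => c _; apply: (wtM (@wt_tos _ _ _ _ _ _) (@wt_tos _ _ _ _ _ _)).
rewrite /hcomp sig_big_dep /mm ser_sum; apply: eq_bigr => c _.
by rewrite /toM -tos_pmul /tos coef_val.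
Qed.

Lemma toM_id (B : V -> finType) : toM (@hid k V Q B) = dl k Q.
Proof.
apply: funext => b; apply: funext => c; apply: tos_eq => [|s].
  exact: (@wtm_dl _ _ Q _ (@tag V (fun i => Finite.sort (B i)))).
rewrite /hid /dl; case: b c s => i b [j c] s /=.
rewrite -[ex_ B i b == ex_ B j c]/(Tagged B b == Tagged B c).
by case: (_ == _).
Qed.

Lemma hid_sub_eqP (B : V -> finType) (F G : hmx k Q B B) :
  hid_sub_eq S F G <-> forall b c : {i : V & B i},
    jid S (tag c) (tag b) (dl k Q b c - toM F b c - toM G b c).
Proof.
rewrite /hid_sub_eq heqP; have -> : toM (fun i b j c s => @hid k V Q B i b j c s - F i b j c s) =
    (fun b c => dl k Q b c - toM F b c).
  apply: funext => b; apply: funext => c; rewrite -toM_id.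
  exact: tos_sub.
by [].
Qed.

Lemma wdl (B : V -> finType) : typed (@dl k V Q {i : V & B i}).
Proof. exact: (@wtm_dl k V Q _ (@tag V (fun i => Finite.sort (B i)))). Qed.

Section TheoremA.
Variables (M : rep k Q) (gM : good M) (noloop : loopless Q).
Variables (D1 D2 : pres k Q) (g1 : Tp D1 -> rsp M) (g2 : Tp D2 -> rsp M).
Hypotheses (ex1 : exact_pres S g1) (ex2 : exact_pres S g2).
Hypothesis card : forall i,
  (#|neg D1 i| + #|pos D2 i| = #|pos D1 i| + #|neg D2 i|)%N.

Notation d1 := (@dm _ _ _ D1).
Notation d2 := (@dm _ _ _ D2).

Lemma lift_gens (D D' : pres k Q) (g : Tp D -> rsp M) (g' : Tp D' -> rsp M) :
  exact_pres S g -> exact_pres S g' ->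
  exists2 f : Tp D -> Tp D' -> K, typed f & forall b, aug g' (f b) = g b.
Proof.
move=> [hg _ _] [_ hs _].
have /choice [f hf] b : exists y, wtv (tag b) y /\ aug g' y = g b.
  by have [y h1 ->] := hs _ _ (hg b); exists y.
by exists f => [b c|b]; case: (hf b).
Qed.

Lemma aug_mm (D D' : pres k Q) (g : Tp D -> rsp M) (g' : Tp D' -> rsp M) f (y : Tp D -> K) :
  (forall b, aug g' (f b) = g b) ->
  aug g' (fun c => \sum_b f b c * y b) = aug g y.
Proof.
move=> h; rewrite aug_sum [RHS]/aug; apply: eq_bigr => b _.
by rewrite augM // h.
Qed.

Lemma jc_mml (I J L : finType) (tI : I -> V) (tJ : J -> V) (tL : L -> V)
    (G : J -> L -> K) (F F' : I -> J -> K) : wtm tJ tL G -> jc tI tJ F F' ->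
  jc tI tL (mm G F) (mm G F').
Proof.
move=> wG h b d; rewrite /mm -sumrB; apply: jid_sum => c _.
by rewrite -mulrBr; apply: (jidMl (wG c d)).
Qed.
Lemma jc_mmr (I J L : finType) (tI : I -> V) (tJ : J -> V) (tL : L -> V)
    (G G' : J -> L -> K) (F : I -> J -> K) : wtm tI tJ F -> jc tJ tL G G' ->
  jc tI tL (mm G F) (mm G' F).
Proof.
move=> wF h b d; rewrite /mm -sumrB; apply: jid_sum => c _.
by rewrite -mulrBl; apply: (jidMr (wF b c)).
Qed.
Lemma jc_nil (I J : finType) (tI : I -> V) (tJ : J -> V) (F G : I -> J -> K) b c :
  jc tI tJ F G -> F b c [::] = G b c [::].
Proof.
move=> h; apply/eqP; rewrite -subr_eq0; apply/eqP.
exact: (jid_ord1 noloop (h b c)).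
Qed.

(** Constant terms of the relations between the columns of [D]. *)
Definition syz (D : pres k Q) i (c : neg D i -> k) := exists z : Tn D -> K,
  [/\ wtv i z, forall b, jid S (tag b) i (img z b)
    & forall m, z (ex_ (neg D) i m) [::] = c m].

Lemma syz_lin (D : pres k Q) i a (c c' : neg D i -> k) :
  syz c -> syz c' -> syz (fun m => a * c m + c' m).
Proof.
move=> [z [w1 j1 e1]] [z' [w2 j2 e2]]; exists (fun m => a *: z m + z' m).
split=> [m|b|m]; first by apply: wtD; [apply: wtZ|].
  have -> : img (fun m => a *: z m + z' m) b = a *: img z b + img z' b.
    rewrite /img scaler_sumr -big_split; apply: eq_bigr => m _ /=.
    by rewrite mulrDr scalerAr.
  by apply: jidD => //; apply: jidZ.
by rewrite serD serZ e1 e2.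
Qed.

Definition BI i : finType := (neg D1 i + pos D2 i)%type.
Definition BJ i : finType := (pos D1 i + neg D2 i)%type.
Definition jl (A B : V -> finType) (a : {i : V & A i}) : {i : V & (A i + B i)%type} :=
  existT (fun i => (A i + B i)%type) (tag a) (inl (tagged a)).
Definition jr (A B : V -> finType) (a : {i : V & B i}) : {i : V & (A i + B i)%type} :=
  existT (fun i => (A i + B i)%type) (tag a) (inr (tagged a)).

Lemma jcase (A B : V -> finType) (P : {i : V & (A i + B i)%type} -> Prop) :
  (forall a, P (jl B a)) -> (forall b, P (jr A b)) -> forall x, P x.
Proof.
move=> h1 h2 [i [a|b]]; first exact: (h1 (ex_ A i a)).
exact: (h2 (ex_ B i b)).
Qed.

Lemma sum_j (A B : V -> finType) (R : zmodType) (F : {i : V & (A i + B i)%type} -> R) :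
  \sum_x F x = \sum_a F (jl B a) + \sum_b F (jr A b).
Proof.
transitivity (\sum_i \sum_(x : (A i + B i)%type)
   F (existT (fun i => (A i + B i)%type) i x)).
  by rewrite sig_big_dep; apply: eq_bigr => -[].
under eq_bigr => i _ do rewrite big_sumType.
rewrite big_split /= !sig_big_dep; congr (_ + _).
Qed.

Definition blk (A B C D : V -> finType) (F11 : {i : V & A i} -> {i : V & C i} -> K)
  (F21 : {i : V & B i} -> {i : V & C i} -> K) (F12 : {i : V & A i} -> {i : V & D i} -> K)
  (F22 : {i : V & B i} -> {i : V & D i} -> K)
  (x : {i : V & (A i + B i)%type}) (y : {i : V & (C i + D i)%type}) : K :=
  match tagged x, tagged y with
  | inl a, inl c => F11 (ex_ A _ a) (ex_ C _ c)
  | inr b, inl c => F21 (ex_ B _ b) (ex_ C _ c)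
  | inl a, inr d => F12 (ex_ A _ a) (ex_ D _ d)
  | inr b, inr d => F22 (ex_ B _ b) (ex_ D _ d)
  end.

Section Blk.
Variables (A B C D : V -> finType) (F11 : {i : V & A i} -> {i : V & C i} -> K)
  (F21 : {i : V & B i} -> {i : V & C i} -> K) (F12 : {i : V & A i} -> {i : V & D i} -> K)
  (F22 : {i : V & B i} -> {i : V & D i} -> K).
Notation F := (blk F11 F21 F12 F22).
Lemma blk11 a c : F (jl B a) (jl D c) = F11 a c. Proof. by case: a c => i a []. Qed.
Lemma blk21 b c : F (jr A b) (jl D c) = F21 b c. Proof. by case: b c => i a []. Qed.
Lemma blk12 a d : F (jl B a) (jr C d) = F12 a d. Proof. by case: a d => i a []. Qed.
Lemma blk22 b d : F (jr A b) (jr C d) = F22 b d. Proof. by case: b d => i a []. Qed.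
Definition blkE := (blk11, blk12, blk21, blk22).
Lemma wtm_blk : typed F11 -> typed F21 -> typed F12 -> typed F22 -> typed F.
Proof.
move=> h11 h21 h12 h22 x y; move: x; apply: jcase => a; move: y; apply: jcase => b;
rewrite blkE; [exact: h11|exact: h12|exact: h21|exact: h22].
Qed.
End Blk.

(** [Phi : P(neg D1) + P(pos D2) -> P(pos D1) + P(neg D2)] is invertible exactly when the
    mapping cone of [(f', f) : D1 -> D2] is contractible.  Its constant term is onto modulo the
    constant terms of syzygies of [D2]; as both sides have equally many summands at each
    vertex, adding to [f'] a map into these syzygies makes it injective ([correct_into]). *)
Lemma cone_invertible : exists (f : Tp D1 -> Tp D2 -> K) (g : Tp D2 -> Tp D1 -> K)
    (f' : Tn D1 -> Tn D2 -> K) (t : Tp D2 -> Tn D2 -> K)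
    (Psi : {i : V & (pos D1 i + neg D2 i)%type} -> {i : V & (neg D1 i + pos D2 i)%type} -> K),
  let Phi := blk (fun a b => - d1 a b) g f' t in
  [/\ [/\ typed f, typed g, typed f', typed t & typed Psi],
      jc (@tag _ _) (@tag _ _) (mm f d1) (mm d2 f'),
      jc (@tag _ _) (@tag _ _) (dl k Q) (fun b c => mm f g b c + mm d2 t b c),
      mm Phi Psi = dl k Q & mm Psi Phi = dl k Q].
Proof.
have [hg1 hs1 he1] := ex1; have [hg2 hs2 he2] := ex2.
have [f wf ef] := lift_gens ex1 ex2; have [g wg eg] := lift_gens ex2 ex1.
have wd1 : typed d1 by move=> m b; apply: wt_dm.
have wd2 : typed d2 by move=> m b; apply: wt_dm.
have aug_d1 a : aug g1 (d1 a) = 0.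
  have w1 : wtv (tag a) (dl k Q a) by move=> b; apply: wdl.
  rewrite -[RHS](aug_img ex1 w1); congr (aug _ _); apply: funext => b.
  by rewrite -[d1 a b]/(d1 a b) -[in LHS](mm1r d1).
have /choice [f0 hf0] a : exists z, wtv (tag a) z /\
    forall b, jid S (tag b) (tag a) (mm f d1 a b - img z b).
  have wy : wtv (tag a) (fun b => mm f d1 a b) by move=> b; apply: (wtm_mm wf wd1).
  have /(he2 _ _ wy) [z h1 h2] : aug g2 (fun b => mm f d1 a b) = 0; last by exists z.
  by rewrite /mm (aug_mm (d1 a) ef) aug_d1.
have wf0 : typed f0 by move=> a m; case: (hf0 a).
have /choice [t ht] b : exists z, wtv (tag b) z /\
    forall c, jid S (tag c) (tag b) (dl k Q b c - mm f g b c - img z c).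
  have wy : wtv (tag b) (fun c => dl k Q b c - mm f g b c).
    by move=> c; apply: wtB; [apply: wdl | apply: (wtm_mm wf wg)].
  have /(he2 _ _ wy) [z h1 h2] : aug g2 (fun c => dl k Q b c - mm f g b c) = 0; last by exists z.
  rewrite augB /mm (aug_mm (g b) ef) eg.
  rewrite [X in X - _](_ : _ = g2 b) ?subrr // /aug (bigD1 b) //= /dl eqxx ev_1 //.
  by rewrite big1 ?addr0 // => c cb; rewrite eq_sym (negbTE cb) ev0E.
have wt_ : typed t by move=> b m; case: (ht b).
have jf0 : jc (@tag _ _) (@tag _ _) (mm f d1) (mm d2 f0) by move=> a b; case: (hf0 a) => _ /(_ b).
have jt : jc (@tag _ _) (@tag _ _) (dl k Q) (fun b c => mm f g b c + mm d2 t b c).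
  by move=> b c; case: (ht b) => _ /(_ c); rewrite opprD addrA.
have delta0 (B : V -> finType) i (b : B i) : wtv i (dl k Q (ex_ B i b)).
  by move=> c; apply: (@wdl B (ex_ B i b) c).
have dl_nil (B : V -> finType) i (b c : B i) : dl k Q (ex_ B i b) (ex_ B i c) [::] = (b == c)%:R.
  rewrite /dl; case: eqP => [e|ne].
    by have -> : b = c := eq_from_Tagged e; rewrite eqxx.
  by case: eqP => // bc; rewrite bc in ne.
(* The family of constants with values [y] at the vertex [i]. *)
pose spread (B : V -> finType) i (y : B i -> k) (b : {i : V & B i}) : K :=
  \sum_b0 y b0 *: dl k Q (ex_ B i b0) b.
have wspread (B : V -> finType) i (y : B i -> k) : wtv i (@spread B i y).
  by move=> b; apply: wt_sum => b0 _; apply/wtZ/delta0.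
have spread_nil (B : V -> finType) i (y : B i -> k) b : @spread B i y (ex_ B i b) [::] = y b.
  rewrite /spread ser_sum (bigD1 b) //= serZ dl_nil eqxx mulr1 big1 ?addr0 // => c cb.
  by rewrite serZ dl_nil (negbTE cb) mulr0.
have wtv0 (B : V -> finType) i (y : {i : V & B i} -> K) x : wtv i y -> tag x != i -> y x [::] = 0.
  by move=> wy ne; apply: (wt_nil (wy x)).
have psiP i : exists psi : Tn D1 -> Tn D2 -> K,
   (forall a : neg D1 i, wtv i (psi (ex_ (neg D1) i a)) /\
      forall b, jid S (tag b) i (img (psi (ex_ (neg D1) i a)) b)) /\
   forall u : BI i -> k, (forall y : BJ i, \sum_x u x *
     (blk (fun a b => - d1 a b) g f0 t (existT (fun i => BI i : Type) i x)
        (existT (fun i => BJ i : Type) i y) [::]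
      + match x, y with inl a, inr m => psi (ex_ (neg D1) i a) (ex_ (neg D2) i m) [::]
        | _, _ => 0 end) = 0) -> forall x, u x = 0.
  have [||Z hZ] := @pred_vspace k {ffun neg D2 i -> k^o} (fun c => @syz D2 i c).
  - exists (fun=> 0); split=> [m|b|m]; [exact: wt0 | | by rewrite ffunE].
    by rewrite /img big1 => [|m _]; [apply: jid0 | rewrite mulr0].
  - move=> a x y hx hy; have := syz_lin a hx hy; congr syz.
    by apply: funext => m; rewrite !ffunE.
  pose c (x : BI i) (y : BJ i) : k := blk (fun a b => - d1 a b) g f0 t
    (existT (fun i => BI i : Type) i x) (existT (fun i => BJ i : Type) i y) [::].
  pose P0 (u : {ffun BI i -> k^o}) : {ffun BJ i -> k^o} := [ffun y => \sum_x u x * c x y].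
  pose p0 (u : {ffun BI i -> k^o}) : {ffun neg D1 i -> k^o} := [ffun a => u (inl a)].
  pose i0 (z : {ffun neg D2 i -> k^o}) : {ffun BJ i -> k^o} :=
    [ffun y => if y is inr m then z m else 0].
  have linP a u v : P0 (a *: u + v) = a *: P0 u + P0 v.
    apply/ffunP => y; rewrite !ffunE scaler_sumr -big_split; apply: eq_bigr => x _ /=.
    by rewrite !ffunE mulrDl -scalerAl.
  have linp a u v : p0 (a *: u + v) = a *: p0 u + p0 v.
    by apply/ffunP => y; rewrite !ffunE.
  have lini a u v : i0 (a *: u + v) = a *: i0 u + i0 v.
    by apply/ffunP => -[y|y]; rewrite !ffunE // scaler0 addr0.
  have [||||psi psiZ psii] := @correct_into k _ _ _ _ (linfun P0) (linfun p0) (linfun i0) Z.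
  - by rewrite !dimvf /dim /= !card_sum card.
  - move=> z; rewrite (linfun_raw lini) => h; apply/ffunP => m.
    by have := congr1 (fun f : {ffun _ -> _} => f (inr m)) h; rewrite !ffunE.
  - move=> y.
    have [X wX X0] : exists2 X : Tp D1 -> K, wtv i X &
        forall b, X (ex_ (pos D1) i b) [::] = y (inl b).
      by exists (@spread (pos D1) i (fun b => y (inl b))) => // b; apply: spread_nil.
    have [X' wX' X'0] : exists2 X' : Tn D2 -> K, wtv i X' &
        forall m, X' (ex_ (neg D2) i m) [::] = y (inr m).
      by exists (@spread (neg D2) i (fun m => y (inr m))) => // m; apply: spread_nil.
    pose e c := \sum_b f b c * X b + img X' c.
    pose X1 b := X b - \sum_c g c b * e c.
    pose X1' m := X' m - \sum_c t c m * e c.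
    have we : wtv i e.
      move=> c'; apply: wtD; last exact: (wtv_img wX').
      by apply: wt_sum => b _; apply: (wtM (wf b c') (wX b)).
    have wX1 : wtv i X1.
      move=> b; apply: wtB; first exact: wX.
      by apply: wt_sum => c' _; apply: (wtM (wg c' b) (we c')).
    have wX1' : wtv i X1'.
      move=> m; apply: wtB; first exact: wX'.
      by apply: wt_sum => c' _; apply: (wtM (wt_ c' m) (we c')).
    have j1 b : jid S (tag b) i (\sum_b' f b' b * X1 b' + img X1' b).
      have -> : \sum_b' f b' b * X1 b' + img X1' b =
          \sum_c (dl k Q c b - (mm f g c b + mm d2 t c b)) * e c.
        rewrite /X1 /img /X1'.
        under eq_bigr => b' _ do rewrite mulrBr mulr_sumr.
        under [X in _ + X]eq_bigr => m _ do rewrite mulrBr mulr_sumr.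
        rewrite !sumrB addrACA -/(img X' b) -/(e b).
        under [RHS]eq_bigr => c' _ do rewrite mulrBl mulrDl.
        rewrite sumrB big_split -opprD; congr (_ - (_ + _)).
        - have dlb : dl k Q b b = 1 by rewrite /dl eqxx.
          rewrite [RHS](bigD1 b) //= dlb mul1r [X in _ = _ + X]big1 ?addr0 // => c' ne.
          by rewrite /dl (negbTE ne) mul0r.
        - rewrite exchange_big; apply: eq_bigr => c' _ /=; rewrite mulr_suml.
          by apply: eq_bigr => b' _; rewrite mulrA.
        rewrite exchange_big; apply: eq_bigr => c' _ /=; rewrite mulr_suml.
        by apply: eq_bigr => b' _; rewrite mulrA.
      by apply: jid_sum => c' _; apply: (jidMr (we c') (jt c' b)).
    have wfX1 : wtv i (fun b => \sum_b' f b' b * X1 b').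
      by move=> b; apply: wt_sum => b' _; apply: (wtM (wf b' b) (wX1 b')).
    have /(he1 _ _ wX1) [a wa ja] : aug g1 X1 = 0.
      rewrite -(aug_mm X1 ef); apply/(he2 _ _ wfX1); exists (fun m => - X1' m).
        by move=> m; apply: wtN.
      move=> b; have := j1 b; rewrite /img.
      by under [X in _ -> jid _ _ _ (_ - X)]eq_bigr => m _ do rewrite mulrN;
         rewrite sumrN opprK.
    pose r m := X1' m + \sum_a' f0 a' m * a a'.
    have wr : wtv i r.
      move=> m; apply: wtD => //; apply: wt_sum => a' _.
      exact: (wtM (wf0 a' m) (wa a')).
    have jr' b : jid S (tag b) i (img r b).
      have -> : img r b = (\sum_b' f b' b * X1 b' + img X1' b)
         - \sum_b' f b' b * (X1 b' - img a b')
         - \sum_a' (mm f d1 a' b - mm d2 f0 a' b) * a a'.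
        rewrite /img /r.
        under eq_bigr => m _ do rewrite mulrDr mulr_sumr.
        under [X in _ - X - _]eq_bigr => b' _ do rewrite mulrBr mulr_sumr.
        under [X in _ - _ - X]eq_bigr => a' _ do rewrite mulrBl.
        rewrite big_split !sumrB /=.
        set A := \sum_i0 d2 i0 b * X1' i0; set B := \sum_i0 f i0 b * X1 i0.
        set C1 := \sum_i0 \sum_i1 _; set C2 := \sum_b' \sum_i0 _.
        set C3 := \sum_a' mm f d1 a' b * a a'; set C4 := \sum_a' mm d2 f0 a' b * a a'.
        have -> : C1 = C4.
          rewrite /C1 /C4 exchange_big; apply: eq_bigr => a' _ /=; rewrite mulr_suml.
          by apply: eq_bigr => m _; rewrite mulrA.
        have -> : C2 = C3.
          rewrite /C2 /C3 exchange_big; apply: eq_bigr => a' _ /=; rewrite mulr_suml.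
          by apply: eq_bigr => m _; rewrite mulrA.
        rewrite (addrC B A) -(addrA A B) opprB (addrC B) subrK.
        by rewrite -(addrA A C3) opprB (addrC C3) subrK.
      apply: jidB; first apply: jidB; first exact: j1.
        by apply: jid_sum => b' _; apply: (jidMl (wf b' b) (ja b')).
      by apply: jid_sum => a' _; apply: (jidMr (wa a') (jf0 a' b)).
    exists [ffun x : BI i => match x with inl a' => - a (ex_ (neg D1) i a') [::]
        | inr c' => e (ex_ (pos D2) i c') [::] end].
    exists [ffun m => r (ex_ (neg D2) i m) [::]].
      by apply/hZ; exists r; split=> // m; rewrite ffunE.
    apply/ffunP => -[b|m]; rewrite !ffunE (linfun_raw linP) (linfun_raw lini) !ffunE.
      rewrite addr0 big_sumType /=.
      have := jid_ord1 noloop (ja (ex_ (pos D1) i b)) (isT : (size [::] < 1)%N).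
      rewrite serD serN; move/subr0_eq; rewrite /X1 serD serN X0 => /(canRL (subrK _)) ->.
      rewrite /img !ser_sum; congr (_ + _).
        rewrite (sum_grade (i := i)) => [|a' ne]; last by rewrite serM_nil (wtv0 _ _ _ _ wa ne) mulr0.
        by apply: eq_bigr => a' _; rewrite !ffunE serM_nil mulNr /c /blk /= serN mulrN opprK mulrC.
      rewrite (sum_grade (i := i)) => [|c' ne]; last by rewrite serM_nil (wtv0 _ _ _ _ we ne) mulr0.
      by apply: eq_bigr => c' _; rewrite !ffunE serM_nil mulrC.
    rewrite big_sumType /= /r /X1' !serD serN X'0 !ser_sum.
    rewrite (sum_grade (i := i)) => [|c' ne]; last by rewrite serM_nil (wtv0 _ _ _ _ we ne) mulr0.
    rewrite [X in _ + _ + (_ + X)](sum_grade (i := i)) => [|a' ne]; last first.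
      by rewrite serM_nil (wtv0 _ _ _ _ wa ne) mulr0.
    set E1 := \sum_b _; set E2 := \sum_b _; set E3 := \sum_i0 _; set E4 := \sum_i0 _.
    have -> : E4 = - E1.
      rewrite /E4 /E1 -sumrN; apply: eq_bigr => a' _.
      by rewrite !ffunE serM_nil mulNr opprK mulrC.
    have -> : E3 = E2 by apply: eq_bigr => c' _; rewrite !ffunE serM_nil mulrC.
    by rewrite addrC addrA subrK subrK.
  - move=> u; rewrite (linfun_raw linp) => hu z /hZ [zz [wz jz ez]].
    rewrite (linfun_raw linP) (linfun_raw lini) => h.
    pose e := @spread (pos D2) i (fun c' => u (inr c')).
    have ul a : u (inl a) = 0.
      by have := congr1 (fun f : {ffun _ -> _} => f a) hu; rewrite !ffunE.
    have hc y : \sum_c' e (ex_ (pos D2) i c') [::] * c (inr c') y = i0 z y.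
      rewrite -h ffunE big_sumType /= [X in _ = X + _]big1 ?add0r => [|a _]; last first.
        by rewrite ul mul0r.
      by apply: eq_bigr => c' _; rewrite /e spread_nil.
    have e0 c' : e c' [::] = 0.
      have := jc_nil _ c' jt.
      suff H : (mm (fun b c => mm f g b c + mm d2 t b c) (fun _ : unit => e) tt c') [::] = 0.
        have jtt : jid S (tag c') i (e c' - mm (fun b c => mm f g b c + mm d2 t b c) (fun _ : unit => e) tt c').
          have := @jc_mmr _ _ _ (fun _ : unit => i) (@tag _ _) (@tag _ _) _ _ (fun _ : unit => e) _ jt tt c'.
          by rewrite mm1l; apply=> _ b; apply: wspread.
        by have := jid_ord1 noloop jtt (isT : (size [::] < 1)%N); rewrite serD serN H subr0.
      have -> : mm (fun b c => mm f g b c + mm d2 t b c) (fun _ : unit => e) tt c' =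
         mm f (mm g (fun _ : unit => e)) tt c' + mm d2 (mm t (fun _ : unit => e)) tt c'.
        by rewrite !mmA /mm -big_split; apply: eq_bigr => b _; rewrite /= mulrDl.
      rewrite serD {1}/mm ser_sum big1 ?add0r => [|b _]; last first.
        rewrite serM_nil; have [bi|ne] := eqVneq (tag b) i; last first.
          rewrite (wtv0 (pos D1) i (fun b => mm g (fun _ : unit => e) tt b)) ?mulr0 // => b'.
          by apply: wt_sum => c'' _; apply: (wtM (wg c'' b') (wspread _ _ _ c'')).
        case: b bi => j b /= ji; subst j; rewrite /mm ser_sum.
        rewrite (sum_grade (i := i)) => [|c'' ne]; last first.
          by rewrite serM_nil (wtv0 _ _ e _ (wspread _ _ _) ne) mulr0.
        rewrite [X in _ * X](_ : _ = 0) ?mulr0 //.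
        have := hc (inl b); rewrite /i0 ffunE => hb; rewrite -[RHS]hb.
        by apply: eq_bigr => c'' _; rewrite serM_nil mulrC.
      transitivity (img zz c' [::]); last exact: (jid_ord1 noloop (jz c')).
      rewrite /img {1}/mm !ser_sum; apply: eq_bigr => m _; rewrite !serM_nil; congr (_ * _).
      have [mi|ne] := eqVneq (tag m) i; last first.
        rewrite (wtv0 _ _ zz _ wz ne).
        rewrite (wtv0 (neg D2) i (fun b => mm t (fun _ : unit => e) tt b)) // => b'.
        by apply: wt_sum => c'' _; apply: (wtM (wt_ c'' b') (wspread _ _ _ c'')).
      case: m mi => j m /= ji; subst j; rewrite ez /mm ser_sum.
      rewrite (sum_grade (i := i)) => [|c'' ne]; last first.
        by rewrite serM_nil (wtv0 _ _ e _ (wspread _ _ _) ne) mulr0.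
      have := hc (inr m); rewrite /i0 ffunE => <-.
      by apply: eq_bigr => c'' _; rewrite serM_nil mulrC.
    apply/ffunP => -[a|c']; rewrite ffunE ?ul //.
    by rewrite -(spread_nil _ _ (fun c' => u (inr c'))) -/e e0.
  have /choice [ps hps] (a : Tn D1) : exists z : Tn D2 -> K, forall a0 : neg D1 i,
     a = ex_ (neg D1) i a0 -> [/\ wtv i z, forall b, jid S (tag b) i (img z b)
       & forall m, z (ex_ (neg D2) i m) [::] = psi [ffun a1 => (a1 == a0)%:R] m].
    have [e|ne] := eqVneq (tag a) i; last by exists (fun=> 0) => a0 e; rewrite e eqxx in ne.
    case: a e => j a /= ji; subst j.
    have /hZ [z [z1 z2 z3]] := psiZ [ffun a1 => (a1 == a)%:R].
    exists z => a0 e; have <- : a = a0 := eq_from_Tagged e.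
    by split.
  exists ps; split=> [a|u hu].
    by have [h1 h2 _] := hps _ a erefl; split.
  suff u0 : [ffun x => u x] = 0 :> {ffun BI i -> k^o}.
    by move=> x; have := congr1 (fun f : {ffun _ -> _} => f x) u0; rewrite !ffunE.
  apply: psii; rewrite (linfun_raw linP) (linfun_raw linp) (linfun_raw lini).
  apply/ffunP => y; rewrite !ffunE -[RHS](hu y).
  under [RHS]eq_bigr => x _ do rewrite mulrDr.
  rewrite big_split /=; congr (_ + _); first by apply: eq_bigr => x _; rewrite ffunE.
  case: y => [b|m].
    by rewrite big1 // => -[a|c'] _; rewrite mulr0.
  rewrite big_sumType /= [X in _ + X]big1 ?addr0 => [|c' _]; last by rewrite mulr0.
  have -> : p0 [ffun x => u x] = \sum_a u (inl a) *: [ffun a1 => (a1 == a)%:R].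
    apply/ffunP => a; rewrite sum_ffunE !ffunE (bigD1 a) //= !ffunE eqxx.
    rewrite big1 ?addr0 => [|a' ne]; first by rewrite /GRing.scale /= mulr1.
    by rewrite !ffunE eq_sym (negbTE ne) scaler0.
  rewrite linear_sum sum_ffunE; apply: eq_bigr => a _.
  by have [_ _ ->] := hps _ a erefl; rewrite linearZ /= ffunE.
have /choice [psi hpsi] := psiP.
pose f' a m := f0 a m + psi (tag a) a m.
have wpsi : typed (fun a m => psi (tag a) a m).
  by case=> i a m; have [h _] := hpsi i; have [w _] := h a; apply: w.
have wf' : typed f' by move=> a m; apply: wtD; [apply: wf0 | apply: wpsi].
have [|||Psi [wPsi e1 e2]] := @graded_inv k V Q BI BJ (blk (fun a b => - d1 a b) g f' t).
- by apply: wtm_blk => // a b; apply: wtN; apply: wd1.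
- by move=> i; rewrite !card_sum card.
- move=> i u hu; have [_ h] := hpsi i; apply: h => y; rewrite -[RHS](hu y).
  apply: eq_bigr => x _; congr (_ * _).
  by case: x => [a|c]; case: y {hu} => [b|m]; rewrite /blk /= ?addr0.
exists f, g, f', t, Psi; split=> // a b.
have -> : mm d2 f' a b = mm d2 f0 a b + img (psi (tag a) a) b.
  by rewrite /mm /img /f' -big_split; apply: eq_bigr => m _; rewrite mulrDr.
rewrite opprD addrA; apply: jidB; first exact: jf0.
by case: a => i a; have [h _] := hpsi i; have [_] := h a; apply.
Qed.

(** The rows of the inverse of the mapping cone of [(f', f)] contain a homotopy inverse and the
    homotopies. *)
Theorem htpy_iso_of_exact : htpy_iso S D1 D2.
Proof.
have [f [g [f' [t [Psi [[wf wg wf' wt_ wPsi] jf jt e1 e2]]]]]] := cone_invertible.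
have wd1 : typed d1 by move=> m b; apply: wt_dm.
have wd2 : typed d2 by move=> m b; apply: wt_dm.
pose p b a := Psi (jl (neg D2) b) (jl (pos D2) a).
pose q m a := Psi (jr (pos D1) m) (jl (pos D2) a).
have wp : typed p by move=> b a; apply: (wPsi (jl _ b) (jl _ a)).
have wq : typed q by move=> b a; apply: (wPsi (jr _ b) (jl _ a)).
pose Phi := blk (fun a b => - d1 a b) g f' t.
have wPhi : typed Phi by apply: wtm_blk => // a b; apply: wtN; apply: wd1.
(* The second row of the inverse of [Phi] is [(f, d2)]. *)
pose E (y : {i : V & (pos D1 i + neg D2 i)%type}) (c : Tp D2) : K :=
  match tagged y with
  | inl b => f (ex_ (pos D1) _ b) c | inr m => d2 (ex_ (neg D2) _ m) c end.
pose P (x : {i : V & (neg D1 i + pos D2 i)%type}) (c : Tp D2) : K :=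
  match tagged x with inl a => 0 | inr c0 => dl k Q (ex_ (pos D2) _ c0) c end.
have E1 b c : E (jl _ b) c = f b c by case: b.
have E2 m c : E (jr _ m) c = d2 m c by case: m.
have P1 a c : P (jl _ a) c = 0 by [].
have P2 c0 c : P (jr _ c0) c = dl k Q c0 c by case: c0.
have jEP : jc (@tag _ _) (@tag _ _) (mm E Phi) P.
  move=> x c; rewrite /mm sum_j; move: x; apply: jcase => [a|c0].
    rewrite P1 subr0 [X in jid _ _ _ X](_ : _ = - (mm f d1 a c - mm d2 f' a c)).
      exact/jidN/jf.
    rewrite opprB addrC /mm -sumrN; congr (_ + _); apply: eq_bigr => e _.
      by rewrite E2 /Phi blk12.
    by rewrite E1 /Phi blk11 mulrN.
  rewrite P2 [X in jid _ _ _ X](_ : _ = - (dl k Q c0 c - (mm f g c0 c + mm d2 t c0 c))).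
    exact/jidN/jt.
  rewrite opprB; congr (_ - _); congr (_ + _); apply: eq_bigr => e _.
    by rewrite E1 /Phi blk21.
  by rewrite E2 /Phi blk22.
have Psi2 y c : jid S (tag c) (tag y) (E y c - Psi y (jr _ c)).
  have := jc_mmr wPsi jEP y c; rewrite -mmA e1 mm1r.
  rewrite [X in jid _ _ _ (_ - X)](_ : _ = Psi y (jr _ c)) //.
  rewrite /mm sum_j big1 ?add0r => [|a _]; last by rewrite P1 mul0r.
  rewrite (bigD1 c) //= P2 /dl eqxx mul1r big1 ?addr0 // => c0 ne.
  by rewrite P2 /dl (negbTE ne) mul0r.
have dlj (A B : V -> finType) (a b : {i : V & A i}) : dl k Q (jl B a) (jl B b) = dl k Q a b :> K.
  rewrite /dl; congr (nat_of_bool _)%:R; apply/eqP/eqP => [e|-> //].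
  case: a b e => [i a] [j b] e; have ij : i = j := congr1 (@tag _ _) e; subst j.
  by have [->] := eq_from_Tagged e.
have dlr (A B : V -> finType) (a b : {i : V & B i}) : dl k Q (jr A a) (jr A b) = dl k Q a b :> K.
  rewrite /dl; congr (nat_of_bool _)%:R; apply/eqP/eqP => [e|-> //].
  case: a b e => [i a] [j b] e; have ij : i = j := congr1 (@tag _ _) e; subst j.
  by have [->] := eq_from_Tagged e.
have dlrl (A B : V -> finType) (a : {i : V & B i}) (b : {i : V & A i}) : dl k Q (jr A a) (jl B b) = 0 :> K.
  by rewrite /dl; case: eqP.
(* The entries of [Psi Phi = 1] and of [Phi Psi = 1]. *)
have r11 a a' : mm q f' a a' - mm p d1 a a' = dl k Q a a'.
  have := congr1 (fun F => F (jl _ a) (jl _ a')) e2; rewrite dlj => <-.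
  rewrite /mm sum_j addrC -sumrN; congr (_ + _); apply: eq_bigr => e _.
    by rewrite blk11 mulrN.
  by rewrite blk12.
have r22 b b' : mm g (fun y c => Psi (jl _ y) (jr _ c)) b b' - mm d1 p b b' = dl k Q b b'.
  have := congr1 (fun F => F (jl _ b) (jl _ b')) e1; rewrite dlj => <-.
  rewrite /mm sum_j addrC -sumrN; congr (_ + _); apply: eq_bigr => e _.
    by rewrite blk11 mulNr.
  by rewrite blk21.
have r23 m b : mm g (fun y c => Psi (jr _ y) (jr _ c)) m b - mm d1 q m b = 0.
  have := congr1 (fun F => F (jr _ m) (jl _ b)) e1; rewrite dlrl => <-.
  rewrite /mm sum_j addrC -sumrN; congr (_ + _); apply: eq_bigr => e _.
    by rewrite blk11 mulNr.
  by rewrite blk21.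
have r33 m m' : mm f' q m m' + mm t (fun y c => Psi (jr _ y) (jr _ c)) m m' = dl k Q m m'.
  have := congr1 (fun F => F (jr _ m) (jr _ m')) e1; rewrite dlr => <-.
  rewrite /mm sum_j; congr (_ + _); apply: eq_bigr => e _.
    by rewrite blk12.
  by rewrite blk22.
have jPf : jc (@tag _ _) (@tag _ _) f (fun y c => Psi (jl _ y) (jr _ c)).
  by move=> y c; rewrite -E1; apply: (Psi2 (jl _ y)).
have jPd : jc (@tag _ _) (@tag _ _) d2 (fun y c => Psi (jr _ y) (jr _ c)).
  by move=> y c; rewrite -E2; apply: (Psi2 (jr _ y)).
have wnp : typed (fun b a => - p b a) by move=> b a; apply: wtN; apply: wp.
have toMd (D : pres k Q) : toM (pmx D) = @dm _ _ _ D by [].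
exists (ofM f'), (ofM f), (ofM q), (ofM g), (ofM (fun b a => - p b a)), (ofM t).
split; [apply/heqP | apply/heqP | split; apply/hid_sub_eqP | split; apply/hid_sub_eqP];
  rewrite ?toM_comp ?toMd ?ofMK //.
- (* (q, g) is a morphism of complexes *)
  move=> m b; rewrite [X in jid _ _ _ X](_ : _ = mm g d2 m b -
     mm g (fun y c => Psi (jr _ y) (jr _ c)) m b); first exact: (jc_mml wg jPd).
  by congr (_ - _); apply/eqP; rewrite eq_sym -subr_eq0 r23.
- move=> a a'; rewrite -(r11 a a') [X in jid _ _ _ X](_ : _ = 0); first exact: jid0.
  rewrite (_ : mm (fun b a => - p b a) d1 a a' = - mm p d1 a a').
    by rewrite opprK [_ - mm p d1 a a']addrC addrK addNr.
  by rewrite /mm -sumrN; apply: eq_bigr => e _; rewrite mulNr.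
- move=> b b'; rewrite -(r22 b b') [X in jid _ _ _ X](_ : _ =
    - (mm g f b b' - mm g (fun y c => Psi (jl _ y) (jr _ c)) b b')).
    exact/jidN/(jc_mml wg jPf).
  rewrite (_ : mm d1 (fun b a => - p b a) b b' = - mm d1 p b b').
    by rewrite opprK opprB addrAC subrK.
  by rewrite /mm -sumrN; apply: eq_bigr => e _; rewrite mulrN.
- move=> m m'; rewrite -(r33 m m') [X in jid _ _ _ X](_ : _ =
    - (mm t d2 m m' - mm t (fun y c => Psi (jr _ y) (jr _ c)) m m')).
    exact/jidN/(jc_mml wt_ jPd).
  by rewrite opprB [X in X - _ - _]addrC addrK.
by move=> c c'; rewrite -addrA -opprD; apply: jt.
Qed.

End TheoremA.
End Hmx.

(** * Isomorphisms of completed path algebras *)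

Section Box.
Variables (k : fieldType) (X : finType).
Notation K := (ser k X).
Implicit Types (x y z : K) (a b c : X).

(** [box c] maps the pair of a word [p c q] and of [y] to [q y p]; thus
    [box c x 1] is the cyclic derivative of [x]. *)
Definition lqs (p : seq X) c x : K := fun t => x (p ++ c :: t).
Definition box c x y : K := fun s =>
  \sum_(n < (size s).+1) (lqs (drop n s) c x * y) (take n s).

Lemma box_rec c x y : box c x y = lq c x * y + \sum_a box c (lq a x) (y * ltr a).
Proof.
apply: serP => s; rewrite serD ser_sum /box big_ord_recr /= addrC.
rewrite drop_size take_size; congr (_ + _).
under [RHS]eq_bigr => a _ do rewrite big_ord_recl /= take0 mulrA serM_nil ltr_nil mulr0 add0r.
rewrite exchange_big; apply: eq_bigr => -[n hn] _ /=.
case: s hn => [//|b0 s'] hn; set s := b0 :: s'.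
pose b := nth b0 s n.
have dE : drop n s = b :: drop n.+1 s by rewrite (drop_nth b0).
have tE : take n.+1 s = rcons (take n s) b by rewrite (take_nth b0).
rewrite /bump add1n tE (bigD1 b) //= big1 ?addr0 => [|a ne].
  rewrite mulrA -[RHS]/(rq b (_ * _ * ltr b) (take n s)) rq_Mltr eqxx mulr1.
  by rewrite dE.
rewrite mulrA -[LHS]/(rq b (_ * _ * ltr a) (take n s)) rq_Mltr.
by rewrite eq_sym (negbTE ne) mulr0.
Qed.

Lemma box_ord n c x y : ord n y -> ord n (box c x y).
Proof.
move=> hy s sn; rewrite /box big1 // => m _.
have h : ord n (lqs (drop m s) c x * y) by apply: ordMl.
apply: h.
by rewrite size_take; case: ifP => // h; apply: ltn_trans h sn.
Qed.

Lemma box_linl c d x x' y : box c (d *: x + x') y = d *: box c x y + box c x' y.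
Proof.
apply: serP => s; rewrite serD serZ /box mulr_sumr -big_split; apply: eq_bigr => n _.
rewrite -[lqs _ _ _]/(d *: lqs (drop n s) c x + lqs (drop n s) c x').
by rewrite mulrDl -scalerAl.
Qed.
Lemma box_linr c d x y y' : box c x (d *: y + y') = d *: box c x y + box c x y'.
Proof.
apply: serP => s; rewrite serD serZ /box mulr_sumr -big_split; apply: eq_bigr => n _.
by rewrite mulrDr -scalerAr.
Qed.
Lemma boxDl c x x' y : box c (x + x') y = box c x y + box c x' y.
Proof. by rewrite -[x in LHS]scale1r box_linl scale1r. Qed.
Lemma boxDr c x y y' : box c x (y + y') = box c x y + box c x y'.
Proof. by rewrite -[y in LHS]scale1r box_linr scale1r. Qed.
Lemma box0l c y : box c 0 y = 0.
Proof. by apply: (addrI (box c 0 y)); rewrite -boxDl !addr0. Qed.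
Lemma box0r c x : box c x 0 = 0.
Proof. by apply: (addrI (box c x 0)); rewrite -boxDr !addr0. Qed.
Lemma boxZl c d x y : box c (d *: x) y = d *: box c x y.
Proof. by rewrite -[d *: x]addr0 box_linl box0l addr0. Qed.
Lemma box_suml c y I (r : seq I) (P : pred I) (F : I -> K) :
  box c (\sum_(i <- r | P i) F i) y = \sum_(i <- r | P i) box c (F i) y.
Proof. by elim/big_ind2: _ => [|x u x' v <- <-|//]; rewrite ?box0l ?boxDl. Qed.
Lemma box_sumr c x I (r : seq I) (P : pred I) (F : I -> K) :
  box c x (\sum_(i <- r | P i) F i) = \sum_(i <- r | P i) box c x (F i).
Proof. by elim/big_ind2: _ => [|y u y' v <- <-|//]; rewrite ?box0r ?boxDr. Qed.
Lemma box1 c y : box c 1 y = 0.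
Proof.
by rewrite box_rec lq1 mul0r add0r big1 // => a _; rewrite lq1 box0l.
Qed.

(** The error moves to longer and longer words. *)
Lemma rec_ord (X2 : eqType) (T : Type) (E : T -> K -> ser k X2) (ok : T -> K -> Prop) (nx : X -> T -> T) :
  (forall t y n, ok t y -> ord n y -> ord n (E t y)) ->
  (forall t y, ok t y -> exists2 P : pred X, forall a, P a -> ok (nx a t) (y * ltr a) &
      E t y = \sum_(a | P a) E (nx a t) (y * ltr a)) ->
  forall t y, ok t y -> E t y = 0.
Proof.
move=> h1 h2.
have H n t y m : ok t y -> ord m y -> ord (m + n) (E t y).
  elim: n t y m => [|n IH] t y m ht hy; first by rewrite addn0; apply: h1.
  have [P hP ->] := h2 t y ht; apply: ord_sum => a Pa.
  rewrite addnS -addSn; apply: IH; first exact: hP.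
  by rewrite -addn1; apply: ordM => //; apply: ord_ltr.
move=> t y ht; apply: ord_eq0 => n; rewrite -[n]add0n; exact: H.
Qed.

Lemma box_mul c x y z : box c (x * y) z = box c x (y * z) + box c y (z * x).
Proof.
apply/eqP; rewrite -subr_eq0; apply/eqP.
pose E (x : K) z := box c (x * y) z - (box c x (y * z) + box c y (z * x)).
apply: (@rec_ord _ _ E (fun _ _ => True) (fun a x => lq a x)) => // {x z}.
  move=> x z n _ hz; rewrite /E; apply: ordB; first exact: box_ord.
  by apply: ordD; apply: box_ord; [apply: ordMl | apply: ordMr].
move=> x z _; exists xpredT => //; rewrite /E.
rewrite box_rec lq_mul mulrDl -scalerAl.
under eq_bigr => a _ do rewrite lq_mul boxDl boxZl.
rewrite big_split -scaler_sumr /=.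
rewrite [X in _ - (X + _)](box_rec c x).
rewrite [X in z * X](lq_dec x) mulrDr boxDr -scalerAr mulr1 -[_ *: z]addr0 box_linr box0r addr0.
rewrite mulr_sumr box_sumr (box_rec c y z) scalerDr !sumrB !big_split /=.
set A := x [::] *: _; set B := lq c x * y * z; set C := x [::] *: _; set D := \sum_i _.
have -> : \sum_i box c (lq i x) (y * (z * ltr i)) = \sum_i box c (lq i x) (y * z * ltr i).
  by apply: eq_bigr => i _; rewrite mulrA.
have -> : \sum_i box c y (z * ltr i * lq i x) = \sum_i box c y (z * (ltr i * lq i x)).
  by apply: eq_bigr => i _; rewrite mulrA.
have -> : lq c x * (y * z) = B by rewrite mulrA.
set F1 := \sum_i box c (lq i x) _; set F2 := \sum_i box c y _.
have -> : A + B + (C + D) = (A + C + B) + D by rewrite addrACA addrA.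
have -> : B + F1 + (A + C + F2) = (A + C + B) + (F1 + F2).
  by rewrite addrACA (addrC B).
by rewrite opprD addrACA subrr add0r.
Qed.

Lemma cder_box1 c x (s : seq X) : box c x 1 s =
  \sum_(n < (size s).+1) x (drop n s ++ c :: take n s).
Proof. by rewrite /box; apply: eq_bigr => n _; rewrite mulr1. Qed.

End Box.

Section TypedBox.
Variables (k : fieldType) (V : finType) (Q : quiver V).
Notation K := (ser k (arr Q)).
Implicit Types (x y : K) (c : arr Q).

Lemma cder_box c x : cder x c = box c x 1.
Proof. by apply: serP => s; rewrite cder_box1. Qed.

Lemma wt_box i j c x y : wt j i x -> wt i j y -> wt (tgt c) (src c) (box c x y).
Proof.
move=> hx hy s hs; rewrite /box big1 // => n _.
have [hw|hw] := boolP (walk j (drop n s) (src c)); last first.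
  rewrite (_ : lqs _ _ _ = 0) ?mul0r //; apply: serP => t; rewrite ser0; apply: hx.
  apply: contra hw => /walk_split [l h1 /= /andP[/eqP e _]].
  by rewrite e.
have w : wt (tgt c) j (lqs (drop n s) c x * y).
  apply: wtM hy => t ht; apply: hx; apply: contra ht => /walk_split [l h1 /= /andP[_]].
  by [].
apply: w; apply: contra hs => h; rewrite -(cat_take_drop n s).
exact: walk_cat h hw.
Qed.

(** Families of subspaces [P i j] of the [e_i A e_j] that form a closed
    two-sided ideal. *)
Record cideal (P : V -> V -> K -> Prop) : Prop := CIdeal {
  ci_wt : forall i j x, P i j x -> wt i j x;
  ci0 : forall i j, P i j 0;
  ciD : forall i j x y, P i j x -> P i j y -> P i j (x + y);
  ciMl : forall i j l x y, wt l i y -> P i j x -> P l j (y * x);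
  ciMr : forall i j l x y, wt j l y -> P i j x -> P i l (x * y);
  ci_closed : forall i j x, wt i j x ->
    (forall N, exists2 y, P i j y & ord N (x - y)) -> P i j x }.

Lemma jid_cideal (S : potential k Q) : cideal (jid S).
Proof.
split.
- by move=> i j x [].
- exact: jid0.
- exact: jidD.
- by move=> i j l x y hy; apply: jidMl.
- by move=> i j l x y hy; apply: jidMr.
exact: jid_closed.
Qed.

Lemma ci_sum P i j I (r : seq I) (p : pred I) (F : I -> K) : cideal P ->
  (forall m, p m -> P i j (F m)) -> P i j (\sum_(m <- r | p m) F m).
Proof.
move=> hP h; elim/big_ind: _ => //; [exact: (ci0 hP) | move=> *; exact: (ciD hP)].
Qed.

Lemma jid_least P (S : potential k Q) : cideal P ->
  (forall a, P (tgt a) (src a) (cder (potS S) a)) -> forall i j x, jid S i j x -> P i j x.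
Proof.
move=> hP hg; apply: jid_min.
- exact: (ci0 hP).
- exact: (ciD hP).
- move=> i j x wx h; apply: (ci_closed hP) => // N.
  by have [y [_ py oy]] := h N; exists y.
by move=> i j a l r wl wr; apply: (ciMr hP) wr _; apply: (ciMl hP) wl _.
Qed.

Lemma box_cideal P i j c x y : cideal P -> wt j i x -> P i j y ->
  P (tgt c) (src c) (box c x y).
Proof.
move=> hP wx py; apply: (ci_closed hP); first exact: wt_box wx (ci_wt hP py).
move=> N.
have : forall n m j x y, wt j i x -> P i j y -> ord m y ->
    exists2 z, P (tgt c) (src c) z & ord (m + n) (box c x y - z).
  elim=> [|n IH] m j' x' y' wx' py' oy.
    exists 0; first exact: (ci0 hP).
    by rewrite addn0 subr0; apply: box_ord.
  have /choice [z hz] a : exists z, P (tgt c) (src c) z /\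
      ord (m + n.+1) (box c (lq a x') (y' * ltr a) - z).
    have [e|ne] := eqVneq (src a) j'; last first.
      by exists 0; split; [apply: (ci0 hP) | rewrite (wt_lq0 wx' ne) box0l subrr].
    have [||| z h1 h2] := IH m.+1 (tgt a) (lq a x') (y' * ltr a).
    - exact: wt_lq wx'.
    - by apply: (ciMr hP) py'; rewrite -e; apply: wt_ltr.
    - by rewrite -addn1; apply: ordM => //; apply: ord_ltr.
    by exists z; split=> //; rewrite addnS -addSn.
  exists (lq c x' * y' + \sum_a z a).
    apply: (ciD hP); last by apply: ci_sum => // a _; case: (hz a).
    have [e|ne] := eqVneq (src c) j'; last first.
      by rewrite (wt_lq0 wx' ne) mul0r; apply: (ci0 hP).
    have h := ciMl hP (wt_lq wx') py'.
    by move: h; rewrite -e; apply.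
  rewrite box_rec opprD addrACA subrr add0r -sumrB; apply: ord_sum => a _.
  by case: (hz a).
by move/(_ N 0%N _ _ _ wx py (@ord_0 _ _ _)); rewrite add0n.
Qed.

End TypedBox.

(** ** Homomorphisms *)

Section Hom.
Variables (k : fieldType) (V : finType) (Q Q' : quiver V).
Notation K := (ser k (arr Q)).
Notation K' := (ser k (arr Q')).
Implicit Types (x y : K).

Record shom (F : V -> V -> K -> K') : Prop := SHom {
  sh_wt : forall i j x, wt i j (F i j x);
  sh_lin : forall i j c x y, wt i j x -> wt i j y ->
    F i j (c *: x + y) = c *: F i j x + F i j y;
  sh_mul : forall i j l x y, wt i j x -> wt j l y -> F i l (x * y) = F i j x * F j l y;
  sh_1 : forall i, F i i 1 = 1 }.

Definition ser_map (f : alg_map k Q Q') i j x : K' := tos (f i j (ofs i j x)).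

End Hom.

Section Iso.
Variables (k : fieldType) (V : finType) (Q Q' : quiver V).
Notation K := (ser k (arr Q)).
Notation K' := (ser k (arr Q')).
Implicit Types (x y : K).
Variables (F : V -> V -> K -> K') (G : V -> V -> K' -> K).
Hypotheses (hF : shom F) (hG : shom G).
Hypothesis GF : forall i j x, wt i j x -> G i j (F i j x) = x.
Hypothesis FG : forall i j (x : K'), wt i j x -> F i j (G i j x) = x.

Lemma shD i j x y : wt i j x -> wt i j y -> F i j (x + y) = F i j x + F i j y.
Proof. by move=> wx wy; rewrite -[x in LHS]scale1r (sh_lin hF) // scale1r. Qed.
Lemma sh0 i j : F i j 0 = 0.
Proof. by apply: (addrI (F i j 0)); rewrite -shD ?addr0. Qed.
Lemma shZ i j c x : wt i j x -> F i j (c *: x) = c *: F i j x.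
Proof. by move=> wx; rewrite -[c *: x]addr0 (sh_lin hF) // sh0 addr0. Qed.
Lemma shB i j x y : wt i j x -> wt i j y -> F i j (x - y) = F i j x - F i j y.
Proof.
move=> wx wy; rewrite -[- y]scaleN1r shD //; last exact: wtZ.
by rewrite shZ // scaleN1r.
Qed.
Lemma sh_sum i j I (r : seq I) (P : pred I) (f : I -> K) :
  (forall m, P m -> wt i j (f m)) ->
  F i j (\sum_(m <- r | P m) f m) = \sum_(m <- r | P m) F i j (f m).
Proof.
move=> h; have : wt i j (\sum_(m <- r | P m) f m) /\
  F i j (\sum_(m <- r | P m) f m) = \sum_(m <- r | P m) F i j (f m); last by case.
elim/big_ind2: _ => [|x u y v [wx <-] [wy <-]|m Pm].
- by split; [apply: wt0 | apply: sh0].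
- by split; [apply: wtD | apply: shD].
by split=> //; apply: h.
Qed.

Lemma wt_ltrM a j y : wt (tgt a) j y -> wt (src a) j (ltr a * y : K).
Proof. by move=> wy; apply: (wtM (@wt_ltr _ _ _ a) wy). Qed.

(** An isomorphism preserves the maximal ideal, since an element of [e_i A e_i]
    with nonzero constant term is invertible. *)
Lemma sh_ord1 i j x : wt i j x -> ord 1 x -> ord 1 (F i j x).
Proof.
move=> wx ox; apply/ord1P; have [e|ne] := eqVneq i j; last first.
  exact: (wt_nil (sh_wt hF x) ne).
subst j; apply: contraTeq isT => c0; set c := F i i x [::] in c0.
pose X (_ _ : unit) : K' := 1 - c^-1 *: F i i x.
have [||N wN eN] := @neumann k V Q' unit (fun=> i) X.
- by move=> y z; apply: wtB; [apply: wt1 | apply/wtZ/(sh_wt hF)].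
- by move=> y z; apply/ord1P; rewrite /X serD serN serZ -/c mulVf // ser1 subrr.
pose y := c^-1 *: N tt tt.
have e1 : F i i x * y = 1.
  have := eN tt tt; rewrite /dl /mm eqxx mulr1n (bigD1 tt) //= big1 ?addr0; last by case.
  rewrite /X mulrBl mul1r => h.
  rewrite /y -scalerAr scalerAl; apply: (addrI (N tt tt - c^-1 *: F i i x * N tt tt)).
  by rewrite subrK [RHS]addrC -h.
have wy : wt i i y by apply: wtZ; apply: wN.
have := congr1 (fun z : K' => (G i i z) [::]) e1.
rewrite (sh_1 hG) (sh_mul hG (sh_wt hF x) wy) GF // serM_nil (ord1P x).1 // mul0r ser1.
by move/esym/eqP; rewrite oner_eq0.
Qed.

Lemma sh_ord i j n x : wt i j x -> ord n x -> ord n (F i j x).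
Proof.
elim: n i x => [|n IH] i x wx ox //.
rewrite (lq_dec x) ox // scale0r add0r (bigID (fun a => src a == i)) /=.
rewrite [X in _ + X]big1 ?addr0 => [|a ne]; last by rewrite (wt_lq0 wx) ?mulr0.
rewrite sh_sum => [|a /eqP <-]; last by apply: wt_ltrM; apply: wt_lq wx.
apply: ord_sum => a /eqP e; rewrite -e.
rewrite (sh_mul hF (@wt_ltr _ _ _ a) (wt_lq wx)) -add1n.
apply: ordM; first by apply: sh_ord1; [apply: wt_ltr | apply: ord_ltr].
by apply: IH; [apply: wt_lq wx | apply: ord_lq].
Qed.

Lemma sh_dec i j x : wt i j x -> F i j x = (if i == j then (x [::])%:A else 0) +
  \sum_(a | src a == i) F i (tgt a) (ltr a) * F (tgt a) j (lq a x).
Proof.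
move=> wx; rewrite {1}(lq_dec x) (bigID (fun a => src a == i)) /=.
rewrite [X in _ + (_ + X)]big1 ?addr0 => [|a ne]; last by rewrite (wt_lq0 wx) ?mulr0.
have wl a : src a == i -> wt i j (ltr a * lq a x).
  by move/eqP => <-; apply: wt_ltrM; apply: wt_lq wx.
have wc : wt i j ((x [::])%:A : K).
  have [->|ne] := eqVneq i j; first by apply: wtZ; apply: wt1.
  by rewrite (wt_nil wx ne) scale0r.
rewrite shD //; last exact: wt_sum.
congr (_ + _).
  have [e|ne] := eqVneq i j; last by rewrite (wt_nil wx ne) scale0r sh0.
  by subst j; rewrite shZ ?(sh_1 hF) //; apply: wt1.
rewrite sh_sum //; apply: eq_bigr => a /eqP e; rewrite -e.
by rewrite (sh_mul hF (@wt_ltr _ _ _ a) (wt_lq wx)).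
Qed.

(** Chain rule for cyclic derivatives: expand the image of [x] by its first letter, which turns
    a cycle of the image into its rotations, and let the part that is not yet expanded become
    arbitrarily long. *)
Lemma box_chain i j c x y : wt j i x -> wt i j y ->
  box c (F j i x) (F i j y) =
  \sum_b box c (F (src b) (tgt b) (ltr b)) (F (tgt b) (src b) (box b x y)).
Proof.
move=> wx wy; apply/eqP; rewrite -subr_eq0; apply/eqP.
pose E (t : V * K) y := box c (F t.1 i t.2) (F i t.1 y) -
  \sum_b box c (F (src b) (tgt b) (ltr b)) (F (tgt b) (src b) (box b t.2 y)).
apply: (@rec_ord _ _ _ _ E (fun t y => wt t.1 i t.2 /\ wt i t.1 y)
  (fun a t => (tgt a, lq a t.2)) _ _ (j, x)) => // {j x y wx wy} -[j x] y /=.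
  move=> n [wx wy] oy; apply: ordB; first by apply: box_ord; apply: sh_ord.
  apply: ord_sum => b _; apply: box_ord; apply: sh_ord; last exact: box_ord.
  exact: wt_box wx wy.
move=> [wx wy]; exists (fun a => src a == j).
  move=> a /eqP e; split=> /=; first exact: wt_lq wx.
  by apply: (wtM wy); rewrite -e; apply: wt_ltr.
rewrite /E /= sumrB.
have wya a : src a == j -> wt i (tgt a) (y * ltr a).
  by move/eqP => e; apply: (wtM wy); rewrite -e; apply: wt_ltr.
have -> : box c (F j i x) (F i j y) = \sum_(a | src a == j)
    (box c (F (src a) (tgt a) (ltr a)) (F (tgt a) (src a) (lq a x * y)) +
     box c (F (tgt a) i (lq a x)) (F i (tgt a) (y * ltr a))).
  rewrite (sh_dec wx) boxDl [X in X + _](_ : _ = 0) ?add0r; last first.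
    by case: eqP => _; rewrite ?boxZl ?box1 ?scaler0 ?box0l.
  rewrite box_suml; apply: eq_bigr => a /eqP e; rewrite box_mul; congr (_ + _).
    by rewrite e -(sh_mul hF (wt_lq wx) wy).
  by rewrite -(sh_mul hF wy) // -e; apply: wt_ltr.
have key b : box c (F (src b) (tgt b) (ltr b)) (F (tgt b) (src b) (box b x y)) =
    (if src b == j then
      box c (F (src b) (tgt b) (ltr b)) (F (tgt b) (src b) (lq b x * y)) else 0) +
    \sum_(a | src a == j) box c (F (src b) (tgt b) (ltr b))
      (F (tgt b) (src b) (box b (lq a x) (y * ltr a))).
  have wb a : src a == j -> wt (tgt b) (src b) (box b (lq a x) (y * ltr a)).
    by move=> e; apply: wt_box (wt_lq wx) (wya a e).
  have wb0 : wt (tgt b) (src b) (lq b x * y).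
    have [e|ne] := eqVneq (src b) j; last by rewrite (wt_lq0 wx ne) mul0r.
    by rewrite e; apply: (wtM (wt_lq wx) wy).
  have -> : box b x y = lq b x * y + \sum_(a | src a == j) box b (lq a x) (y * ltr a).
    rewrite box_rec; congr (_ + _); rewrite (bigID (fun a => src a == j)) /=.
    by rewrite addrC big1 ?add0r // => a ne; rewrite (wt_lq0 wx) ?box0l.
  rewrite shD //; last exact: wt_sum.
  rewrite boxDr sh_sum // box_sumr; congr (_ + _).
  by case: eqP => // /eqP ne; rewrite (wt_lq0 wx ne) mul0r sh0 box0r.
under [X in _ - X = _]eq_bigr => b _ do rewrite key.
rewrite !big_split /= -[X in _ - (X + _)]big_mkcond opprD addrACA subrr add0r.
by congr (_ - _); rewrite exchange_big.
Qed.

End Iso.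

(** * Right-equivalences and Jacobian ideals *)

Section Potentials.
Variables (k : fieldType) (V : finType) (Q : quiver V).
Implicit Types (S T : potential k Q).

Lemma cycl_walk i (s : seq (arr Q)) : s != [::] -> walk i s i -> cycl s.
Proof. by case: s => [|a s] //= _ /andP[/eqP ->]. Qed.

Lemma pot_atE S i s : tos (@pot_at k V Q S i) s = if walk i s i then coef S s else 0.
Proof.
rewrite /tos; case: ifP => h; last by rewrite coef_out ?h.
by rewrite (coef_in _ h).
Qed.

Lemma potS_nil S : potS S [::] = 0.
Proof. exact: coef_out. Qed.

Lemma potS_sum S : potS S = \sum_i tos (@pot_at k V Q S i).
Proof.
apply: serP => s; rewrite ser_sum.
under eq_bigr => i _ do rewrite pot_atE.
case: s => [|a s].
  by rewrite potS_nil big1 // => i _; rewrite -[coef S [::]]/(potS S [::]) potS_nil if_same.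
have [h|h] := boolP (cycl (a :: s)); last first.
  by rewrite /potS coef_out // big1 // => i _; rewrite if_same.
rewrite (bigD1 (src a)) //= eqxx (h : walk _ _ _) /= big1 ?addr0 // => i ne.
by rewrite eq_sym (negbTE ne).
Qed.

Lemma potS_to_pot (x : forall i, pser k Q i i) : (forall i, tos (x i) [::] = 0 :> k) ->
  potS (@to_pot k V Q x) = \sum_i tos (x i).
Proof.
move=> h; apply: serP => s; rewrite ser_sum /potS.
have [c|c] := boolP (cycl s); first by rewrite (coef_in _ c).
rewrite coef_out // big1 // => i _; have [e|ne] := eqVneq s [::]; first by rewrite e h.
by apply: wt_tos; apply: contra c; apply: cycl_walk.
Qed.

(** The derivative sums over all rotations, so that [g_w (w - rot 1 w)] contributes a
    telescoping sum. *)
Lemma cyc_eq_cder S T a : cyc_eq S T -> cder (potS S) a = cder (potS T) a.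
Proof.
move=> [g hg]; apply/eqP; rewrite -subr_eq0; apply/eqP; apply: serP => p; rewrite ser0.
have [w|w] := boolP (walk (tgt a) p (src a)); last first.
  by apply: (wtB (@wt_cder _ _ _ S a) (@wt_cder _ _ _ T a)).
rewrite serD serN /cder -sumrB.
pose G n := coef g (drop n p ++ a :: take n p).
have c n : cycl (drop n p ++ a :: take n p).
  by rewrite cycl_cat /= cat_take_drop.
have h0 : potS S (drop 0 p ++ a :: take 0 p) - potS T (drop 0 p ++ a :: take 0 p) =
    G 0%N - G (size p).
  rewrite /G drop_size take_size /=; move: (c 0%N); rewrite drop0 take0 cats1 => c0.
  exact: hg.
have hS n : (n < size p)%N -> potS S (drop n.+1 p ++ a :: take n.+1 p) -
    potS T (drop n.+1 p ++ a :: take n.+1 p) = G n.+1 - G n.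
  move=> hn; move: (c n.+1); rewrite /G (drop_nth a hn) (take_nth a hn).
  by rewrite -rcons_cons -rcons_cat => c1; apply: hg.
have key m : (m <= size p)%N -> \sum_(n < m.+1) (potS S (drop n p ++ a :: take n p) -
    potS T (drop n p ++ a :: take n p)) = G m - G (size p).
  elim: m => [|m IH] hm; first by rewrite big_ord1 h0.
  rewrite big_ord_recr /= (IH (ltnW hm)) hS //.
  by rewrite addrC addrA subrK.
by rewrite key // subrr.
Qed.

End Potentials.

Section AlgIso.
Variables (k : fieldType) (V : finType).

Lemma ser_map_tos (Q Q' : quiver V) (f : alg_map k Q Q') i j x :
  ser_map f i j (tos x) = tos (f i j x).
Proof. by rewrite /ser_map ofs_tos. Qed.

Lemma alg_iso_sym (Q Q' : quiver V) (f : alg_map k Q Q') g : alg_iso f g -> alg_iso g f.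
Proof.
move=> [h1 h2 h3 h4 h5].
have fK i j x : g i j (f i j x) = x by apply: funext; apply: h4.
have gK i j x : f i j (g i j x) = x by apply: funext; apply: h5.
split=> //.
- move=> i j c x y s; transitivity (g i j (f i j (fun s => c * g i j x s + g i j y s)) s); last by rewrite fK.
  by congr (g i j _ s); apply: funext => t; rewrite h1 !gK.
- move=> i j l x y s; transitivity (g i l (f i l (pmul (g i j x) (g j l y))) s); last by rewrite fK.
  by congr (g i l _ s); apply: funext => t; rewrite h2 !gK.
- move=> i s; transitivity (g i i (f i i (pone Q i)) s); last by rewrite fK.
  by congr (g i i _ s); apply: funext => t; rewrite h3.
Qed.

Lemma alg_iso_shom (Q Q' : quiver V) (f : alg_map k Q Q') g : alg_iso f g -> shom (ser_map f).
Proof.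
move=> [h1 h2 h3 h4 h5]; split.
- by move=> i j x; apply: wt_tos.
- move=> i j c x y wx wy; rewrite -tos_lin; congr tos; apply: funext => s.
  by rewrite -h1; congr (f i j _ s).
- move=> i j l x y wx wy; rewrite -tos_pmul; congr tos; apply: funext => s.
  rewrite -h2; congr (f i l _ s); apply: tos_inj.
  by rewrite tos_pmul !tos_ofs //; apply: wtM wx wy.
move=> i; rewrite -(@tos_pone k V Q' i); congr tos; apply: funext => s.
by rewrite -h3; congr (f i i _ s).
Qed.

Lemma alg_isoK (Q Q' : quiver V) (f : alg_map k Q Q') g : alg_iso f g ->
  forall i j x, wt i j x -> ser_map g i j (ser_map f i j x) = x.
Proof.
move=> [h1 h2 h3 h4 h5] i j x wx; rewrite /ser_map ofs_tos -[RHS](tos_ofs wx).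
by congr tos; apply: funext; apply: h4.
Qed.

End AlgIso.

Section Equiv.
Variables (k : fieldType) (V : finType) (Q Q' : quiver V).
Notation K := (ser k (arr Q)).
Notation K' := (ser k (arr Q')).
Variables (F : V -> V -> K -> K') (G : V -> V -> K' -> K).
Hypotheses (hF : shom F) (hG : shom G).
Hypothesis GF : forall i j x, wt i j x -> G i j (F i j x) = x.
Hypothesis FG : forall i j (x : K'), wt i j x -> F i j (G i j x) = x.

Lemma pull_cideal P : cideal P -> cideal (fun i j (x : K') => wt i j x /\ P i j (G i j x)).
Proof.
move=> hP; split.
- by move=> i j x [].
- by move=> i j; split; [apply: wt0 | rewrite (sh0 hG); apply: (ci0 hP)].
- move=> i j x y [wx px] [wy py]; split; first exact: wtD.
  by rewrite (shD hG) //; apply: (ciD hP).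
- move=> i j l x y wy [wx px]; split; first exact: wtM wy wx.
  by rewrite (sh_mul hG wy wx); apply: (ciMl hP) px; apply: (sh_wt hG).
- move=> i j l x y wy [wx px]; split; first exact: wtM wx wy.
  by rewrite (sh_mul hG wx wy); apply: (ciMr hP) px; apply: (sh_wt hG).
move=> i j x wx h; split=> //; apply: (ci_closed hP); first exact: (sh_wt hG).
move=> N; have [y [wy py] oy] := h N; exists (G i j y) => //.
rewrite -(shB hG) //; apply: (sh_ord hG hF FG) => //; exact: wtB.
Qed.

(** [S] and [T] are related by the chain rule as when [T] is cyclically
    equivalent to the image of [S]. *)
Lemma jid_equiv S T :
  (forall c, cder (potS T) c = \sum_b box c (F (src b) (tgt b) (ltr b))
     (F (tgt b) (src b) (cder (potS S) b))) ->
  forall i j x, jid T i j x -> jid S i j (G i j x).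
Proof.
move=> h i j x hx; pose P i j (x : K') := wt i j x /\ jid S i j (G i j x).
have hP : cideal P by apply: pull_cideal; apply: jid_cideal.
suff: P i j x by case.
apply: (jid_least hP _ hx) => c; rewrite h; apply: (@ci_sum _ _ _ P) => // b _.
apply: (box_cideal c hP); first exact: (sh_wt hF).
split; first exact: (sh_wt hF).
by rewrite GF; [apply: jid_gen | apply: wt_cder].
Qed.

(** The chain rule for a sum of homogeneous elements. *)
Lemma cder_chain (p : V -> K) c : (forall i, wt i i (p i)) ->
  cder (\sum_i F i i (p i)) c = \sum_b box c (F (src b) (tgt b) (ltr b))
     (F (tgt b) (src b) (cder (\sum_i p i) b)).
Proof.
move=> wp; rewrite cder_sum.
under eq_bigr => i _ do rewrite cder_box -(sh_1 hF i) (box_chain hF hG GF _ (wp i) (@wt1 k _ _ i)).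
rewrite exchange_big; apply: eq_bigr => b _ /=.
rewrite -box_sumr; congr (box c _ _); rewrite -(sh_sum hF) => [|i _]; last first.
  exact: wt_box (wp i) (@wt1 k _ _ i).
by rewrite cder_sum; congr (F _ _ _); apply: eq_bigr => i _; rewrite cder_box.
Qed.

End Equiv.

Section RightEquiv.
Variables (k : fieldType) (V : finType) (Q Q' : quiver V).
Variables (f : alg_map k Q Q') (g : alg_map k Q' Q) (S : potential k Q) (T : potential k Q').
Hypotheses (fg : alg_iso f g) (ST : cyc_eq (image_pot f S) T).

Let hF := alg_iso_shom fg.
Let hG := alg_iso_shom (alg_iso_sym fg).
Let GF := alg_isoK fg.
Let FG := alg_isoK (alg_iso_sym fg).

Lemma potS_image : potS (image_pot f S) = \sum_i ser_map f i i (tos (@pot_at k V Q S i)).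
Proof.
rewrite potS_to_pot => [|i]; first by apply: eq_bigr => i _; rewrite ser_map_tos.
rewrite -ser_map_tos; apply/ord1P; apply: (sh_ord1 hF hG GF); first exact: wt_tos.
by apply/ord1P; rewrite pot_atE /= eqxx -[LHS]/(potS S [::]) potS_nil.
Qed.

Lemma jid_to i j x : jid S i j x -> jid T i j (ser_map f i j x).
Proof.
move=> hx; apply: (jid_equiv hG hF FG GF _ hx) => c.
under eq_bigr => b _ do rewrite -(cyc_eq_cder b ST) potS_image.
rewrite -(cder_chain hG hF FG) => [|m]; last exact: (sh_wt hF).
rewrite potS_sum; congr (cder _ c); apply: eq_bigr => m _.
by rewrite GF //; apply: wt_tos.
Qed.

Lemma jid_from i j x : jid T i j x -> jid S i j (ser_map g i j x).
Proof.
move=> hx; apply: (jid_equiv hF hG GF FG _ hx) => c.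
rewrite -(cyc_eq_cder c ST) potS_image (cder_chain hF hG GF) => [|m]; last exact: wt_tos.
by rewrite -potS_sum.
Qed.

End RightEquiv.

(** * Subquivers: direct sums and restrictions *)

Section VertexMap.
Variables (k : fieldType) (V1 V2 : finType) (Q1 : quiver V1) (Q2 : quiver V2).
Variables (io : arr Q1 -> arr Q2) (de : arr Q2 -> option (arr Q1)) (h : V1 -> V2).
Hypothesis ioK : pcancel io de.
Hypothesis deK : forall b a, de b = Some a -> b = io a.
Hypothesis hI : injective h.
Hypothesis io_src : forall a, src (io a) = h (src a).
Hypothesis io_tgt : forall a, tgt (io a) = h (tgt a).

Lemma walk_map i s j : walk (h i) (map io s) (h j) = walk i s j.
Proof.
elim: s i => [|a s IH] i /=; first by rewrite (inj_eq hI).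
by rewrite io_src io_tgt (inj_eq hI) IH.
Qed.
Lemma cycl_map s : cycl (map io s) = cycl s.
Proof. by case: s => [|a s] //=; rewrite io_src io_tgt walk_map. Qed.

Lemma wt_ext i j (x : ser k (arr Q1)) : wt i j x -> wt (h i) (h j) (ext de x).
Proof.
move=> wx w hw; rewrite /ext; case: (boolP (all _ _)) => // hall.
rewrite mulr1n; apply: wx; apply: contra hw => hp.
by rewrite (all_deP deK hall) walk_map.
Qed.
Lemma wt_res i j (z : ser k (arr Q2)) : wt (h i) (h j) z -> wt i j (res io z).
Proof. by move=> wz s hs; apply: wz; rewrite walk_map. Qed.

Lemma potS_ext (S : potential k Q1) w : ~~ cycl w -> ext de (potS S) w = 0.
Proof.
move=> hw; rewrite /ext; case: (boolP (all _ _)) => // hall.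
rewrite mulr1n /potS coef_out //; apply: contra hw => hp.
by rewrite (all_deP deK hall) cycl_map.
Qed.

End VertexMap.

Section Pull.
Variables (k : fieldType) (V1 V2 : finType) (Q1 : quiver V1) (Q2 : quiver V2).
Variables (T : ser k (arr Q1) -> ser k (arr Q2)) (h : V1 -> V2).
Hypothesis TD : forall x y, T (x + y) = T x + T y.
Hypothesis TM : forall x y, T (x * y) = T x * T y.
Hypothesis To : forall n x, ord n x -> ord n (T x).
Hypothesis Tw : forall i j x, wt i j x -> wt (h i) (h j) (T x).

Lemma pull_cideal_map P : cideal P -> cideal (fun i j x => wt i j x /\ P (h i) (h j) (T x)).
Proof.
have T0 : T 0 = 0 by apply: (addrI (T 0)); rewrite -TD !addr0.
have TB x y : T (x - y) = T x - T y.
  by apply: (addIr (T y)); rewrite -TD !subrK.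
move=> hP; split.
- by move=> i j x [].
- by move=> i j; split; [apply: wt0 | rewrite T0; apply: (ci0 hP)].
- move=> i j x y [wx px] [wy py]; split; first exact: wtD.
  by rewrite TD; apply: (ciD hP).
- move=> i j l x y wy [wx px]; split; first exact: wtM wy wx.
  by rewrite TM; apply: (ciMl hP) px; apply: Tw.
- move=> i j l x y wy [wx px]; split; first exact: wtM wx wy.
  by rewrite TM; apply: (ciMr hP) px; apply: Tw.
move=> i j x wx hx; split=> //; apply: (ci_closed hP); first exact: Tw.
by move=> N; have [y [wy py] oy] := hx N; exists (T y) => //; rewrite -TB; apply: To.
Qed.

Lemma jid_map (S1 : potential k Q1) (S2 : potential k Q2) :
  (forall a, jid S2 (h (tgt a)) (h (src a)) (T (cder (potS S1) a))) ->
  forall i j x, jid S1 i j x -> jid S2 (h i) (h j) (T x).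
Proof.
move=> hg i j x hx; pose P i j x := wt i j x /\ jid S2 (h i) (h j) (T x).
have hP : cideal P by apply: pull_cideal_map; apply: jid_cideal.
suff: P i j x by case.
by apply: (jid_least hP _ hx) => a; split; [apply: wt_cder | apply: hg].
Qed.

End Pull.

Section QSum.
Variables (k : fieldType) (V : finType) (Q1 Q2 : quiver V).
Notation QS := (qsum Q1 Q2).

Definition arr_r (c : arr Q2) : arr QS := @mkarr V QS (src c) (tgt c) (inr (tagged c)).

Lemma arr_lK : pcancel (@arr_l V Q1 Q2) (@in_l V Q1 Q2). Proof. by case=> -[i j] c. Qed.
Lemma arr_rK : pcancel arr_r (@in_r V Q1 Q2). Proof. by case=> -[i j] c. Qed.
Lemma in_lK b a : @in_l V Q1 Q2 b = Some a -> b = arr_l Q2 a.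
Proof. by case: b => -[i j] [c|c] //= [<-]. Qed.
Lemma in_rK b a : @in_r V Q1 Q2 b = Some a -> b = arr_r a.
Proof. by case: b => -[i j] [c|c] //= [<-]. Qed.
Lemma in_lr b : (exists a, b = arr_l Q2 a) \/ (exists a, b = arr_r a).
Proof.
case: b => -[i j] [c|c]; [left; exists (@mkarr V Q1 i j c) | right; exists (@mkarr V Q2 i j c)] => //.
Qed.

Definition extl := ext (k := k) (@in_l V Q1 Q2).
Definition extr := ext (k := k) (@in_r V Q1 Q2).
Definition resl := res (k := k) (@arr_l V Q1 Q2).

Lemma wt_extl i j x : wt i j x -> wt i j (extl x).
Proof. by apply: (wt_ext in_lK (h := id)). Qed.
Lemma wt_extr i j x : wt i j x -> wt i j (extr x).
Proof. by apply: (wt_ext in_rK (h := id)). Qed.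
Lemma wt_resl i j x : wt i j x -> wt i j (resl x).
Proof. by apply: (wt_res (io := @arr_l V Q1 Q2) (h := id)). Qed.

Variables (S1 : potential k Q1) (S2 : potential k Q2).
Notation SS := (pot_sum S1 S2).

Lemma potS_pot_sum : potS SS = extl (potS S1) + extr (potS S2).
Proof.
apply: serP => w; rewrite serD; have [c|c] := boolP (cycl w).
  by rewrite /potS (coef_in _ c).
have e1 : extl (potS S1) w = 0 by apply: (potS_ext in_lK (h := id)).
have e2 : extr (potS S2) w = 0 by apply: (potS_ext in_rK (h := id)).
by rewrite e1 e2 addr0 /potS coef_out.
Qed.

Lemma cder_suml a : cder (potS SS) (arr_l Q2 a) = extl (cder (potS S1) a).
Proof.
rewrite potS_pot_sum cderD (cder_ext arr_lK in_lK) [X in _ + X]cder_ext0 ?addr0 //.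
Qed.
Lemma cder_sumr a : cder (potS SS) (arr_r a) = extr (cder (potS S2) a).
Proof.
by rewrite potS_pot_sum cderD (cder_ext arr_rK in_rK) [X in X + _]cder_ext0 ?add0r.
Qed.

Lemma jid_extl i j x : jid S1 i j x -> jid SS i j (extl x).
Proof.
apply: (jid_map (h := id)).
- exact: extD.
- by move=> y z; apply: extM.
- exact: ext_ord.
- exact: wt_extl.
by move=> a; rewrite -cder_suml; apply: (@jid_gen _ _ _ SS (arr_l Q2 a)).
Qed.
Lemma jid_extr i j x : jid S2 i j x -> jid SS i j (extr x).
Proof.
apply: (jid_map (h := id)).
- exact: extD.
- by move=> y z; apply: extM.
- exact: ext_ord.
- exact: wt_extr.
by move=> a; rewrite -cder_sumr; apply: (@jid_gen _ _ _ SS (arr_r a)).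
Qed.

Hypothesis trv : trivial_pot S2.

Lemma jid_resl i j x : jid SS i j x -> jid S1 i j (resl x).
Proof.
apply: (jid_map (T := resl) (h := id)).
- by [].
- exact: resM.
- exact: res_ord.
- exact: wt_resl.
move=> b; have [[a ->]|[a ->]] := in_lr b.
  by rewrite cder_suml /resl (res_ext arr_lK); apply: jid_gen.
rewrite cder_sumr (_ : resl _ = 0); first exact: jid0.
apply: serP => -[|c s]; last by [].
rewrite /resl /res /extr /ext /= /cder big_ord1 /=.
by rewrite mulr1n; apply: trv.1.
Qed.

Lemma jid_ltr_r a : jid SS (src a) (tgt a) (ltr (arr_r a)).
Proof.
have /jidP := trv.2 a; rewrite tos_parr => /jid_extr.
by rewrite /extr (ext_ltr _ arr_rK in_rK).
Qed.

(** The arrows of the trivial summand lie in its Jacobian ideal. *)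
Lemma jid_ker_resl i j z : wt i j z -> resl z = 0 -> jid SS i j z.
Proof.
move=> wz z0; apply: jid_closed => // N.
elim: N i z wz z0 => [|N IH] i z wz z0; first by exists 0 => //; apply: jid0.
have /choice [y hy] a : exists y, jid SS i j y /\ ord N.+1 (ltr a * lq a z - y).
  have [e|ne] := eqVneq (src a) i; last first.
    by exists 0; rewrite (wt_lq0 wz ne) mulr0 subrr; split=> //; apply: jid0.
  have wa := wt_lq (a := a) wz; rewrite -e; have [[b eb]|[b eb]] := in_lr a.
    have [|y hy oy] := IH _ _ wa; first by rewrite eb /resl -lq_res -/(resl z) z0 lq0.
    exists (ltr a * y); split; first by apply: jidMl hy; apply: wt_ltr.
    by rewrite -mulrBr -add1n; apply: ordM oy; apply: ord_ltr.
  exists (ltr a * lq a z); rewrite subrr; split=> //.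
  by apply: jidMr wa _; rewrite eb; apply: jid_ltr_r.
exists (\sum_a y a); first by apply: jid_sum => a _; case: (hy a).
rewrite {1}(lq_dec z) (_ : z [::] = 0); last by rewrite -[z [::]]/(resl z [::]) z0.
rewrite scale0r add0r -sumrB; apply: ord_sum => a _; by case: (hy a).
Qed.

End QSum.

(** ** Counting arrows *)

Section Counting.
Variables (k : fieldType) (V : finType).

Lemma card_le_mx (A B : finType) (x : A -> B -> k) (y : B -> A -> k) :
  (forall a a', \sum_b x a b * y b a' = (a == a')%:R) -> (#|A| <= #|B|)%N.
Proof.
move=> h; apply: (@mulmx1_min _ #|A| #|B| (\matrix_(i, j) x (enum_val i) (enum_val j))
  (\matrix_(i, j) y (enum_val i) (enum_val j))).
apply/matrixP => i j; rewrite !mxE -(inj_eq enum_val_inj) -h.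
rewrite (reindex (@enum_val B xpredT)) /=; last by apply: onW_bij; apply: enum_val_bij.
by apply: eq_bigr => l _; rewrite !mxE.
Qed.

(** The linear part of a typed series. *)
Lemma lin_part (Q : quiver V) i j (y : ser k (arr Q)) : wt i j y -> ord 1 y ->
  ord 2 (y - \sum_(b : Q i j) y [:: mkarr b] *: ltr (mkarr b)).
Proof.
move=> wy oy; case=> [|c [|]] //= _.
  rewrite serD serN (ord1P y).1 // ser_sum big1 ?subr0 // => b _.
  by rewrite serZ ltr_nil mulr0.
rewrite serD serN ser_sum; have [w|w] := boolP (walk i [:: c] j); last first.
  rewrite wy // big1 ?subr0 // => b _; rewrite serZ /ltr.
  by case: eqP => [[e]|]; rewrite ?mulr0 // -e; move: w; rewrite e /= !eqxx.
move: w => /= /andP[/eqP ei /eqP ej].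
case: c ei ej => -[i' j'] b /= ei ej.
rewrite /src /= in ei; rewrite /tgt /= in ej; subst i' j'.
rewrite (bigD1 b) //= serZ /ltr eqxx mulr1 big1 ?addr0 ?subrr // => b' ne.
rewrite serZ; case: eqP => [[e]|]; rewrite ?mulr0 //.
have e' : b = b' := eq_from_Tagged e.
by rewrite e' eqxx in ne.
Qed.

Lemma eq_mkarr (Q : quiver V) i j (b b' : Q i j) : (mkarr b == mkarr b' :> arr Q) = (b == b').
Proof. by apply/eqP/eqP => [e|-> //]; apply: (eq_from_Tagged e). Qed.

(** An isomorphism induces one on the linear parts, that is, on the spans of the arrows. *)
Lemma card_iso (Q Q' : quiver V) (f : alg_map k Q Q') g i j :
  alg_iso f g -> #|Q i j| = #|Q' i j|.
Proof.
have H (Q1 Q2 : quiver V) (f1 : alg_map k Q1 Q2) g1 : alg_iso f1 g1 -> (#|Q1 i j| <= #|Q2 i j|)%N.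
  move=> fg; have hF := alg_iso_shom fg; have hG := alg_iso_shom (alg_iso_sym fg).
  have GF := alg_isoK fg; have FG := alg_isoK (alg_iso_sym fg).
  have wa (Q0 : quiver V) (a : Q0 i j) : wt i j (ltr (mkarr a) : ser k (arr Q0)).
    exact: (@wt_ltr k V Q0 (mkarr a)).
  apply: (@card_le_mx _ _ (fun a b => ser_map f1 i j (ltr (mkarr a)) [:: mkarr b])
    (fun b a => ser_map g1 i j (ltr (mkarr b)) [:: mkarr a])) => a a'.
  set y := ser_map f1 i j (ltr (mkarr a)).
  have wy : wt i j y by apply: (sh_wt hF).
  have oy : ord 1 y by apply: (sh_ord1 hF hG GF); [apply: wa | apply: ord_ltr].
  have or := lin_part wy oy; set r := y - _ in or.
  have ws : wt i j (\sum_(b : Q2 i j) y [:: mkarr b] *: ltr (mkarr b) : ser k (arr Q2)).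
    by apply: wt_sum => b _; apply: wtZ; apply: wa.
  have wr : wt i j r by apply: wtB.
  have : ser_map g1 i j (r + \sum_(b : Q2 i j) y [:: mkarr b] *: ltr (mkarr b)) [:: mkarr a'] =
      (a == a')%:R.
    by rewrite subrK GF // /ltr eqseq_cons andbT eq_mkarr eq_sym.
  rewrite (shD hG) // serD (sh_ord hG hF FG wr or) // add0r (sh_sum hG) => [|b _]; last first.
    by apply: wtZ; apply: wa.
  rewrite ser_sum.
  move=> <-; apply: eq_bigr => b _; by rewrite (shZ hG); [rewrite serZ | apply: wa].
by move=> fg; apply/eqP; rewrite eqn_leq (H _ _ _ _ fg) (H _ _ _ _ (alg_iso_sym fg)).
Qed.

(** The derivatives of a potential of degree two are linear forms in the opposite arrows; they
    span these because the arrows lie in the Jacobian ideal. *)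
Lemma card_trivial (Q : quiver V) (S : potential k Q) i j : trivial_pot S ->
  #|Q i j| = #|Q j i|.
Proof.
move=> [h2 trv].
have d0 c : ord 1 (cder (potS S) c).
  by apply/ord1P; rewrite /cder big_ord1 /=; apply: h2.
suff H i' j' : (#|Q i' j'| <= #|Q j' i'|)%N by apply/eqP; rewrite eqn_leq !H.
pose P (p q : V) (x : ser k (arr Q)) := [/\ wt p q x, ord 1 x & exists2 la : arr Q -> k,
  forall c, la c != 0 -> tgt c = p /\ src c = q & ord 2 (x - \sum_c la c *: cder (potS S) c)].
have hP : cideal P.
  split.
  - by move=> p q x [].
  - move=> p q; split=> //; exists (fun=> 0) => [c|]; first by rewrite eqxx.
    by rewrite sub0r big1 ?oppr0 // => c _; rewrite scale0r.
  - move=> p q x y [wx ox [l hl ol]] [wy oy [m hm om]]; split; [exact: wtD | exact: ordD |].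
    exists (fun c => l c + m c) => [c|].
      have [l0|l0 _] := eqVneq (l c) 0; last exact: hl.
      by rewrite l0 add0r => /hm.
    under eq_bigr => c _ do rewrite scalerDl.
    by rewrite big_split opprD addrACA; apply: ordD.
  - move=> p q p' x y wy [wx ox [l hl ol]]; split; [exact: wtM wy wx | exact: ordMl |].
    exists (fun c => y [::] * l c) => [c|].
      rewrite mulf_eq0 negb_or => /andP[y0 lc0].
      have [e|ne] := eqVneq p' p; last by rewrite (wt_nil wy ne) eqxx in y0.
      by rewrite e; apply: hl.
    have -> : y * x = (y - (y [::])%:A) * x + y [::] *: x.
      by rewrite mulrBl -scalerAl mul1r subrK.
    under eq_bigr => c _ do rewrite -scalerA.
    rewrite -scaler_sumr -addrA -scalerBr; apply: ordD; last exact: ordZ.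
    rewrite -[2%N]/(1 + 1)%N; apply: ordM => //; apply/ord1P.
    by rewrite serD serN serZ ser1 mulr1 subrr.
  - move=> p q q' x y wy [wx ox [l hl ol]]; split; [exact: wtM wx wy | exact: ordMr |].
    exists (fun c => y [::] * l c) => [c|].
      rewrite mulf_eq0 negb_or => /andP[y0 lc0].
      have [e|ne] := eqVneq q q'; last by rewrite (wt_nil wy ne) eqxx in y0.
      by rewrite -e; apply: hl.
    have -> : x * y = x * (y - (y [::])%:A) + y [::] *: x.
      by rewrite mulrBr -scalerAr mulr1 subrK.
    under eq_bigr => c _ do rewrite -scalerA.
    rewrite -scaler_sumr -addrA -scalerBr; apply: ordD; last exact: ordZ.
    rewrite -[2%N]/(1 + 1)%N; apply: ordM => //; apply/ord1P.
    by rewrite serD serN serZ ser1 mulr1 subrr.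
  move=> p q x wx hx; have [y [wy oy [l hl ol]] oxy] := hx 2%N; split=> //.
    by rewrite -(subrK y x); apply: ordD => //; apply: ordW oxy.
  exists l => //; rewrite -(subrK y x) -addrA; exact: ordD.
have hl a : P (src a) (tgt a) (ltr a).
  have /jidP := trv a; rewrite tos_parr; apply: (jid_least hP) => c; split=> //.
    exact: wt_cder.
  exists (fun c' => (c' == c)%:R) => [c'|].
    by have [e|ne] := eqVneq c' c; [rewrite e | rewrite eqxx].
  rewrite (bigD1 c) //= eqxx scale1r big1 ?addr0 ?subrr // => c' ne.
  by rewrite (negbTE ne) scale0r.
have /choice [l hla] (a : Q i' j') : exists l : arr Q -> k,
    (forall c, l c != 0 -> tgt c = i' /\ src c = j') /\
    ord 2 (ltr (mkarr a) - \sum_c l c *: cder (potS S) c).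
  by have [_ _ [l h1 h3]] := hl (mkarr a); exists l.
apply: (@card_le_mx _ _ (fun a c => l a (mkarr c)) (fun c a => cder (potS S) (mkarr c) [:: mkarr a])).
move=> a a'; have [h1 /(_ [:: mkarr a'] isT)] := hla a.
rewrite serD serN ser_sum /ltr eqseq_cons andbT eq_mkarr eq_sym => /eqP; rewrite subr_eq0 => /eqP ->.
rewrite (sum_grade (i := (j', i'))) => [|c ne]; first by apply: eq_bigr.
rewrite serZ; have [->|l0] := eqVneq (l a c) 0; first by rewrite mul0r.
have [e1 e2] := h1 c l0; case/eqP: ne.
by rewrite -e1 -e2 /src /tgt; case: (tag c).
Qed.

End Counting.

Section Restriction.
Variables (k : fieldType) (V : finType) (Q : quiver (option V)).

Lemma embK : pcancel (@emb V Q) (@unemb V Q).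
Proof. by case=> -[i j] c. Qed.
Lemma unembK b a : @unemb V Q b = Some a -> b = emb a.
Proof. by case: b => -[[i|] [j|]] c //= [<-]. Qed.
Lemma emb_surj (b : arr Q) i j : src b = Some i -> tgt b = Some j -> exists a, b = emb a.
Proof. by case: b => -[[i'|] [j'|]] c // _ _; exists (@mkarr V (restr Q) i' j' c). Qed.

Definition exte := ext (k := k) (@unemb V Q).
Definition rese := res (k := k) (@emb V Q).

Lemma wt_exte i j x : wt i j x -> wt (Some i) (Some j) (exte x).
Proof. by apply: (wt_ext unembK (h := Some)) => // a b []. Qed.
Lemma wt_rese i j z : wt (Some i) (Some j) z -> wt i j (rese z).
Proof. by apply: (wt_res (h := Some)) => // a b []. Qed.
Lemma rese_exte x : rese (exte x) = x. Proof. exact: (res_ext embK). Qed.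

Lemma rese_to0 i z : wt i None z -> z [::] = 0 -> rese z = 0.
Proof.
move=> wz z0; apply: serP => s; case/lastP: s => [|s a] //.
by rewrite /rese /res map_rcons; apply: wz; rewrite walk_rcons andbF.
Qed.
Lemma rese_from0 j z : wt None j z -> z [::] = 0 -> rese z = 0.
Proof. by move=> wz z0; apply: serP => -[|a s] //; apply: wz. Qed.

Lemma potS_restr (S : potential k Q) : potS (restr_pot S) = rese (potS S).
Proof.
apply: serP => s; rewrite /potS; have [c|c] := boolP (cycl s).
  by rewrite (coef_in _ c).
rewrite coef_out // /rese /res coef_out // (cycl_map (h := Some)) //.
by move=> i j [].
Qed.

Lemma cder_restr (S : potential k Q) a :
  cder (potS (restr_pot S)) a = rese (cder (potS S) (emb a)).
Proof. by rewrite potS_restr cder_res. Qed.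

Lemma jid_rese (S : potential k Q) i j x : jid S (Some i) (Some j) x ->
  jid (restr_pot S) i j (rese x).
Proof.
pose P (p q : option V) (x : ser k (arr Q)) := wt p q x /\
  forall i j, p = Some i -> q = Some j -> jid (restr_pot S) i j (rese x).
have hP : cideal P.
  split.
  - by move=> p q y [].
  - by move=> p q; split=> // i' j' _ _; apply: jid0.
  - move=> p q y z [wy hy] [wz hz]; split=> [|i' j' ei ej]; first exact: wtD.
    by apply: jidD; [apply: hy | apply: hz].
  - move=> p q l y z wz [wy hy]; split=> [|i' j' ei ej]; first exact: wtM wz wy.
    rewrite /rese resM; case: p wz wy hy => [p|] wz wy hy; subst.
      by apply: jidMl (hy _ _ _ _) => //; apply: wt_rese.
    rewrite -/rese (rese_to0 wz) ?mul0r; first exact: jid0.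
    by apply: (wt_nil wz).
  - move=> p q l y z wz [wy hy]; split=> [|i' j' ei ej]; first exact: wtM wy wz.
    rewrite /rese resM; case: q wz wy hy => [q|] wz wy hy; subst.
      by apply: jidMr (hy _ _ _ _) => //; apply: wt_rese.
    rewrite -/rese (rese_from0 wz) ?mulr0; first exact: jid0.
    by apply: (wt_nil wz).
  move=> p q y wy hy; split=> // i' j' ei ej; subst.
  apply: jid_closed => [|N]; first exact: wt_rese.
  have [z [wz hz] oz] := hy N; exists (rese z); first exact: hz.
  by rewrite -resB; apply: res_ord.
move=> hx; suff: P (Some i) (Some j) x by case=> _; apply.
apply: (jid_least hP _ hx) => a; split=> [|i' j' ei ej]; first exact: wt_cder.
have [a' ea] := emb_surj ej ei; move: ei ej; rewrite ea => -[<-] [<-].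
by rewrite -cder_restr; apply: jid_gen.
Qed.

End Restriction.

(** ** Homomorphisms compatible with the powers of the maximal ideal *)

Section OHom.
Variables (k : fieldType) (V : finType) (Q Q' : quiver V).
Implicit Types (F : V -> V -> ser k (arr Q) -> ser k (arr Q')).

Record ohom F : Prop := OHom {
  oh_s : shom F;
  oh_ord : forall i j n x, wt i j x -> ord n x -> ord n (F i j x) }.

Lemma alg_iso_ohom (f : alg_map k Q Q') g : alg_iso f g -> ohom (ser_map f).
Proof.
move=> fg; have hF := alg_iso_shom fg; split=> // i j n x.
exact: (sh_ord hF (alg_iso_shom (alg_iso_sym fg)) (alg_isoK fg)).
Qed.

Lemma oh_nil F i j x : ohom F -> wt i j x -> (F i j x) [::] = x [::].
Proof.
move=> [hF oF] wx; have [e|ne] := eqVneq i j; last first.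
  by rewrite (wt_nil wx ne) (wt_nil (sh_wt hF x) ne).
subst j; have w1 : wt i i ((x [::])%:A : ser k (arr Q)) by apply/wtZ/wt1.
rewrite -{1}(subrK (x [::])%:A x) (shD hF) //; last exact: wtB.
have -> : (F i i (x - (x [::])%:A) + F i i (x [::])%:A) [::] = F i i (x [::])%:A [::].
  rewrite serD (oF i i 1%N) ?add0r //; first exact: wtB.
  by apply/ord1P; rewrite serD serN serZ ser1 mulr1 subrr.
by rewrite (shZ hF) ?(sh_1 hF) ?serZ ?ser1 ?mulr1 //; apply: wt1.
Qed.

Lemma jid_ohom F (S : potential k Q) (S' : potential k Q') : ohom F ->
  (forall a, jid S' (tgt a) (src a) (F (tgt a) (src a) (cder (potS S) a))) ->
  forall i j x, jid S i j x -> jid S' i j (F i j x).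
Proof.
move=> [hF oF] hg i j x hx; pose P i j x := wt i j x /\ jid S' i j (F i j x).
have hP : cideal P.
  have hS := jid_cideal S'; split.
  - by move=> p q y [].
  - by move=> p q; split; [apply: wt0 | rewrite (sh0 hF); apply: jid0].
  - move=> p q y z [wy hy] [wz hz]; split; first exact: wtD.
    by rewrite (shD hF) //; apply: jidD.
  - move=> p q l y z wz [wy hy]; split; first exact: wtM wz wy.
    by rewrite (sh_mul hF wz wy); apply: jidMl hy; apply: (sh_wt hF).
  - move=> p q l y z wz [wy hy]; split; first exact: wtM wy wz.
    by rewrite (sh_mul hF wy wz); apply: jidMr hy; apply: (sh_wt hF).
  move=> p q y wy hy; split=> //; apply: jid_closed => [|N]; first exact: (sh_wt hF).
  have [z [wz hz] oz] := hy N; exists (F p q z) => //.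
  by rewrite -(shB hF) //; apply: oF => //; apply: wtB.
suff: P i j x by case.
by apply: (jid_least hP _ hx) => a; split; [apply: wt_cder | apply: hg].
Qed.

End OHom.

(** A path through [None] is a product of two paths that meet at [None], and so is every path
    of its image. *)
Lemma rese_ker (k : fieldType) (V : finType) (Q Q' : quiver (option V))
    (F : option V -> option V -> ser k (arr Q) -> ser k (arr Q')) i j x :
  loopless Q -> ohom F -> wt (Some i) (Some j) x -> rese x = 0 -> rese (F (Some i) (Some j) x) = 0.
Proof.
move=> noloop [hF oF] wx x0; apply: ord_eq0 => N.
elim: N i x wx x0 => [|N IH] i x wx x0 //.
have wl a : src a == Some i -> wt (Some i) (Some j) (ltr a * lq a x).
  by move/eqP => <-; apply: wt_ltrM; apply: wt_lq wx.
rewrite {1}(lq_dec x) (_ : x [::] = 0) ?scale0r ?add0r; last first.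
  by rewrite -[x [::]]/(rese x [::]) x0.
rewrite (bigID (fun a => src a == Some i)) /= [X in _ + X]big1 ?addr0; last first.
  by move=> a ne; rewrite (wt_lq0 wx) ?mulr0.
rewrite (sh_sum hF) // /rese res_sum; apply: ord_sum => a e; rewrite -/rese.
rewrite -(eqP e) (sh_mul hF (@wt_ltr _ _ _ a) (wt_lq wx)) resM.
case et: (tgt a) => [t|].
  rewrite -add1n; apply: ordM.
    by apply: res_ord; rewrite -et; apply: oF; [apply: wt_ltr | apply: ord_ltr].
  apply: IH; first by rewrite -et; apply: wt_lq wx.
  have [a' ea] := emb_surj (eqP e) et.
  by rewrite ea /rese -lq_res -/rese -/(rese x) x0 lq0.
have w1 := sh_wt hF (i := src a) (j := None) (ltr a).
rewrite (_ : res _ (F (src a) None (ltr a)) = 0) ?mul0r //; apply: (rese_to0 w1).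
by apply: (wt_nil w1); rewrite (eqP e).
Qed.

Section OHomComp.
Variables (k : fieldType) (V : finType).

Lemma ohom_comp (Q1 Q2 Q3 : quiver V) F G : @ohom k V Q1 Q2 F -> @ohom k V Q2 Q3 G ->
  ohom (fun i j x => G i j (F i j x)).
Proof.
move=> [hF oF] [hG oG]; split=> [|i j n x wx ox]; last first.
  by apply: oG; [apply: (sh_wt hF) | apply: oF].
split.
- by move=> i j x; apply: (sh_wt hG).
- move=> i j c x y wx wy; rewrite (sh_lin hF) // (sh_lin hG) //; exact: (sh_wt hF).
- move=> i j l x y wx wy; by rewrite (sh_mul hF wx wy) (sh_mul hG (sh_wt hF x) (sh_wt hF y)).
by move=> i; rewrite (sh_1 hF) (sh_1 hG).
Qed.

(** Off the typed series, a homomorphism is normalised to be zero. *)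
Definition cutoff (Q Q' : quiver V) (T : ser k (arr Q) -> ser k (arr Q')) i j x :=
  tos (ofs i j (T (tos (ofs i j x)))).

Lemma cutoffE (Q Q' : quiver V) (T : ser k (arr Q) -> ser k (arr Q')) i j x :
  (forall i j x, wt i j x -> wt i j (T x)) -> wt i j x -> cutoff T i j x = T x.
Proof. by move=> h wx; rewrite /cutoff (tos_ofs wx) tos_ofs //; apply: h. Qed.

Lemma ohom_cutoff (Q Q' : quiver V) (T : ser k (arr Q) -> ser k (arr Q')) :
  (forall i j x, wt i j x -> wt i j (T x)) ->
  (forall c x y, T (c *: x + y) = c *: T x + T y) ->
  (forall x y, T (x * y) = T x * T y) -> T 1 = 1 ->
  (forall n x, ord n x -> ord n (T x)) -> ohom (cutoff T).
Proof.
move=> Tw Tl Tm T1 To; split=> [|i j n x wx ox]; last by rewrite cutoffE //; apply: To.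
split.
- by move=> i j x; apply: wt_tos.
- by move=> i j c x y wx wy; rewrite !cutoffE //; apply: wtD => //; apply: wtZ.
- move=> i j l x y wx wy; rewrite (cutoffE Tw wx) (cutoffE Tw wy) cutoffE //.
  exact: wtM wx wy.
by move=> i; rewrite cutoffE //; apply: wt1.
Qed.

Lemma ohom_extl (Q1 Q2 : quiver V) : ohom (cutoff (@extl k V Q1 Q2)).
Proof.
apply: ohom_cutoff; [exact: wt_extl | | exact: extM | exact: ext1 | exact: ext_ord].
by move=> c x y; rewrite /extl extD extZ.
Qed.

Lemma ohom_resl (Q1 Q2 : quiver V) : ohom (cutoff (@resl k V Q1 Q2)).
Proof.
by apply: ohom_cutoff; [exact: wt_resl | | exact: resM | exact: res1 | exact: res_ord].
Qed.

End OHomComp.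

(** ** The homomorphism modulo the vertex [None] *)

Section Bar.
Variables (k : fieldType) (V : finType) (Q Q' : quiver (option V)).
Implicit Types (F : option V -> option V -> ser k (arr Q) -> ser k (arr Q')).

Definition bar F i j (x : ser k (arr (restr Q))) : ser k (arr (restr Q')) :=
  rese (F (Some i) (Some j) (exte x)).

Lemma ohom_bar F : ohom F -> ohom (bar F).
Proof.
move=> [hF oF]; split=> [|i j n x wx ox]; last first.
  by apply: res_ord; apply: oF; [apply: wt_exte | apply: ext_ord].
split.
- by move=> i j x; apply: wt_rese; apply: (sh_wt hF).
- move=> i j c x y wx wy; rewrite /bar /exte extD extZ (sh_lin hF) //; exact: wt_exte.
- move=> i j l x y wx wy; rewrite /bar /exte extM.
  by rewrite (sh_mul hF (wt_exte wx) (wt_exte wy)) /rese resM.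
by move=> i; rewrite /bar /exte ext1 (sh_1 hF) /rese res1.
Qed.

Hypothesis noloop : loopless Q.

Lemma bar_rese F i j x : ohom F -> wt (Some i) (Some j) x ->
  bar F i j (rese x) = rese (F (Some i) (Some j) x).
Proof.
move=> oF wx; apply/eqP; rewrite -subr_eq0 -resB; apply/eqP.
have we : wt (Some i) (Some j) (exte (rese x)) by apply/wt_exte/wt_rese.
rewrite -(shB (oh_s oF)) // -/(rese _); apply: rese_ker => //; first exact: wtB.
by rewrite /rese resB -/(rese _) rese_exte subrr.
Qed.

Lemma jid_bar F (S : potential k Q) (S' : potential k Q') : ohom F ->
  (forall i j x, jid S i j x -> jid S' i j (F i j x)) ->
  forall i j x, jid (restr_pot S) i j x -> jid (restr_pot S') i j (bar F i j x).
Proof.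
move=> oF h; apply: jid_ohom; first exact: ohom_bar.
move=> a; rewrite cder_restr bar_rese //; last exact: (@wt_cder _ _ _ S (emb a)).
by apply: jid_rese; apply: h; apply: (@jid_gen _ _ _ S (emb a)).
Qed.

End Bar.

(** ** Restriction of scalars *)

Section PullRep.
Variables (k : fieldType) (V : finType) (Q Q' : quiver V).
Variables (F : V -> V -> ser k (arr Q) -> ser k (arr Q')) (M : rep k Q').
Hypotheses (oF : ohom F) (gM : good M).
Let hF := oh_s oF.

(** The arrows of [Q] act as their images under [F]. *)
Definition pull_rep : rep k Q := @Rep k V Q (rsp M) (ridem M)
  (fun c => (ev M (F (src c) (tgt c) (ltr c)) \o ridem M (src c))%VF).

Lemma pull_arr c m : rarr pull_rep c m = ev M (F (src c) (tgt c) (ltr c)) (ridem M (src c) m).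
Proof. by rewrite comp_lfunE. Qed.

Lemma pull_wact i j s m : walk i s j -> vt (M := M) i m -> exists x,
  [/\ wt i j x, ord (size s) x & wact pull_rep s m = ev M x m].
Proof.
elim: s i m => [|a s IH] i m /=.
  by move/eqP <- => _; exists 1; split=> //; [apply: wt1 | rewrite ev_1 // id_lfunE].
case/andP=> /eqP e w hm; have wa := sh_wt hF (i := src a) (j := tgt a) (ltr a).
rewrite -e in hm; have [|x [wx ox ex]] := IH (tgt a) (rarr pull_rep a m) w.
  by rewrite pull_arr; apply: vt_ev wa _ => //; rewrite [ridem _ _ _]hm.
exists (F (src a) (tgt a) (ltr a) * x); split.
- by rewrite -e; apply: wtM wa wx.
- rewrite -add1n; apply: ordM => //.
  by apply: (oh_ord oF); [apply: wt_ltr | apply: ord_ltr].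
by rewrite comp_lfunE ex pull_arr hm ev_mul.
Qed.

Lemma good_pull : good pull_rep.
Proof.
have [[h1 h2 h3] h4] := gM; split.
  split=> // c; split; apply/lfunP => m; rewrite comp_lfunE.
    by rewrite !pull_arr (idem_idem gM) eqxx.
  rewrite pull_arr; apply: (vt_ev gM (sh_wt hF _)); exact: idem_vt.
exists (\dim {: rsp M}).+1 => -[|a s] i j //= /andP[/eqP e w] hs.
apply/lfunP => m; rewrite zero_lfunE.
have wa := sh_wt hF (i := src a) (j := tgt a) (ltr a).
have [|x [wx ox ex]] := @pull_wact (tgt a) j s (rarr pull_rep a m) w.
  by rewrite pull_arr; apply: (vt_ev gM wa); apply: idem_vt.
rewrite comp_lfunE ex ev_big //.
exact: ordW ox.
Qed.

Lemma ev_pull i j y m : wt i j y -> vt (M := M) i m -> ev pull_rep y m = ev M (F i j y) m.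
Proof.
move: (filP good_pull m); move: (\dim _) => n; elim: n i y m => [|n IH] i y m fm wy hm.
  by rewrite (fil0 fm) !linear0.
rewrite (ev_rec good_pull) (sh_dec hF wy) evDE; congr (_ + _).
  have [e|ne] := eqVneq i j; first by rewrite evZE ev_1.
  by rewrite (wt_nil wy ne) scale0r ev0E.
rewrite (bigID (fun a => src a == i)) /= [X in _ + X]big1 ?addr0 => [|a ne]; last first.
  by rewrite (wt_lq0 wy ne); exact: (@ev0E _ _ _ pull_rep (rarr pull_rep a m)).
rewrite ev_sum; apply: eq_bigr => a /eqP e; have wa := sh_wt hF (i := src a) (j := tgt a) (ltr a).
transitivity (ev M (F (tgt a) j (lq a y)) (rarr pull_rep a m)).
  apply: IH; [exact: fil_arr | exact: wt_lq wy |].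
  by rewrite pull_arr; apply: (vt_ev gM wa); apply: idem_vt.
by rewrite ev_mul // pull_arr e (_ : ridem M i m = m).
Qed.

Lemma killed_pull (S : potential k Q) (S' : potential k Q') : killed M S' ->
  (forall i j x, jid S i j x -> jid S' i j (F i j x)) -> killed pull_rep S.
Proof.
move=> kM h a m hm; rewrite (ev_pull (@wt_cder _ _ _ S a) hm).
by apply: (jid_ev0 gM kM) hm; apply: h; apply: jid_gen.
Qed.

End PullRep.

Section Transport.
Variables (k : fieldType) (V : finType) (A B : quiver V) (SA : potential k A) (SB : potential k B).
Variables (sig : V -> V -> ser k (arr B) -> ser k (arr A)).
Variables (rho : V -> V -> ser k (arr A) -> ser k (arr B)).
Hypotheses (osig : ohom sig) (orho : ohom rho).
Hypothesis sigJ : forall i j x, jid SB i j x -> jid SA i j (sig i j x).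
Hypothesis rhoJ : forall i j x, jid SA i j x -> jid SB i j (rho i j x).
Hypothesis rhosig : forall i j x, wt i j x -> rho i j (sig i j x) = x.
Hypothesis sigrho : forall i j x, wt i j x -> jid SA i j (sig i j (rho i j x) - x).
Variables (M : rep k A) (gM : good M) (kM : killed M SA).
Variables (D : pres k B).

Definition push_pres : pres k A := @Pres k V A (neg D) (pos D)
  (fun i m j b => ofs j i (sig j i (tos (pmx D i m j b)))).

Lemma dm_push (m : Tn D) (b : Tp D) :
  @dm k V A push_pres m b = sig (tag b) (tag m) (dm m b).
Proof. by rewrite /dm tos_ofs //; apply: (sh_wt (oh_s osig)). Qed.

Variables (g : Tp D -> rsp M).
Hypothesis hg : forall b, vt (M := M) (tag b) (g b).
Notation MB := (pull_rep sig M).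

Lemma aug_pull l y : wtv l y -> aug (M := MB) g y = aug (M := M) g (fun b => sig (tag b) l (y b)).
Proof. by move=> wy; apply: eq_bigr => b _; apply: ev_pull (wy b) (hg b). Qed.

Lemma aug_push l y : wtv l y -> aug (M := M) g y = aug (M := MB) g (fun b => rho (tag b) l (y b)).
Proof.
move=> wy; rewrite (@aug_pull l) => [|b]; last exact: (sh_wt (oh_s orho)).
apply/eqP; rewrite -subr_eq0 -sumrB; apply/eqP; apply: big1 => b _.
by rewrite -evBE -opprB evNE (jid_ev0 gM kM (sigrho (wy b)) (hg b)) oppr0.
Qed.

Lemma img_push l z b : wtv l z ->
  img (D := D) (fun m => rho (tag m) l (z m)) b = rho (tag b) l (@img k V A push_pres z b).
Proof.
move=> wz; have wd (m : Tn D) : wt (tag b) (tag m) (sig (tag b) (tag m) (dm m b)).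
  exact: (sh_wt (oh_s osig)).
rewrite (sh_sum (oh_s orho)) => [|m _]; last by rewrite dm_push; apply: wtM (wd m) (wz m).
apply: eq_bigr => m _; rewrite dm_push (sh_mul (oh_s orho) (wd m) (wz m)).
by rewrite rhosig //; apply: wt_dm.
Qed.

Hypothesis ex : exact_pres SB (M := MB) (D := D) g.

(** Composing with [sig] only changes the presentation modulo the image of the Jacobian ideal,
    since [sig] and [rho] are mutually inverse modulo the Jacobian ideals. *)
Lemma exact_push : @exact_pres k V A SA M push_pres g.
Proof.
have [_ onto ker] := ex; split=> //.
  move=> l x hx; have [y wy ->] := onto l x hx.
  exists (fun b => sig (tag b) l (y b)); last exact: aug_pull.
  by move=> b; apply: (sh_wt (oh_s osig)).
move=> l y wy; rewrite (aug_push wy) ker; last by move=> b; apply: (sh_wt (oh_s orho)).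
split=> -[z wz hz].
  exists (fun m => sig (tag m) l (z m)) => [m|b]; first exact: (sh_wt (oh_s osig)).
  have := sigJ (hz b); rewrite (shB (oh_s osig)); last 2 first.
  - exact: (sh_wt (oh_s orho)).
  - exact: (wtv_img wz).
  move=> h.
  have -> : @img k V A push_pres (fun m => sig (tag m) l (z m)) b = sig (tag b) l (img z b).
    rewrite (sh_sum (oh_s osig)) => [|m _]; last exact: wtM (@wt_dm k V B D m b) (wz m).
    apply: eq_bigr => m _; rewrite dm_push.
    by rewrite (sh_mul (oh_s osig) (@wt_dm k V B D m b) (wz m)).
  have -> : y b - sig (tag b) l (img z b) = (sig (tag b) l (rho (tag b) l (y b)) -
      sig (tag b) l (img z b)) - (sig (tag b) l (rho (tag b) l (y b)) - y b).
    by rewrite opprB [RHS]addrC addrA subrK.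
  by apply: jidB; last exact: sigrho.
exists (fun m => rho (tag m) l (z m)) => [m|b]; first exact: (sh_wt (oh_s orho)).
rewrite (img_push b wz) -(shB (oh_s orho)) //; last exact: (@wtv_img _ _ _ push_pres).
exact: rhoJ.
Qed.

Hypothesis mc : min_conds SB (M := MB) (D := D) g.

Lemma min_push : @min_conds k V A SA M push_pres g.
Proof.
have [h1 h2] := mc; split.
  move=> l y wy y0 b; rewrite -(oh_nil orho (wy b)); apply: (h1 l (fun b => rho (tag b) l (y b))).
    by move=> b'; apply: (sh_wt (oh_s orho)).
  by rewrite -aug_push.
move=> l z wz hz m; rewrite -(oh_nil orho (wz m)).
apply: (h2 l (fun m => rho (tag m) l (z m))) => [m'|b]; first exact: (sh_wt (oh_s orho)).
by rewrite img_push //; apply: rhoJ.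
Qed.

End Transport.

(** ** The reduction and its restriction *)

Section RedMaps.
Variables (k : fieldType) (V : finType) (Qb : quiver V) (Sb : potential k Qb).
Variables (R : red_data k Qb).
Hypothesis red : is_reduction Sb R.
Hypothesis noloop : loopless Qb.

Let Q2 := qsum (Qr R) (Qt R).
Let S2 := pot_sum (Sr R) (St R).

Lemma red_iso : alg_iso (@rphi _ _ _ R) (@rpsi _ _ _ R). Proof. by case: red. Qed.
Lemma red_cyc : cyc_eq (image_pot (@rphi _ _ _ R) Sb) S2. Proof. by case: red. Qed.
Lemma red_triv : trivial_pot (St R). Proof. by case: red. Qed.

Lemma card_red i j : #|Qb i j| = (#|Qr R i j| + #|Qt R i j|)%N.
Proof. by rewrite (card_iso i j red_iso) card_sum. Qed.
Lemma card_Qt i j : #|Qt R i j| = #|Qt R j i|.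
Proof. exact: card_trivial red_triv. Qed.
Lemma loopless_r : loopless (Qr R).
Proof. by move=> i; have := noloop i; rewrite card_red; case: #|Qr R i i|. Qed.

Definition Gl i j (y : ser k (arr (Qr R))) : ser k (arr Qb) :=
  ser_map (@rpsi _ _ _ R) i j (cutoff (@extl k V (Qr R) (Qt R)) i j y).
Definition Fl i j (x : ser k (arr Qb)) : ser k (arr (Qr R)) :=
  cutoff (@resl k V (Qr R) (Qt R)) i j (ser_map (@rphi _ _ _ R) i j x).

Let oF := alg_iso_ohom red_iso.
Let oG := alg_iso_ohom (alg_iso_sym red_iso).

Lemma ohom_Gl : ohom Gl.
Proof. exact: ohom_comp (@ohom_extl _ _ _ _) oG. Qed.
Lemma ohom_Fl : ohom Fl.
Proof. exact: ohom_comp oF (@ohom_resl _ _ _ _). Qed.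

Lemma GlE i j y : wt i j y -> Gl i j y = ser_map (@rpsi _ _ _ R) i j (@extl k V (Qr R) (Qt R) y).
Proof. by move=> wy; rewrite /Gl cutoffE //; apply: wt_extl. Qed.
Lemma FlE i j x : Fl i j x = resl (ser_map (@rphi _ _ _ R) i j x).
Proof. by rewrite /Fl cutoffE //; [apply: wt_resl | apply: (sh_wt (oh_s oF))]. Qed.

Lemma jid_Gl i j y : jid (Sr R) i j y -> jid Sb i j (Gl i j y).
Proof.
move=> hy; rewrite (GlE (jid_wt hy)); apply: (jid_from red_iso red_cyc).
exact: jid_extl.
Qed.
Lemma jid_Fl i j x : jid Sb i j x -> jid (Sr R) i j (Fl i j x).
Proof.
move=> hx; rewrite FlE; apply: jid_resl (red_triv) _ _ _ _.
exact: (jid_to red_iso red_cyc).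
Qed.
Lemma FlGl i j y : wt i j y -> Fl i j (Gl i j y) = y.
Proof.
move=> wy; rewrite FlE (GlE wy) (alg_isoK (alg_iso_sym red_iso)); last exact: wt_extl.
by rewrite /resl (res_ext (@arr_lK _ _ _)).
Qed.
Lemma jid_GlFl i j x : wt i j x -> jid Sb i j (Gl i j (Fl i j x) - x).
Proof.
move=> wx; set w := ser_map (@rphi _ _ _ R) i j x.
have ww : wt i j w by apply: (sh_wt (oh_s oF)).
have wr : wt i j (resl w) by apply: wt_resl.
rewrite FlE (GlE wr) -[X in _ - X](alg_isoK red_iso wx) -/w.
rewrite -(shB (oh_s oG)) //; last exact: wt_extl.
apply: (jid_from red_iso red_cyc); apply: jid_ker_resl; first exact: red_triv.
  by apply: wtB => //; apply: wt_extl.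
rewrite -[LHS]/(res _ (ext _ (resl w)) - resl w).
by rewrite (res_ext (@arr_lK _ _ _)) subrr.
Qed.

End RedMaps.

Section RedBar.
Variables (k : fieldType) (V : finType) (Qb : quiver (option V)) (Sb : potential k Qb).
Variables (R : red_data k Qb).
Hypothesis red : is_reduction Sb R.
Hypothesis noloop : loopless Qb.

Definition sig := bar (@Gl _ _ _ R).
Definition rho := bar (@Fl _ _ _ R).

Let oGl := ohom_Gl red.
Let oFl := ohom_Fl red.

Lemma ohom_sig : ohom sig. Proof. exact: ohom_bar. Qed.
Lemma ohom_rho : ohom rho. Proof. exact: ohom_bar. Qed.
Lemma jid_sig i j x : jid (restr_pot (Sr R)) i j x -> jid (restr_pot Sb) i j (sig i j x).
Proof. by apply: jid_bar => //; [apply: loopless_r red noloop | apply: jid_Gl]. Qed.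
Lemma jid_rho i j x : jid (restr_pot Sb) i j x -> jid (restr_pot (Sr R)) i j (rho i j x).
Proof. by apply: jid_bar => //; apply: jid_Fl. Qed.
Lemma rho_sig i j x : wt i j x -> rho i j (sig i j x) = x.
Proof.
move=> wx; rewrite /rho -[sig _ _ _]/(rese (@Gl _ _ _ R (Some i) (Some j) (exte x))).
rewrite bar_rese //; last exact: (sh_wt (oh_s oGl)).
by rewrite (FlGl red) ?rese_exte //; apply: wt_exte.
Qed.
Lemma sig_rho i j x : wt i j x -> jid (restr_pot Sb) i j (sig i j (rho i j x) - x).
Proof.
move=> wx; rewrite /sig -[rho _ _ _]/(rese (@Fl _ _ _ R (Some i) (Some j) (exte x))).
rewrite bar_rese //; first last.
- exact: (sh_wt (oh_s oFl)).
- exact: loopless_r red noloop.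
rewrite -[x in _ - x]rese_exte /rese -resB; apply: jid_rese; apply: jid_GlFl => //.
exact: wt_exte.
Qed.

Lemma tos_restr (Q : quiver (option V)) i j (x : pser k Q (Some i) (Some j)) :
  tos (pser_restr x) = rese (tos x).
Proof. by apply: tos_eq => //; apply: wt_rese; apply: wt_tos. Qed.
Lemma tos_ext (Q : quiver (option V)) i j (x : pser k (restr Q) i j) :
  tos (pser_ext x) = exte (tos x).
Proof. by apply: tos_eq => //; apply: wt_exte; apply: wt_tos. Qed.

Lemma red_drep_pull (W : drep k (restr Qb)) :
  drmod (red_drep (restr_red R) W) = pull_rep sig (drmod W).
Proof.
case: W => M m; rewrite /red_drep /pull_rep /=; congr Rep; apply: funext => c.
apply/lfunP => x; rewrite act_ev comp_lfunE; congr (ev M _ _).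
rewrite tos_restr -ser_map_tos tos_ext tos_parr /sig /bar (GlE); last first.
  by apply: wt_exte; apply: wt_ltr.
congr (rese _); congr (ser_map _ _ _ _).
rewrite /exte (ext_ltr _ (@embK _ _) (@unembK _ _)) (ext_ltr _ (@embK _ _) (@unembK _ _)).
by rewrite /extl (ext_ltr _ (@arr_lK _ _ _) (@in_lK _ _ _)).
Qed.

End RedBar.

(** * The map gamma *)

Section BrkRep.
Variables (k : fieldType) (V : finType) (Q : quiver V) (u : V).
Hypothesis noloop : loopless Q.
Variables (M : rep k Q).
Hypothesis gM : good M.
Notation MB := (brk_rep u M).

Lemma wact_cat s t : wact M (s ++ t) = (wact M t \o wact M s)%VF.
Proof.
elim: s => [|a s IH] /=; first by apply/lfunP => m; rewrite comp_lfunE id_lfunE.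
by rewrite IH comp_lfunA.
Qed.

Lemma wact_un w : wact MB w = wact M (un w).
Proof. by elim: w => //= e w ->; rewrite -wact_cat. Qed.

Lemma size_un (w : seq (arr (brk Q u))) : (size w <= size (un w))%N.
Proof.
elim: w => //= e w IH; rewrite size_cat -add1n leq_add //.
by case: e => -[i j] [].
Qed.

Lemma arr_brk_old (c : oldT Q u) : rarr MB (bold c) = rarr M (val c).
Proof.
rewrite -[rarr _ _]/(wact M (unbrk (bold c))) unbrk_bold /=.
by apply/lfunP => m; rewrite comp_lfunE id_lfunE.
Qed.
Lemma arr_brk_br a b : rarr MB (abr a b) = (rarr M (aout b) \o rarr M (ain a))%VF.
Proof.
rewrite -[rarr _ _]/(wact M (unbrk (abr a b))) unbrk_abr /=.
by apply/lfunP => m; rewrite !comp_lfunE id_lfunE.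
Qed.

Lemma good_brk : good MB.
Proof.
have [[h1 h2 h3] [n hn]] := gM; split.
  split=> //; apply: brk_case => [c|a b].
    by rewrite arr_brk_old; apply: (h3 (val c)).
  rewrite arr_brk_br; split; apply/lfunP => m; rewrite !comp_lfunE.
    by rewrite -[X in _ = rarr M (aout b) X](arr_src gM (ain a)).
  exact: (arr_tgt gM (aout b)).
exists n => s i j w sn; rewrite wact_un; apply: (hn _ i j); first by rewrite walk_un.
exact: leq_trans sn (size_un s).
Qed.

Lemma lq_sub_old (c : oldT Q u) (x : ser k (arr Q)) : lq (bold c) (sub x) = sub (lq (val c) x) :> ser k (arr (brk Q u)).
Proof. by apply: serP => w; rewrite -[LHS]/(x (unbrk (bold c) ++ un w)) unbrk_bold. Qed.
Lemma lq_sub_br a b (x : ser k (arr Q)) : lq (abr a b) (sub x) = sub (lq (aout b) (lq (ain a) x)) :> ser k (arr (brk Q u)).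
Proof. by []. Qed.

(** A path between vertices other than [u] is a word in the bracket arrows. *)
Lemma ev_brk i j x m : i != u -> j != u -> wt i j x -> vt i m -> ev MB (sub x) m = ev M x m.
Proof.
move=> + ju; move: (filP gM m); move: (\dim _) => n.
elim: n i x m => [|n IH] i x m fm iu wx hm; first by rewrite (fil0 fm) !linear0.
rewrite (ev_rec good_brk) (ev_rec gM); congr (_ + _).
rewrite sum_brk (sum_arr u noloop).
rewrite [X in _ = _ + X]big1 ?addr0 => [|b _]; last by rewrite (wt_lq0 wx) ?ev0E // eq_sym.
congr (_ + _); apply: eq_bigr.
  move=> c _; have [_ tu] := okE c.
  rewrite lq_sub_old arr_brk_old (IH (tgt (val c))) //.
  - exact: fil_arr.
  - exact: wt_lq wx.
  exact: (arr_tgt gM (val c)).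
move=> a _; have wa := wt_lq (a := ain a) wx.
rewrite (ev_rec gM (lq (ain a) x)) (wt_nil wa) ?scale0r ?add0r; last by rewrite tgt_ain eq_sym.
rewrite (sum_arr u noloop).
rewrite [X in _ = X + _ + _]big1 ?add0r => [|c _]; last first.
  by rewrite (wt_lq0 wa) ?ev0E // tgt_ain; case: (okE c).
rewrite [X in _ = X + _]big1 ?add0r => [|a' _]; last first.
  by rewrite (wt_lq0 wa) ?ev0E // tgt_ain src_ain (tag_in noloop).
apply: eq_bigr => b _; rewrite lq_sub_br arr_brk_br comp_lfunE (IH (tag b)) //.
- by apply: fil_arr; apply: (filW (leqnSn n)); apply: fil_arr.
- exact: (tag_out noloop).
- exact: (wt_lq (a := aout b) wa).
exact: (arr_tgt gM (aout b)).
Qed.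

End BrkRep.

(** The definition of [gamma] uses the action of the bracket quiver; its composite arrows act
    as the paths [ab]. *)
Lemma gammaE (k : fieldType) (V : finType) (Q : quiver V) (u : V) (S : potential k Q)
    (W : drep k Q) (z : {ffun arr_out Q u -> rsp (drmod W)}) a :
  loopless Q -> good (drmod W) -> (forall b, vt (M := drmod W) (tag b) (z b)) ->
  @gamma k V Q u S W z a = \sum_b ev (drmod W) (rq (ain a) (cder (potS S) (aout b))) (z b).
Proof.
move=> noloop gM hz; rewrite /gamma linfun_raw => [|c x y]; last first.
  apply/ffunP => b; rewrite !ffunE scaler_sumr -big_split; apply: eq_bigr => b' _ /=.
  by rewrite !ffunE linearP.
rewrite ffunE; apply: eq_bigr => b _; rewrite act_ev cder_pot.
rewrite -[barr _ _]/(abr a b) cder_brk_br -[tgt _]/(tag b) -[ridem _ _ _]/(ridem (drmod W) (tag b) (z b)).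
rewrite hz; apply: (ev_brk noloop gM (i := tag b) (j := tag a)).
- exact: (tag_out noloop).
- exact: (tag_in noloop).
- exact: (wt_rq (a := ain a) (@wt_cder _ _ _ S (aout b))).
exact: hz.
Qed.

(** * The extended quiver with potential *)

Lemma sum_option (V : finType) (R : zmodType) (F : option V -> R) :
  \sum_i F i = F None + \sum_i F (Some i).
Proof.
rewrite (bigD1 None) //=; congr (_ + _).
rewrite (reindex_omap Some id) => [|[]] //=.
by apply: eq_bigl => i; rewrite eqxx.
Qed.

Section ExtQP.
Variables (k : fieldType) (V : finType) (Q : quiver V) (S : potential k Q) (D : pres k Q).
Notation Qe := (ext_quiver D).
Notation Se := (ext_pot S D).

Definition ea (a : arr Q) : arr Qe := @emb V Qe a.
Definition pa (b : Tp D) : arr Qe := @mkarr (option V) Qe None (Some (tag b)) (tagged b).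
Definition na (m : Tn D) : arr Qe := @mkarr (option V) Qe (Some (tag m)) None (tagged m).

Lemma eaK : pcancel ea (@unemb V Qe). Proof. exact: embK. Qed.
Lemma ea_inj : injective ea. Proof. exact: (pcan_inj eaK). Qed.
Lemma pa_inj : injective pa.
Proof.
move=> [i a] [j b] e; have /= [ij] : Some i = Some j := congr1 (@tgt _ Qe) e.
by subst j; congr existT; apply: (eq_from_Tagged e).
Qed.
Lemma na_inj : injective na.
Proof.
move=> [i a] [j b] e; have /= [ij] : Some i = Some j := congr1 (@src _ Qe) e.
by subst j; congr existT; apply: (eq_from_Tagged e).
Qed.

Definition ext_arrs (x : (arr Q + Tp D + Tn D)%type) : arr Qe :=
  match x with inl (inl a) => ea a | inl (inr b) => pa b | inr m => na m end.
Lemma ext_arrs_bij : bijective ext_arrs.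
Proof.
apply: inj_surj_bij => [|c].
  move=> [[a|b]|m] [[a'|b']|m'] /= e; try by [rewrite (ea_inj e) | rewrite (pa_inj e) |
    rewrite (na_inj e) | have := congr1 (@src _ Qe) e | have := congr1 (@tgt _ Qe) e].
case: c => -[[i|] [j|]] c //.
- by exists (inl (inl (@mkarr V Q i j c))).
- by exists (inr (existT _ i c)).
by exists (inl (inr (existT _ j c))).
Qed.
Lemma ext_case (P : arr Qe -> Prop) : (forall a, P (ea a)) -> (forall b, P (pa b)) ->
  (forall m, P (na m)) -> forall c, P c.
Proof.
move=> h1 h2 h3 c; have [f _ fK] := ext_arrs_bij; rewrite -(fK c).
by case: (f c) => [[a|b]|m]; [apply: h1 | apply: h2 | apply: h3].
Qed.
Lemma ext_def T (fe : arr Q -> T) (fp : Tp D -> T) (fn : Tn D -> T) :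
  exists F : arr Qe -> T, [/\ forall a, F (ea a) = fe a, forall b, F (pa b) = fp b &
    forall m, F (na m) = fn m].
Proof.
have [f fK Kf] := ext_arrs_bij.
exists (fun c => match f c with inl (inl a) => fe a | inl (inr b) => fp b | inr m => fn m end).
by split=> [a|b|m]; [rewrite (fK (inl (inl a))) | rewrite (fK (inl (inr b))) | rewrite (fK (inr m))].
Qed.
Lemma sum_ext (R : zmodType) (F : arr Qe -> R) :
  \sum_c F c = \sum_a F (ea a) + \sum_b F (pa b) + \sum_m F (na m).
Proof.
rewrite (reindex ext_arrs) /=; last exact: (onW_bij _ ext_arrs_bij).
by rewrite !big_sumType.
Qed.

Lemma loopless_ext : loopless Q -> loopless Qe.
Proof. by move=> h [i|]; [apply: h | apply: card_void]. Qed.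

Definition rse : ser k (arr Qe) -> ser k (arr Q) := res ea.

Lemma all_isSome_map s : all (isSome \o @unemb V Qe) (map ea s).
Proof.
rewrite all_map; apply/allP => a _.
by rewrite -[X in is_true X]/(isSome (unemb (ea a))) eaK.
Qed.

Lemma walk_ea i s j : walk (Some i) (map ea s) (Some j) = walk i s j.
Proof. by apply: (walk_map (h := Some)) => // x y []. Qed.
Lemma cycl_ea s : cycl (map ea s) = cycl s.
Proof. by apply: (cycl_map (h := Some)) => // x y []. Qed.

Lemma ext_pot0 w : (forall m b p, w != na m :: pa b :: p) ->
  ~~ all (isSome \o @unemb V Qe) w -> potS Se w = 0.
Proof.
move=> h1 h2; rewrite /potS; have [c|c] := boolP (cycl w); last by rewrite coef_out.
rewrite (coef_in _ c) /ext_pot /= (negbTE h2) mulr0n add0r.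
rewrite big1 // => i _; rewrite big1 // => a _; rewrite big1 // => j _; rewrite big1 // => b _.
case: w h1 {c h2} => [|a' [|b' p]] // h1.
case: eqP => [ea'|]; last by rewrite mulr0n.
case: eqP => [eb'|]; last by rewrite mulr0n.
by case/eqP: (h1 (existT _ i a) (existT _ j b) p); rewrite ea' eb'.
Qed.

Lemma potS_ext_old : rse (potS Se) = potS S.
Proof.
apply: serP => s; rewrite /rse /res /potS; have [c|c] := boolP (cycl s); last first.
  by rewrite !coef_out // cycl_ea.
have c' : cycl (map ea s) by rewrite cycl_ea.
rewrite (coef_in _ c') /ext_pot /= all_isSome_map mulr1n (map_pK eaK).
rewrite [X in _ + X]big1 ?addr0 // => i _; rewrite big1 // => a _.
rewrite big1 // => j _; rewrite big1 // => b _.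
case: s {c c'} => [|a' [|b' p]] //=.
by case: eqP => [/(congr1 (@tgt _ Qe)) //|]; rewrite mulr0n.
Qed.

Lemma potS_ext_new m b s : potS Se (na m :: pa b :: map ea s) = dm m b s.
Proof.
rewrite /potS; have [c|c] := boolP (cycl (na m :: pa b :: map ea s)); last first.
  rewrite coef_out // (@wt_dm _ _ _ _ m b) //; apply: contra c => h.
  by move: h; rewrite -walk_ea.
rewrite (coef_in _ c) /ext_pot /= mulr0n add0r all_isSome_map (map_pK eaK).
rewrite sig_big_dep /= (bigD1 m) //= [X in _ + X]big1 ?addr0; last first.
  move=> m' ne; rewrite big1 // => j _; rewrite big1 // => b' _.
  case: eqP => [e|]; last by rewrite mulr0n.
  by move/eqP: ne; case; apply: na_inj; rewrite e; case: m' {e}.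
rewrite sig_big_dep /= (bigD1 b) //= [X in _ + X]big1 ?addr0; last first.
  move=> b' ne; case: (pa b =P _) => [e|]; last by rewrite andbF mulr0n.
  by move/eqP: ne; case; apply: pa_inj; rewrite e; case: b' {e}.
by case: m {c} => i m; case: b => j b; rewrite !eqxx mulr1n.
Qed.

Lemma cder_ext_old a : rse (cder (potS Se) (ea a)) = cder (potS S) a.
Proof. by rewrite -potS_ext_old /rse cder_res. Qed.

Lemma cder_ext_new m b : rse (lq (pa b) (cder (potS Se) (na m))) = dm m b.
Proof.
apply: serP => s; rewrite -[LHS]/(cder (potS Se) (na m) (pa b :: map ea s)) /cder.
rewrite big_ord_recr /= drop_oversize ?take_oversize ?size_map //= potS_ext_new.
rewrite big1 ?add0r // => n _; apply: ext_pot0 => [m' b' p|]; last first.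
  by rewrite all_cat /= andbF.
case: n => -[|n] hn; first by apply/eqP => /(congr1 (fun w => tgt (head (na m) w))).
have hn' : (n < size s)%N by move: hn; rewrite /= ltnS.
rewrite -[nat_of_ord _]/n.+1 -[drop n.+1 _]/(drop n (map ea s)) -map_drop.
case e : (drop n s) => [|x s']; last first.
  by apply/eqP => /(congr1 (fun w => tgt (head (na m) w))).
by move: (congr1 size e); rewrite size_drop /=; lia.
Qed.

Section N.
Variables (M : rep k Q) (gM : good M) (kM : killed M S) (noloop : loopless Q).
Variables (g : Tp D -> rsp M) (ex : exact_pres S g).
Hypothesis gfree : forall w (c : Tp D -> k) y, tyin (M := M) y ->
   \sum_(b | tag b == w) c b *: g b + \sum_(a | tgt a == w) rarr M a (y a) = 0 ->
   forall b, tag b = w -> c b = 0.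
Hypothesis dm0 : forall m b, dm (D := D) m b [::] = 0.

Let E := rsp M.
Definition NE : vectType k := (k^o * E)%type.

Definition nidem (i : option V) : 'End(NE) :=
  linfun (fun x : NE => if i is Some i' then ((0, ridem M i' x.2) : NE) else ((x.1, 0) : NE)).
Definition narr (c : arr Qe) : 'End(NE) :=
  linfun (fun x : NE => ((0, match c with existT (i, j) c0 =>
    match i, j return Qe i j -> E with
    | Some i', Some j' => fun c1 => rarr M (@mkarr V Q i' j' c1) x.2
    | None, Some w => fun b => x.1 *: g (existT (fun w => pos D w : Type) w b)
    | _, _ => fun=> 0
    end c0 end) : NE)).

(** The extension of [M] by a line at the new vertex, on which the arrow of a generator [b]
    takes the value [g b]. *)
Definition extN : rep k Qe := @Rep k (option V) Qe NE nidem narr.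
Notation N := extN.

Lemma nidemS i (x : NE) : ridem N (Some i) x = (0, ridem M i x.2).
Proof.
rewrite /N /= linfun_raw // => c [x1 x2] [y1 y2].
by rewrite linearP /= -[RHS]/(c *: 0 + 0 : k^o, _) scaler0 addr0.
Qed.
Lemma nidemN (x : NE) : ridem N None x = (x.1, 0).
Proof.
rewrite /N /= linfun_raw // => c [x1 x2] [y1 y2].
by rewrite -[RHS]/((c *: x1 + y1, c *: (0 : E) + 0) : NE) scaler0 addr0.
Qed.
Lemma narrE c (x : NE) : rarr N c x = (0, match c with existT (i, j) c0 =>
    match i, j return Qe i j -> E with
    | Some i', Some j' => fun c1 => rarr M (@mkarr V Q i' j' c1) x.2
    | None, Some w => fun b => x.1 *: g (existT (fun w => pos D w : Type) w b)
    | _, _ => fun=> 0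
    end c0 end).
Proof.
rewrite /N /= linfun_raw // => d [x1 x2] [y1 y2].
rewrite -[RHS]/((d *: 0 + 0, _) : NE) scaler0 addr0; congr pair.
case: c => -[[i|] [j|]] c /=; rewrite ?linearP ?scaler0 ?addr0 //.
by rewrite scalerDl -scalerA.
Qed.
Lemma narr_e a x : rarr N (ea a) x = (0, rarr M a x.2).
Proof. by rewrite narrE; case: a => -[i j] a. Qed.
Lemma narr_p b x : rarr N (pa b) x = (0, x.1 *: g b).
Proof. by rewrite narrE; case: b => i b. Qed.
Lemma narr_n m x : rarr N (na m) x = 0.
Proof. by rewrite narrE; case: m => i b. Qed.

Lemma vtNP x : vt (M := N) None x <-> x.2 = 0.
Proof. by case: x => x y; rewrite /vt nidemN; split=> [[]|/= ->]. Qed.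
Lemma vtSP i x : vt (M := N) (Some i) x <-> x.1 = 0 /\ vt (M := M) i x.2.
Proof. by case: x => x y; rewrite /vt nidemS; split=> [[<- ->]|/= [-> ->]]. Qed.

Definition laN : 'Hom(E, NE) := linfun (fun m : E => ((0, m) : NE)).
Lemma laNE m : laN m = (0, m).
Proof.
rewrite linfun_raw // => c x y.
by rewrite -[RHS]/(c *: 0 + 0 : k^o, _) scaler0 addr0.
Qed.
Definition nv : NE := (1 : k^o, 0).

Lemma pair_dec (x : NE) : x = x.1 *: nv + laN x.2.
Proof.
case: x => x y; rewrite laNE -[RHS]/((x *: (1 : k^o) + 0, x *: (0 : E) + y) : NE).
by rewrite scaler0 add0r addr0; congr pair; rewrite -[RHS]/(x * 1) mulr1.
Qed.

Lemma isrep_N : is_rep N.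
Proof.
have [[h1 h2 h3] _] := gM; split.
- move=> i j; apply/lfunP => x; rewrite comp_lfunE.
  case: i j => [i|] [j|] /=; rewrite ?nidemS ?nidemN ?zero_lfunE ?linear0 //.
  rewrite (inj_eq (@Some_inj _)) [(_, _).2]/= (idem_idem gM).
  by case: eqP => _; rewrite ?nidemS ?zero_lfunE.
- apply/lfunP => x; rewrite sum_lfunE id_lfunE sum_option nidemN.
  under eq_bigr => i _ do rewrite nidemS -laNE.
  rewrite -linear_sum -(idem_sum gM) /= laNE.
  by case: x => x y; rewrite -[LHS]/((x + 0, 0 + y) : NE) addr0 add0r.
move=> c; split; apply/lfunP => x; rewrite comp_lfunE; move: c; apply: ext_case => [a|b|m].
- by rewrite !narr_e nidemS (arr_src gM).
- by rewrite !narr_p nidemN.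
- by rewrite !narr_n.
- by rewrite !narr_e nidemS (arr_tgt gM a).
- by rewrite !narr_p nidemS linearZ /= -[ridem _ _ _]/(ridem M (tag b) (g b)); case: ex => ->.
by rewrite !narr_n linear0.
Qed.

Lemma fil_la n m : fil n m -> fil (M := N) n (laN m).
Proof.
elim: n m => [|n IH] m fm; first by rewrite (fil0 fm) linear0; apply: fil_0.
apply: filS; apply: ext_case => [a|b|m'].
- by rewrite narr_e laNE /= -laNE; apply: IH; apply: fil_arr.
- by rewrite narr_p laNE /= scale0r; apply: fil_0.
by rewrite narr_n; apply: fil_0.
Qed.

Lemma good_N : good N.
Proof.
split; first exact: isrep_N.
have H (x : NE) : fil (M := N) (\dim {: E}).+1 x.
  apply: filS; apply: ext_case => [a|b|m].
  - by rewrite narr_e -laNE; apply: fil_la; apply: (filP gM).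
  - by rewrite narr_p -laNE; apply: fil_la; apply: (filP gM).
  by rewrite narr_n; apply: fil_0.
exists (\dim {: E}).+1 => s i j _ hs; apply/lfunP => x; rewrite zero_lfunE; exact: H.
Qed.
Let gN := good_N.

Lemma ev_la x m : ev N x (laN m) = laN (ev M (rse x) m).
Proof.
apply: (ev_res (de := @unemb V Qe)) => //.
- exact: eaK.
- exact: unembK.
- by move=> a m'; rewrite narr_e laNE /= laNE.
apply: ext_case => [a|b|m'] m'' e.
- by move: e; rewrite eaK.
- by rewrite narr_p laNE /= scale0r.
exact: narr_n.
Qed.

Lemma ev_nv x : ev N x nv = x [::] *: nv + \sum_b laN (ev M (rse (lq (pa b) x)) (g b)).
Proof.
rewrite (ev_rec gN); congr (_ + _); rewrite sum_ext.
rewrite [X in X + _ + _]big1 ?add0r => [|a _]; last by rewrite narr_e linear0 -laNE !linear0.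
rewrite [X in _ + X]big1 ?addr0 => [|m _]; last by rewrite narr_n linear0.
by apply: eq_bigr => b _; rewrite narr_p scale1r -laNE ev_la.
Qed.

(** The arrows into the new vertex act by zero. *)
Lemma ev_to i x m : wt i None x -> x [::] = 0 -> ev N x m = 0.
Proof.
move=> wx x0; rewrite (ev_rdec gN) x0 scale0r add0r big1 // => c _.
have [e|ne] := eqVneq (tgt c) None; last by rewrite (wt_rq0 wx) ?ev0E ?linear0.
by move: c e; apply: ext_case => // m' _; apply: narr_n.
Qed.

(** The derivative at an arrow into the new vertex is the image of the corresponding relation,
    which vanishes in [M]; the derivative at an arrow of [Q] is the old one; the derivative at
    an arrow from the new vertex ends in an arrow into it. *)
Lemma killed_N : killed N Se.
Proof.
apply: ext_case => [a|b|m] x hx.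
- have [x1 x2] := (vtSP _ _).1 hx; rewrite (pair_dec x) x1 scale0r add0r ev_la cder_ext_old.
  by rewrite kM ?linear0.
- by apply: (ev_to _ (@wt_cder _ _ _ Se (pa b))); apply: (wt_nil (@wt_cder _ _ _ Se (pa b))).
have x2 := (vtNP _).1 hx; rewrite (pair_dec x) x2 !linear0 addr0 linearZ /= ev_nv.
rewrite (wt_nil (@wt_cder _ _ _ Se (na m))) // scale0r add0r.
under eq_bigr => b _ do rewrite cder_ext_new.
rewrite -linear_sum /= -[\sum_b _]/(aug g (fun b => dm m b)).
rewrite (_ : (fun b => dm m b) = img (D := D) (fun m' => (m' == m)%:R)); last first.
  apply: funext => b; rewrite /img (bigD1 m) //= eqxx mulr1 big1 ?addr0 // => m' /negbTE ->.
  by rewrite mulr0.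
rewrite (aug_img ex (l := tag m)) ?linear0 ?scaler0 // => m'.
by case: eqP => [->|_]; [apply: wt1 | apply: wt0].
Qed.

Lemma onto_N w : onto_at N (Some w).
Proof.
move=> x /vtSP [x1 x2]; have [c [y [ty e]]] := gen_onto gM ex x2.
have [F [Fe Fp Fn]] := ext_def (fun a => laN (y a)) (fun b => c b *: nv) (fun=> 0).
exists F.
  apply: ext_case => [a|b|m]; rewrite ?Fe ?Fp ?Fn; last exact: vt0.
  - by apply/vtSP; rewrite laNE; split=> //; apply: (ty a).
  - by apply/vtNP; rewrite -[LHS]/(_ *: (0 : E)) scaler0.
rewrite big_mkcond sum_ext [X in _ + X]big1 ?addr0 // (pair_dec x) x1 scale0r add0r e.
rewrite linearD /= addrC !linear_sum /=; congr (_ + _).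
  rewrite big_mkcond; apply: eq_bigr => a _ /=.
  by rewrite -[tgt (ea a)]/(Some (tgt a)) (inj_eq (@Some_inj _)) Fe narr_e !laNE.
rewrite big_mkcond; apply: eq_bigr => b _ /=.
rewrite -[tgt (pa b)]/(Some (tag b)) (inj_eq (@Some_inj _)) Fp narr_p !laNE.
by case: eqP => // _; congr (0, _ *: _); rewrite -[RHS]/(_ * 1) mulr1.
Qed.

(** At [w] the arrows from and to the new vertex contribute the generators and the relations of
    the presentation, so that [rel_onto] and the freeness of the generators become exactness. *)
Lemma exact_N w : exact_at Se N (Some w).
Proof.
move=> y ty; rewrite big_mkcond sum_ext [X in _ + X]big1 ?addr0 // => h0.
have ty1 a : (y (ea a)).1 = 0 by have [] := (vtSP _ _).1 (ty (ea a)).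
have ty2 : tyin (M := M) (fun a => (y (ea a)).2).
  by move=> a; have [] := (vtSP _ _).1 (ty (ea a)).
have h1 : \sum_(b | tag b == w) (y (pa b)).1 *: g b +
    \sum_(a | tgt a == w) rarr M a (y (ea a)).2 = 0.
  transitivity ((0 : NE).2) => //; rewrite -h0 addrC.
  transitivity ((laN (\sum_(a | tgt a == w) rarr M a (y (ea a)).2 +
     \sum_(b | tag b == w) (y (pa b)).1 *: g b)).2); first by rewrite laNE addrC.
  congr (_.2); rewrite linearD /= !linear_sum /=; congr (_ + _).
    rewrite big_mkcond; apply: eq_bigr => a _ /=.
    by rewrite -[tgt (ea a)]/(Some (tgt a)) (inj_eq (@Some_inj _)) narr_e laNE.
  rewrite big_mkcond; apply: eq_bigr => b _ /=.
  by rewrite -[tgt (pa b)]/(Some (tag b)) (inj_eq (@Some_inj _)) narr_p laNE.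
have yp b : tag b = w -> y (pa b) = 0.
  move=> e; have h2 : (y (pa b)).2 = 0 := (vtNP _).1 (ty (pa b)).
  by rewrite (pair_dec (y (pa b))) h2 linear0 addr0 (gfree ty2 h1 e) scale0r.
have h2 : \sum_(a | tgt a == w) rarr M a (y (ea a)).2 = 0.
  have := h1; rewrite big1 ?add0r // => b /eqP e.
  by rewrite (gfree ty2 h1 e) scale0r.
have [c [z [tz hz]]] := rel_onto gM kM noloop ex ty2 h2.
have [Z [Ze Zp Zn]] := ext_def (fun a => laN (z a)) (fun=> 0) (fun m => c m *: nv).
exists Z.
  apply: ext_case => [a|b|m]; rewrite ?Ze ?Zp ?Zn; [|exact: vt0|].
  - by apply/vtSP; rewrite laNE; split=> //; apply: (tz a).
  - by apply/vtNP; rewrite -[LHS]/(_ *: (0 : E)) scaler0.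
have gE e : gam (M := N) Se (Some w) Z e =
    \sum_(a | src a == w) ev N (rq e (cder (potS Se) (ea a))) (laN (z a)) +
    \sum_(m | tag m == w) c m *: ev N (rq e (cder (potS Se) (na m))) nv.
  rewrite /gam big_mkcond sum_ext [X in _ + X + _]big1 ?addr0 //; congr (_ + _).
    rewrite [RHS]big_mkcond; apply: eq_bigr => a _ /=.
    by rewrite -[src (ea a)]/(Some (src a)) (inj_eq (@Some_inj _)) Ze.
  rewrite [RHS]big_mkcond; apply: eq_bigr => m _ /=.
  by rewrite -[src (na m)]/(Some (tag m)) (inj_eq (@Some_inj _)) Zn linearZ.
apply: ext_case => [a|b|m] //.
- move=> [aw]; rewrite gE (pair_dec (y (ea a))) ty1 scale0r add0r (hz a aw) linearD addrC /=.
  congr (_ + _); rewrite ?linear_sum; apply: eq_bigr => m _ /=.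
    by rewrite ev_la /rse -rq_res -/rse cder_ext_old.
  rewrite linearZ /=; congr (_ *: _); rewrite ev_nv (wt_nil (wt_rq (a := ea a) (@wt_cder _ _ _ Se (na m)))) //.
  rewrite scale0r add0r /relv /aug linear_sum; apply: eq_bigr => b _ /=.
  congr (laN (ev M _ _)); rewrite lq_rq /rse -rq_res -/rse cder_ext_new //.
- move=> [bw]; rewrite (yp b bw) gE big1 ?add0r => [|a _].
    rewrite big1 // => m _; rewrite (ev_to _ (wt_rq (a := pa b) (@wt_cder _ _ _ Se (na m)))) ?scaler0 //.
    by rewrite -[LHS]/(rse (lq (pa b) (cder (potS Se) (na m))) [::]) cder_ext_new.
  apply: (ev_to _ (wt_rq (a := pa b) (@wt_cder _ _ _ Se (ea a)))).
  exact: (wt_nil (wt_rq (a := pa b) (@wt_cder _ _ _ Se (ea a)))).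
Qed.

End N.

End ExtQP.

(** * Construction of a mutation *)

Section AbsMut.
Variables (k : fieldType) (V : finType) (Q : quiver V) (u : V).
Hypothesis noloop : loopless Q.
Variables (S : potential k Q) (M : rep k Q).
Hypothesis gM : good M.
Variables (T : vectType k) (al : arr_out Q u -> 'Hom(rsp M, T)) (be : arr_in Q u -> 'Hom(T, rsp M)).
Notation E := (rsp M).
Let U : {vspace E} := lker (ridem M u).
Definition amsp : vectType k := (subvs_of (lker (ridem M u)) * T)%type.

Definition aka : 'Hom(amsp, E) := linfun (fun t : amsp => vsval t.1).
Definition ala : 'Hom(E, amsp) :=
  linfun (fun m : E => ((vsproj U (m - ridem M u m), 0) : amsp)).
Definition apr : 'Hom(amsp, T) := linfun (fun t : amsp => t.2).
Definition ains : 'Hom(T, amsp) := linfun (fun t : T => ((0, t) : amsp)).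
Definition aidem (i : V) : 'End(amsp) :=
  if i == u then (ains \o apr)%VF else (ala \o ridem M i \o aka)%VF.

Lemma akaE t : aka t = vsval t.1.
Proof. by rewrite linfun_raw // => c x y; rewrite linearP. Qed.
Lemma alaE m : ala m = (vsproj U (m - ridem M u m), 0).
Proof.
rewrite linfun_raw // => c x y.
rewrite -[RHS]/((c *: vsproj U _ + vsproj U _, c *: (0 : T) + 0) : amsp) scaler0 addr0.
by rewrite -linearP; congr (vsproj U _, _); rewrite linearP opprD addrACA -scalerBr.
Qed.
Lemma aprE t : apr t = t.2. Proof. by rewrite linfun_raw. Qed.
Lemma ainsE t : ains t = (0, t).
Proof.
by rewrite linfun_raw // => c x y; rewrite -[RHS]/((c *: 0 + 0, _) : amsp) scaler0 addr0.
Qed.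

Lemma memU m : (m \in U) = (ridem M u m == 0). Proof. by rewrite memv_ker. Qed.
Lemma aka_ala m : aka (ala m) = m - ridem M u m.
Proof.
rewrite akaE alaE vsprojK // memU linearB /= (idem_idem gM) eqxx subrr //.
Qed.
Lemma ala_aka t : ala (aka t) = (t.1, 0).
Proof.
have h := subvsP t.1; rewrite memU in h; rewrite akaE alaE (eqP h) subr0.
by rewrite vsvalK.
Qed.
Lemma aka_u t : ridem M u (aka t) = 0.
Proof. by have h := subvsP t.1; rewrite memU in h; rewrite akaE (eqP h). Qed.
Lemma adec t : t = ala (aka t) + ains t.2.
Proof. by case: t => s t; rewrite ala_aka ainsE; congr pair; rewrite /= ?addr0 ?add0r. Qed.
Lemma ala_vt i m : i != u -> vt i m -> aka (ala m) = m.
Proof. by move=> iu hm; rewrite aka_ala (idem_vt0 gM hm) ?subr0 // eq_sym. Qed.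
Lemma aka_ains t : aka (ains t) = 0. Proof. by rewrite akaE ainsE linear0. Qed.
Lemma apr_ala m : apr (ala m) = 0. Proof. by rewrite aprE alaE. Qed.
Lemma apr_ains t : apr (ains t) = t. Proof. by rewrite aprE ainsE. Qed.

Definition aarr_sig := cid (premut_def noloop
  (fun c : oldT Q u => (ala \o rarr M (val c) \o aka)%VF)
  (fun a b => (ala \o rarr M (aout b) \o rarr M (ain a) \o aka)%VF)
  (fun a => (ala \o be a \o apr)%VF)
  (fun b => (ains \o al b \o ridem M (tag b) \o aka)%VF)).
(** A mutation at [u] from data [al = alpha'] and [be = beta'] on a space [T]: the module is
    [T] at [u] and unchanged elsewhere. *)
Definition absM : rep k (premut Q u) := @Rep k V (premut Q u) amsp aidem (projT1 aarr_sig).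

Lemma abs_mold c t : rarr absM (mold c) t = ala (rarr M (val c) (aka t)).
Proof. by case: (projT2 aarr_sig) => h _ _ _; rewrite -[rarr absM _]/(projT1 aarr_sig (mold c)) h !comp_lfunE. Qed.
Lemma abs_mbr a b t : rarr absM (mbr a b) t = ala (rarr M (aout b) (rarr M (ain a) (aka t))).
Proof. by case: (projT2 aarr_sig) => _ h _ _; rewrite -[rarr absM _]/(projT1 aarr_sig (mbr a b)) h !comp_lfunE. Qed.
Lemma abs_sin a t : rarr absM (sin a) t = ala (be a (apr t)).
Proof. by case: (projT2 aarr_sig) => _ _ h _; rewrite -[rarr absM _]/(projT1 aarr_sig (sin a)) h !comp_lfunE. Qed.
Lemma abs_sout b t : rarr absM (sout b) t = ains (al b (ridem M (tag b) (aka t))).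
Proof. by case: (projT2 aarr_sig) => _ _ _ h; rewrite -[rarr absM _]/(projT1 aarr_sig (sout b)) h !comp_lfunE. Qed.
Lemma abs_idu t : ridem absM u t = ains (apr t).
Proof. by rewrite /absM /= /aidem eqxx comp_lfunE. Qed.
Lemma abs_id i t : i != u -> ridem absM i t = ala (ridem M i (aka t)).
Proof. by move=> /negbTE iu; rewrite /absM /= /aidem iu !comp_lfunE. Qed.

Lemma abs_vtu t : vt (M := absM) u t -> t = ains (apr t).
Proof. by rewrite /vt abs_idu. Qed.
Lemma abs_vt i t : i != u -> vt (M := absM) i t -> vt i (aka t) /\ t = ala (aka t).
Proof.
move=> iu; rewrite /vt abs_id // => h; split; last first.
  by rewrite -{2}h aka_ala (idem_idem gM) eq_sym (negbTE iu) subr0 h.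
by rewrite -{2}h aka_ala !(idem_idem gM) eq_sym (negbTE iu) subr0.
Qed.
Lemma vt_ala i m : i != u -> vt i m -> vt (M := absM) i (ala m).
Proof. by move=> iu hm; rewrite /vt abs_id // (ala_vt iu hm) hm. Qed.
Lemma vt_ains t : vt (M := absM) u (ains t).
Proof. by rewrite /vt abs_idu apr_ains. Qed.

Hypothesis be_vt : forall a t, vt (tag a) (be a t).

Lemma abs_rep : is_rep absM.
Proof.
split.
- move=> i j; apply/lfunP => t; rewrite comp_lfunE.
  have [->|iu] := eqVneq i u; have [->|ju] := eqVneq j u; rewrite ?abs_idu ?(abs_id _ ju).
  + by rewrite apr_ains.
  + by rewrite apr_ala linear0 zero_lfunE.
  + by rewrite (abs_id _ iu) aka_ains !linear0 (negbTE iu) zero_lfunE.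
  rewrite (abs_id _ iu) (ala_vt ju (idem_vt gM j _)) (idem_idem gM).
  by case: eqP => _; rewrite ?linear0 ?zero_lfunE ?(abs_id _ iu).
- apply/lfunP => t; rewrite id_lfunE sum_lfunE (bigD1 u) //= abs_idu.
  under eq_bigr => i iu do rewrite (abs_id _ iu).
  rewrite -linear_sum /= [RHS]adec addrC aprE; congr (ala _ + _).
  by rewrite [RHS](idem_sum gM) [RHS](bigD1 u) //= aka_u add0r.
move=> e; split; apply/lfunP => t; rewrite comp_lfunE; move: e;
  apply: (premut_case noloop) => [c|a b|a|b].
- have [su _] := okE c; rewrite src_mold (abs_id _ su) !abs_mold.
  by rewrite (ala_vt su (idem_vt gM (src (val c)) _)) (arr_src gM (val c)).
- rewrite src_mbr (abs_id _ (tag_in noloop a)) !abs_mbr.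
  rewrite (ala_vt (tag_in noloop a) (idem_vt gM (tag a) _)).
  by rewrite -[tag a]/(src (ain a)) (arr_src gM).
- by rewrite src_sin abs_idu !abs_sin apr_ains.
- rewrite src_sout (abs_id _ (tag_out noloop b)) !abs_sout.
  rewrite (ala_vt (tag_out noloop b) (idem_vt gM (tag b) _)).
  by rewrite (idem_idem gM) eqxx.
- have [_ tu] := okE c; rewrite tgt_mold (abs_id _ tu) abs_mold.
  by rewrite (ala_vt tu (arr_tgt gM (val c) _)) (arr_tgt gM (val c)).
- rewrite tgt_mbr (abs_id _ (tag_out noloop b)) abs_mbr.
  rewrite (ala_vt (tag_out noloop b) (arr_tgt gM (aout b) _)).
  by congr (ala _); apply: (arr_tgt gM (aout b)).
- rewrite tgt_sin (abs_id _ (tag_in noloop a)) abs_sin (ala_vt (tag_in noloop a) (be_vt a _)).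
  by congr (ala _); apply: be_vt.
by rewrite tgt_sout abs_idu abs_sout apr_ains.
Qed.

Hypothesis al_io : forall a b m, vt (tag b) m ->
  be a (al b m) = - ev M (rq (ain a) (cder (potS S) (aout b))) m.
Hypothesis al_out : forall z : arr_out Q u -> E, (forall b, vt (tag b) (z b)) ->
  (\sum_b al b (z b) = 0 <-> exists2 m, vt u m & forall b, z b = rarr M (aout b) m).
Hypothesis be_in : forall y : arr_in Q u -> E, (forall a, vt (tag a) (y a)) ->
  (\sum_a rarr M (ain a) (y a) = 0 <-> exists t, forall a, y a = be a t).

Lemma abs_mutrel : mutrel S (M := M) (M' := absM) aka ala.
Proof.
split.
- exact: abs_rep.
- exact: aka_ala.
- by move=> t; rewrite abs_idu {2}[t]adec aprE addrK.
- by move=> i t iu /(abs_vt iu) [].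
- by move=> t /abs_vtu ->; apply: aka_ains.
- exact: vt_ala.
- apply: brk_case => [c|a b] t.
    by rewrite -[premut_brk _]/(mold c) abs_mold unbrk_bold /= comp_lfunE id_lfunE.
  by rewrite -[premut_brk _]/(mbr a b) abs_mbr unbrk_abr /= !comp_lfunE id_lfunE.
- move=> a b t /(abs_vt (tag_out noloop b)) [h _].
  by rewrite abs_sin abs_sout apr_ains h al_io // linearN.
- move=> z hz; have h b := (abs_vt (tag_out noloop b) (hz b)).1.
  have e : \sum_b rarr absM (sout b) (z b) = ains (\sum_b al b (aka (z b))).
    by rewrite linear_sum; apply: eq_bigr => b _; rewrite abs_sout h.
  rewrite e -(al_out h); split=> [/(congr1 apr)|->]; last exact: linear0.
  by rewrite apr_ains linear0.
move=> y hy; have h a := (abs_vt (tag_in noloop a) (hy a)).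
rewrite (be_in (fun a => (h a).1)); split=> [[t ht]|[t _ ht]].
  exists (ains t); first exact: vt_ains.
  by move=> a; rewrite abs_sin apr_ains -ht; case: (h a).
by exists (apr t) => a; rewrite ht abs_sin (ala_vt (tag_in noloop a) (be_vt a _)).
Qed.

Lemma abs_onto : (forall t, exists2 z : arr_out Q u -> E, forall b, vt (tag b) (z b) &
    t = \sum_b al b (z b)) ->
  forall t, vt (M := absM) u t -> exists2 z, forall b : arr_out Q u, vt (M := absM) (tag b) (z b) &
    t = \sum_b rarr absM (sout b) (z b).
Proof.
move=> h t /abs_vtu e; have [z hz ez] := h (apr t).
exists (fun b => ala (z b)) => [b|]; first by apply: vt_ala => //; apply: (tag_out noloop).
rewrite e ez linear_sum; apply: eq_bigr => b _.
by rewrite abs_sout (ala_vt (tag_out noloop b) (hz b)) hz.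
Qed.

End AbsMut.

(** * The space of the mutated representation at the vertex *)

Section SubVs.
Variables (k : fieldType) (E : vectType k) (U : {vspace E}).
Lemma vsproj0 : vsproj U 0 = 0. Proof. exact: linear0. Qed.
Lemma vsprojN x : vsproj U (- x) = - vsproj U x. Proof. exact: linearN. Qed.
Lemma vsprojL c x y : vsproj U (c *: x + y) = c *: vsproj U x + vsproj U y.
Proof. exact: linearP. Qed.
Lemma vsval0 : vsval (0 : subvs_of U) = 0. Proof. exact: linear0. Qed.
Lemma vsvalN (x : subvs_of U) : vsval (- x) = - vsval x. Proof. exact: linearN. Qed.
Lemma vsval_eq0 (x : subvs_of U) : vsval x = 0 -> x = 0.
Proof. by move=> h; rewrite -[x]vsvalK h vsproj0. Qed.
End SubVs.

Section MutAt.
Variables (k : fieldType) (V : finType) (Q : quiver V) (u : V) (S : potential k Q) (W : drep k Q).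
Hypothesis noloop : loopless Q.
Notation M := (drmod W).
Notation E := (rsp M).
Hypotheses (gM : good M) (kM : killed M S).
Notation Zout := {ffun arr_out Q u -> E}.
Notation Zin := {ffun arr_in Q u -> E}.
Notation Mout := (@M_out k V Q u W).
Notation Min := (@M_in k V Q u W).
Notation alp := (@alpha k V Q u W).
Notation bet := (@beta k V Q u W).
Notation gma := (@gamma k V Q u S W).
Notation kalpha := (@ker_alpha k V Q u W).
Notation kgamma := (@ker_gamma k V Q u S W).
Notation igamma := (@im_gamma k V Q u S W).
Notation ibeta := (@im_beta k V Q u W).
Notation mat := (@mut_at k V Q u S W).
Notation malpha := (@mut_alpha k V Q u S W).
Notation mbeta := (@mut_beta k V Q u S W).

Definition vto (z : Zout) := forall b, vt (M := M) (tag b) (z b).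
Definition vti (y : Zin) := forall a, vt (M := M) (tag a) (y a).

Lemma sum_in_u (R : zmodType) (F : arr Q -> R) : \sum_(e | tgt e == u) F e = \sum_(a : arr_in Q u) F (ain a).
Proof.
rewrite big_mkcond (sum_arr u noloop).
rewrite [X in X + _ + _]big1 ?add0r => [|c _]; last by rewrite ifN //; case: (okE c).
rewrite [X in _ + X]big1 ?addr0 => [|b _]; last by rewrite tgt_aout (negbTE (tag_out noloop _)).
by apply: eq_bigr => a _; rewrite tgt_ain eqxx.
Qed.
Lemma sum_out_u (R : zmodType) (F : arr Q -> R) : \sum_(e | src e == u) F e = \sum_(b : arr_out Q u) F (aout b).
Proof.
rewrite big_mkcond (sum_arr u noloop).
rewrite [X in X + _ + _]big1 ?add0r => [|c _]; last by rewrite ifN //; case: (okE c).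
rewrite [X in X + _]big1 ?add0r => [|b _]; last by rewrite src_ain (negbTE (tag_in noloop _)).
by apply: eq_bigr => a _; rewrite src_aout eqxx.
Qed.

Lemma mem_Mout (z : Zout) : z \in Mout <-> vto z.
Proof.
have h : forall z : Zout, linfun (fun z : Zout => [ffun b : arr_out Q u => ridem M (tag b) (z b)]) z =
    [ffun b : arr_out Q u => ridem M (tag b) (z b)].
  by move=> {}z; rewrite linfun_raw // => c x y; apply/ffunP => b; rewrite !ffunE linearP.
split=> [/memv_imgP[z' _ ->] b|hz]; first by rewrite h ffunE; apply: (idem_vt gM).
by apply/memv_imgP; exists z; rewrite ?memvf // h; apply/ffunP => b; rewrite ffunE hz.
Qed.
Lemma mem_Min (z : Zin) : z \in Min <-> vti z.
Proof.
have h : forall z : Zin, linfun (fun z : Zin => [ffun b : arr_in Q u => ridem M (tag b) (z b)]) z =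
    [ffun b : arr_in Q u => ridem M (tag b) (z b)].
  by move=> {}z; rewrite linfun_raw // => c x y; apply/ffunP => b; rewrite !ffunE linearP.
split=> [/memv_imgP[z' _ ->] b|hz]; first by rewrite h ffunE; apply: (idem_vt gM).
by apply/memv_imgP; exists z; rewrite ?memvf // h; apply/ffunP => b; rewrite ffunE hz.
Qed.
Lemma mem_Mat m : m \in @M_at k V Q u W <-> vt (M := M) u m.
Proof.
split=> [/memv_imgP[m' _ ->]|h]; first exact: (idem_vt gM).
by apply/memv_imgP; exists m; rewrite ?memvf // h.
Qed.
Lemma alphaE y : alp y = \sum_a rarr M (ain a) (y a).
Proof.
rewrite /alpha linfun_raw // => c x z; rewrite scaler_sumr -big_split.
by apply: eq_bigr => a _ /=; rewrite !ffunE linearP.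
Qed.
Lemma betaE m b : bet m b = rarr M (aout b) m.
Proof.
by rewrite /beta linfun_raw ?ffunE // => c x z; apply/ffunP => b'; rewrite !ffunE linearP.
Qed.

Lemma mem_kalpha y : y \in kalpha <-> vti y /\ \sum_a rarr M (ain a) (y a) = 0.
Proof.
rewrite memv_cap memv_ker alphaE; split=> [/andP[/eqP-> /mem_Min]|[/mem_Min -> ->]] //.
by rewrite eqxx.
Qed.
Lemma mem_kgamma z : z \in kgamma <-> vto z /\ gma z = 0.
Proof.
by rewrite memv_cap memv_ker; split=> [/andP[/eqP-> /mem_Mout]|[/mem_Mout -> ->]] //; rewrite eqxx.
Qed.
Lemma mem_ibeta z : z \in ibeta <-> exists2 m, vt (M := M) u m & z = bet m.
Proof.
split=> [/memv_imgP[m /mem_Mat hm ->]|[m /mem_Mat hm ->]]; first by exists m.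
by apply/memv_imgP; exists m.
Qed.
Lemma mem_igamma y : y \in igamma <-> exists2 z, vto z & y = gma z.
Proof.
split=> [/memv_imgP[m /mem_Mout hm ->]|[m /mem_Mout hm ->]]; first by exists m.
by apply/memv_imgP; exists m.
Qed.

Lemma gma_gam (z : Zout) (zz : arr Q -> E) a : vto z -> (forall b, zz (aout b) = z b) ->
  gma z a = gam S u zz (ain a).
Proof.
move=> hz hzz; rewrite gammaE // /gam sum_out_u.
by apply: eq_bigr => b _; rewrite hzz.
Qed.

Lemma igamma_kalpha y : y \in igamma -> y \in kalpha.
Proof.
move=> /mem_igamma [z hz ->]; apply/mem_kalpha.
have [zz [z1 z2 z3]] := arr_def noloop (fun=> 0 : E) (fun=> 0 : E) (fun b => z b).
have tz : tyout zz.
  by apply: (arr_case (u := u) noloop) => [c|a|b]; rewrite ?z1 ?z2 ?z3; [apply: vt0 | apply: vt0 | apply: hz].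
split=> [a|]; first by rewrite (gma_gam a hz z3); apply: (@vt_gam _ _ _ S M u zz (ain a) gM tz).
rewrite -[RHS](@arr_gam _ _ _ S M u zz gM noloop kM tz) sum_in_u.
by apply: eq_bigr => a _; rewrite (gma_gam a hz z3).
Qed.

Lemma gma_beta m : vt (M := M) u m -> gma (bet m) = 0.
Proof.
move=> hm; have hb : vto (bet m) by move=> b; rewrite betaE; apply: (arr_tgt gM (aout b)).
apply/ffunP => a; rewrite gammaE // ffunE -[RHS](kM (a := ain a) hm) (ev_rec gM).
rewrite (jid_ord1 noloop (jid_gen S (ain a))) // scale0r add0r.
rewrite [RHS](bigID (fun c => src c == u)) /= [X in _ = _ + X]big1 ?addr0; last first.
  by move=> c ne; rewrite (wt_lq0 (@wt_cder _ _ _ S (ain a))) ?ev0E.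
by rewrite sum_out_u; apply: eq_bigr => b _; rewrite betaE lq_cder.
Qed.

Lemma malpha_lin c z z' : malpha (c *: z + z') = c *: malpha z + malpha z'.
Proof.
have e1 : addv_pi1 kgamma ibeta (projv kgamma (c *: z + z')) =
    c *: addv_pi1 kgamma ibeta (projv kgamma z) + addv_pi1 kgamma ibeta (projv kgamma z').
  by rewrite !linearP.
have e2 : gma (c *: z + z') = c *: gma z + gma z' by rewrite linearP.
rewrite /mut_alpha e1 e2 !vsprojL !opprD -!scalerN; congr (_, _, _, _).
  by rewrite -[RHS]/(c *: (0 : subvs_of _) + 0) scaler0 addr0.
by rewrite -[RHS]/(c *: (0 : 'rV_(drdec W u)) + 0) scaler0 addr0.
Qed.
Lemma mbeta_lin c t t' : mbeta (c *: t + t') = c *: mbeta t + mbeta t'.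
Proof. by rewrite /mut_beta !linearP scalerDr addrACA. Qed.

Lemma mem_gma z : vto z -> gma z \in igamma.
Proof. by move=> hz; apply/mem_igamma; exists z. Qed.

Lemma mbeta_alpha z : vto z -> mbeta (malpha z) = - gma z.
Proof.
move=> hz; rewrite -[LHS]/(vsval (- vsproj igamma (gma z)) + vsval (0 : subvs_of _)).
by rewrite vsvalN vsval0 addr0 vsprojK // mem_gma.
Qed.

(** [beta'] shows that [gamma z = 0], and on [ker gamma] the first component of [alpha'] is the
    projection modulo [im beta]. *)
Lemma malpha0 z : vto z -> (malpha z = 0 <-> exists2 m, vt (M := M) u m & z = bet m).
Proof.
move=> hz; split=> [h|[m hm ->]].
  have h2 : gma z = 0.
    by apply/eqP; rewrite -oppr_eq0 -mbeta_alpha // h /mut_beta !linear0 addr0.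
  have zk : z \in kgamma by apply/mem_kgamma.
  apply/mem_ibeta; have /= h1 := congr1 (fun t : mat => t.1.1.1) h.
  have p0 : addv_pi1 kgamma ibeta z = 0.
    have hp : addv_pi1 kgamma ibeta z \in @coh_out k V Q u S W by apply: memv_pi.
    rewrite -(vsprojK hp); move/eqP: h1; rewrite oppr_eq0 (projv_id zk) => /eqP ->.
    exact: vsval0.
  have := @addv_pi1_pi2 _ _ kgamma ibeta z; rewrite p0 add0r => <-; first exact: memv_pi2.
  exact: (subvP (addvSl _ _)).
have h0 := gma_beta hm; rewrite /mut_alpha h0 vsproj0.
have zi : bet m \in ibeta by apply/mem_ibeta; exists m.
have zk : bet m \in kgamma.
  by apply/mem_kgamma; split=> // b; rewrite betaE; apply: (arr_tgt gM (aout b)).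
rewrite (projv_id zk) (_ : addv_pi1 _ _ _ = 0) ?vsproj0 ?oppr0 //.
have zz : bet m \in (kgamma + ibeta)%VS by apply: (subvP (addvSl _ _)).
have := addv_pi1_pi2 zz; rewrite addv_pi2_id // -[X in _ = X]add0r.
exact: addIr.
Qed.

Lemma mbeta_ker t : mbeta t \in kalpha.
Proof.
apply: memvD; first by apply: igamma_kalpha; apply: subvsP.
by apply: (subvP (diffvSl _ igamma)); apply: subvsP.
Qed.

Lemma mbeta_onto y : y \in kalpha -> exists t : mat, [/\ t.1.1.1 = 0, t.2 = 0 & mbeta t = y].
Proof.
move=> hy; have h := @addv_pi1_pi2 _ _ kalpha igamma y.
exists ((0, vsproj igamma (addv_pi2 kalpha igamma y),
  vsproj (@coh_in k V Q u S W) (addv_pi1 kalpha igamma y), 0) : mat); split=> //.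
rewrite /mut_beta /= !vsprojK; last 2 first.
- exact: memv_pi.
- exact: memv_pi2.
by rewrite addrC h //; apply: (subvP (addvSl _ _)).
Qed.

Lemma malpha_onto (t : mat) : t.2 = 0 -> mbeta t \in igamma -> exists2 z, vto z & t = malpha z.
Proof.
move=> t2 ht.
have t12 : t.1.2 = 0.
  apply: vsval_eq0.
  apply/eqP; rewrite -memv0 -(capv_diff kalpha igamma) memv_cap subvsP /=.
  by rewrite -(addKr (vsval t.1.1.2) (vsval t.1.2)) addrC memvB // subvsP.
have /mem_igamma [z1 hz1 e1] := subvsP t.1.1.2.
pose w := projv kgamma z1 - vsval t.1.1.1.
have c1 : vsval t.1.1.1 \in (kgamma :\: ibeta)%VS by apply: subvsP.
have c1k : vsval t.1.1.1 \in kgamma by apply: (subvP (diffvSl _ ibeta)).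
have wk : w \in kgamma by rewrite memvB // memv_proj.
have [hw w0] := (mem_kgamma w).1 wk.
exists (w - z1) => [b|]; first by rewrite ffunE; apply: vtD; [apply: hw | rewrite ffunE; apply: vtN; apply: hz1].
have e2 : gma (w - z1) = - vsval t.1.1.2 by rewrite linearB /= w0 sub0r -e1.
have e3 : addv_pi1 kgamma ibeta (projv kgamma (w - z1)) = - vsval t.1.1.1.
  rewrite linearB /= (projv_id wk) /w addrAC subrr sub0r linearN /=; congr (- _).
  by apply: daddv_pi_id => //; apply: capv_diff.
rewrite /mut_alpha e2 e3 !vsprojN !vsvalK !opprK.
by case: t t2 t12 {ht e1 w c1 c1k wk hw w0 e2 e3} => [[[a b] c] d] /= -> ->.
Qed.

End MutAt.

Lemma sum_sig (I : finType) (B : I -> finType) (R : zmodType) (F : {i : I & B i} -> R) :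
  \sum_x F x = \sum_i \sum_(b : B i) F (existT (fun i => B i : Type) i b).
Proof. by rewrite sig_big_dep; apply: eq_bigr => -[]. Qed.

(** * Mutation of the extended representation *)

Section MutN.
Variables (k : fieldType) (V : finType) (Q : quiver V) (S : potential k Q) (u : V).
Variables (W : drep k Q) (D0 : pres k Q).
Notation M := (drmod W).
Notation D := (add_neg D0 (drdec W)).
Hypotheses (noloop : loopless Q) (no2 : no_2cycle_at Q u) (ncs : no_common_summand D).
Hypotheses (gM : good M) (kM : killed M S).
Variables (g : Tp D0 -> rsp M).
Hypotheses (ex0 : exact_pres S g) (mc : min_conds S g).

Notation E := (rsp M).
Notation Qe := (ext_quiver D).
Notation Se := (ext_pot S D).
Notation mat := (@mut_at k V Q u S W).
Notation mbeta := (@mut_beta k V Q u S W).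

Definition tl (m : Tn D0) : Tn D := existT (fun i => neg D i : Type) (tag m) (inl (tagged m)).
Definition tr (r : {i : V & 'I_(drdec W i)}) : Tn D :=
  existT (fun i => neg D i : Type) (tag r) (inr (tagged r)).

Lemma Tn_case (P : Tn D -> Prop) : (forall m, P (tl m)) -> (forall r, P (tr r)) -> forall m, P m.
Proof.
move=> h1 h2 [i [m|j]]; [exact: (h1 (existT _ i m)) | exact: (h2 (existT _ i j))].
Qed.
Lemma sum_Tn (R : zmodType) (F : Tn D -> R) : \sum_m F m = \sum_m F (tl m) + \sum_r F (tr r).
Proof.
rewrite !sum_sig -big_split; apply: eq_bigr => i _.
by rewrite /= big_sumType.
Qed.
Lemma dm_tr r (b : Tp D0) : @dm k V Q D (tr r) b = 0. Proof. exact: tos_zero. Qed.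
Lemma img_D (z : Tn D -> ser k (arr Q)) b : @img k V Q D z b = @img k V Q D0 (z \o tl) b.
Proof.
rewrite /img sum_Tn [X in _ + X]big1 ?addr0 // => r _.
by rewrite dm_tr mul0r.
Qed.

(** A summand [P -> 0] does not change the cokernel. *)
Lemma exact_add_neg : @exact_pres k V Q S M D g.
Proof.
have [h1 h2 h3] := ex0; split=> // l y wy; rewrite h3 //; split=> -[z wz hz]; last first.
  by exists (z \o tl) => [m|b]; [apply: (wz (tl m)) | rewrite -img_D; apply: hz].
exists (fun m : Tn D => match m with existT i (inl m0) =>
      z (existT (fun i => neg D0 i : Type) i m0) | _ => 0 end).
  by apply: Tn_case => [[i m]|r]; [apply: (wz (existT _ i m)) | apply: wt0].
move=> b; rewrite img_D (_ : _ \o tl = z) //; apply: funext => -[i m] //.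
Qed.
Let ex := exact_add_neg.
Lemma rel_tl m a : @relv k V Q M D g (tl m) a = relv g m a. Proof. by []. Qed.
Lemma rel_tr r a : @relv k V Q M D g (tr r) a = 0.
Proof.
by rewrite /relv /aug big1 // => b _; rewrite (dm_tr r b) rq0 ev0E.
Qed.
Lemma dmD0 m b : @dm k V Q D m b [::] = 0.
Proof.
move: m b; apply: Tn_case => [m|r] b; last by rewrite dm_tr.
exact: (dm_nil ex0 mc m b).
Qed.
Lemma gfreeD w (c : Tp D -> k) y : tyin (M := M) y ->
   \sum_(b | tag b == w) c b *: (g b : E) + \sum_(a | tgt a == w) rarr M a (y a) = 0 ->
   forall b, tag b = w -> c b = 0.
Proof. exact: (gen_free gM ex0 mc). Qed.

Notation N := (@extN k V Q D M g).
Let gN : good N := good_N gM ex.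
Let kN : killed N Se := killed_N gM kM ex.
Lemma no2_Qe : no_2cycle_at Qe (Some u).
Proof. by move=> [i|] /=; [apply: no2 | have [|] := ncs u; [right | left]]. Qed.

Definition relz (m : Tn D) : {ffun arr_in Q u -> E} := [ffun a => @relv k V Q M D g m (ain a)].

Lemma relz_ker m : tag m = u -> relz m \in @ker_alpha k V Q u W.
Proof.
move=> mu; apply/(mem_kalpha gM); split=> [a|].
  by rewrite ffunE; apply: (vt_rel gM ex (a := ain a)); rewrite mu.
transitivity (aug (M := M) g (fun b => dm m b)).
  under eq_bigr => a _ do rewrite ffunE linear_sum.
  rewrite exchange_big; apply: eq_bigr => b _ /=.
  rewrite (ev_rdec gM) dmD0 scale0r add0r [RHS](bigID (fun e => tgt e == u)) /=.
  rewrite [X in _ = _ + X]big1 ?addr0 => [|e ne]; last first.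
    by rewrite (wt_rq0 (@wt_dm _ _ _ D m b)) ?ev0E ?linear0 // mu.
  by rewrite (sum_in_u u noloop).
rewrite (_ : (fun b => dm m b) = @img k V Q D (fun m' => (m' == m)%:R)).
  apply: (aug_img ex (l := tag m)) => m'.
  by case: eqP => [->|_]; [apply: wt1 | apply: wt0].
apply: funext => b; rewrite /img (bigD1 m) //= eqxx mulr1 big1 ?addr0 // => m' /negbTE ->.
by rewrite mulr0.
Qed.

(** [tau m] is the value on the generator of the new vertex of the reversal of the arrow of [m]
    : a lift along [beta'] of minus the relation of [m], and a basis vector of the summand
    [k^(drdec W u)] when [m] comes from the decoration. *)
Lemma tau_ex : exists tau : Tn D -> mat, [/\ forall m, tag m = u -> mbeta (tau m) = - relz m,
  forall m, (tau (tl m)).2 = 0 & forall r, tau (tr r) = (0, \row_j ((tagged r : nat) == j)%:R)].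
Proof.
have /choice [t0 ht] m : exists t : mat, tag m = u -> mbeta t = - relz (tl m) /\ t.2 = 0.
  have [mu|ne] := eqVneq (tag m) u; last by exists 0 => e; rewrite e eqxx in ne.
  have [|t [_ h2 h3]] := @mbeta_onto _ _ _ u S W (- relz (tl m)).
    by rewrite memvN; apply: relz_ker.
  by exists t.
pose tau (m : Tn D) : mat := match m with existT i mm => match mm with
  | inl m0 => if i == u then t0 (existT (fun i => neg D0 i : Type) i m0) else 0
  | inr j => (0, \row_j' ((j : nat) == j')%:R) end end.
exists tau; split.
- apply: Tn_case => [[i m]|[i j]] /= e.
    by case: eqP => [_|/(_ e) []]; case: (ht (existT _ i m) e).
  rewrite -[LHS]/(vsval 0 + vsval 0) !vsval0 addr0; apply/ffunP => a; rewrite !ffunE.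
  by rewrite (rel_tr (existT _ i j)) oppr0.
- move=> [i m] /=; case: eqP => [e|//]; by case: (ht (existT _ i m) e).
by case.
Qed.

End MutN.

Lemma sum_at (I : finType) (B : I -> finType) (R : zmodType) i (F : {i : I & B i} -> R) :
  \sum_(x | tag x == i) F x = \sum_(b : B i) F (existT (fun i => B i : Type) i b).
Proof.
rewrite big_mkcond sum_sig (bigD1 i) //= [X in _ + X]big1 ?addr0.
  by apply: eq_bigr => b _; rewrite eqxx.
by move=> j /negbTE ne; apply: big1 => b _; rewrite /= ne.
Qed.
Lemma fun_at (I : finType) (B : I -> finType) (R : zmodType) i (f : B i -> R) :
  exists F : {i : I & B i} -> R, forall b, F (existT (fun i => B i : Type) i b) = f b.
Proof.
have /choice [F hF] (x : {i : I & B i}) : exists c, forall b, x = existT (fun i => B i : Type) i b -> c = f b.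
  case: x => j b; have [e|ne] := eqVneq j i; last first.
    by exists 0 => b' /(congr1 (@tag _ _)) /= e; rewrite e eqxx in ne.
  by subst j; exists (f b) => b' e; congr f; apply: (eq_from_Tagged e).
by exists F => b; apply: hF.
Qed.

(** Rank formula: both sides are the dimension of the graph of the relation. *)
Lemma dim_rel (k : fieldType) (E F : vectType k) (R : E -> F -> Prop)
    (A A0 : {vspace E}) (B B0 : {vspace F}) :
  R 0 0 -> (forall c x y x' y', R x y -> R x' y' -> R (c *: x + x') (c *: y + y')) ->
  (forall x, x \in A <-> exists y, R x y) -> (forall y, y \in B <-> exists x, R x y) ->
  (forall x, x \in A0 <-> R x 0) -> (forall y, y \in B0 <-> R 0 y) ->
  (\dim A + \dim B0 = \dim B + \dim A0)%N.
Proof.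
move=> R0 Rl hA hB hA0 hB0.
have [W hW] := @pred_vspace k (E * F)%type (fun xy => R xy.1 xy.2) R0 (fun c x y => @Rl c x.1 x.2 y.1 y.2).
pose f : 'Hom((E * F)%type, E) := linfun (fun xy : E * F => xy.1).
pose h : 'Hom((E * F)%type, F) := linfun (fun xy : E * F => xy.2).
have fE xy : f xy = xy.1 by rewrite /f linfun_raw.
have hE xy : h xy = xy.2 by rewrite /h linfun_raw.
have e1 : (f @: W)%VS = A.
  apply/vspaceP => x; apply/idP/idP => [/memv_imgP[[a b] /hW r ->]|/hA [y r]].
    by rewrite fE; apply/hA; exists b.
  by apply/memv_imgP; exists (x, y); [apply/hW | rewrite fE].
have e2 : (h @: W)%VS = B.
  apply/vspaceP => x; apply/idP/idP => [/memv_imgP[[a b] /hW r ->]|/hB [y r]].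
    by rewrite hE; apply/hB; exists a.
  by apply/memv_imgP; exists (y, x); [apply/hW | rewrite hE].
have inj (X Y : vectType k) (q : 'Hom((E * F)%type, X)) (q' : 'Hom((E * F)%type, Y)) (C : {vspace X}) :
    (forall xy, q xy = 0 -> q' xy = 0 -> xy = 0) -> (q @: (W :&: lker q'))%VS = C ->
    \dim (W :&: lker q') = \dim C.
  move=> hi <-; rewrite -(limg_ker_dim q) (_ : (_ :&: lker q)%VS = 0%VS) ?dimv0 //.
  apply/eqP; rewrite -subv0; apply/subvP => xy; rewrite !memv_cap !memv_ker memv0.
  by case/andP => /andP[_ /eqP h2] /eqP h1; rewrite (hi _ h1 h2).
have z (xy : E * F) : f xy = 0 -> h xy = 0 -> xy = 0 by case: xy => x y; rewrite fE hE /= => -> ->.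
have d1 : \dim (W :&: lker f) = \dim B0.
  apply: (inj F E h f B0) => [xy a b|]; first exact: z.
  apply/vspaceP => y; apply/idP/idP => [/memv_imgP[[a b]]|/hB0 r].
    by rewrite memv_cap memv_ker fE hE => /andP[/hW r /eqP /= e] ->; apply/hB0; rewrite -e.
  by apply/memv_imgP; exists (0, y); rewrite ?hE // memv_cap memv_ker fE eqxx andbT; apply/hW.
have d2 : \dim (W :&: lker h) = \dim A0.
  apply: (inj E F f h A0) => [xy a b|]; first exact: z.
  apply/vspaceP => x; apply/idP/idP => [/memv_imgP[[a b]]|/hA0 r].
    by rewrite memv_cap memv_ker fE hE => /andP[/hW r /eqP /= e] ->; apply/hA0; rewrite -e.
  by apply/memv_imgP; exists (x, 0); rewrite ?fE // memv_cap memv_ker hE eqxx andbT; apply/hW.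
by rewrite -e1 -e2 -d1 -d2 addnC limg_ker_dim addnC limg_ker_dim.
Qed.

(** The coordinates at the arrows [i -> None] of the elements of the kernel of [gamma : N_out
    -> N_in] at [i]. *)
Definition deco_rel (k : fieldType) (V : finType) (Qb : quiver (option V)) (Sb : potential k Qb)
    (N : rep k Qb) (nv : rsp N) i (ze : {ffun Qb (Some i) None -> k^o}) :=
  exists z : arr Qb -> rsp N, [/\ tyout z,
    forall m : Qb (Some i) None, z (@mkarr (option V) Qb (Some i) None m) = ze m *: nv
    & forall e, tgt e = Some i -> gam Sb (Some i) z e = 0].

Lemma deco_vspace (k : fieldType) (V : finType) (Qb : quiver (option V)) (Sb : potential k Qb)
    (N : rep k Qb) (nv : rsp N) i :
  exists Z : {vspace {ffun Qb (Some i) None -> k^o}}, forall ze, ze \in Z <-> deco_rel Sb nv ze.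
Proof.
apply: pred_vspace.
  by exists (fun=> 0); split=> [c|m|e _]; [apply: vt0 | rewrite ffunE scale0r | apply: gam0].
move=> c x y [z [tz ez hz]] [z' [tz' ez' hz']]; exists (fun a => c *: z a + z' a); split=> [a|m|e he].
- by apply: vtD; [apply: vtZ; apply: tz | apply: tz'].
- by rewrite ez ez' !ffunE scalerDl scalerA.
by rewrite gam_lin hz // hz' // scaler0 addr0.
Qed.

Lemma pair_eq (A B : Type) (p q : A * B) : p.1 = q.1 -> p.2 = q.2 -> p = q.
Proof. by case: p q => a b [c d] /= -> ->. Qed.

Section MutN2.
Variables (k : fieldType) (V : finType) (Q : quiver V) (S : potential k Q) (u : V).
Variables (W : drep k Q) (D0 : pres k Q).
Notation M := (drmod W).
Notation D := (add_neg D0 (drdec W)).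
Hypotheses (noloop : loopless Q) (no2 : no_2cycle_at Q u) (ncs : no_common_summand D).
Hypotheses (gM : good M) (kM : killed M S).
Variables (g : Tp D0 -> rsp M).
Hypotheses (ex0 : exact_pres S g) (mc : min_conds S g).

Notation E := (rsp M).
Notation Qe := (ext_quiver D).
Notation Se := (ext_pot S D).
Notation mat := (@mut_at k V Q u S W).
Notation malpha := (@mut_alpha k V Q u S W).
Notation mbeta := (@mut_beta k V Q u S W).
Notation N := (@extN k V Q D M g).
Let ex : @exact_pres k V Q S M D g := exact_add_neg ex0.
Let gN : good N := good_N gM ex.
Let kN : killed N Se := killed_N gM kM ex.
Notation tlD := (@tl k V Q W D0).
Notation trD := (@tr k V Q W D0).
Notation relzD := (@relz k V Q u W D0 g).

Variable tau : Tn D -> mat.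
Hypothesis tau1 : forall m, tag m = u -> mbeta (tau m) = - relzD m.
Hypothesis tau2 : forall m, (tau (tlD m)).2 = 0.
Hypothesis tau3 : forall r, tau (trD r) = (0, \row_j ((tagged r : nat) == j)%:R).

Definition lo (b : arr_out Q u) : arr_out Qe (Some u) :=
  existT (fun j => Qe (Some u) j : Type) (Some (tag b)) (tagged b).
Definition no (m : neg D u) : arr_out Qe (Some u) := existT (fun j => Qe (Some u) j : Type) None m.
Definition li (a : arr_in Q u) : arr_in Qe (Some u) :=
  existT (fun j => Qe j (Some u) : Type) (Some (tag a)) (tagged a).
Definition ni (b : pos D u) : arr_in Qe (Some u) := existT (fun j => Qe j (Some u) : Type) None b.
Definition nu (m : neg D u) : Tn D := existT (fun i => neg D i : Type) u m.
Definition pu (b : pos D u) : Tp D := existT (fun i => pos D i : Type) u b.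

Lemma out_case (P : arr_out Qe (Some u) -> Prop) : (forall b, P (lo b)) -> (forall m, P (no m)) -> forall b, P b.
Proof. by move=> h1 h2 [[j|] b]; [apply: (h1 (existT _ j b)) | apply: (h2 b)]. Qed.
Lemma in_case (P : arr_in Qe (Some u) -> Prop) : (forall b, P (li b)) -> (forall m, P (ni m)) -> forall b, P b.
Proof. by move=> h1 h2 [[j|] b]; [apply: (h1 (existT _ j b)) | apply: (h2 b)]. Qed.
Lemma sum_out (R : zmodType) (F : arr_out Qe (Some u) -> R) :
  \sum_b F b = \sum_b F (lo b) + \sum_m F (no m).
Proof. by rewrite !sum_sig sum_option addrC. Qed.
Lemma sum_in (R : zmodType) (F : arr_in Qe (Some u) -> R) :
  \sum_b F b = \sum_b F (li b) + \sum_m F (ni m).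
Proof. by rewrite !sum_sig sum_option addrC. Qed.

Definition dlt (b : arr_out Q u) (m : E) : {ffun arr_out Q u -> E} := [ffun b' => if b' == b then m else 0].
Lemma dlt_lin b c x y : dlt b (c *: x + y) = c *: dlt b x + dlt b y.
Proof. by apply/ffunP => b'; rewrite !ffunE; case: eqP => _; rewrite ?scaler0 ?addr0. Qed.
Lemma sum_dlt (z : arr_out Q u -> E) : \sum_b dlt b (z b) = [ffun b => z b].
Proof.
apply/ffunP => b; rewrite sum_ffunE ffunE (bigD1 b) //= ffunE eqxx big1 ?addr0 // => b' ne.
by rewrite ffunE eq_sym (negbTE ne).
Qed.
Definition alH : 'Hom({ffun arr_out Q u -> E}, mat) := linfun malpha.
Lemma alHE z : alH z = malpha z. Proof. by apply: linfun_raw => c x y; apply: malpha_lin. Qed.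
Definition beH : 'Hom(mat, {ffun arr_in Q u -> E}) := linfun mbeta.
Lemma beHE t : beH t = mbeta t. Proof. by apply: linfun_raw => c x y; apply: mbeta_lin. Qed.

(** Extension of [alpha'] to the arrows [u -> v], by [tau]. *)
Definition alN (b : arr_out Qe (Some u)) : 'Hom(NE M, mat) :=
  match b with existT i b0 => match i return Qe (Some u) i -> 'Hom(NE M, mat) with
  | Some j => fun b1 => linfun (fun x : NE M => malpha (dlt (existT (fun j => Q u j : Type) j b1) x.2))
  | None => fun m => linfun (fun x : NE M => x.1 *: tau (nu m)) end b0 end.
(** Extension of [beta'] to the arrows [v -> u]: zero, because the arrows into the new vertex
    act by zero. *)
Definition beN (a : arr_in Qe (Some u)) : 'Hom(mat, NE M) :=
  match a with existT i a0 => match i return Qe i (Some u) -> 'Hom(mat, NE M) with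
  | Some j => fun a1 => linfun (fun t : mat => laN M (mbeta t (existT (fun j => Q j u : Type) j a1)))
  | None => fun=> 0 end a0 end.
Lemma alN_lo b x : alN (lo b) x = malpha (dlt b x.2).
Proof.
case: b => j b; apply: (linfun_raw (f := fun x : NE M => malpha (dlt (existT _ j b) x.2))) => c y z.
by rewrite -malpha_lin -dlt_lin.
Qed.
Lemma alN_no m x : alN (no m) x = x.1 *: tau (nu m).
Proof.
by apply: (linfun_raw (f := fun x : NE M => x.1 *: tau (nu m))) => c y z; rewrite scalerDl scalerA.
Qed.
Lemma beN_li a t : beN (li a) t = laN M (mbeta t a).
Proof.
case: a => j a; apply: (linfun_raw (f := fun t : mat => laN M (mbeta t (existT _ j a)))) => c y z.
by rewrite mbeta_lin [X in laN M X]ffunE [X in laN M (X + _)]ffunE linearP.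
Qed.
Lemma beN_ni b t : beN (ni b) t = 0. Proof. by rewrite /= zero_lfunE. Qed.

Lemma ain_li a : ain (li a) = ea D (ain a). Proof. by []. Qed.
Lemma ain_ni b : ain (ni b) = pa (pu b). Proof. by []. Qed.
Lemma aout_lo b : aout (lo b) = ea D (aout b). Proof. by []. Qed.
Lemma aout_no m : aout (no m) = na (nu m). Proof. by []. Qed.

Lemma mb_ker t : vti (mbeta t) /\ \sum_a rarr M (ain a) (mbeta t a) = 0.
Proof. by apply/(mem_kalpha gM); apply: mbeta_ker. Qed.

Lemma ev_relv m a : ev N (rq (ea D a) (cder (potS Se) (na m))) (nv M) = laN M (relv (M := M) (D := D) g m a).
Proof.
rewrite (ev_nv gM ex) (wt_nil (wt_rq (a := ea D a) (@wt_cder _ _ _ Se (na m)))) //.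
rewrite scale0r add0r /relv /aug linear_sum; apply: eq_bigr => b _ /=.
congr (laN M (ev M _ _)); rewrite lq_rq /rse -rq_res; congr (rq _ _).
exact: cder_ext_new.
Qed.

Lemma beN_vt a t : vt (M := N) (tag a) (beN a t).
Proof.
move: a; apply: in_case => [a|b]; last by rewrite beN_ni; apply: vt0.
by rewrite beN_li laNE; apply/vtSP; split=> //; have [h _] := mb_ker t; apply: h.
Qed.

Lemma vto_dlt b m : vt (M := M) (tag b) m -> vto (dlt b m).
Proof. by move=> h b'; rewrite ffunE; case: eqP => [->|_] //; apply: vt0. Qed.

(** [beta' alpha' = - gamma] for the extension; a nonzero value at a pair of arrows [v -> u ->
    v] would need a common summand of the two terms of the presentation. *)
Lemma alN_io a b x : vt (M := N) (tag b) x ->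
  beN a (alN b x) = - ev N (rq (ain a) (cder (potS Se) (aout b))) x.
Proof.
move: a b; apply: in_case => [a|b0] b hx; last first.
  rewrite beN_ni ain_ni (ev_to gM ex _ (wt_rq (a := pa (pu b0)) (@wt_cder _ _ _ Se (aout b)))) ?oppr0 //.
  move: b {hx}; apply: out_case => [b|m].
    exact: (wt_nil (wt_rq (a := pa (pu b0)) (@wt_cder _ _ _ Se (aout (lo b))))).
  by have [/card0_eq/(_ m)|/card0_eq/(_ b0)] := ncs u.
rewrite beN_li ain_li; move: b hx; apply: out_case => [b|m] hx.
  have [x1 x2] := (vtSP _ _).1 hx.
  rewrite alN_lo (mbeta_alpha S gM (vto_dlt x2)) ffunE (@gammaE _ _ _ _ S W _ a noloop gM (vto_dlt x2)).
  rewrite (bigD1 b) //= [X in _ + X]big1 ?addr0 => [|b' ne]; last by rewrite ffunE (negbTE ne) linear0.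
  rewrite ffunE eqxx linearN; congr (- _).
  rewrite {2}(pair_dec x) x1 scale0r add0r (ev_la gM ex) aout_lo.
  congr (laN M (ev M _ _)); rewrite /rse -rq_res; congr (rq _ _); apply: esym.
  exact: cder_ext_old.
have x2 := (vtNP _).1 hx; rewrite alN_no {2}(pair_dec x) x2 linear0 addr0 linearZ /= aout_no ev_relv.
have -> : mbeta (x.1 *: tau (nu m)) = x.1 *: mbeta (tau (nu m)) by rewrite -!beHE linearZ.
by rewrite tau1 // !ffunE scalerN linearN linearZ.
Qed.

Lemma sum_alN (z : arr_out Qe (Some u) -> NE M) x : (forall m, x (nu m) = (z (no m)).1) ->
  \sum_b alN b (z b) = malpha [ffun b => (z (lo b)).2] + \sum_(m | tag m == u) x m *: tau m.
Proof.
move=> hx; rewrite sum_out; congr (_ + _).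
  rewrite -alHE -sum_dlt linear_sum; apply: eq_bigr => b _ /=.
  by rewrite alN_lo alHE.
by rewrite sum_at; apply: eq_bigr => m _; rewrite alN_no -hx.
Qed.

Lemma mbeta_tau (x : Tn D -> k) a : mbeta (\sum_(m | tag m == u) x m *: tau m) a =
  - \sum_(m | tag m == u) x (tlD m) *: relv g m (ain a).
Proof.
have -> : mbeta (\sum_(m | tag m == u) x m *: tau m) = - \sum_(m | tag m == u) x m *: relzD m.
  rewrite -beHE linear_sum -sumrN; apply: eq_bigr => m /eqP mu.
  by rewrite linearZ /= beHE tau1 // scalerN.
rewrite ffunE sum_ffunE big_mkcond sum_Tn [X in _ + X]big1 ?addr0.
  rewrite -big_mkcond; congr (- _); apply: eq_bigr => m _.
  by rewrite !ffunE rel_tl.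
by move=> r _; case: ifP => // _; rewrite !ffunE rel_tr scaler0.
Qed.

Lemma tau_2 (x : Tn D -> k) j : (\sum_(m | tag m == u) x m *: tau m).2 0 j =
  x (trD (existT (fun i => 'I_(drdec W i) : Type) u j)).
Proof.
have e2 (t t' : mat) c : (c *: t + t').2 = c *: t.2 + t'.2 by [].
have es (I : finType) (P : pred I) (F : I -> mat) : (\sum_(i | P i) F i).2 = \sum_(i | P i) (F i).2.
  by elim/big_rec2: _ => // i t1 t2 _ <-.
rewrite es big_mkcond sum_Tn big1 ?add0r => [|m _]; last first.
  by case: ifP => // _; rewrite -[LHS]/(x (tlD m) *: (tau (tlD m)).2) tau2 scaler0.
rewrite -big_mkcond sum_at summxE (bigD1 j) //= -[trD _]/(trD (existT _ u j)).
rewrite big1 ?addr0 => [|j' ne].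
  by rewrite tau3 !mxE eqxx mulr1.
rewrite -[trD _]/(trD (existT _ u j')) tau3 !mxE /=.
by rewrite (_ : (_ == _) = false) ?mulr0 //; apply/negbTE; rewrite (inj_eq val_inj).
Qed.

(** A combination in the kernel involves the relations [r_m] modulo the image of [gamma] and
    the decoration, which are both independent; hence only [ker alpha'] for [M] is left. *)
Lemma alN_out (z : arr_out Qe (Some u) -> NE M) : (forall b, vt (M := N) (tag b) (z b)) ->
  (\sum_b alN b (z b) = 0 <-> exists2 m, vt (M := N) (Some u) m & forall b, z b = rarr N (aout b) m).
Proof.
move=> hz; have [x hx] := fun_at (B := neg D) (fun m => (z (no m)).1 : k).
rewrite (sum_alN hx); set Z := [ffun b => _].
have hZ : vto Z by move=> b; rewrite ffunE; have [] := (vtSP _ _).1 (hz (lo b)).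
split=> [h0|[m hm em]]; last first.
  have ez : Z = beta u W m.2.
    by apply/ffunP => b; rewrite ffunE betaE em aout_lo narr_e.
  have [_ m2] := (vtSP _ _).1 hm.
  rewrite (malpha0 noloop gM kM hZ).2 ?add0r; last by exists m.2.
  rewrite sum_at big1 // => m' _; rewrite hx em aout_no narr_n.
  by rewrite -[_.1]/(0 : k) scale0r.
have h1 a : @gamma k V Q u S W Z a + \sum_(m | tag m == u) x (tlD m) *: relv g m (ain a) = 0.
  have := congr1 (fun t => beH t a) h0; rewrite linear0 linearD /= [RHS]ffunE [LHS]ffunE !beHE.
  rewrite mbeta_tau (mbeta_alpha S gM hZ) ffunE -opprD => /eqP.
  by rewrite oppr_eq0 => /eqP.
have [zz [z1 z2 z3]] := arr_def noloop (fun=> 0 : E) (fun=> 0 : E) (fun b => Z b).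
have tz : tyout (M := M) zz.
  by apply: (arr_case (u := u) noloop) => [c|a|b]; rewrite ?z1 ?z2 ?z3; [apply: vt0 | apply: vt0 | apply: hZ].
have x0 m : tag m = u -> x (tlD m) = 0.
  apply: (rel_free gM noloop ex0 mc (z := zz) (c := fun m => x (tlD m))) => //.
  apply: (arr_case (u := u) noloop) => [c|a|b] /eqP e.
  - by case: (okE c) => _; rewrite e.
  - by rewrite -(gma_gam S noloop gM a hZ z3) addrC h1.
  by move: e; rewrite tgt_aout (negbTE (tag_out noloop b)).
have x1 j : x (trD (existT (fun i => 'I_(drdec W i) : Type) u j)) = 0.
  rewrite -tau_2; have h2 : ((malpha Z).2 + (\sum_(m | tag m == u) x m *: tau m).2) 0 j =
    (0 : 'rV_(drdec W u)) 0 j := congr1 (fun t : mat => t.2 0 j) h0.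
  move: h2; rewrite -[(malpha Z).2]/(0 : 'rV_(drdec W u)) add0r => ->.
  by rewrite mxE.
have xn (m : neg D u) : (z (no m)).1 = 0.
  rewrite -hx; case: m => [m|j]; first exact: (x0 (existT (fun i => neg D0 i : Type) u m)).
  exact: x1.
have [m hm em] : exists2 m, vt (M := M) u m & Z = beta u W m.
  apply/(malpha0 noloop gM kM hZ); rewrite -[LHS]addr0 -[RHS]h0; congr (_ + _).
  by rewrite sum_at big1 // => m _; rewrite hx xn scale0r.
exists (laN M m); first by rewrite laNE; apply/vtSP.
apply: out_case => [b|m'].
  have [y1 y2] := (vtSP _ _).1 (hz (lo b)).
  rewrite aout_lo narr_e laNE /= -betaE -em ffunE.
  by rewrite {1}(pair_dec (z (lo b))) y1 scale0r add0r laNE.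
have y2 := (vtNP _).1 (hz (no m')).
by rewrite aout_no narr_n (pair_dec (z (no m'))) xn y2 scale0r linear0 addr0.
Qed.

(** A combination of generators in the image of [alpha] has zero coefficients, by minimality. *)
Lemma beN_in (y : arr_in Qe (Some u) -> NE M) : (forall a, vt (M := N) (tag a) (y a)) ->
  (\sum_a rarr N (ain a) (y a) = 0 <-> exists t, forall a, y a = beN a t).
Proof.
move=> hy; have [x hx] := fun_at (B := pos D) (fun b => (y (ni b)).1 : k).
pose Y : {ffun arr_in Q u -> E} := [ffun a => (y (li a)).2].
have hY : vti Y by move=> b; rewrite ffunE; have [] := (vtSP _ _).1 (hy (li b)).
have eS : \sum_a rarr N (ain a) (y a) =
    laN M (\sum_(b | tag b == u) x b *: (g b : E) + \sum_a rarr M (ain a) (Y a)).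
  transitivity (laN M (\sum_(b | tag b == u) x b *: (g b : E)) + laN M (\sum_a rarr M (ain a) (Y a))).
    rewrite sum_in addrC sum_at; congr (_ + _).
      rewrite linear_sum; apply: eq_bigr => b _.
      by rewrite ain_ni narr_p -hx; exact: esym (laNE _).
    rewrite linear_sum; apply: eq_bigr => b _.
    by rewrite ain_li narr_e ffunE; exact: esym (laNE _).
  by rewrite linearD.
split=> [h0|[t ht]]; last first.
  rewrite sum_in [X in _ + X]big1 ?addr0 => [|b _]; last by rewrite ht beN_ni linear0.
  have [_ h] := mb_ker t; rewrite -[RHS](linear0 (laN M)) -h linear_sum; apply: eq_bigr => a _.
  by rewrite ht beN_li ain_li narr_e laNE; exact: esym (laNE _).
have h1 : \sum_(b | tag b == u) x b *: (g b : E) + \sum_a rarr M (ain a) (Y a) = 0.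
  by have := congr1 snd (etrans (esym eS) h0); rewrite laNE.
have [yy [y1 y2 y3]] := arr_def noloop (fun=> 0 : E) (fun a => Y a) (fun=> 0 : E).
have ty : tyin (M := M) yy.
  by apply: (arr_case (u := u) noloop) => [c|a|b]; rewrite ?y1 ?y2 ?y3; [apply: vt0 | apply: hY | apply: vt0].
have x0 b : tag b = u -> x b = 0.
  apply: (gfreeD gM ex0 mc ty); rewrite (sum_in_u u noloop) -[RHS]h1; congr (_ + _).
  by apply: eq_bigr => a _; rewrite y2.
have hk : Y \in ker_alpha u W.
  apply/(mem_kalpha gM); split=> //; have := h1; rewrite [X in X + _]big1 ?add0r // => b /eqP e.
  by rewrite x0 // scale0r.
have [t [_ _ et]] := mbeta_onto S hk; exists t; apply: in_case => [a|b].
  have [z1 z2] := (vtSP _ _).1 (hy (li a)).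
  by rewrite beN_li et ffunE {1}(pair_dec (y (li a))) z1 scale0r add0r.
have z2 := (vtNP _).1 (hy (ni b)).
by rewrite beN_ni (pair_dec (y (ni b))) -hx x0 // z2 scale0r linear0 addr0.
Qed.

(** [ker alpha] is spanned by the image of [gamma] and the relations at [u]; the decoration is
    hit by the arrows of the summands [P_u -> 0]. *)
Lemma alN_onto t : exists2 z : arr_out Qe (Some u) -> NE M,
  forall b, vt (M := N) (tag b) (z b) & t = \sum_b alN b (z b).
Proof.
have [hv hs] := mb_ker t.
have [yy [y1 y2 y3]] := arr_def noloop (fun=> 0 : E) (fun a => mbeta t a) (fun=> 0 : E).
have ty : tyin (M := M) yy.
  by apply: (arr_case (u := u) noloop) => [c|a|b]; rewrite ?y1 ?y2 ?y3; [apply: vt0 | apply: hv | apply: vt0].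
have [|c [zz [tz hz]]] := rel_onto gM kM noloop ex0 (w := u) ty.
  by rewrite (sum_in_u u noloop) -[RHS]hs; apply: eq_bigr => a _; rewrite y2.
have [xr hxr] := fun_at (B := fun i => 'I_(drdec W i)) (fun j => t.2 0 j : k).
pose x (m : Tn D) : k := match m with existT i mm => match mm with
  | inl m0 => - c (existT (fun i => neg D0 i : Type) i m0)
  | inr j => xr (existT (fun i => 'I_(drdec W i) : Type) i j) end end.
have xl m : x (tlD m) = - c m by case: m.
have xt r : x (trD r) = xr r by case: r.
pose Z0 : {ffun arr_out Q u -> E} := [ffun b => zz (aout b)].
have hZ0 : vto Z0 by move=> b; rewrite ffunE; apply: (tz (aout b)).
pose t' : mat := t - \sum_(m | tag m == u) x m *: tau m.
have [||Z hZ eZ] := @malpha_onto _ _ _ u S W gM t'.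
- apply/rowP => j; rewrite -[LHS]/((t.2 - (\sum_(m | tag m == u) x m *: tau m).2) 0 j).
  by rewrite !mxE tau_2 xt hxr subrr.
- rewrite (_ : mbeta t' = @gamma k V Q u S W Z0) ?mem_gma //; apply/ffunP => a.
  rewrite -beHE /t' linearB /= !beHE ffunE [X in _ + X]ffunE mbeta_tau opprK -y2 (hz (ain a)) //.
  rewrite (gma_gam S noloop gM (zz := zz) a hZ0) => [|b]; last by rewrite ffunE.
  rewrite addrAC -big_split big1 ?add0r // => m _.
  by rewrite -[LHS]/(c m *: relv g m (ain a) + x (tlD m) *: relv g m (ain a)) xl scaleNr subrr.
have [z zlo zno] : exists2 z : arr_out Qe (Some u) -> NE M, forall b, z (lo b) = laN M (Z b) &
    forall m, z (no m) = x (nu m) *: nv M.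
  exists (fun b => match b with existT i b0 => match i return Qe (Some u) i -> NE M with
    | Some j => fun b1 => laN M (Z (existT (fun j => Q u j : Type) j b1))
    | None => fun m => x (nu m) *: nv M end b0 end) => //.
  by case.
exists z.
  apply: out_case => [b|m]; rewrite ?zlo ?zno.
    by rewrite laNE; apply/vtSP.
  by apply/vtNP; rewrite -[LHS]/(_ *: (0 : E)) scaler0.
rewrite (sum_alN (x := x)) => [|m]; last by rewrite zno -[RHS]/(_ * 1) mulr1.
rewrite (_ : [ffun b => _] = Z) ?[X in X + _](_ : _ = t') ?subrK //.
by apply/ffunP => b; rewrite ffunE zlo laNE.
Qed.

(** The mutation of the extension lives on the space of the mutation of [W] at [u]. *)
Definition mutN : rep k (premut Qe (Some u)) := @absM k (option V) Qe (Some u) (@loopless_ext k V Q D noloop) N mat alN beN.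

(** * The mutated extension *)

Notation Qm := (premut Qe (Some u)).
Notation Sm := (premut_pot (Some u) Se).
Notation T' := (@amsp k (option V) Qe (Some u) N mat).
Notation alaN := (@ala k (option V) Qe (Some u) N mat).
Notation akaN := (@aka k (option V) Qe (Some u) N mat).
Notation ainsN := (@ains k (option V) Qe (Some u) N mat).
Notation aprN := (@apr k (option V) Qe (Some u) N mat).
Let nlE : loopless Qe := @loopless_ext k V Q D noloop.
Let no2E : no_2cycle_at Qe (Some u) := no2_Qe no2 ncs.

Lemma mutN_rel : mutrel Se (M := N) (M' := mutN) akaN alaN.
Proof.
rewrite /mutN; apply: (abs_mutrel nlE gN); [exact: beN_vt | exact: alN_io | exact: alN_out | exact: beN_in].
Qed.

Lemma good_mutN : good mutN. Proof. exact: (good_mut nlE no2E gN mutN_rel). Qed.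
Lemma killed_mutN : killed mutN Sm. Proof. exact: (killed_mut nlE no2E gN kN mutN_rel). Qed.
Lemma exact_mutN w : onto_at mutN (Some w) /\ exact_at Sm mutN (Some w).
Proof.
apply: (exact_mut nlE no2E gN kN mutN_rel).
- exact: (abs_onto gN alN_onto).
- exact: (onto_N gM ex).
- exact: (onto_N gM ex).
exact: (exact_N gM kM noloop ex (gfreeD gM ex0 mc) (dmD0 ex0 mc)).
Qed.

Lemma mutN_mold (c : oldT Qe (Some u)) (t : T') : rarr mutN (mold c) t = alaN (rarr N (val c) (akaN t)).
Proof. exact: abs_mold. Qed.
Lemma mutN_mbr (a : arr_in Qe (Some u)) (b : arr_out Qe (Some u)) (t : T') :
  rarr mutN (mbr a b) t = alaN (rarr N (aout b) (rarr N (ain a) (akaN t))).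
Proof. exact: abs_mbr. Qed.
Lemma mutN_sin (a : arr_in Qe (Some u)) (t : T') : rarr mutN (sin a) t = alaN (beN a (aprN t)).
Proof. exact: abs_sin. Qed.
Lemma mutN_sout (b : arr_out Qe (Some u)) (t : T') :
  rarr mutN (sout b) t = ainsN (alN b (ridem N (tag b) (akaN t))).
Proof. exact: abs_sout. Qed.
Lemma mutN_idu (t : T') : ridem mutN (Some u) t = ainsN (aprN t). Proof. exact: abs_idu. Qed.
Lemma mutN_id i (t : T') : i != Some u -> ridem mutN i t = alaN (ridem N i (akaN t)).
Proof. exact: abs_id. Qed.

Lemma intoN (c : arr Qe) x : tgt c = None -> rarr N c x = 0.
Proof. by move: c; apply: ext_case => [a|b|m] // _; apply: narr_n. Qed.

Definition nvm : rsp mutN := alaN (nv M).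
Lemma vt_nv : vt (M := N) None (nv M). Proof. exact/vtNP. Qed.
Lemma aka_nvm : akaN nvm = nv M. Proof. exact: (@ala_vt _ _ _ (Some u) N gN mat None (nv M) isT vt_nv). Qed.
Lemma nv_free (c : k) : c *: nv M = 0 -> c = 0.
Proof. by move/(congr1 fst) => h; rewrite -[RHS]h -[RHS]/(c * 1) mulr1. Qed.
Lemma vt_nvm : vt (M := mutN) None nvm.
Proof. exact: (@vt_ala _ _ _ (Some u) nlE N gN mat alN beN None (nv M) isT vt_nv). Qed.
Lemma nvm0 : nvm != 0.
Proof.
apply/eqP => /(congr1 akaN); rewrite aka_nvm linear0 => h.
by have /eqP := nv_free (c := 1) (etrans (scale1r _) h); rewrite oner_eq0.
Qed.
Lemma span_nvm x : vt (M := mutN) None x -> exists c, x = c *: nvm.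
Proof.
move=> hx; have [h e] := @abs_vt _ _ _ (Some u) nlE N gN mat alN beN None x isT hx.
have h2 := (vtNP _).1 h; exists (akaN x).1.
by rewrite {1}e {1}(pair_dec (akaN x)) h2 [X in alaN (_ + X)]linear0 addr0 linearZ.
Qed.
Lemma into_mutN (c : arr Qm) x : tgt c = None -> rarr mutN c x = 0.
Proof.
move: c; apply: (premut_case nlE) => [c|a b|a|b] h.
- by rewrite mutN_mold intoN ?linear0.
- by rewrite mutN_mbr intoN ?linear0.
- rewrite mutN_sin; move: a h; apply: in_case => [a|b] // _.
  by rewrite beN_ni linear0.
by [].
Qed.

Notation mrest := (@M_rest k V Q u W).
Notation msp := (@mut_sp k V Q u S W).
Notation M' := (drmod (premut_drep u S W)).

Lemma rest_out i m : i != u -> vt (M := M) i m -> vsval (vsproj mrest m) = m.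
Proof. by move=> iu hm; apply: vsprojK; rewrite memv_ker (idem_vt0 gM hm) // eq_sym. Qed.
Lemma rest_ker (s : subvs_of mrest) : ridem M u (vsval s) = 0.
Proof. by have := subvsP s; rewrite memv_ker => /eqP. Qed.

(** The mutation of [W] sits in the mutation of the extension as the part off the new vertex. *)
Definition lam : 'Hom(msp, T') := linfun (fun t : msp => alaN (laN M (vsval t.1)) + ainsN t.2).
Lemma lamE (t : msp) : lam t = alaN (laN M (vsval t.1)) + ainsN t.2.
Proof.
apply: (linfun_raw (f := fun t : msp => alaN (laN M (vsval t.1)) + ainsN t.2)) => c x y.
have -> : vsval (c *: x + y).1 = c *: vsval x.1 + vsval y.1 by exact: linearP.
have -> : (c *: x + y).2 = c *: x.2 + y.2 by [].
by rewrite !linearP scalerDr addrACA.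
Qed.
Lemma lam0 (x : mat) : lam ((0, x) : msp) = ainsN x.
Proof.
rewrite lamE; transitivity (alaN (laN M (vsval (0 : subvs_of mrest))) + ainsN x) => //.
by rewrite vsval0 !linear0 add0r.
Qed.
Lemma lam_old i m : i != u -> vt (M := M) i m -> lam ((vsproj mrest m, 0) : msp) = alaN (laN M m).
Proof.
move=> iu hm; rewrite lamE.
transitivity (alaN (laN M (vsval (vsproj mrest m))) + ainsN 0) => //.
by rewrite linear0 addr0 (rest_out iu hm).
Qed.
Lemma aka_lam (t : msp) : akaN (lam t) = laN M (vsval t.1).
Proof.
have e0 : ridem N (Some u) (laN M (vsval t.1)) = 0.
  by rewrite nidemS laNE -[(_, _).2]/(vsval t.1) rest_ker.
by rewrite lamE linearD /= (aka_ala (Some u) gN) e0 aka_ains subr0 addr0.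
Qed.
Lemma apr_lam (t : msp) : aprN (lam t) = t.2.
Proof. by rewrite lamE linearD /= apr_ala apr_ains add0r. Qed.

Lemma lam_inj (t : msp) : lam t = 0 -> t = 0.
Proof.
move=> h; have h1 := congr1 akaN h; have h2 := congr1 aprN h.
rewrite aka_lam linear0 laNE in h1; rewrite apr_lam linear0 in h2.
by apply: pair_eq => //; apply: vsval_eq0; apply: (congr1 snd h1).
Qed.

Lemma mut_idE i (t : msp) : ridem M' i t =
  (if i == u then ((0, t.2) : msp) else ((vsproj mrest (ridem M i (vsval t.1)), 0) : msp)).
Proof.
apply: (linfun_raw (f := fun t : msp => if i == u then ((0, t.2) : msp)
  else ((vsproj mrest (ridem M i (vsval t.1)), 0) : msp))) => c x y.
case: (i == u); apply: pair_eq.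
- by transitivity (c *: (0 : subvs_of mrest) + 0); [rewrite scaler0 addr0 | ].
- by [].
- transitivity (c *: vsproj mrest (ridem M i (vsval x.1)) + vsproj mrest (ridem M i (vsval y.1))); last by [].
  by rewrite -vsprojL -linearP; congr (vsproj _ (ridem _ _ _)); exact: linearP.
by transitivity (c *: (0 : mat) + 0); [rewrite scaler0 addr0 | ].
Qed.

Lemma mut_brkE (e : arr (brk Q u)) (t : msp) :
  rarr M' (premut_brk e) t = ((vsproj mrest (wact M (unbrk e) (vsval t.1)), 0) : msp).
Proof.
transitivity (linfun (fun t : msp => ((vsproj mrest (wact M (unbrk e) (vsval t.1)), 0) : msp)) t).
  by case: e => -[i j] c0.
apply: linfun_raw => c x y.
apply: pair_eq.
  transitivity (c *: vsproj mrest (wact M (unbrk e) (vsval x.1)) + vsproj mrest (wact M (unbrk e) (vsval y.1))); last by [].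
  by rewrite -vsprojL -linearP; congr (vsproj _ (wact _ _ _)); exact: linearP.
by transitivity (c *: (0 : mat) + 0); [rewrite scaler0 addr0 | ].
Qed.

Lemma mut_arr_to i j (c0 : {c : Q j i | (i == u) || (j == u)}) : j != u ->
  @mut_arr k V Q u S W (@mkarr V (premut Q u) i j (inl c0)) = linfun (fun t : msp => ((vsproj mrest
    (\sum_(b : arr_in Q u | mkarr (tagged b) == @mkarr V Q j i (val c0)) mbeta t.2 b), 0) : msp)).
Proof. by move=> ju; rewrite /mut_arr /mkarr /= ifF; [ | exact: negbTE]. Qed.
Lemma mut_arr_from i j (c0 : {c : Q j i | (i == u) || (j == u)}) : j == u ->
  @mut_arr k V Q u S W (@mkarr V (premut Q u) i j (inl c0)) = linfun (fun t : msp => ((0, malpha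
    [ffun b : arr_out Q u => if mkarr (tagged b) == @mkarr V Q j i (val c0)
      then ridem M (tag b) (vsval t.1) else 0]) : msp)).
Proof. by move=> ju; rewrite /mut_arr /mkarr /= ifT. Qed.

Lemma mut_sinE (a : arr_in Q u) (t : msp) :
  rarr M' (sin a) t = ((vsproj mrest (mbeta t.2 a), 0) : msp).
Proof.
pose f (x : msp) : msp := (vsproj mrest (mbeta x.2 a), 0).
transitivity (linfun f t); last first.
  apply: linfun_raw => c x y; apply: pair_eq.
    transitivity (c *: vsproj mrest (mbeta x.2 a) + vsproj mrest (mbeta y.2 a)); last by [].
    rewrite -vsprojL; congr (vsproj _ _).
    have -> : mbeta (c *: x + y).2 = c *: mbeta x.2 + mbeta y.2 by exact: mbeta_lin.
    by rewrite ffunE [X in X + _]ffunE.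
  by transitivity (c *: (0 : mat) + 0); [rewrite scaler0 addr0 | ].
transitivity (@mut_arr k V Q u S W (sin a) t) => //.
rewrite /sin /star_in mut_arr_to ?(tag_in noloop) //.
apply: (congr1 (fun h => linfun h t)); apply: funext => x; rewrite /f (big_pred1 a) // => b.
exact: (inj_eq (@ain_inj _ _ _)).
Qed.

Lemma mut_soutE (b : arr_out Q u) (t : msp) :
  rarr M' (sout b) t = ((0, malpha (dlt b (ridem M (tag b) (vsval t.1)))) : msp).
Proof.
pose f (x : msp) : msp := (0, malpha (dlt b (ridem M (tag b) (vsval x.1)))).
transitivity (linfun f t); last first.
  apply: linfun_raw => c x y; apply: pair_eq.
    by transitivity (c *: (0 : subvs_of mrest) + 0); [rewrite scaler0 addr0 | ].
  transitivity (c *: malpha (dlt b (ridem M (tag b) (vsval x.1))) + malpha (dlt b (ridem M (tag b) (vsval y.1)))); last by [].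
  by rewrite -malpha_lin -dlt_lin -linearP; congr (malpha (dlt _ (ridem _ _ _))); exact: linearP.
transitivity (@mut_arr k V Q u S W (sout b) t) => //.
rewrite /sout /star_out mut_arr_from ?eqxx //.
apply: (congr1 (fun h => linfun h t)); apply: funext => x; rewrite /f; congr (0, malpha _).
apply/ffunP => b'; rewrite !ffunE (_ : (_ == _) = (b' == b)); first by case: eqP => // ->.
exact: (inj_eq (@aout_inj _ _ _)).
Qed.

Lemma lam_vt i (t : msp) : lam (ridem M' i t) = ridem mutN (Some i) (lam t).
Proof.
have [->|iu] := eqVneq i u.
  by rewrite mut_idE eqxx lam0 mutN_idu apr_lam.
rewrite mut_idE (negbTE iu) (lam_old iu (idem_vt gM _ _)) (@mutN_id (Some i) _ iu) aka_lam.
by rewrite nidemS !laNE.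
Qed.
Lemma lam_none (t : msp) : ridem mutN None (lam t) = 0.
Proof. by rewrite (@mutN_id None _ isT) aka_lam nidemN laNE; exact: linear0. Qed.
Lemma lam_onto i x : vt (M := mutN) (Some i) x -> exists m, x = lam m.
Proof.
case: (eqVneq i u) => [->|iu] hx.
  by have e := @abs_vtu _ _ _ (Some u) nlE N mat alN beN x hx; exists (0, aprN x); rewrite lam0.
have [h e] := @abs_vt _ _ _ (Some u) nlE N gN mat alN beN (Some i) x iu hx; have [h1 h2] := (vtSP _ _).1 h.
exists (vsproj mrest (akaN x).2, 0); rewrite (lam_old iu h2) {1}e; congr (alaN _).
by rewrite {1}(pair_dec (akaN x)) h1 scale0r add0r.
Qed.

Definition eo (c : oldT Q u) : oldT Qe (Some u) := exist _ (ea D (val c)) (valP c).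
Lemma emb_mold (c : oldT Q u) : @emb V Qm (mold c) = mold (eo c).
Proof.
have e (p q : (Some (src (val c)) != Some u) && (Some (tgt (val c)) != Some u)) :
  @mkarr (option V) Qm (Some (src (val c))) (Some (tgt (val c))) (inr (inl (exist _ (tagged (val c)) p))) =
  @mkarr (option V) Qm (Some (src (val c))) (Some (tgt (val c))) (inr (inl (exist _ (tagged (val c)) q))).
  by rewrite (bool_irrelevance p q).
exact: (e _ _).
Qed.
Lemma emb_sin (a : arr_in Q u) : @emb V Qm (sin a) = sin (li a).
Proof.
have e (p q : (Some u == Some u) || (Some (tag a) == Some u)) :
  @mkarr (option V) Qm (Some u) (Some (tag a)) (inl (exist _ (tagged a) p)) =
  @mkarr (option V) Qm (Some u) (Some (tag a)) (inl (exist _ (tagged a) q)).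
  by rewrite (bool_irrelevance p q).
exact: (e _ _).
Qed.
Lemma emb_sout (b : arr_out Q u) : @emb V Qm (sout b) = sout (lo b).
Proof.
have e (p q : (Some (tag b) == Some u) || (Some u == Some u)) :
  @mkarr (option V) Qm (Some (tag b)) (Some u) (inl (exist _ (tagged b) p)) =
  @mkarr (option V) Qm (Some (tag b)) (Some u) (inl (exist _ (tagged b) q)).
  by rewrite (bool_irrelevance p q).
exact: (e _ _).
Qed.

Lemma lam_arr (a : arr (premut Q u)) (t : msp) : lam (rarr M' a t) = rarr mutN (@emb V Qm a) (lam t).
Proof.
have w1 c m : wact M [:: c] m = rarr M c m by rewrite /= comp_lfunE id_lfunE.
have w2 c d m : wact M [:: c; d] m = rarr M d (rarr M c m) by rewrite /= !comp_lfunE id_lfunE.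
move: a; apply: (premut_case noloop) => [c|a b|a|b].
- have tc := (okE c).2.
  have -> : rarr M' (mold c) t = ((vsproj mrest (rarr M (val c) (vsval t.1)), 0) : msp).
    by rewrite (mut_brkE (bold c)) unbrk_bold w1.
  rewrite (lam_old tc (arr_tgt gM _ _)) emb_mold mutN_mold aka_lam -[val (eo c)]/(ea D (val c)) narr_e.
  by rewrite !laNE.
- have -> : rarr M' (mbr a b) t = ((vsproj mrest (rarr M (aout b) (rarr M (ain a) (vsval t.1))), 0) : msp).
    by rewrite (mut_brkE (abr a b)) unbrk_abr w2.
  rewrite (lam_old (tag_out noloop b) (arr_tgt gM (aout b) _)).
  rewrite -[@emb V Qm (mbr a b)]/(mbr (li a) (lo b)) mutN_mbr aka_lam ain_li aout_lo !narr_e.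
  by rewrite !laNE.
- rewrite mut_sinE (lam_old (tag_in noloop a) ((mb_ker t.2).1 a)) emb_sin mutN_sin beN_li apr_lam.
  by [].
rewrite mut_soutE lam0 emb_sout mutN_sout alN_lo aka_lam -[tag (lo b)]/(Some (tag b)) nidemS.
by rewrite !laNE.
Qed.

(** Inherited from the mutation of the extension through [lam]. *)
Lemma good_mut_drep : good M'.
Proof.
have inj2 (x y : msp) : lam x = lam y -> x = y.
  by move=> h; apply/eqP; rewrite -subr_eq0; apply/eqP/lam_inj; rewrite linearB /= h subrr.
have [[r1 r2 r3] [n hn]] := good_mutN; split.
  split=> [i j||a].
  - apply/lfunP => t; apply: inj2; rewrite comp_lfunE !lam_vt -comp_lfunE r1 (inj_eq Some_inj).
    by case: eqP => _; rewrite ?lam_vt // !zero_lfunE linear0.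
  - apply/lfunP => t; apply: inj2; rewrite sum_lfunE linear_sum id_lfunE.
    have e : lam t = \sum_i ridem mutN i (lam t) by rewrite -sum_lfunE r2 id_lfunE.
    rewrite [RHS]e sum_option lam_none add0r; apply: eq_bigr => i _; exact: lam_vt.
  have [h1 h2] := r3 (@emb V Qm a).
  split; apply/lfunP => t; apply: inj2; rewrite comp_lfunE ?lam_vt !lam_arr ?lam_vt -comp_lfunE.
    by rewrite h1.
  by rewrite h2.
exists n => s i j ws ns; apply/lfunP => t; apply: inj2; rewrite zero_lfunE linear0.
have -> : lam (wact M' s t) = wact mutN (map (@emb V Qm) s) (lam t).
  elim: s t {ws ns} => [|a s IH] t; first by rewrite !id_lfunE.
  by rewrite [wact M' _]/= [wact mutN _]/= !comp_lfunE IH lam_arr.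
rewrite (hn (map (@emb V Qm) s) (Some i) (Some j)) ?zero_lfunE ?size_map //.
elim: s i ws {ns} => //= a s IH i /andP[h1 h2]; apply/andP; split; first exact: h1.
exact: IH.
Qed.

(** * Decorations of the mutation *)

Lemma gam_N i (z : arr Qe -> rsp N) a : tyout (M := N) z -> gam (M := N) Se (Some i) z (ea D a) =
  laN M (gam (M := M) S i (fun c => (z (ea D c)).2) a +
         \sum_(m | tag m == i) (z (na m)).1 *: (@relv k V Q M D g m a : E)).
Proof.
move=> tz; rewrite /gam big_mkcond sum_ext [X in _ + X + _]big1 ?addr0 // linearD /=; congr (_ + _).
  rewrite linear_sum -big_mkcond; apply: eq_bigr => c _.
  have [h1 h2] := (vtSP _ _).1 (tz (ea D c)).
  rewrite {1}(pair_dec (z (ea D c))) h1 scale0r add0r (ev_la gM ex).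
  by congr (laN M (ev M _ _)); rewrite /rse -rq_res; congr (rq _ _); exact: cder_ext_old.
rewrite linear_sum -big_mkcond; apply: eq_bigr => m _.
have h := (vtNP _).1 (tz (@na k V Q D m)).
by rewrite {1}(pair_dec (z (@na k V Q D m))) h linear0 addr0 !linearZ /= ev_relv.
Qed.

Lemma gam_Np i (z : arr Qe -> rsp N) (b : Tp D) : (forall a, z (ea D a) = 0) -> tag b = i ->
  gam (M := N) Se (Some i) z (pa b) = 0.
Proof.
move=> h tb; rewrite /gam big1 // => c /eqP; move: c; apply: ext_case => [a|b'|m] sc; first by rewrite h linear0.
  by [].
case: m sc => j m0 [ej]; case: b tb => j' b0 /= ej'; subst j j'.
by have [/card0_eq/(_ m0)|/card0_eq/(_ b0)] := ncs i.
Qed.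

Lemma sum_relD i (x : Tn D -> k) a : \sum_(m | tag m == i) x m *: (@relv k V Q M D g m a : E) =
  \sum_(m | tag m == i) x (tlD m) *: relv g m a.
Proof.
rewrite big_mkcond sum_Tn [X in _ + X]big1 ?addr0 => [|r _]; last first.
  by case: ifP => // _; rewrite rel_tr scaler0.
by rewrite -big_mkcond; apply: eq_bigr => m _; rewrite rel_tl.
Qed.

Definition naok (m : Tn D) (h : tag m != u) : oldT Qe (Some u) :=
  exist _ (na m) (introT (@andP (tag m != u) true) (conj h isT)).

Section DecoAway.
Variables (i : V) (iu : i != u).
Notation d := (drdec W i).
Definition rr (r : 'I_d) : {i : V & 'I_(drdec W i)} := existT (fun i => 'I_(drdec W i) : Type) i r.
Definition mr (r : 'I_d) : arr Qm := mold (naok (m := trD (rr r)) iu).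
Definition mN (r : 'I_d) : Qm (Some i) None := tagged (mr r).
Definition dF (s : {ffun 'I_d -> k^o}) (e : arr Qm) : k := \sum_r (e == mr r)%:R * s r.
Notation mk m := (@mkarr (option V) Qm (Some i) None m).

Lemma tr_inj r r' : trD (rr r) = trD (rr r') -> r = r'.
Proof. by move=> h; have : (inr r : (neg D0 i + 'I_d)%type) = inr r' := eq_from_Tagged h; case. Qed.
Lemma mr_inj : injective mr.
Proof. by move=> r r' /mold_inj/(congr1 val)/na_inj/tr_inj. Qed.
Lemma dF_mr s r : dF s (mr r) = s r.
Proof.
rewrite /dF (bigD1 r) //= eqxx mul1r big1 ?addr0 // => r' ne.
by rewrite (inj_eq mr_inj) eq_sym (negbTE ne) mul0r.
Qed.
Lemma dF0 s e : (forall r, e <> mr r) -> dF s e = 0.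
Proof. by move=> h; apply: big1 => r _; case: eqP => [/h|] //; rewrite mul0r. Qed.
Lemma mold_mr (c : oldT Qe (Some u)) r : na (trD (rr r)) = val c -> mold c = mr r.
Proof. by move=> e; congr mold; apply: val_inj. Qed.
Lemma tl_mr (c : oldT Qe (Some u)) m r : na (tlD m) = val c -> mold c <> mr r.
Proof.
move=> e /mold_inj/(congr1 val); rewrite -e => /na_inj.
case: m {e} => j m h; have ej : j = i := congr1 (@tag _ _) h; subst j.
by have : (inl m : (neg D0 i + 'I_d)%type) = inr r := eq_from_Tagged h.
Qed.

(** For [i != u] an element of the kernel is carried back to [N] by [gam_ker_to], where the
    minimal relations at [i] are independent: only the coordinates of the decoration survive,
    and they are arbitrary. *)
Lemma deco_away (ze : {ffun Qm (Some i) None -> k^o}) :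
  deco_rel Sm nvm ze <-> exists s, forall m, ze m = dF s (mk m).
Proof.
split=> [[z' [tz' ez' hz']]|[s hs]].
  have [z [tz gz zo zb]] := @gam_ker_to _ _ _ _ nlE no2E _ _ _ gN _ _ mutN_rel (Some i) iu z' tz' hz'.
  exists [ffun r => ze (mN r)] => m.
  have x0 m0 : tag m0 = i -> (z (na (tlD m0))).1 = 0.
    apply: (rel_free gM noloop ex0 mc (c := fun m => (z (na (tlD m))).1) (z := fun c => (z (ea D c)).2)).
      by move=> c; have [] := (vtSP _ _).1 (tz (ea D c)).
    move=> a ta; have := gz (ea D a) (congr1 Some ta); rewrite gam_N // laNE => h.
    have {h} h := congr1 snd h; rewrite -[LHS]/(_ + _) in h.
    rewrite addrC; apply: etrans h; congr (_ + _).
    exact: esym (sum_relD i (fun m : Tn D => (z (@na k V Q D m)).1) a).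
  have av : akaN (z' (mk m)) = ze m *: nv M by rewrite ez' linearZ /= aka_nvm.
  have H : forall e, e = mk m -> ze m = dF [ffun r => ze (mN r)] e.
    apply: (premut_case nlE) => [c|a b|a|b] em.
    - have : forall d, d = val c -> ze m = dF [ffun r => ze (mN r)] (mold c).
        apply: ext_case => [a0|b0|m1] ec.
        + by have := congr1 (@tgt _ Qm) em; rewrite tgt_mold -ec.
        + by have := congr1 (@src _ Qm) em; rewrite src_mold -ec.
        have sm : tag m1 = i by have := congr1 (@src _ Qm) em; rewrite src_mold -ec => -[].
        move: m1 ec sm; apply: Tn_case => [m0|r] ec sm.
          rewrite dF0 => [|r]; last exact: (tl_mr ec).
          by apply: nv_free; rewrite -av -em -zo -ec (pair_dec (z _)) x0 // scale0r add0r
            ((vtNP _).1 (tz (na (tlD m0)))) linear0.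
        case: r ec sm => j r ec /= ej; subst j; have er := mold_mr (r := r) ec.
        rewrite er dF_mr ffunE; congr (ze _).
        have : mk m = mk (mN r) by rewrite -em er.
        exact: eq_from_Tagged.
      by move/(_ _ erefl).
    - have sa : tag a = Some i := congr1 (@src _ Qm) em.
      have tb : tag b = None := congr1 (@tgt _ Qm) em.
      rewrite dF0 => [|r /eqP]; last by rewrite eq_sym (negbTE (mold_mbr _ _ _)).
      by apply: nv_free; rewrite -av -em zb // intoN.
    - by have := congr1 (@src _ Qm) em; rewrite src_sin => -[e]; case: (negP iu); apply/eqP.
    by have := congr1 (@tgt _ Qm) em.
  exact: H.
have [xr hxr] := fun_at (B := fun i => 'I_(drdec W i)) (fun r => s r : k).
pose xs (m : Tn D) : k := match m with existT i mm => match mm with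
  | inl m0 => 0
  | inr j => xr (existT (fun i => 'I_(drdec W i) : Type) i j) end end.
have xtl m : xs (tlD m) = 0 by case: m.
have xtr r : xs (trD r) = xr r by case: r.
have [z [z1 z2 z3]] := ext_def (fun=> 0 : rsp N) (fun b : Tp D => 0 : rsp N) (fun m : Tn D => xs m *: nv M).
have tz : tyout (M := N) z.
  apply: ext_case => [a|b|m]; rewrite ?z1 ?z2 ?z3; [exact: vt0 | exact: vt0 |].
  by apply/vtNP; rewrite -[LHS]/(_ *: (0 : E)) scaler0.
have g0 : forall e, tgt e = Some i -> gam (M := N) Se (Some i) z e = 0.
  apply: ext_case => [a|b|m] e //; last by apply: gam_Np => //; case: e.
  rewrite gam_N // (_ : (fun c => (z (ea D c)).2) = (fun=> 0)); last by apply: funext => c; rewrite z1.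
  rewrite gam0 add0r sum_relD big1 ?linear0 // => m _.
  have -> : (z (na (tlD m))).1 = 0 by rewrite z3 xtl scale0r.
  by rewrite scale0r.
have [a b|b tb|z' [tz' m1 b1 [g1 g2 g3]]] :=
  @gam_lift _ _ _ _ nlE no2E _ _ _ gN _ _ mutN_rel (Some i) iu z (fun _ _ => 0) tz.
- exact: vt0.
- by rewrite g0 // big1 // => a _; rewrite !linear0.
exists z'; split=> //.
  have H : forall e, src e = Some i -> tgt e = None -> z' e = dF s e *: nvm.
    apply: (premut_case nlE) => [c|a b|a|b] se te.
    - rewrite m1; have : forall d, d = val c -> alaN (z (val c)) = dF s (mold c) *: nvm.
        apply: ext_case => [a0|b0|m2] ec.
        + by have := te; rewrite tgt_mold -ec.
        + by have := se; rewrite src_mold -ec.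
        have sm : tag m2 = i by have := se; rewrite src_mold -ec => -[].
        rewrite -ec z3 linearZ; congr (_ *: _); move: m2 ec sm; apply: Tn_case => [m0|r] ec sm.
          by rewrite xtl dF0 // => r; exact: (tl_mr ec).
        case: r ec sm => j r ec /= ej; subst j.
        by rewrite (mold_mr (r := r) ec) dF_mr; exact: hxr.
      by move/(_ _ erefl).
    - by rewrite b1 // intoN // linear0 dF0 ?scale0r // => r /eqP; rewrite eq_sym (negbTE (mold_mbr _ _ _)).
    - by move: se; rewrite src_sin => -[e]; case: (negP iu); apply/eqP.
    by [].
  by move=> m; rewrite hs H.
apply: (premut_case nlE) => [c|a b|a|b] te.
- by rewrite g1 // g0 // linear0.
- by rewrite g3.
- by rewrite g2.
by move: te; rewrite tgt_sout => -[e]; case: (negP iu); apply/eqP.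
Qed.

Lemma deco_dim_away (Z : {vspace {ffun Qm (Some i) None -> k^o}}) :
  (forall ze, ze \in Z <-> deco_rel Sm nvm ze) -> \dim Z = d.
Proof.
move=> hZ; have := @dim_rel k _ _ (fun (s : {ffun 'I_d -> k^o}) (ze : {ffun Qm (Some i) None -> k^o}) => forall m, ze m = dF s (mk m)) fullv 0%VS Z 0%VS.
have F0 e : dF 0 e = 0 by apply: big1 => r _; rewrite ffunE mulr0.
rewrite !dimv0 !addn0 dimvf /dim /= !muln1 card_ord => h; apply: esym; apply: h => //.
- by move=> m; rewrite ffunE F0.
- move=> c x y x' y' h h' m; rewrite !ffunE h h' /dF scaler_sumr -big_split; apply: eq_bigr => r _ /=.
  by rewrite !ffunE mulrDr; congr (_ + _); rewrite -[LHS]/(c * (_ * _)) mulrCA.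
- by move=> s; rewrite memvf; split=> // _; exists [ffun m => dF s (mk m) : k^o] => m; rewrite ffunE.
- by move=> ze; rewrite hZ; exact: deco_away.
- move=> s; rewrite memv0; split=> [/eqP-> m|h]; first by rewrite F0 ffunE.
  by apply/eqP/ffunP => r; have := h (mN r); rewrite !ffunE -[mk _]/(mr r) dF_mr.
move=> ze; rewrite memv0; split=> [/eqP-> m|h]; first by rewrite F0 ffunE.
by apply/eqP/ffunP => m; rewrite h F0 ffunE.
Qed.
End DecoAway.

Definition mb (b : pos D u) : Qm (Some u) None := tagged (sin (ni b)).
Notation mku m := (@mkarr (option V) Qm (Some u) None m).
Lemma mku_mb b : mku (mb b) = sin (ni b). Proof. by []. Qed.
Lemma mb_inj : injective mb.
Proof.
move=> b b' e; have h := @sin_inj _ _ _ (ni b) (ni b') (congr1 (fun m => mku m) e); exact: eq_from_Tagged h.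
Qed.
Lemma mb_onto m : exists b, m = mb b.
Proof.
have H : forall e, e = mku m -> exists b, m = mb b.
  apply: (premut_case nlE) => [c|a b|a|b] em.
  - have h := (okE c).1; have es : src (val c) = Some u := congr1 (@src _ Qm) em.
    by rewrite es eqxx in h.
  - have h := tag_in nlE a; have es : tag a = Some u := congr1 (@src _ Qm) em.
    by rewrite es eqxx in h.
  - move: a em; apply: in_case => [a|b] em; first by have := congr1 (@tgt _ Qm) em.
    by exists b; have := etrans (esym em) (esym (mku_mb b)); exact: eq_from_Tagged.
  by have := congr1 (@tgt _ Qm) em.
exact: H.
Qed.

Lemma sumN_in (y : arr_in Qe (Some u) -> rsp N) : \sum_a rarr N (ain a) (y a) =
  laN M (\sum_a rarr M (ain a) (y (li a)).2 + \sum_(b : pos D u) (y (ni b)).1 *: (g (pu b) : E)).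
Proof.
rewrite sum_in linearD /=; congr (_ + _); rewrite linear_sum; apply: eq_bigr => a _.
  by rewrite ain_li narr_e; exact: esym (laNE _).
by rewrite ain_ni narr_p; exact: esym (laNE _).
Qed.

Notation kbeta := (@ker_beta k V Q u W).
Notation ialpha := (@im_alpha k V Q u W).
Lemma mem_kbeta m : m \in kbeta <-> vt (M := M) u m /\ forall b : arr_out Q u, rarr M (aout b) m = 0.
Proof.
have hM : m \in @M_at k V Q u W <-> vt (M := M) u m by apply: mem_Mat.
rewrite memv_cap memv_ker; split=> [/andP[/eqP h1 /hM h2]|[h1 h2]].
  by split=> [|b] //; rewrite -betaE h1 ffunE.
apply/andP; split; last exact/hM.
by apply/eqP/ffunP => b; rewrite betaE h2 ffunE.
Qed.

(** [m] lies in [ker beta], and differs from the combination of the generators at [u] with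
    coefficients [ze] by an element of [im alpha]. *)
Definition ureli (m : E) (ze : {ffun Qm (Some u) None -> k^o}) := m \in kbeta /\
  exists2 y : {ffun arr_in Q u -> E}, vti y &
    m = \sum_a rarr M (ain a) (y a) + \sum_(b : pos D u) ze (mb b) *: (g (pu b) : E).

(** At [u], [gamma'] vanishes on a family iff [alpha] sends it into [ker beta]; the arrows [u
    -> v] of the mutated quiver are the reversals of those of the generators at [u]. *)
Lemma deco_at ze : deco_rel Sm nvm ze <-> exists m, ureli m ze.
Proof.
split=> [[z' [tz' ez' hz']]|[m [/mem_kbeta [vm km] [y hy em]]]].
  have y1 b : (akaN (z' (sin (ni b)))).1 = ze (mb b).
    by rewrite -mku_mb ez' linearZ /= aka_nvm -[LHS]/(_ * 1) mulr1.
  pose y : {ffun arr_in Q u -> E} := [ffun a => (akaN (z' (sin (li a)))).2].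
  have hy : vti y.
    move=> a; rewrite ffunE; have [h _] := @abs_vt _ _ _ (Some u) nlE N gN mat alN beN (Some (tag a)) _ (tag_in noloop a) (tz' (sin (li a))).
    by have [] := (vtSP _ _).1 h.
  exists (\sum_a rarr M (ain a) (y a) + \sum_(b : pos D u) ze (mb b) *: (g (pu b) : E)).
  split; last by exists y.
  apply/mem_kbeta; split=> [|b].
    apply: vtD; first by apply: vt_sum => a _; exact: (arr_tgt gM (ain a)).
    by apply: vt_sum => b _; apply: vtZ; have [hg _ _] := ex0; exact: (hg (pu b)).
  have := hz' (sout (lo b)) erefl.
  rewrite (@gam_u_sout _ _ _ _ nlE no2E _ _ _ gN _ _ mutN_rel z' (lo b) tz') sumN_in aout_lo narr_e laNE.
  rewrite -laNE => /(congr1 akaN); rewrite (@ala_vt _ _ _ (Some u) N gN mat (Some (tag b)) _ (tag_out noloop b)).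
    rewrite linear0 laNE => /(congr1 snd) h; rewrite -[RHS]h; congr (rarr M _ (_ + _)).
      by apply: eq_bigr => a _; rewrite ffunE.
    by apply: eq_bigr => b0 _; rewrite y1.
  by rewrite laNE; apply/vtSP; split=> //; exact: (arr_tgt gM (aout b)).
have [yN yl yn] : exists2 yN : arr_in Qe (Some u) -> rsp N, forall a, yN (li a) = laN M (y a) &
    forall b, yN (ni b) = ze (mb b) *: nv M.
  exists (fun b => match b with existT i b0 => match i return Qe i (Some u) -> NE M with
    | Some j => fun b1 => laN M (y (existT (fun j => Q j u : Type) j b1))
    | None => fun b => ze (mb b) *: nv M end b0 end) => //.
  by case.
have tN : forall a, vt (M := N) (tag a) (yN a).
  apply: in_case => [a|b]; rewrite ?yl ?yn; first by rewrite laNE; apply/vtSP; split=> //; exact: hy.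
  by apply/vtNP; rewrite -[LHS]/(_ *: (0 : E)) scaler0.
have [z' [e1 e2 e3 e4]] := premut_def nlE (fun=> 0 : rsp mutN) (fun _ _ => 0)
   (fun a => alaN (yN a)) (fun=> 0).
have tz' : tyout (M := mutN) z'.
  apply: (premut_case nlE) => [c|a b|a|b]; rewrite ?e1 ?e2 ?e3 ?e4; try exact: vt0.
  exact: (@vt_ala _ _ _ (Some u) nlE N gN mat alN beN _ _ (tag_in nlE a) (tN a)).
exists z'; split=> // [m0|].
  by have [b ->] := mb_onto m0; rewrite mku_mb e3 yn linearZ.
apply: (premut_case nlE) => [c|a b|a|b] te.
- by have := (okE c).2; rewrite -tgt_mold te eqxx.
- by have := tag_out nlE b; rewrite -(tgt_mbr a b) te eqxx.
- by have := tag_in nlE a; rewrite -(tgt_sin a) te eqxx.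
rewrite (@gam_u_sout _ _ _ _ nlE no2E _ _ _ gN _ _ mutN_rel z' b tz').
have -> : \sum_a rarr N (ain a) (akaN (z' (sin a))) = laN M m.
  under eq_bigr => a _ do rewrite e3 (@ala_vt _ _ _ (Some u) N gN mat _ _ (tag_in nlE a) (tN a)).
  rewrite sumN_in em; congr (laN M (_ + _)).
    by apply: eq_bigr => a _; rewrite yl laNE.
  by apply: eq_bigr => b0 _; rewrite yn -[_.1]/(_ * 1) mulr1.
move: b {te}; apply: out_case => [b|m0].
  rewrite aout_lo narr_e (_ : (_, _) = 0) ?linear0 // laNE.
  by rewrite -[(_, _).2]/m km.
by rewrite aout_no narr_n linear0.
Qed.

(** The coefficients over the generators at [u] map [ker beta] onto the space [Z], with kernel
    [ker beta :&: im alpha]. *)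
Lemma deco_dim_at (Z : {vspace {ffun Qm (Some u) None -> k^o}}) :
  (forall ze, ze \in Z <-> deco_rel Sm nvm ze) -> \dim Z = (\dim kbeta - \dim (kbeta :&: ialpha))%N.
Proof.
move=> hZ; have hMin y : y \in @M_in k V Q u W <-> vti y by apply: mem_Min.
have := @dim_rel k _ _ ureli kbeta (kbeta :&: ialpha)%VS Z 0%VS.
rewrite dimv0 addn0 => -> //; first by rewrite addnK.
- split; first exact: mem0v.
  exists [ffun=> 0]; first by move=> a; rewrite ffunE; apply: vt0.
  rewrite !big1 ?addr0 // => [b _|a _]; rewrite ffunE ?scale0r ?linear0 //.
- move=> c x ze x' ze' [hx [y ty ey]] [hx' [y' ty' ey']]; split; first by apply: memvD; rewrite ?memvZ.
  exists (c *: y + y'); first by move=> a; rewrite !ffunE; apply: vtD; [apply: vtZ; apply: ty | apply: ty'].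
  rewrite ey ey' scalerDr addrACA; congr (_ + _); rewrite scaler_sumr -big_split; apply: eq_bigr => a _ /=.
    by rewrite !ffunE linearP.
  by rewrite !ffunE scalerDl scalerA.
- move=> x; split=> [hx|[ze []]] //; have [vx _] := (mem_kbeta _).1 hx.
  have [c [y [ty exx]]] := gen_onto gM ex vx.
  have /choice [ze hze] m : exists q, forall b, m = mb b -> q = c (pu b).
    by have [b e] := mb_onto m; exists (c (pu b)) => b'; rewrite e => /mb_inj ->.
  exists [ffun m => ze m : k^o]; split=> //; exists [ffun a => y (ain a)].
    by move=> a; rewrite ffunE; apply: (ty (ain a)).
  rewrite exx addrC (sum_in_u u noloop); congr (_ + _); first by apply: eq_bigr => a _; rewrite ffunE.
  by rewrite sum_at; apply: eq_bigr => b _; rewrite ffunE (hze _ b).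
- by move=> ze; rewrite hZ; exact: deco_at.
- move=> x; rewrite memv_cap; split=> [/andP[hx /memv_imgP[y hy e]]|[hx [y hy e]]].
    split=> //; exists y; first exact/hMin.
    by rewrite [X in _ + X]big1 ?addr0 => [|b _]; [rewrite e alphaE | rewrite ffunE scale0r].
  rewrite hx; apply/memv_imgP; exists y; first exact/hMin.
  by rewrite alphaE e [X in _ + X]big1 ?addr0 // => b _; rewrite ffunE scale0r.
move=> ze; rewrite memv0; split=> [/eqP->|[_ [y hy e]]].
  split; first exact: mem0v.
  exists [ffun=> 0]; first by move=> a; rewrite ffunE; apply: vt0.
  by rewrite !big1 ?addr0 // => [b _|a _]; rewrite ffunE ?scale0r ?linear0.
have [c hc] := fun_at (B := pos D) (fun b => ze (mb b) : k).
have [yy [y1 y2 y3]] := arr_def noloop (fun=> 0 : E) (fun a => y a) (fun=> 0 : E).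
have ty : tyin (M := M) yy.
  by apply: (arr_case (u := u) noloop) => [c0|a|b]; rewrite ?y1 ?y2 ?y3; [apply: vt0 | apply: hy | apply: vt0].
apply/eqP/ffunP => m; have [b ->] := mb_onto m; rewrite ffunE -hc.
apply: (gfreeD gM ex0 mc (w := u) ty) => //; rewrite (sum_in_u u noloop) sum_at addrC [RHS]e; congr (_ + _).
  by apply: eq_bigr => a _; rewrite y2.
by apply: eq_bigr => b0 _; rewrite hc.
Qed.

Lemma deco_dim i (Z : {vspace {ffun Qm (Some i) None -> k^o}}) :
  (forall ze, ze \in Z <-> deco_rel Sm nvm ze) -> \dim Z = drdec (premut_drep u S W) i.
Proof.
rewrite -[drdec _ i]/(if i == u then (\dim kbeta - \dim (kbeta :&: ialpha))%N else drdec W i).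
have [e|iu] := eqVneq i u; last exact: deco_dim_away.
by subst i; apply: deco_dim_at.
Qed.

(** The mutation of [N] at [u], with what is used of it at the new vertex and off it. *)
Theorem mutation_extends : exists (N' : rep k Qm) (nv' : rsp N') (la : 'Hom(rsp M', rsp N')),
  [/\ good N', killed N' Sm, forall w, onto_at N' (Some w), forall w, exact_at Sm N' (Some w) &
  [/\ vt (M := N') None nv', nv' != 0, forall x, vt (M := N') None x -> exists c, x = c *: nv',
      forall c x, tgt c = None -> rarr N' c x = 0 &
  [/\ good M', forall m, la m = 0 -> m = 0, forall i m, la (ridem M' i m) = ridem N' (Some i) (la m),
      forall m, ridem N' None (la m) = 0 &
  [/\ forall i x, vt (M := N') (Some i) x -> exists m, x = la m,
      forall (a : arr (premut Q u)) m, la (rarr M' a m) = rarr N' (@emb V Qm a) (la m) &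
      forall i (Z : {vspace {ffun Qm (Some i) None -> k^o}}),
        (forall ze, ze \in Z <-> deco_rel Sm nv' ze) -> \dim Z = drdec (premut_drep u S W) i]]]].
Proof.
exists mutN, nvm, lam; split; [exact: good_mutN | exact: killed_mutN | | |].
- by move=> w; case: (exact_mutN w).
- by move=> w; case: (exact_mutN w).
split; [exact: vt_nvm | exact: nvm0 | exact: span_nvm | exact: into_mutN |].
split; [exact: good_mut_drep | exact: lam_inj | exact: lam_vt | exact: lam_none |].
split; [exact: lam_onto | exact: lam_arr | exact: deco_dim].
Qed.

End MutN2.

(** * From approximate to exact syzygies *)

Lemma subr_regroup (Z : zmodType) (a p r t j : Z) :
  a - (p + r) - ((a - p - t) + j) = t - r - j.
Proof.
rewrite opprD addrA; move: (a - p) => x; rewrite opprD addrA; congr (_ - _).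
by rewrite opprB addrC addrA subrK.
Qed.

Section Lift.
Variables (k : fieldType) (V : finType) (Q : quiver V) (S : potential k Q) (M : rep k Q).
Hypotheses (gM : good M).
Variables (D : pres k Q) (g : Tp D -> rsp M).
Notation K := (ser k (arr Q)).
Hypothesis approx : forall l y, wtv l y -> aug g y = 0 ->
  exists z j, [/\ wtv l z, forall b, jid S (tag b) l (j b) &
    forall b, ord (\dim {: rsp M}).+1 (y b - @img k V Q D z b - j b)].
Hypothesis aug_img0 : forall l z, wtv l z -> aug g (@img k V Q D z) = 0.

Let T := (V * (Tp D -> K))%type.
Let ok (t : T) := wtv t.1 t.2 /\ aug g t.2 = 0.

Lemma lift_step : exists (z0 : T -> Tn D -> k) (y' : T -> arr Q -> Tp D -> K), forall t, ok t ->
  [/\ forall m, tag m != t.1 -> z0 t m = 0, forall a, tgt a = t.1 -> ok (src a, y' t a) &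
    forall b, jid S (tag b) t.1 (t.2 b - \sum_m dm m b * (z0 t m)%:A -
      \sum_(a | tgt a == t.1) y' t a b * ltr a)].
Proof.
suff /choice [f hf] : forall t, exists p : (Tn D -> k) * (arr Q -> Tp D -> K), ok t ->
  [/\ forall m, tag m != t.1 -> p.1 m = 0, forall a, tgt a = t.1 -> ok (src a, p.2 a) &
    forall b, jid S (tag b) t.1 (t.2 b - \sum_m dm m b * (p.1 m)%:A -
      \sum_(a | tgt a == t.1) p.2 a b * ltr a)].
  by exists (fun t => (f t).1), (fun t => (f t).2).
move=> [l y]; have [hok|nok] := pselect (ok (l, y)); last by exists (fun=> 0, fun _ _ => 0).
case: (hok) => /= wy y0; have [z [j [wz hj he]]] := approx wy y0.
pose e b := y b - @img k V Q D z b - j b.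
have we : wtv l e.
  by move=> b; apply: wtB; [apply: wtB; [apply: wy | apply: (wtv_img wz)] | case: (hj b)].
exists (fun m => z m [::], fun a b => @img k V Q D (fun m => rq a (z m)) b + rq a (e b)).
move=> _; split=> /=.
- by move=> m ne; apply: (wt_nil (wz m)).
- move=> a al; have wza : wtv (src a) (fun m => rq a (z m)) by move=> m; apply: wt_rq (wz m).
  split=> /= [b|]; first by apply: wtD; [apply: (wtv_img wza) | apply: wt_rq (we b)].
  rewrite augD (aug_img0 wza) add0r; apply: (aug_big gM) => b.
  by apply: ord_rq; apply: he.
move=> b.
have eZ : @img k V Q D z b = \sum_m dm m b * (z m [::])%:A +
    \sum_(a | tgt a == l) @img k V Q D (fun m => rq a (z m)) b * ltr a.
  rewrite /img; under [X in _ + X]eq_bigr => a _ do rewrite mulr_suml.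
  rewrite exchange_big -big_split; apply: eq_bigr => m _ /=.
  rewrite {1}(rq_dec (z m)) mulrDr; congr (_ + _).
  rewrite (bigID (fun a => tgt a == l)) /= [X in _ + X]big1 ?addr0 => [|a ne]; last first.
    by rewrite (wt_rq0 (wz m)) ?mul0r.
  by rewrite mulr_sumr; apply: eq_bigr => a _; rewrite mulrA.
have eE : e b = \sum_(a | tgt a == l) rq a (e b) * ltr a.
  rewrite {1}(rq_dec (e b)) (_ : e b [::] = 0); last by apply: he.
  rewrite scale0r add0r (bigID (fun a => tgt a == l)) /= [X in _ + X]big1 ?addr0 // => a ne.
  by rewrite (wt_rq0 (we b)) ?mul0r.
have -> : \sum_(a | tgt a == l) (@img k V Q D (fun m => rq a (z m)) b + rq a (e b)) * ltr a =
    \sum_(a | tgt a == l) @img k V Q D (fun m => rq a (z m)) b * ltr a + e b.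
  by rewrite {2}eE -big_split; apply: eq_bigr => a _; rewrite mulrDl.
rewrite opprD addrA -[y b - _ - _]addrA -opprD -eZ /e !opprB.
by rewrite addrCA -[X in _ + (_ + X)]opprB subrr addr0.
Qed.

(** Subtract an approximate preimage: the rest is long, so that its right quotients by the
    arrows are again relations, and a recursion over words adds up to an exact preimage. *)
Lemma lift_exact l y : wtv l y -> aug g y = 0 ->
  exists2 z, wtv l z & forall b, jid S (tag b) l (y b - @img k V Q D z b).
Proof.
move=> wy y0; have [z0 [y' hs]] := lift_step.
pose Z := fix Z (w : seq (arr Q)) (t : T) : Tn D -> k := if w is a :: w' then
  (if tgt a == t.1 then Z w' (src a, y' t a) else fun=> 0) else z0 t.
pose zeta t m : K := fun s => Z (rev s) t m.
have z_rq t m a : rq a (zeta t m) = if tgt a == t.1 then zeta (src a, y' t a) m else 0.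
  by apply: serP => s; rewrite /rq /zeta rev_rcons /=; case: eqP.
have wz t : ok t -> wtv t.1 (zeta t).
  move=> ht m s; elim/last_ind: s t ht => [|s a IH] t ht; first by move=> /= ne; have [h _ _] := hs t ht; apply: h.
  rewrite walk_rcons negb_and -[zeta t m _]/(rq a (zeta t m) s) z_rq.
  case: eqP => // e; rewrite orbF => ns; apply: IH => //.
  by have [_ h _] := hs t ht; apply: h.
have key N t : ok t -> forall b, exists2 J, jid S (tag b) t.1 J &
    ord N (t.2 b - @img k V Q D (zeta t) b - J).
  elim: N t => [|N IH] t ht b; first by exists 0 => //; apply: jid0.
  have [h1 h2 h3] := hs t ht.
  have /choice [J hJ] a : exists J, jid S (tag b) t.1 J /\ (tgt a = t.1 ->
      ord N.+1 ((y' t a b - @img k V Q D (zeta (src a, y' t a)) b) * ltr a - J)).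
    have [e|ne] := eqVneq (tgt a) t.1; last by exists 0; split; [apply: jid0 | move=> e; rewrite e eqxx in ne].
    have [J j1 j2] := IH _ (h2 a e) b; exists (J * ltr a); split=> [|_].
      by apply: jidMr j1; rewrite -e; apply: wt_ltr.
    by rewrite -mulrBl -addn1; apply: ordM => //; apply: ord_ltr.
  set A := t.2 b - \sum_m dm m b * (z0 t m)%:A - \sum_(a | tgt a == t.1) y' t a b * ltr a.
  exists (A + \sum_(a | tgt a == t.1) J a).
    by apply: jidD; [apply: h3 | apply: jid_sum => a _; case: (hJ a)].
  have eZ : @img k V Q D (zeta t) b = \sum_m dm m b * (z0 t m)%:A +
      \sum_(a | tgt a == t.1) @img k V Q D (zeta (src a, y' t a)) b * ltr a.
    rewrite /img; under [X in _ + X]eq_bigr => a _ do rewrite mulr_suml.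
    rewrite exchange_big -big_split; apply: eq_bigr => m _ /=.
    rewrite {1}(rq_dec (zeta t m)) mulrDr; congr (_ + _).
    rewrite mulr_sumr [RHS]big_mkcond; apply: eq_bigr => a _; rewrite z_rq.
    by case: eqP => _; rewrite ?mul0r ?mulr0 ?mulrA.
  have -> : t.2 b - @img k V Q D (zeta t) b - (A + \sum_(a | tgt a == t.1) J a) =
      \sum_(a | tgt a == t.1) ((y' t a b - @img k V Q D (zeta (src a, y' t a)) b) * ltr a - J a).
    rewrite eZ sumrB; under [in RHS]eq_bigr => a _ do rewrite mulrBl.
    by rewrite sumrB /A subr_regroup.
  by apply: ord_sum => a /eqP e; case: (hJ a) => _; apply.
exists (zeta (l, y)); first exact: (wz (l, y)).
move=> b; apply: jid_closed => [|N]; last by have [J j1 j2] := @key N (l, y) (conj wy y0) b; exists J.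
by apply: wtB; [apply: wy | apply: (wtv_img (wz (l, y) (conj wy y0)))].
Qed.

End Lift.

(** * The module generated by the new vertex *)

Section Ret.
Variables (k : fieldType) (V : finType) (Qb : quiver (option V)) (Sb : potential k Qb).
Variables (N : rep k Qb).
Hypotheses (gN : good N) (kN : killed N Sb) (noloop : loopless Qb).
Hypothesis onto : forall w, onto_at N (Some w).
Hypothesis exactN : forall w, exact_at Sb N (Some w).
Variable nv : rsp N.
Hypotheses (vnv : vt (M := N) None nv) (nv0 : nv != 0).
Hypothesis span : forall x, vt (M := N) None x -> exists c, x = c *: nv.
Hypothesis into0 : forall c x, tgt c = None -> rarr N c x = 0.
Notation K := (ser k (arr Qb)).

Fixpoint radp n (x : rsp N) : Prop := if n is n'.+1 then
  exists2 y : arr Qb -> rsp N, (forall a, radp n' (y a)) & x = \sum_a rarr N a (y a) else True.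
Lemma radp_fil n d x : (forall y, fil (M := N) d y) -> radp n x -> fil (M := N) (d - n) x.
Proof.
move=> hd; elim: n x => [|n IH] x; first by rewrite subn0.
case=> y hy ->; apply: fil_sum => a _; rewrite subnS.
have := IH _ (hy a); case: (d - n)%N => [|m] h; last exact: fil_arr.
by rewrite (fil0 h) linear0; apply: fil_0.
Qed.

Lemma gen_all i x : vt (M := N) i x -> exists2 X : K, wt None i X & x = ev N X nv.
Proof.
have key n w y : vt (M := N) (Some w) y -> exists2 X : K, wt None (Some w) X & radp n (y - ev N X nv).
  elim: n w y => [|n IH] w y hy; first by exists 0.
  have [z tz ->] := onto hy.
  have /choice [X hX] a : exists X : K, wt None (src a) X /\ radp n (z a - ev N X nv).
    case e : (src a) (tz a) => [p|] hz.
      by have [X h1 h2] := IH _ _ hz; exists X.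
    have [c ec] := span hz; exists (c%:A); split; first by apply/wtZ/wt1.
    rewrite evZE (ev_1 gN) -ec subrr.
    by elim: (n) => // n' IH'; exists (fun=> 0) => //; rewrite big1 // => a' _; rewrite linear0.
  exists (\sum_(a | tgt a == Some w) X a * ltr a).
    by apply: wt_sum => a /eqP <-; apply: wtM (hX a).1 (@wt_ltr _ _ _ a).
  exists (fun a => if tgt a == Some w then z a - ev N (X a) nv else 0).
    move=> a; case: ifP => _; first by case: (hX a).
    by elim: (n) => // n' IH'; exists (fun=> 0) => //; rewrite big1 // => a' _; rewrite linear0.
  rewrite ev_sum -sumrB big_mkcond; apply: eq_bigr => a _.
  by case: ifP => _; rewrite ?linear0 // linearB (ev_mul gN) (ev_ltr gN).
case: i => [w|] hx; last first.
  by have [c ->] := span hx; exists (c%:A); [apply/wtZ/wt1 | rewrite evZE (ev_1 gN)].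
have [X h1 h2] := key (\dim {: rsp N}) _ _ hx; exists X => //.
have := radp_fil (filP gN) h2; rewrite subnn => /fil0 /eqP.
by rewrite subr_eq0 => /eqP.
Qed.

(** A series [x] from [v] that kills the generator is peeled from the right.  Exactness at the
    end vertex of [x] writes the values of its right quotients by the second derivatives;
    lifting the coefficients to series shows that [x] is a combination of derivatives plus
    relations followed by an arrow, and one iterates. *)
Lemma ret n w X : wt None (Some w) X -> ev N X nv = 0 ->
  exists2 J, jid Sb None (Some w) J & forall b, src b = None -> ord n (rese (lq b (X - J))).
Proof.
elim: n w X => [|n IH] w X wX X0; first by exists 0 => //; apply: jid0.
have nilX (Y : K) : wt None (Some w) Y -> Y [::] = 0 by move=> wY; apply: (wt_nil wY).
have sumX (Y : K) : wt None (Some w) Y -> Y = \sum_(a | tgt a == Some w) rq a Y * ltr a.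
  move=> wY; rewrite {1}(rq_dec Y) nilX // scale0r add0r (bigID (fun a => tgt a == Some w)) /=.
  by rewrite [X in _ + X]big1 ?addr0 // => a ne; rewrite (wt_rq0 wY) ?mul0r.
have ty : tyin (M := N) (fun a => if tgt a == Some w then ev N (rq a X) nv else 0).
  by move=> a; case: eqP => [e|_]; [apply: (vt_ev gN (wt_rq (a := a) wX) vnv) | apply: vt0].
have hx := exactN (w := w); have [|z tz hz] := hx _ ty.
  rewrite -[RHS]X0 {2}(sumX X wX) ev_sum; apply: eq_bigr => a ->.
  by rewrite (ev_mul gN) (ev_ltr gN).
have /choice [Z hZ] c : exists Z : K, wt None (tgt c) Z /\ z c = ev N Z nv.
  by have [Z h1 h2] := gen_all (tz c); exists Z.
pose J0 := \sum_(c | src c == Some w) Z c * cder (potS Sb) c.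
have j0 : jid Sb None (Some w) J0.
  apply: jid_sum => c /eqP <-; apply: jidMl (hZ c).1 _; exact: jid_gen.
have wX' : wt None (Some w) (X - J0) by apply: wtB => //; apply: jid_wt j0.
have ev0 a : tgt a = Some w -> ev N (rq a (X - J0)) nv = 0.
  move=> e; rewrite -[X - J0]/(X + - J0) rqD rqN evDE evNE; apply/eqP; rewrite subr_eq0; apply/eqP.
  have := hz a e; rewrite e eqxx => ->; rewrite /gam rq_sum ev_sum; apply: eq_bigr => c _.
  rewrite rq_mul (ord1P _).1 ?scale0r ?addr0; last exact: (jid_ord1 noloop (jid_gen Sb c)).
  by rewrite (ev_mul gN) -(hZ c).2.
have /choice [J hJ] a : exists J, jid Sb None (Some w) J /\ (tgt a = Some w ->
    forall b, src b = None -> ord n.+1 (rese (lq b (rq a (X - J0) * ltr a - J)))).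
  have [e|ne] := eqVneq (tgt a) (Some w); last first.
    by exists 0; split; [apply: jid0 | move=> e; rewrite e eqxx in ne].
  have wa := wt_rq (a := a) wX'.
  case es : (src a) wa => [p|] wa.
    have [J j1 j2] := IH _ _ wa (ev0 a e); exists (J * ltr a); split=> [|_ b sb].
      by apply: jidMr j1; rewrite -e -es; apply: wt_ltr.
    rewrite -mulrBl lq_mul (wt_nil (wtB wa (jid_wt j1))) // scale0r add0r /rese resM -addn1.
    by apply: ordM; [apply: j2 | apply: res_ord; apply: ord_ltr].
  exists 0; split; first exact: jid0.
  move=> _ b sb; rewrite subr0 lq_mul.
  have c0 : rq a (X - J0) [::] = 0.
    apply/eqP; have := ev0 a e; rewrite (ev_rdec gN) big1 ?addr0 => [/eqP|c _].
      by rewrite scaler_eq0 (negbTE nv0) orbF.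
    have [ec|ne] := eqVneq (tgt c) None; first exact: into0.
    by rewrite (wt_rq0 wa ne) ev0E linear0.
  rewrite c0 scale0r add0r.
  have -> : rese (lq b (rq a (X - J0)) * ltr a) = rese (lq b (rq a (X - J0))) * rese (ltr a) by apply: resM.
  rewrite (rese_to0 (wt_lq (a := b) wa)) ?mul0r //.
  apply: (wt_nil (wt_lq (a := b) wa)); apply/eqP => eb.
  have : b \in [pred b | (src b == None) && (tgt b == None)] by rewrite inE sb eb.
  have := noloop None; case: (b) sb eb => -[i j] b0; rewrite /src /tgt /= => ei ej; subst i j.
  by move/card0_eq/(_ b0).
exists (J0 + \sum_(a | tgt a == Some w) J a).
  by apply: jidD => //; apply: jid_sum => a _; case: (hJ a).
move=> b sb; rewrite opprD addrA {1}(sumX _ wX') -sumrB lq_sum /rese res_sum.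
by apply: ord_sum => a /eqP e; case: (hJ a) => _; apply.
Qed.

End Ret.

(** * The presentation attached to the new vertex *)

Section Vertex.
Variables (k : fieldType) (V : finType) (Qb : quiver (option V)) (Sb : potential k Qb).
Variables (R : red_data k Qb).
Hypotheses (red : is_reduction Sb R) (noloop : loopless Qb).
Variables (N : rep k Qb).
Hypotheses (gN : good N) (kN : killed N Sb).
Hypothesis onto : forall w, onto_at N (Some w).
Hypothesis exactN : forall w, exact_at Sb N (Some w).
Variable nv : rsp N.
Hypotheses (vnv : vt (M := N) None nv) (nv0 : nv != 0).
Hypothesis span : forall x, vt (M := N) None x -> exists c, x = c *: nv.
Hypothesis into0 : forall c x, tgt c = None -> rarr N c x = 0.
Variables (M : rep k (restr Qb)) (la : 'Hom(rsp M, rsp N)).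
Hypothesis gM : good M.
Hypothesis kM : killed M (restr_pot Sb).
Hypothesis la_inj : forall m, la m = 0 -> m = 0.
Hypothesis la_vt : forall i m, la (ridem M i m) = ridem N (Some i) (la m).
Hypothesis la_none : forall m, ridem N None (la m) = 0.
Hypothesis la_onto : forall i x, vt (M := N) (Some i) x -> exists m, x = la m.
Hypothesis la_arr : forall a m, la (rarr M a m) = rarr N (emb a) (la m).

Notation Q1 := (Qr R).
Notation S1 := (Sr R).
Notation Dv := (vertex_pres S1).
Notation NR := (pull_rep (@Gl _ _ _ R) N).
Notation MR := (pull_rep (sig (R := R)) M).
Let oGl := ohom_Gl red.
Let osig := ohom_sig red.
Let nl1 := loopless_r red noloop.
Let gNR : good NR := good_pull oGl gN.
Let gMR : good MR := good_pull osig gM.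
Let kNR : killed NR S1 := killed_pull oGl gN kN (jid_Gl red).
Let kMR : killed MR (restr_pot S1) := killed_pull osig gM kM (jid_sig red noloop).

Definition pb (b : Tp Dv) : arr Q1 := @mkarr (option V) Q1 None (Some (tag b)) (tagged b).
Definition nb (m : Tn Dv) : arr Q1 := @mkarr (option V) Q1 (Some (tag m)) None (tagged m).

Lemma un_emb (s : seq (arr (restr Q1))) : un (map (@emb_brk V Q1) s) = map (@emb V Q1) s.
Proof. by elim: s => //= c s IH; rewrite /un /= -/(un _) IH. Qed.

Lemma dm_vertex (m : Tn Dv) (b : Tp Dv) : dm m b = rese (lq (pb b) (cder (potS S1) (nb m))).
Proof.
have w : wt (Some (tag b)) (Some (tag m)) (lq (pb b) (cder (potS S1) (nb m))).
  rewrite lq_cder; exact: (wt_rq (a := nb m) (@wt_cder _ _ _ S1 (pb b))).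
apply: tos_eq => [|s]; first exact: wt_rese w.
transitivity (tos (cderiv (brk_pot None S1) (barr (tagged m) (tagged b))) (map (@emb_brk V Q1) (val s))) => //.
rewrite cder_pot -[barr _ _]/(abr (existT (fun i => Q1 i None : Type) (Some (tag m)) (tagged m))
  (existT (fun i => Q1 None i : Type) (Some (tag b)) (tagged b))) cder_brk_br.
by rewrite /sub un_emb lq_cder.
Qed.

Lemma from_none (a : arr Q1) : src a = None -> exists b, a = pb b.
Proof.
case: a => -[i [j|]] c; rewrite /src /= => e; subst i; first by exists (existT _ j c).
by have /card0_eq/(_ c) := nl1 None.
Qed.
Lemma pb_inj : injective pb.
Proof.
move=> [i a] [j b] e; have /= [ij] : Some i = Some j := congr1 (@tgt _ Q1) e.
by subst j; congr existT; apply: (eq_from_Tagged e).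
Qed.
Lemma nb_inj : injective nb.
Proof.
move=> [i a] [j b] e; have /= [ij] : Some i = Some j := congr1 (@src _ Q1) e.
by subst j; congr existT; apply: (eq_from_Tagged e).
Qed.
Lemma sum_pb (X : zmodType) (F : arr Q1 -> X) : \sum_(a | src a == None) F a = \sum_b F (pb b).
Proof.
have h b : [pick x | pb x == b] = if src b == None then [pick x | pb x == b] else None.
  by case: eqP => // ne; case: pickP => // x /eqP e; case: ne; rewrite -e.
rewrite (reindex_omap pb (fun a => [pick x | pb x == a])) => [|a /eqP e].
  apply: eq_bigl => b; rewrite eqxx /=; case: pickP => [x /eqP/pb_inj ->|/(_ b)]; rewrite ?eqxx //.
have [b ->] := from_none e.
by case: pickP => [x /eqP e'|/(_ b)]; [rewrite /= e' | rewrite eqxx].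
Qed.

Lemma into0R c x : tgt c = None -> rarr NR c x = 0.
Proof.
move=> e; rewrite pull_arr; have w := sh_wt (oh_s oGl) (i := src c) (j := tgt c) (ltr c).
rewrite (ev_rdec gN) (oh_ord oGl (n := 1) (@wt_ltr _ _ _ c) (@ord_ltr _ _ c)) // scale0r add0r.
rewrite big1 // => a _; have [ea|ne] := eqVneq (tgt a) None; first exact: into0.
by rewrite (wt_rq0 w) ?ev0E ?linear0 // e.
Qed.

Lemma vt_la i m : vt (M := M) i m -> vt (M := N) (Some i) (la m).
Proof. by rewrite /vt -la_vt => ->. Qed.

Lemma unemb_none (Q : quiver (option V)) (b : arr Q) : unemb b = None -> src b = None \/ tgt b = None.
Proof. by case: b => -[[i|] [j|]] c // _; [right | left | left]. Qed.

Lemma la_other b m : unemb b = None -> rarr N b (la m) = 0.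
Proof.
case/unemb_none => e; last exact: into0.
by rewrite -(arr_src gN b) e la_none linear0.
Qed.

Lemma ev_laN x m : ev N x (la m) = la (ev M (rese x) m).
Proof.
apply: (ev_res (de := @unemb V Qb)) => //; [exact: embK | exact: unembK | exact: la_other].
Qed.

Lemma la_arrR a m : la (rarr MR a m) = rarr NR (emb a) (la m).
Proof.
rewrite !pull_arr -la_vt ev_laN; congr (la (ev M _ _)).
by rewrite /sig /bar /exte (ext_ltr _ (@embK _ _) (@unembK _ _)).
Qed.

Lemma la_otherR b m : unemb b = None -> rarr NR b (la m) = 0.
Proof.
case/unemb_none => e; last exact: into0R.
by rewrite pull_arr e la_none linear0.
Qed.

Lemma ev_laR x m : ev NR x (la m) = la (ev MR (rese x) m).
Proof.
exact: (@ev_res k V _ (restr Q1) Q1 (@emb V Q1) (@unemb V Q1) (@embK V Q1) (@unembK V Q1) MR NR la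
  gMR gNR la_arrR la_otherR x m).
Qed.

Lemma gen_ex : exists gen : Tp Dv -> rsp M, forall b, vt (M := M) (tag b) (gen b) /\ la (gen b) = rarr NR (pb b) nv.
Proof.
suff /choice [gen h] : forall b, exists m, vt (M := M) (tag b) m /\ la m = rarr NR (pb b) nv by exists gen.
move=> b; have h : vt (M := N) (Some (tag b)) (rarr NR (pb b) nv) by apply: (arr_tgt gNR (pb b)).
have [m em] := la_onto h; exists (ridem M (tag b) m); split; first exact: (idem_vt gM).
by rewrite la_vt -em h.
Qed.

Section Gen.
Variable gen : Tp Dv -> rsp M.
Hypothesis vgen : forall b, vt (M := M) (tag b) (gen b).
Hypothesis lgen : forall b, la (gen b) = rarr NR (pb b) nv.

(** Every path from the new vertex starts with one of the generators. *)
Lemma ev_nvR l X : wt None (Some l) X -> ev NR X nv = la (aug (M := MR) gen (fun b => rese (lq (pb b) X))).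
Proof.
move=> wX; rewrite (ev_rec gNR) (wt_nil wX) // scale0r add0r.
transitivity (\sum_(a | src a == None) ev NR (lq a X) (rarr NR a nv)).
  rewrite [RHS]big_mkcond; apply: eq_bigr => a _; case: eqP => // /eqP ne.
  by rewrite (wt_lq0 wX ne); exact: (@ev0E _ _ _ NR (rarr NR a nv)).
rewrite (sum_pb (fun a => ev NR (lq a X) (rarr NR a nv))) linear_sum; apply: eq_bigr => b _.
by rewrite -lgen; apply: ev_laR.
Qed.

Lemma aug_img_vertex l z : wtv l z -> aug (M := MR) gen (@img _ _ _ Dv z) = 0.
Proof.
move=> wz; rewrite (_ : @img _ _ _ Dv z = fun b => \sum_m dm m b * z m) //.
transitivity (\sum_m aug (M := MR) gen (fun b => dm m b * z m)); first exact: aug_sum.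
apply: big1 => m _.
transitivity (ev MR (z m) (aug (M := MR) gen (fun b => dm m b))); first by apply: augM.
rewrite (_ : aug _ _ = 0) ?linear0 //; apply: la_inj.
rewrite (_ : (fun b => dm m b) = fun b => rese (lq (pb b) (cder (potS S1) (nb m)))).
  rewrite -(ev_nvR (l := tag m)); last exact: (@wt_cder _ _ _ S1 (nb m)).
  by apply: kNR.
by apply: funext => b; apply: dm_vertex.
Qed.

Lemma vertex_onto l x : vt (M := M) l x -> exists2 y, wtv l y & x = aug (M := MR) gen y.
Proof.
move=> hx; have [X wX eX] := gen_all gN onto span (vt_la hx).
have wY : wt None (Some l) (Fl (R := R) None (Some l) X) by apply: (sh_wt (oh_s (ohom_Fl red))).
exists (fun b => rese (lq (pb b) (Fl (R := R) None (Some l) X))).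
  by move=> b; apply: wt_rese; apply: (wt_lq (a := pb b) wY).
apply/eqP; rewrite -subr_eq0; apply/eqP/la_inj; rewrite linearB /= -(ev_nvR wY).
apply/eqP; rewrite subr_eq0; apply/eqP; rewrite eX (ev_pull oGl gN wY vnv).
apply/eqP; rewrite eq_sym -subr_eq0 -evBE; apply/eqP.
exact: (jid_ev0 gN kN (jid_GlFl red wX) vnv).
Qed.

Lemma jid_vertex n l J : jid S1 None (Some l) J -> exists z j, [/\ wtv l z,
  forall b : Tp Dv, jid (restr_pot S1) (tag b) l (j b) &
  forall b, ord n (rese (lq (pb b) J) - @img _ _ _ Dv z b - j b)].
Proof.
case=> wJ /(_ n.+1) [t ht].
pose TT := {a : arr Q1 & (pser k Q1 None (tgt a) * pser k Q1 (src a) (Some l))%type}.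
pose L (x : TT) : ser k (arr Q1) := tos (tagged x).1.
pose Rr (x : TT) : ser k (arr Q1) := tos (tagged x).2.
pose C (x : TT) := cder (potS S1) (tag x).
have wL x : wt None (tgt (tag x)) (L x) by apply: wt_tos.
have wR x : wt (src (tag x)) (Some l) (Rr x) by apply: wt_tos.
exists (fun m => \sum_(x <- t) (if tag x == nb m then L x [::] *: rese (Rr x) else 0)).
exists (fun b => \sum_(x <- t) rese (lq (pb b) (L x)) * rese (C x) * rese (Rr x)).
split.
- move=> m; apply: wt_sum => x _; case: eqP => [e|_]; last exact: wt0.
  by apply/wtZ/wt_rese; have := wR x; rewrite e.
- move=> b; apply: jid_sum => x _.
  have wl := wt_lq (a := pb b) (wL x); have wr := wR x.
  have := @jid_gen _ _ _ S1 (tag x).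
  case et : (tgt (tag x)) wl => [p|] wl; last first.
    by move=> _; rewrite (rese_to0 wl) ?mul0r ?(wt_nil wl) //; apply: jid0.
  case es : (src (tag x)) wr => [q|] wr; last first.
    by move=> _; rewrite (rese_from0 wr) ?mulr0 ?(wt_nil wr) //; apply: jid0.
  move=> hj; apply: jidMr (wt_rese wr) _; apply: jidMl (wt_rese wl) _.
  exact: jid_rese hj.
move=> b.
have eI : @img _ _ _ Dv (fun m => \sum_(x <- t) (if tag x == nb m then L x [::] *: rese (Rr x) else 0)) b =
    \sum_(x <- t) L x [::] *: (rese (lq (pb b) (C x)) * rese (Rr x)).
  rewrite /img; under eq_bigr => m _ do rewrite mulr_sumr.
  rewrite exchange_big; apply: eq_bigr => x _ /=.
  have [e|ne] := eqVneq (tgt (tag x)) None; last first.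
    rewrite (wt_nil (wL x)) 1?eq_sym // !scale0r big1 // => m _.
    by rewrite if_same mulr0.
  have [m em] : exists m, tag x = nb m.
    case: (tag x) e => -[[i|] j] c; rewrite /tgt /= => e; subst j; first by exists (existT _ i c).
    by have /card0_eq/(_ c) := nl1 None.
  rewrite (bigD1 m) //= em eqxx big1 ?addr0 => [|m' ne]; last first.
    by rewrite (inj_eq nb_inj) eq_sym (negbTE ne) mulr0.
  by rewrite dm_vertex -scalerAr /C em.
have -> : rese (lq (pb b) J) - @img _ _ _ Dv (fun m => \sum_(x <- t) (if tag x == nb m then L x [::] *: rese (Rr x) else 0)) b -
    \sum_(x <- t) rese (lq (pb b) (L x)) * rese (C x) * rese (Rr x) =
    rese (lq (pb b) (J - \sum_(x <- t) L x * C x * Rr x)).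
  rewrite -[J - _]/(J + - _) lqD lqN -[RHS]/(rese (lq (pb b) J) - rese (lq (pb b) (\sum_(x <- t) L x * C x * Rr x))).
  rewrite -addrA -opprD eI; congr (_ - _); rewrite lq_sum /rese res_sum -big_split; apply: eq_bigr => x _ /=.
  have c0 : C x [::] = 0 by apply/ord1P; apply: (jid_ord1 nl1 (jid_gen S1 (tag x))).
  have -> : lq (pb b) (L x * C x * Rr x) =
      L x [::] *: (lq (pb b) (C x) * Rr x) + lq (pb b) (L x) * (C x * Rr x).
    by rewrite -mulrA lq_mul lq_mul c0 scale0r add0r.
  by rewrite -[RHS]/(L x [::] *: res _ _ + res _ _) !resM mulrA.
by apply: res_ord; apply: ord_lq; apply: ht.
Qed.

Lemma ret_stable n l X : wt None (Some l) X -> (forall b, src b = None -> ord n (rese (lq b X))) ->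
  forall b, src b = None -> ord n (rese (lq b (Fl (R := R) None (Some l) X))).
Proof.
move=> wX hX b sb; have oFl := ohom_Fl red; rewrite (sh_dec (oh_s oFl) wX) /= add0r lq_sum /rese res_sum.
apply: ord_sum => a /eqP sa.
have wa := @wt_ltr k _ _ a; rewrite lq_mul.
have -> : Fl (R := R) None (tgt a) (ltr a) [::] = 0.
  by apply: (oh_ord oFl (n := 1)) => //; [rewrite -sa | apply: ord_ltr].
rewrite scale0r add0r resM; apply: ordMl.
have wl := wt_lq (a := a) wX; have hl := hX a sa.
case et : (tgt a) wl => [p|] wl; last first.
  move: noloop; case: (a) sa et => -[i j] c; rewrite /src /tgt /= => ei ej; subst i j.
  by move/(_ None)/card0_eq/(_ c).
rewrite -/(rese _) -(bar_rese noloop oFl wl).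
by apply: (oh_ord (ohom_bar oFl)) => //; apply: wt_rese.
Qed.

(** A relation between the generators is a series from the new vertex that kills [nv]; by [ret]
    it lies in the Jacobian ideal up to returning paths, and the derivatives at the arrows into
    [v] are the columns of [d_v]. *)
Lemma vertex_exact : exact_pres (restr_pot S1) (M := MR) (D := Dv) gen.
Proof.
split; [exact: vgen | exact: vertex_onto |].
move=> l y wy; split=> [y0|[z wz hz]]; last first.
  have e0 : aug (M := MR) gen (fun b => y b - @img _ _ _ Dv z b) = 0.
    by apply: big1 => b _; apply: (jid_ev0 gMR kMR (hz b) (vgen b)).
  have eB : aug (M := MR) gen (fun b => y b - @img _ _ _ Dv z b) =
    aug (M := MR) gen y - aug (M := MR) gen (@img _ _ _ Dv z) by exact: augB.
  by move: e0; rewrite eB; move: (aug_img_vertex wz) => ->; rewrite subr0.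
apply: (lift_exact gMR _ aug_img_vertex wy y0) => {l y wy y0} l y wy y0.
set n := (\dim {: rsp MR}).+1.
pose Y := \sum_b ltr (pb b) * exte (y b).
have wY : wt None (Some l) Y.
  by apply: wt_sum => b _; apply: (wtM (@wt_ltr _ _ _ (pb b))); apply: wt_exte (wy b).
have lY b : rese (lq (pb b) Y) = y b.
  rewrite lq_sum (bigD1 b) //= lq_ltrM eqxx mul1r big1 ?addr0 ?rese_exte // => b' ne.
  by rewrite lq_ltrM (inj_eq pb_inj) eq_sym (negbTE ne) mul0r.
pose X := Gl (R := R) None (Some l) Y.
have wX : wt None (Some l) X by apply: (sh_wt (oh_s oGl)).
have X0 : ev N X nv = 0.
  rewrite -(ev_pull oGl gN wY vnv) (ev_nvR wY) (_ : (fun b => rese (lq (pb b) Y)) = y) ?y0 ?linear0 //.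
  by apply: funext.
have [J jJ hJ] := ret gN noloop onto exactN vnv nv0 span into0 n wX X0.
have [z [j [wz hj hz]]] := jid_vertex n (jid_Fl red jJ).
exists z, j; split=> // b.
have eY : Y = Fl (R := R) None (Some l) J + Fl (R := R) None (Some l) (X - J).
  rewrite -(shD (oh_s (ohom_Fl red))) ?(addrC J) ?subrK ?(FlGl red wY) //; first exact: jid_wt jJ.
  by apply: wtB => //; apply: jid_wt jJ.
have wXJ : wt None (Some l) (X - J) by apply: wtB => //; apply: jid_wt jJ.
have yb : y b = rese (lq (pb b) (Fl (R := R) None (Some l) J)) +
    rese (lq (pb b) (Fl (R := R) None (Some l) (X - J))) by rewrite -[LHS]lY {1}eY lqD.
rewrite yb (addrAC _ (rese _)) (addrAC _ (rese _)).
by apply: ordD; [apply: hz | apply: ret_stable].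
Qed.

End Gen.

End Vertex.

(** * Counting summands *)

Section Numerics.
Variables (k : fieldType) (V : finType) (Qb : quiver (option V)) (Sb : potential k Qb).
Variables (N : rep k Qb).
Hypotheses (gN : good N) (kN : killed N Sb) (noloop : loopless Qb).
Hypothesis onto : forall w, onto_at N (Some w).
Hypothesis exactN : forall w, exact_at Sb N (Some w).
Variable nv : rsp N.
Hypotheses (vnv : vt (M := N) None nv) (nv0 : nv != 0).
Hypothesis span : forall x, vt (M := N) None x -> exists c, x = c *: nv.
Hypothesis into0 : forall c x, tgt c = None -> rarr N c x = 0.
Variables (M : rep k (restr Qb)) (la : 'Hom(rsp M, rsp N)).
Hypothesis gM : good M.
Hypothesis kM : killed M (restr_pot Sb).
Hypothesis la_inj : forall m, la m = 0 -> m = 0.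
Hypothesis la_vt : forall i m, la (ridem M i m) = ridem N (Some i) (la m).
Hypothesis la_onto : forall i x, vt (M := N) (Some i) x -> exists m, x = la m.
Hypothesis la_arr : forall a m, la (rarr M a m) = rarr N (emb a) (la m).
Hypothesis ev_laN : forall x m, ev N x (la m) = la (ev M (rese x) m).
Variables (D : pres k (restr Qb)) (g : Tp D -> rsp M).
Hypotheses (ex : exact_pres (restr_pot Sb) g) (mc : min_conds (restr_pot Sb) g).
Variable i : V.

Notation Nn := (Qb (Some i) None).
Notation P := (Qb None (Some i)).
Definition inn (m : Nn) : arr Qb := @mkarr (option V) Qb (Some i) None m.
Definition outn (b : P) : arr Qb := @mkarr (option V) Qb None (Some i) b.

Lemma nl_restr : loopless (restr Qb). Proof. by move=> j; apply: noloop. Qed.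

Lemma sum_in_i (X : zmodType) (F : arr Qb -> X) : \sum_(e | tgt e == Some i) F e =
  \sum_(a : arr (restr Qb) | tgt a == i) F (emb a) + \sum_b F (outn b).
Proof.
rewrite big_mkcond sum_sig.
pose G p q := if q == Some i then \sum_(b : Qb p q) F (@mkarr _ Qb p q b) else 0.
transitivity (\sum_(ij : option V * option V) G ij.1 ij.2).
  by apply: eq_bigr => -[p q] _; rewrite /G /tgt /=; case: eqP => // _; rewrite big1.
rewrite -(pair_bigA _ G) /= /G.
under eq_bigr => p _ do rewrite -big_mkcond big_pred1_eq.
rewrite sum_option addrC; congr (_ + _).
rewrite [RHS]big_mkcond sum_sig.
pose G' p q := if q == i then \sum_(b : Qb (Some p) (Some q)) F (@mkarr _ Qb (Some p) (Some q) b) else 0.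
transitivity (\sum_(pq : V * V) G' pq.1 pq.2); last first.
  by apply: eq_bigr => -[p q] _; rewrite /G' /tgt /=; case: eqP => // _; rewrite big1.
rewrite -(pair_bigA _ G') /= /G'.
by apply: eq_bigr => p _; rewrite -big_mkcond big_pred1_eq.
Qed.

Lemma emb_out (e : arr Qb) : tgt e = Some i -> (exists a, e = emb a /\ tgt a = i) \/ exists b, e = outn b.
Proof.
case: e => -[[p|] q] c; rewrite /tgt /= => e; subst q; last by right; exists c.
by left; exists (@mkarr V (restr Qb) p i c).
Qed.

Lemma la_vt' j m : vt (M := M) j m -> vt (M := N) (Some j) (la m).
Proof. by rewrite /vt -la_vt => ->. Qed.
Lemma la_pre j x : vt (M := N) (Some j) x -> exists2 m, vt (M := M) j m & x = la m.
Proof.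
move=> hx; have [m e] := la_onto hx; exists (ridem M j m); first exact: (idem_vt gM).
by rewrite la_vt -e.
Qed.

Lemma arr_ext (f : arr (restr Qb) -> rsp N) (o : P -> rsp N) (n : Nn -> rsp N) : exists F : arr Qb -> rsp N,
  [/\ forall a, F (emb a) = f a, forall b, F (outn b) = o b, forall m, F (inn m) = n m &
   forall e, (forall a, e <> emb a) -> (forall b, e <> outn b) -> (forall m, e <> inn m) -> F e = 0].
Proof.
have /choice [F hF] e : exists x, [/\ forall a, e = emb a -> x = f a, forall b, e = outn b -> x = o b,
    forall m, e = inn m -> x = n m &
    (forall a, e <> emb a) -> (forall b, e <> outn b) -> (forall m, e <> inn m) -> x = 0].
  have [[a ea]|h1] := pselect (exists a, e = emb a).
    exists (f a); split.
    - by move=> a' e'; congr f; apply: (pcan_inj (@embK V Qb)); rewrite -ea.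
    - by move=> b e'; have := congr1 (@src _ Qb) (etrans (esym ea) e').
    - by move=> b e'; have := congr1 (@tgt _ Qb) (etrans (esym ea) e').
    by move=> h; case: (h a).
  have [[b eb]|h2] := pselect (exists b, e = outn b).
    exists (o b); split.
    - by move=> a' e'; case: h1; exists a'.
    - by move=> b' e'; congr o; have := etrans (esym eb) e'; apply: eq_from_Tagged.
    - by move=> m e'; have := congr1 (@src _ Qb) (etrans (esym eb) e').
    by move=> _ h; case: (h b).
  have [[m em]|h3] := pselect (exists m, e = inn m).
    exists (n m); split.
    - by move=> a' e'; case: h1; exists a'.
    - by move=> b' e'; case: h2; exists b'.
    - by move=> m' e'; congr n; have := etrans (esym em) e'; apply: eq_from_Tagged.
    by move=> _ _ h; case: (h m).
  exists 0; split=> // x e'; [case: h1 | case: h2 | case: h3]; by exists x.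
exists F; split=> [a|b|m|e h1 h2 h3].
- by case: (hF (emb a)) => h _ _ _; apply: h.
- by case: (hF (outn b)) => _ h _ _; apply: h.
- by case: (hF (inn m)) => _ _ h _; apply: h.
by case: (hF e) => _ _ _; apply.
Qed.

Lemma gam_la (z : arr Qb -> rsp N) (y : arr (restr Qb) -> rsp M) a :
  (forall c, z (emb c) = la (y c)) -> (forall m, z (inn m) = 0) ->
  gam Sb (Some i) z (emb a) = la (gam (restr_pot Sb) i y a).
Proof.
move=> h1 h2; rewrite /gam (bigID (fun c => tgt c == None)) /= big1 ?add0r; last first.
  move=> c /andP[/eqP e1 /eqP e2]; rewrite (_ : z c = 0) ?linear0 //.
  by case: c e1 e2 => -[p q] c; rewrite /src /tgt /= => e1 e2; subst p q; apply: (h2 c).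
rewrite linear_sum /= (reindex_omap (@emb V Qb) (@unemb V Qb)) => [|c]; last first.
  by case: c => -[[p|] [q|]] c; rewrite /src /tgt //= ?andbF.
apply: eq_big => [c|c _]; last by rewrite h1 ev_laN cder_restr rq_res.
by rewrite embK /= eqxx !andbT.
Qed.

Lemma gam_out (z : arr Qb -> rsp N) b : tyout z -> (forall m, z (inn m) = 0) ->
  gam Sb (Some i) z (outn b) = 0.
Proof.
move=> tz h; apply: big1 => c /eqP sc.
have w := wt_rq (a := outn b) (@wt_cder _ _ _ Sb c).
case et : (tgt c) => [p|]; last first.
  rewrite (_ : z c = 0) ?linear0 //.
  by case: c sc et {w} => -[p q] c; rewrite /src /tgt /= => e1 e2; subst p q; apply: (h c).
rewrite (ev_rdec gN) (wt_nil w) ?et // scale0r add0r big1 // => e _.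
have [ee|ne] := eqVneq (tgt e) None; first exact: into0.
by rewrite (wt_rq0 w ne) ev0E linear0.
Qed.

Notation gD b := (g (existT (fun i => pos D i : Type) i b)).
Notation rD m := (relv g (existT (fun i => neg D i : Type) i m)).
Definition relA (c : {ffun pos D i -> k^o}) (x : {ffun P -> k^o}) := exists2 y : arr (restr Qb) -> rsp M, tyin y &
  la (\sum_(b : pos D i) c b *: gD b) + \sum_b x b *: rarr N (outn b) nv =
  la (\sum_(a | tgt a == i) rarr M a (y a)).
Definition relB (ze : {ffun Nn -> k^o}) (x : {ffun P -> k^o}) := exists z : arr Qb -> rsp N, [/\ tyout z,
  forall m, z (inn m) = ze m *: nv & forall b, gam Sb (Some i) z (outn b) = x b *: nv].
Definition relC (ze : {ffun Nn -> k^o}) (c : {ffun neg D i -> k^o}) := exists z : arr Qb -> rsp N, [/\ tyout z,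
  forall m, z (inn m) = ze m *: nv, forall b, gam Sb (Some i) z (outn b) = 0 &
  forall a : arr (restr Qb), tgt a = i -> gam Sb (Some i) z (emb a) =
    la (\sum_(m : neg D i) c m *: rD m a)].
Notation relZ := (@deco_rel k V Qb Sb N nv i).

Lemma lin_z c (z z' : arr Qb -> rsp N) : tyout z -> tyout z' -> tyout (fun e => c *: z e + z' e).
Proof. by move=> h h' e; apply: vtD; [apply: vtZ; apply: h | apply: h']. Qed.

Lemma vt_out b : vt (M := N) (Some i) (rarr N (outn b) nv).
Proof. exact: (arr_tgt gN (outn b)). Qed.

Lemma la_gen (c : {ffun pos D i -> k^o}) : vt (M := M) i (\sum_(b : pos D i) c b *: gD b).
Proof. by apply: vt_sum => b _; apply: vtZ; case: ex => h _ _; apply: (h (existT _ i b)). Qed.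

Lemma la_inj2 m m' : la m = la m' -> m = m'.
Proof.
by move=> e; apply/eqP; rewrite -subr_eq0; apply/eqP/la_inj; rewrite linearB /= e subrr.
Qed.

Lemma gen_free_i (c : {ffun pos D i -> k^o}) y : tyin (M := M) y ->
  \sum_(b : pos D i) c b *: gD b = \sum_(a | tgt a == i) rarr M a (y a) -> c = 0.
Proof.
move=> ty h; have [f hf] := fun_at (B := pos D) (fun b => c b : k).
apply/ffunP => b; rewrite ffunE -hf.
apply: (gen_free gM ex mc (y := fun a => - y a) (w := i) (c := f)) => //.
  by move=> a; apply: vtN; apply: ty.
rewrite sum_at; under eq_bigr => b' _ do rewrite hf.
rewrite h -big_split big1 // => a _ /=.
by rewrite linearN subrr.
Qed.

Lemma rel_free_i (c : {ffun neg D i -> k^o}) z : tyout (M := M) z ->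
  (forall a, tgt a = i -> \sum_(m : neg D i) c m *: rD m a = gam (restr_pot Sb) i z a) -> c = 0.
Proof.
move=> tz h; have [f hf] := fun_at (B := neg D) (fun b => c b : k).
apply/ffunP => b; rewrite ffunE -hf.
apply: (rel_free gM nl_restr ex mc (z := fun a => - z a) (w := i) (c := f)) => //.
  by move=> a; apply: vtN; apply: tz.
move=> a ea; rewrite sum_at; under eq_bigr => b' _ do rewrite hf.
rewrite (h a ea) /gam -big_split big1 // => c' _ /=.
by rewrite linearN subrr.
Qed.

Lemma in_dec (y : arr Qb -> rsp N) : tyin y -> exists (Y : arr (restr Qb) -> rsp M) (x : {ffun P -> k^o}),
  [/\ tyin Y, forall a, y (emb a) = la (Y a) & forall b, y (outn b) = x b *: nv].
Proof.
move=> ty; have /choice [Y hY] a : exists m, vt (M := M) (src a) m /\ y (emb a) = la m.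
  by have [m h1 h2] := la_pre (ty (emb a)); exists m.
have /choice [x hx] b : exists c, y (outn b) = c *: nv by apply: span; apply: (ty (outn b)).
exists Y, [ffun b => x b : k^o]; split=> [a|a|b]; rewrite ?ffunE //; by case: (hY a).
Qed.

Lemma rel_ker (m : neg D i) : \sum_(a | tgt a == i) rarr M a (rD m a) = 0.
Proof.
set t := existT _ i m.
transitivity (aug g (fun b => dm t b)).
  rewrite /relv /aug; under eq_bigr => a _ do rewrite linear_sum.
  rewrite exchange_big; apply: eq_bigr => b _ /=.
  rewrite (ev_rdec gM) (dm_nil ex mc) scale0r add0r [RHS](bigID (fun e => tgt e == i)) /=.
  rewrite [X in _ = _ + X]big1 ?addr0 // => e ne.
  by rewrite (wt_rq0 (@wt_dm _ _ _ D t b)) ?ev0E ?linear0.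
rewrite (_ : (fun b => dm t b) = @img k V (restr Qb) D (fun m' => (m' == t)%:R)).
  by apply: (aug_img ex (l := i)) => m'; case: eqP => [->|_]; [apply: wt1 | apply: wt0].
apply: funext => b; rewrite /img (bigD1 t) //= eqxx mulr1 big1 ?addr0 // => m' /negbTE ->.
by rewrite mulr0.
Qed.

(** The generators of a minimal presentation span a complement of the image of [alpha] for [M],
    and the arrows from [v] take the same values; [relA] compares the two. *)
Lemma numA (A : {vspace {ffun P -> k^o}}) :
  (forall x, x \in A <-> relA 0 x) -> (#|pos D i| + \dim A)%N = #|P|.
Proof.
move=> hA; have := @dim_rel k _ _ relA fullv 0%VS fullv A.
rewrite dimv0 addn0 !dimvf /dim /= !muln1 => -> //.
- by exists (fun=> 0); [move=> a; apply: vt0 | rewrite !big1 ?linear0 ?addr0 // => b _; rewrite ?ffunE ?scale0r ?linear0].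
- move=> c x y x' y' [z tz ez] [z' tz' ez']; exists (fun a => c *: z a + z' a).
    by move=> a; apply: vtD; [apply: vtZ; apply: tz | apply: tz'].
  have -> : \sum_(b : pos D i) (c *: x + x') b *: gD b =
      c *: (\sum_(b : pos D i) x b *: gD b) + \sum_(b : pos D i) x' b *: gD b.
    by rewrite scaler_sumr -big_split; apply: eq_bigr => b _; rewrite !ffunE scalerDl scalerA.
  have -> : \sum_b (c *: y + y') b *: rarr N (outn b) nv =
      c *: (\sum_b y b *: rarr N (outn b) nv) + \sum_b y' b *: rarr N (outn b) nv.
    by rewrite scaler_sumr -big_split; apply: eq_bigr => b _; rewrite !ffunE scalerDl scalerA.
  have -> : \sum_(a | tgt a == i) rarr M a (c *: z a + z' a) =
      c *: (\sum_(a | tgt a == i) rarr M a (z a)) + \sum_(a | tgt a == i) rarr M a (z' a).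
    by rewrite scaler_sumr -big_split; apply: eq_bigr => a _; rewrite linearP.
  by rewrite !linearP addrACA -scalerDr ez ez'.
- move=> c; rewrite memvf; split=> // _.
  have [y ty ey] := onto (la_vt' (la_gen c)); have [Y [x [tY eY ex']]] := in_dec ty.
  exists (- x); exists Y => //; rewrite ey sum_in_i linear_sum /= -addrA -[RHS]addr0; congr (_ + _).
    by apply: eq_bigr => a _; rewrite eY la_arr.
  by rewrite -big_split big1 // => b _ /=; rewrite ex' linearZ ffunE scaleNr subrr.
- move=> x; rewrite memvf; split=> // _.
  have vx : vt (M := N) (Some i) (\sum_b x b *: rarr N (outn b) nv).
    by apply: vt_sum => b _; apply: vtZ; apply: vt_out.
  have [m hm em] := la_pre vx; have [c [y [ty ey]]] := gen_onto gM ex hm.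
  exists [ffun b => - c (existT (fun i => pos D i : Type) i b)]; exists y => //.
  rewrite em ey sum_at linearD /= addrA -linearD /= -big_split big1 ?linear0 ?add0r // => b _ /=.
  by rewrite ffunE scaleNr addNr.
- move=> c; rewrite memv0; split=> [/eqP->|[y ty]].
    by exists (fun=> 0); [move=> a; apply: vt0 | rewrite !big1 ?linear0 ?addr0 // => b _; rewrite ?ffunE ?scale0r ?linear0].
  rewrite [X in _ + X]big1 ?addr0 => [/la_inj2 h|b _]; last by rewrite ffunE scale0r.
  by apply/eqP; apply: gen_free_i h.
Qed.

(** [relB] pairs the coordinates at the arrows [i -> v] of a family with the components of its
    image under [gamma] at the arrows [v -> i]; by exactness the latter range over the
    combinations of these arrows whose value lies in the image of [alpha] for [M]. *)
Lemma numB (A : {vspace {ffun P -> k^o}}) (B : {vspace {ffun Nn -> k^o}}) :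
  (forall x, x \in A <-> relA 0 x) -> (forall ze, ze \in B <-> relB ze 0) ->
  #|Nn| = (\dim A + \dim B)%N.
Proof.
move=> hA hB; have := @dim_rel k _ _ relB fullv B A 0%VS.
rewrite dimv0 addn0 dimvf /dim /= !muln1 => -> //.
- by exists (fun=> 0); split=> [c|m|b]; rewrite ?ffunE ?scale0r //; [apply: vt0 | apply: gam0].
- move=> c x y x' y' [z [tz ez hz]] [z' [tz' ez' hz']]; exists (fun a => c *: z a + z' a).
  split=> [|m|b]; first exact: lin_z.
    by rewrite ez ez' !ffunE scalerDl scalerA.
  by rewrite gam_lin hz hz' !ffunE scalerDl scalerA.
- move=> ze; rewrite memvf; split=> // _.
  have [F [f1 f2 f3 f4]] := arr_ext (fun=> 0) (fun=> 0) (fun m => ze m *: nv).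
  have tF : tyout F.
    move=> e; have [[m ->]|h3] := pselect (exists m, e = inn m); first by rewrite f3; apply: vtZ.
    have [[b ->]|h2] := pselect (exists m, e = outn m); first by rewrite f2; apply: vt0.
    have [[a ->]|h1] := pselect (exists m, e = emb m); first by rewrite f1; apply: vt0.
    by rewrite f4 => [|a ea|b eb|m em]; [apply: vt0 | case: h1; exists a | case: h2; exists b | case: h3; exists m].
  have /choice [x hx] b : exists c, gam Sb (Some i) F (outn b) = c *: nv.
    by apply: span; apply: (@vt_gam _ _ _ Sb N (Some i) F (outn b) gN tF).
  by exists [ffun b => x b : k^o]; exists F; split=> // b; rewrite ffunE.
- move=> x; rewrite hA; split=> [[y ty]|[ze [z [tz ez hz]]]].
    rewrite [X in la X]big1 ?linear0 ?add0r => [h|b _]; last by rewrite ffunE scale0r.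
    have [F [f1 f2 f3 f4]] := arr_ext (fun a => la (- y a)) (fun b => x b *: nv) (fun=> 0).
    have tF : tyin F.
      move=> e; have [[m ->]|h3] := pselect (exists m, e = inn m); first by rewrite f3; apply: vt0.
      have [[b ->]|h2] := pselect (exists m, e = outn m); first by rewrite f2; apply: vtZ.
      have [[a ->]|h1] := pselect (exists m, e = emb m).
        by rewrite f1; apply: la_vt'; apply: vtN; apply: ty.
      by rewrite f4 => [|a ea|b eb|m em]; [apply: vt0 | case: h1; exists a | case: h2; exists b | case: h3; exists m].
    have [|z tz hz] := exactN (w := i) tF.
      rewrite sum_in_i; under [X in _ + X]eq_bigr => b _ do rewrite f2 linearZ.
      rewrite h linear_sum -big_split big1 // => a _ /=.
      by rewrite f1 -la_arr linearN linearN addNr.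
    have /choice [ze hze] m : exists c, z (inn m) = c *: nv by apply: span; apply: (tz (inn m)).
    exists [ffun m => ze m : k^o]; exists z; split=> // [m|b]; first by rewrite ffunE.
    by rewrite -f2 hz.
  have tg : tyin (gam Sb (Some i) z) by move=> e; apply: vt_gam.
  have := @arr_gam _ _ _ Sb N (Some i) z gN noloop kN tz; rewrite sum_in_i.
  have [Y [x' [tY eY ex']]] := in_dec tg => h.
  exists (fun a => - Y a); first by move=> a; apply: vtN; apply: tY.
  rewrite [X in la X]big1 ?linear0 ?add0r => [|b _]; last by rewrite ffunE scale0r.
  have eA : \sum_(a | tgt a == i) rarr N (emb a) (gam Sb (Some i) z (emb a)) = la (\sum_(a | tgt a == i) rarr M a (Y a)).
    by rewrite linear_sum; apply: eq_bigr => a _; rewrite eY; exact: esym (la_arr _ _).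
  have eB : \sum_b rarr N (outn b) (gam Sb (Some i) z (outn b)) = \sum_b x b *: rarr N (outn b) nv.
    by apply: eq_bigr => b _; rewrite hz linearZ.
  have eN : \sum_(a | tgt a == i) rarr M a (- Y a) = - \sum_(a | tgt a == i) rarr M a (Y a).
    by rewrite -sumrN; apply: eq_bigr => a _; rewrite linearN.
  by move: h; rewrite eA eB eN linearN => /eqP; rewrite addrC addr_eq0 => /eqP.
move=> x; rewrite memv0; split=> [/eqP->|[z [tz ez hz]]].
  by exists (fun=> 0); split=> [c|m|b]; rewrite ?ffunE ?scale0r //; [apply: vt0 | apply: gam0].
apply/eqP/ffunP => b; have := hz b; rewrite gam_out // => [|m]; last by rewrite ez ffunE scale0r.
by move/esym/eqP; rewrite scaler_eq0 (negbTE nv0) orbF ffunE => /eqP.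
Qed.

(** For the families whose image under [gamma] vanishes at the arrows [v -> i], the coordinates
    at the arrows [i -> v] produce exactly the minimal relations at [i], modulo the image of
    [gamma] for [M]. *)
Lemma numC (B Z : {vspace {ffun Nn -> k^o}}) :
  (forall ze, ze \in B <-> relB ze 0) -> (forall ze, ze \in Z <-> relZ ze) ->
  \dim B = (#|neg D i| + \dim Z)%N.
Proof.
move=> hB hZ; have := @dim_rel k _ _ relC B Z fullv 0%VS.
rewrite dimv0 addn0 dimvf /dim /= !muln1 => -> //.
- exists (fun=> 0); split=> [c|m|b|a _]; rewrite ?gam0 ?ffunE ?scale0r //; first exact: vt0.
  by rewrite big1 ?linear0 // => m _; rewrite ffunE scale0r.
- move=> c x y x' y' [z [tz ez hz ga]] [z' [tz' ez' hz' ga']]; exists (fun a => c *: z a + z' a).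
  split=> [|m|b|a ea]; first exact: lin_z.
  + by rewrite ez ez' !ffunE scalerDl scalerA.
  + by rewrite gam_lin hz hz' scaler0 addr0.
  rewrite gam_lin ga // ga' // -linearP /=; congr (la _).
  by rewrite scaler_sumr -big_split; apply: eq_bigr => m _; rewrite !ffunE scalerDl scalerA.
- move=> ze; rewrite hB; split=> [[z [tz ez hz]]|[c [z [tz ez hz ga]]]]; last first.
    by exists z; split=> // b; rewrite hz ffunE scale0r.
  have tg : tyin (gam Sb (Some i) z) by move=> e; apply: vt_gam.
  have [Y [x' [tY eY ex']]] := in_dec tg.
  have [|c [y [ty ey]]] := rel_onto gM kM nl_restr ex (w := i) tY.
    apply: la_inj; have := @arr_gam _ _ _ Sb N (Some i) z gN noloop kN tz; rewrite sum_in_i.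
    rewrite [X in _ + X]big1 ?addr0 => [<-|b _]; last by rewrite hz ffunE scale0r linear0.
    by rewrite linear_sum; apply: eq_bigr => a _ /=; rewrite eY la_arr.
  have [F [f1 f2 f3 f4]] := arr_ext (fun a => la (y a)) (fun=> 0) (fun=> 0).
  have tF : tyout F.
    move=> e; have [[m ->]|h3] := pselect (exists m, e = inn m); first by rewrite f3; apply: vt0.
    have [[b ->]|h2] := pselect (exists m, e = outn m); first by rewrite f2; apply: vt0.
    have [[a ->]|h1] := pselect (exists m, e = emb m); first by rewrite f1; apply: la_vt'; apply: ty.
    by rewrite f4 => [|a ea|b eb|m em]; [apply: vt0 | case: h1; exists a | case: h2; exists b | case: h3; exists m].
  exists [ffun m => c (existT (fun i => neg D i : Type) i m)]; exists (fun e => (-1) *: F e + z e).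
  split=> [|m|b|a ea]; first exact: lin_z.
  + by rewrite f3 scaler0 add0r ez.
  + by rewrite gam_lin (gam_out _ tF f3) hz ffunE scale0r scaler0 addr0.
  rewrite gam_lin (gam_la a f1 f3) eY (ey a ea) sum_at linearD /= scaleN1r addrC addrK.
  by congr (la _); apply: eq_bigr => m _; rewrite ffunE.
- move=> c; rewrite memvf; split=> // _.
  pose Y a := \sum_(m : neg D i) c m *: rD m a.
  have [F [f1 f2 f3 f4]] := arr_ext (fun a => if tgt a == i then la (Y a) else 0) (fun=> 0) (fun=> 0).
  have tF : tyin F.
    move=> e; have [[m ->]|h3] := pselect (exists m, e = inn m); first by rewrite f3; apply: vt0.
    have [[b ->]|h2] := pselect (exists m, e = outn m); first by rewrite f2; apply: vt0.
    have [[a ->]|h1] := pselect (exists m, e = emb m).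
      rewrite f1; case: eqP => [ea|_]; last exact: vt0.
      by apply: la_vt'; apply: vt_sum => m _; apply: vtZ; apply: (vt_rel gM ex).
    by rewrite f4 => [|a ea|b eb|m em]; [apply: vt0 | case: h1; exists a | case: h2; exists b | case: h3; exists m].
  have [|z tz hz] := exactN (w := i) tF.
    rewrite sum_in_i [X in _ + X]big1 ?addr0 => [|b _]; last by rewrite f2 linear0.
    transitivity (la (\sum_(a | tgt a == i) rarr M a (Y a))).
      by rewrite linear_sum; apply: eq_bigr => a ea; rewrite f1 ea; exact: esym (la_arr _ _).
    rewrite [X in la X](_ : _ = 0) ?linear0 //.
    under eq_bigr => a _ do rewrite linear_sum.
    rewrite exchange_big big1 // => m _ /=.
    under eq_bigr => a _ do rewrite linearZ.
    by rewrite -scaler_sumr rel_ker scaler0.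
  have /choice [ze hze] m : exists c, z (inn m) = c *: nv by apply: span; apply: (tz (inn m)).
  exists [ffun m => ze m : k^o]; exists z; split=> // [m|b|a ea]; first by rewrite ffunE.
    by rewrite -hz // f2.
  by rewrite -hz ?f1 ?ea ?eqxx // -ea.
- move=> ze; rewrite hZ; split=> [[z [tz ez hz]]|[z [tz ez hz ga]]]; exists z; split=> //.
  + by move=> b; apply: hz.
  + move=> a ea; rewrite hz; last by rewrite -ea.
    by rewrite big1 ?linear0 // => m _; rewrite ffunE scale0r.
  move=> e /emb_out [[a [-> ea]]|[b ->]]; last exact: hz.
  by rewrite ga // big1 ?linear0 // => m _; rewrite ffunE scale0r.
move=> c; rewrite memv0; split=> [/eqP->|[z [tz ez hz ga]]].
  exists (fun=> 0); split=> [e|m|b|a _]; rewrite ?gam0 ?ffunE ?scale0r //; first exact: vt0.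
  by rewrite big1 ?linear0 // => m _; rewrite ffunE scale0r.
have /choice [Zm hZm] a : exists m, vt (M := M) (tgt a) m /\ z (emb a) = la m.
  by have [m h1 h2] := la_pre (tz (emb a)); exists m.
apply/eqP; apply: (rel_free_i (z := Zm)) => [a|a ea]; first by case: (hZm a).
apply: la_inj2; rewrite -(ga a ea); apply: gam_la => [c'|m]; first by case: (hZm c').
by rewrite ez ffunE scale0r.
Qed.

(** Alternating sum of the dimensions of the domains and kernels of the linear relations
    [relA], [relB] and [relC]. *)
Lemma numerics (Z : {vspace {ffun Nn -> k^o}}) : (forall ze, ze \in Z <-> relZ ze) ->
  (#|Nn| + #|pos D i| = #|P| + (#|neg D i| + \dim Z))%N.
Proof.
move=> hZ.
have [|c x y h h'|A hA] := @pred_vspace k _ (relA 0).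
- by exists (fun=> 0); [move=> a; apply: vt0 | rewrite !big1 ?linear0 ?addr0 // => b _; rewrite ?ffunE ?scale0r ?linear0].
- case: h h' => z tz ez [z' tz' ez']; exists (fun a => c *: z a + z' a).
    by move=> a; apply: vtD; [apply: vtZ; apply: tz | apply: tz'].
  have e0 : la (\sum_(b : pos D i) (0 : {ffun pos D i -> k^o}) b *: gD b) = 0.
    by rewrite big1 ?linear0 // => b _; rewrite ffunE scale0r.
  move: ez ez'; rewrite !e0 !add0r => ez ez'.
  have -> : \sum_b (c *: x + y) b *: rarr N (outn b) nv =
      c *: (\sum_b x b *: rarr N (outn b) nv) + \sum_b y b *: rarr N (outn b) nv.
    by rewrite scaler_sumr -big_split; apply: eq_bigr => b _; rewrite !ffunE scalerDl scalerA.
  rewrite ez ez' -linearP /=; congr (la _).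
  by rewrite scaler_sumr -big_split; apply: eq_bigr => a _; rewrite linearP.
have [|c x y h h'|B hB] := @pred_vspace k _ (fun ze => relB ze 0).
- by exists (fun=> 0); split=> [c|m|b]; rewrite ?ffunE ?scale0r //; [apply: vt0 | apply: gam0].
- case: h h' => z [tz ez hz] [z' [tz' ez' hz']]; exists (fun a => c *: z a + z' a).
  split=> [|m|b]; first exact: lin_z.
    by rewrite ez ez' !ffunE scalerDl scalerA.
  by rewrite gam_lin hz hz' !ffunE !scale0r scaler0 addr0.
by rewrite (numB hA hB) (numC hB hZ) -(numA hA); lia.
Qed.

End Numerics.

(* W is the decorated representation, D = d_W; R is a reduction of the
   premutation at u of the extended QP (Q, S)[W], so that (Qr R, Sr R) is
   mu_u ((Q, S)[W]) and (restr (Qr R), restr_pot (Sr R)) is mu_u (Q, S);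
   D' = d_{mu_u(W)}. *)
Theorem lemma2p15 (k : closedFieldType) (V : finType) (Q : quiver V)
    (S : potential k Q) (u : V) (W : drep k Q) (D : pres k Q)
    (R : red_data k (premut (ext_quiver D) (Some u)))
    (D' : pres k (restr (Qr R))) :
  loopless Q -> no_2cycle_at Q u ->
  is_Jmod S (drmod W) ->
  pres_of S W D -> no_common_summand D ->
  is_reduction (premut_pot (Some u) (ext_pot S D)) R ->
  simple_at (Sr R) None ->
  pres_of (restr_pot (Sr R)) (red_drep (restr_red R) (premut_drep u S W)) D' ->
  htpy_iso (restr_pot (Sr R)) (vertex_pres (Sr R)) D'.
Proof.
move=> noloop no2 jW [D0 mp0 eD] ncs red _ [D1 mp1 eD']; subst D D'.
have [gM kM] := is_Jmod_killed jW; have [g [ex0 mc]] := min_presP gM mp0.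
have [tau [t1 t2 t3]] := tau_ex u noloop gM ex0 mc.
have [N [nv [la [gN kN onto exN [vnv nv0 span into0 [gM' linj lavt lanone [laonto laarr hdim]]]]]]] :=
  mutation_extends noloop no2 ncs gM kM ex0 mc t1 t2 t3.
have nlb : loopless (premut (ext_quiver (add_neg D0 (drdec W))) (Some u)).
  by apply: loopless_premut; [apply: loopless_ext | apply: no2_Qe].
have evla := ev_laN gN into0 (M := drmod (premut_drep u S W)) gM' lanone laarr.
have kM' : killed (Q := restr (premut (ext_quiver (add_neg D0 (drdec W))) (Some u)))
    (drmod (premut_drep u S W)) (restr_pot (premut_pot (Some u) (ext_pot S (add_neg D0 (drdec W))))).
  move=> a m hm; apply: linj; rewrite cder_restr -evla; apply: kN.
  have h : vt (M := N) (Some (tgt a)) (la m) by rewrite /vt -lavt hm.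
  exact: h.
have osig := ohom_sig red; have orho := ohom_rho red.
have gP : good (pull_rep (sig (R := R)) (drmod (premut_drep u S W))) := good_pull osig gM'.
move: mp1; rewrite red_drep_pull => mp1; have [g' [ex1 mc1]] := min_presP gP mp1.
have hg' : forall b, vt (M := drmod (premut_drep u S W)) (tag b) (g' b) by case: ex1.
have ex2 := exact_push osig orho (jid_sig red nlb) (jid_rho red nlb) (rho_sig red nlb) (sig_rho red nlb)
  gM' kM' hg' ex1.
have mc2 := min_push osig orho (jid_rho red nlb) (rho_sig red nlb) (sig_rho red nlb) gM' kM' hg' mc1.
have [gen hgen] := gen_ex red gN nv gM' lavt laonto.
have exv := vertex_exact red nlb gN kN onto exN vnv nv0 span into0 gM' kM' linj lavt lanone laarr
  (fun b => (hgen b).1) (fun b => (hgen b).2).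
have exd := @exact_add_neg k V _ _ (@DRep k V _ (pull_rep (sig (R := R)) (drmod (premut_drep u S W)))
  (drdec (premut_drep u S W))) D1 g' ex1.
apply: (htpy_iso_of_exact gP _ exv exd) => i; first exact: (loopless_r red nlb (Some i)).
have [Z hZ] := deco_vspace (premut_pot (Some u) (ext_pot S (add_neg D0 (drdec W)))) nv i.
have dZ := hdim i Z hZ.
have := numerics gN kN nlb onto exN vnv nv0 span into0 gM' kM' linj lavt laonto laarr evla ex2 mc2 hZ.
rewrite dZ (card_red red (Some i) None) (card_red red None (Some i)) (card_Qt red (Some i) None).
move=> h; have {}h : (#|Qr R (Some i) None| + #|Qt R None (Some i)| + #|pos D1 i| =
  #|Qr R None (Some i)| + #|Qt R None (Some i)| + (#|neg D1 i| + drdec (premut_drep u S W) i))%N := h.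
transitivity (#|Qr R (Some i) None| + #|pos D1 i|)%N => //.
transitivity (#|Qr R None (Some i)| + #|((neg D1 i + 'I_(drdec (premut_drep u S W) i))%type : finType)|)%N => //.
rewrite card_sum card_ord; move: h.
lia.
Qed.
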